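(* Let $n$ be a natural number. The map $\theta:\widehat D_n\to\overline F_n(\mathbb R)$ is a homeomorphism from the cube complex $\widehat D_n$ to the real locus of the cactus flower space. It is compatible with the homeomorphism $\Theta:\widehat X_n\cong\overline{\mathfrak t}_n(\mathbb R)$, i.e. $\gamma\circ\theta=\Theta\circ\Gamma$, where $\Gamma:\widehat D_n\to\widehat X_n$ and $\gamma:\overline F_n(\mathbb R)\to\overline{\mathfrak t}_n(\mathbb R)$ are the natural maps.
   Context: **Spaces $\overline{\mathfrak t}_n$, $\overline F_n$.** For a finite set $S$, $p(S)$ and $t(S)$ are the sets of ordered pairs $ij$ and triples $ijk$ of distinct elements. Equations in products of $\mathbb P^1$ are read after homogenizing. $\overline{\mathfrak t}_n\subset(\mathbb P^1)^{p([n])}$ is defined by $\nu_{ij}\nu_{jk}=\nu_{ik}\nu_{jk}+\nu_{ij}\nu_{ik}$, $\nu_{ij}+\nu_{ji}=0$ for distinct $i,j,k$; put $\delta_{ij}=\nu_{ij}^{-1}$. For a set partition $\mathcal S=\{S_1,\dots,S_m\}$ of $[n]$, $U_{\mathcal S}\subset\overline{\mathfrak t}_n$ is the open set where $\nu_{ij}\neq\infty$ if $i\not\sim_{\mathcal S}j$ and $\nu_{ij}\ne0$ if $i\sim_{\mathcal S}j$; $\tilde U_{\mathcal S}\subset U_{\mathcal S}\times\prod_k(\mathbb P^1)^{t(S_k)}$ is defined by $\mu_{ijk}\mu_{ikj}=1$, $\mu_{ijk}+\mu_{jik}=1$, $\mu_{ijk}\mu_{ikl}=\mu_{ijl}$,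 $\mu_{ijk}\nu_{ik}=\nu_{ij}$ for distinct indices in a common part. $\overline F_n$ is glued from the $\tilde U_{\mathcal S}$ along preimages of $U_{\mathcal S}\cap U_{\mathcal S'}$, by the isomorphism preserving $\nu$ and those $\mu_{ijk}$ with $i,j,k$ in one part of both partitions (other $\mu_{ijk}=\nu_{ij}\nu_{ik}^{-1}$ on the overlap). $\gamma:\overline F_n\to\overline{\mathfrak t}_n$ forgets $\mu$. For $|S|\geq 1$ let $\widetilde M_{S+1}$ be the scheme $\tilde U_{\{S\}}$ for the one-part partition of $S$ (so $\delta_{ij}$ are finite there; write $\delta_{ij}=z_i-z_j$; $\mu_{ijk}=\frac{z_i-z_k}{z_i-z_j}$; it is a point if $|S|=1$). The locus $\tilde V_{\mathcal S}\subset\overline F_n$ where $\delta_{ij}\neq\infty\Leftrightarrow i\sim_{\mathcal S}j$ is isomorphic to $\widetilde M_{S_1+1}\times\dots\times\widetilde M_{S_m+1}$ by restricting coordinates to each part. **Planar forests.** A rooted tree is a tree with a distinguished vertex (root) contained in exactly one edge (the trunk) and with no vertex contained in exactly two edges. For a non-root vertex $v$, the edge at $v$ towards the root is descending at $v$, the other edges at $v$ are ascending; leaves are the vertices with no ascending edges; internal vertices are neither leaf nor root; a vertex is above an edge or vertex if that edge or vertex lies on its path to the root. The meet of two leaves is the maximal vertex below both. A planar tree is a rooted tree with an order on the ascending edges at each vertex; a planar forest is a sequence $\tau=(\tau_1,\dots,\tau_m)$ of planar trees. All forests are labelled by $[n]$ (bijection with the leaves). $E(\tau)$ is the set of internal edges,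 i.e. edges containing no leaf. Reading the leaves of $\tau_1,\dots,\tau_m$ in depth-first order gives a total order $w_\tau$ of $[n]$; ''consecutive'' refers to it. $r_e(\tau)$ is obtained by reversing the order of ascending edges at the vertex $v$ at which $e$ is descending and at all vertices above $v$. $d_e(\tau)$ is obtained by collapsing $e$; if $e$ is the trunk of $\tau_i$, then $\tau_i$ is replaced by the sequence of planar trees which, glued at their roots in that order, give the tree obtained by collapsing $e$. **Cube complexes.** $D_n=\bigcup_\tau[0,1]^{E(\tau)}/\sim$ over planar forests $\tau$, with $\sim$ generated by $(\tau,(t,0))\sim(r_e(\tau),(t,0))$ and $(\tau,(t,1))\sim(d_e(\tau),t)$ for $t\in[0,1]^{E(\tau)\setminus\{e\}}$, the last value being the coordinate at $e$. $\widehat D_n$ is the quotient of $D_n$ by also identifying $[0,1]^{E(\tau)}$ with $[0,1]^{E(\tau')}$ whenever $\tau'$ is obtained from $\tau$ by permuting its trees. **The star.** $X_n=\bigcup_{w\in S_n}X_n^w$, $X_n^w=\{x\in\mathbb R^n/\mathbb R:0\le x_{w(i)}-x_{w(i+1)}\le1,\ 1\le i\le n-1\}$. A point $x\in X_n^w$ determines the finest set partition $\mathcal S$ of $[n]$ such that $w(i),w(i+1)$ lie in the same part whenever $x_{w(i)}-x_{w(i+1)}<1$. $\widehat X_n$ is the quotient of $X_n$ identifying $x,x'$ if they determine the same partition $\mathcal S=\{S_1,\dots,S_m\}$ and have the same image in $\prod_j\mathbb R^{S_j}/\mathbb R$. Fix an increasing diffeomorphism $f:[-1,1]\to[-\infty,\infty]$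 with $f(0)=0$. $\Theta:\widehat X_n\to\overline{\mathfrak t}_n(\mathbb R)$ sends $x\in X_n^w$ to the point with $\delta_{w(i)w(j)}=\sum_{k=i}^{j-1}f(x_{w(k)}-x_{w(k+1)})$ for $i<j$ and $\delta_{ij}=-\delta_{ji}$; it is a homeomorphism. **The map $\Gamma$.** For $t\in[0,1]^{E(\tau)}$ and consecutive $i,j$ (in the order $w_\tau$): $x=\Gamma(t)\in X_n^{w_\tau}$ has $x_i-x_j=1$ if the leaves $i,j$ lie in different trees, and otherwise $x_i-x_j=\prod_et_e$ over the edges on the path from the meet of $i,j$ to the root. It descends to $\widehat D_n\to\widehat X_n$. **The map $\theta$.** First let $\tau$ be a planar binary tree labelled by $S$ (every internal vertex in exactly three edges), $|S|\ge2$, with trunk $e_0$. Let $W_\tau\subset\widetilde M_{S+1}$ be the open set where $\mu_{ijk}\neq\infty$ whenever the meet of $i,k$ is above (and different from) the meet of $i,j$. For $e\in E(\tau)$ joining a lower vertex $v'$ to an upper vertex $v$, let $i,j$ be the unique consecutive labels ($i$ before $j$) with meet $v$; if $e\neq e_0$ let $k,l$ be the unique consecutive labels ($k$ before $l$) with meet $v'$. Put $b_{e_0}=z_i-z_j$ and $b_e=\frac{z_i-z_j}{z_k-z_l}$ for $e\ne e_0$. The functions $(b_e)$ identify $W_\tau$ with an open subset of $\mathbb C^{E(\tau)}$ that contains $[0,\infty)\times[0,1]^{E(\tau)\setminus\{e_0\}}$. For $t\in[0,1]^{E(\tau)}$ with $t_{e_0}\neq1$, $\theta(\tau,t)\in\widetilde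 M_{S+1}(\mathbb R)$ is the point of $W_\tau$ with $b_{e_0}=f(t_{e_0})$ and, for $e\ne e_0$, $b_e=f\big(t_e\prod_{e'<e}t_{e'}\big)/f\big(\prod_{e'<e}t_{e'}\big)$ if all $t_{e'}\neq0$ for $e'<e$, and $b_e=t_e$ otherwise; here $e'<e$ means $e'\ne e$ lies on the path from $e$ to the root. For a forest $\tau=(\tau_1,\dots,\tau_m)$ of planar binary trees (single edges allowed) with label sets $S_1,\dots,S_m$ and $t\in[0,1]^{E(\tau)}$ with all trunk values $\neq1$, $\theta(\tau,t)$ is the point $(\theta(\tau_1,t|_{\tau_1}),\dots,\theta(\tau_m,t|_{\tau_m}))\in\prod_j\widetilde M_{S_j+1}(\mathbb R)\cong\tilde V_{\mathcal S}(\mathbb R)\subset\overline F_n(\mathbb R)$ (a single-edge tree contributing a point). Every point of $\widehat D_n$ is represented in this way, and this gives a well-defined map $\theta:\widehat D_n\to\overline F_n(\mathbb R)$. *)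

(* Defs.v *)
From HB Require Import structures.
From Stdlib Require Import Relation_Operators.
From mathcomp Require Import all_boot all_order all_algebra perm generic_quotient.
From mathcomp Require Import all_classical all_reals all_analysis.

Set Implicit Arguments.
Unset Strict Implicit.
Unset Printing Implicit Defensive.

Import Order.TTheory GRing.Theory Num.Theory.
Import numFieldNormedType.Exports.

Local Open Scope classical_set_scope.
Local Open Scope ring_scope.

Section Quotient.
Local Open Scope quotient_scope.
Variables (T : topologicalType) (r : T -> T -> Prop).

Definition gen_eqv (x y : T) : bool := `[< clos_refl_sym_trans T r x y >].

Lemma gen_eqv_refl : reflexive gen_eqv.
Proof. by move=> x; apply/asboolP; exact: rst_refl. Qed.

Lemma gen_eqv_sym : symmetric gen_eqv.
Proof. by move=> x y; apply/asboolP/asboolP; exact: rst_sym. Qed.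

Lemma gen_eqv_trans : transitive gen_eqv.
Proof.
by move=> y x z /asboolP xy /asboolP yz; apply/asboolP; exact: rst_trans xy yz.
Qed.

Definition gen_equiv_rel : equiv_rel T :=
  EquivRel gen_eqv gen_eqv_refl gen_eqv_sym gen_eqv_trans.

(* The quotient space of T by the equivalence relation generated by r. *)
Definition quot : topologicalType :=
  quotient_topology {eq_quot gen_equiv_rel}.

Definition qclass (x : T) : quot := \pi_{eq_quot gen_equiv_rel} x.

Definition qrepr (q : quot) : T := repr (q : {eq_quot gen_equiv_rel}).

Lemma qreprK : cancel qrepr qclass.
Proof. by move=> q; rewrite /qclass /qrepr reprK. Qed.

Lemma qclass_eqP (x y : T) :
  qclass x = qclass y <-> clos_refl_sym_trans T r x y.
Proof.
have h := eqmodP gen_equiv_rel x y.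
by split=> [/h/asboolP|/asboolP/h].
Qed.

End Quotient.
Arguments qclass {T} r x.

Definition homeomorphism (T U : topologicalType) (h : T -> U) : Prop :=
  continuous h /\
  exists g : U -> T, [/\ cancel h g, cancel g h & continuous g].

Section ProjectiveLine.
Variable R : realType.

Definition nonzero_vec : topologicalType := set_type [set v : R * R | v != 0].

Definition proportional (v w : nonzero_vec) : Prop :=
  exists2 c : R, c != 0 & val w = (c * (val v).1, c * (val v).2).

(* The affine coordinate of the class of (a, b) is a / b. *)
Definition P1 : topologicalType := quot proportional.

Definition P1mk (v : R * R) (hv : v != 0) : P1 :=
  qclass proportional (exist _ v (mem_set hv)).

(* Homogeneous coordinates of a chosen representative.  They are only used in
   equations that are homogeneous in each point involved, and in the inverse and
   the affine coordinate below, so that the choice does not matter. *)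
Definition hx (p : P1) : R := (val (qrepr p)).1.
Definition hy (p : P1) : R := (val (qrepr p)).2.

Lemma fin_neq0 (a : R) : (a, 1) != 0 :> R * R.
Proof. by apply/eqP => -[_ /eqP]; rewrite oner_eq0. Qed.

Lemma inf_neq0 : (1, 0) != 0 :> R * R.
Proof. by apply/eqP => -[/eqP]; rewrite oner_eq0. Qed.

Lemma swap_neq0 (p : P1) : (hy p, hx p) != 0 :> R * R.
Proof.
have /eqP pN0 := set_mem (valP (qrepr p)); apply/eqP => -[y0 x0]; apply: pN0.
by rewrite [LHS]surjective_pairing; congr pair.
Qed.

Definition P1fin (a : R) : P1 := P1mk (fin_neq0 a).
Definition P1inf : P1 := P1mk inf_neq0.
Definition P1inv (p : P1) : P1 := P1mk (swap_neq0 p).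

(* Both infinities of [-oo, +oo] go to the single point at infinity. *)
Definition P1_of_ereal (a : \bar R) : P1 :=
  if a is EFin b then P1fin b else P1inf.

(* Only meaningful at finite points; its value at P1inf is 0. *)
Definition affine (p : P1) : R := hx p / hy p.

End ProjectiveLine.
Arguments P1inf {R}.

Section CactusFlower.
Variables (R : realType) (n : nat).

Definition pairs := {p : 'I_n * 'I_n | p.1 != p.2}.

Definition nu_space : topologicalType := {ptws pairs -> P1 R}.

(* Total accessor; the value on the diagonal is never used. *)
Definition nu_at (nu : nu_space) (i j : 'I_n) : P1 R :=
  if insub (i, j) is Some p then nu p else P1fin 0.

Definition delta_at (nu : nu_space) (i j : 'I_n) : P1 R := P1inv (nu_at nu i j).

Definition tbar_set : set nu_space := [set nu |
  (forall i j, i != j ->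
     hx (nu_at nu i j) * hy (nu_at nu j i)
     + hx (nu_at nu j i) * hy (nu_at nu i j) = 0) /\
  (forall i j k, uniq [:: i; j; k] ->
     hx (nu_at nu i j) * hx (nu_at nu j k) * hy (nu_at nu i k)
     = hx (nu_at nu i k) * hx (nu_at nu j k) * hy (nu_at nu i j)
     + hx (nu_at nu i j) * hx (nu_at nu i k) * hy (nu_at nu j k))].

Definition tbar : topologicalType := set_type tbar_set.

Definition setpart := {S : {set {set 'I_n}} | finset.partition S [set: 'I_n]%SET}.

Definition same_part (S : setpart) (i j : 'I_n) : bool :=
  finset.pblock (val S) i == finset.pblock (val S) j.

Definition U_set (S : setpart) : set nu_space := [set nu | tbar_set nu /\
  forall i j, i != j -> if same_part S i j then nu_at nu i j <> P1fin 0
                        else nu_at nu i j <> P1inf].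

Definition in_part (S : setpart) (i j k : 'I_n) : bool :=
  [&& uniq [:: i; j; k], same_part S i j & same_part S i k].

Definition triples (S : setpart) :=
  {t : 'I_n * 'I_n * 'I_n | in_part S t.1.1 t.1.2 t.2}.

Definition mu_space (S : setpart) : topologicalType :=
  {ptws triples S -> P1 R}.

Definition mu_at (S : setpart) (mu : mu_space S) (i j k : 'I_n) : P1 R :=
  if insub (i, j, k) is Some t then mu t else P1fin 0.

Definition Utilde_set (S : setpart) : set (nu_space * mu_space S) :=
  [set p | let nu := nu_at p.1 in let mu := mu_at p.2 in
    [/\ U_set S p.1,
     forall i j k, in_part S i j k ->
       hx (mu i j k) * hx (mu i k j) = hy (mu i j k) * hy (mu i k j),
     forall i j k, in_part S i j k ->
       hx (mu i j k) * hy (mu j i k) + hx (mu j i k) * hy (mu i j k)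
       = hy (mu i j k) * hy (mu j i k),
     forall i j k l, in_part S i j k -> in_part S i j l -> k != l ->
       hx (mu i j k) * hx (mu i k l) * hy (mu i j l)
       = hx (mu i j l) * hy (mu i j k) * hy (mu i k l) &
     forall i j k, in_part S i j k ->
       hx (mu i j k) * hx (nu i k) * hy (nu i j)
       = hx (nu i j) * hy (mu i j k) * hy (nu i k)]].

Definition Utilde (S : setpart) : topologicalType := set_type (@Utilde_set S).

Definition charts : topologicalType := {S : setpart & Utilde S}.

Definition chart_nu (p : charts) : nu_space := (val (projT2 p)).1.

Definition chart_mu (p : charts) (i j k : 'I_n) : P1 R :=
  mu_at (val (projT2 p)).2 i j k.

(* Equality of the nu coordinates puts them in U_S and in U_S'; on the overlap
   the mu_ijk with i, j, k in one part of only one of the two partitions are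
   then determined by mu_ijk nu_ik = nu_ij. *)
Definition glue (p q : charts) : Prop :=
  chart_nu p = chart_nu q /\
  forall i j k, in_part (projT1 p) i j k -> in_part (projT1 q) i j k ->
    chart_mu p i j k = chart_mu q i j k.

Definition Fbar : topologicalType := quot glue.

Lemma chart_tbar (p : charts) : tbar_set (chart_nu p).
Proof. by case: (set_mem (valP (projT2 p))) => -[]. Qed.

Definition gamma (q : Fbar) : tbar :=
  exist _ (chart_nu (qrepr q)) (mem_set (chart_tbar (qrepr q))).

Lemma gamma_qclass (p : charts) : val (gamma (qclass glue p)) = chart_nu p.
Proof.
have /qclass_eqP : qclass glue (qrepr (qclass glue p)) = qclass glue p.
  by rewrite qreprK.
rewrite [LHS]/=; move: (qrepr _) => q.
by elim=> // [? ? [] | ? ? ? _ -> _ ->].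
Qed.

End CactusFlower.

(* The root and the trunk of a planar tree are implicit: a term stands for the
   trunk together with the vertex above it, and each element of the list under
   Node for an ascending edge together with the vertex above it. *)
Unset Elimination Schemes.
Inductive ptree (n : nat) := Leaf of 'I_n | Node of seq (ptree n).
Set Elimination Schemes.
Arguments Leaf {n}.
Arguments Node {n}.

Section PlanarForests.
Variable n : nat.
Implicit Types T : ptree n.

Fixpoint ptree_code T : GenTree.tree 'I_n :=
  match T with
  | Leaf i => GenTree.Leaf i
  | Node s => GenTree.Node 0 (map ptree_code s)
  end.

Fixpoint ptree_decode (t : GenTree.tree 'I_n) : ptree n :=
  match t with
  | GenTree.Leaf i => Leaf i
  | GenTree.Node _ s => Node (map ptree_decode s)
  end.

Lemma ptree_codeK : cancel ptree_code ptree_decode.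
Proof.
rewrite /cancel; fix loop 1; case=> [i|s]; first exact: erefl.
rewrite /=; congr Node; elim: s => [|T s IHs]; first exact: erefl.
by rewrite /= IHs loop.
Qed.

HB.instance Definition _ := Countable.copy (ptree n) (can_type ptree_codeK).

Fixpoint tleaves T : seq 'I_n :=
  match T with
  | Leaf i => [:: i]
  | Node s => flatten (map tleaves s)
  end.

(* Vertices are encoded by the set of the labels above them, and edges by the
   vertex at which they are descending: leaves have distinct labels and internal
   vertices have at least two ascending edges, so this is faithful.  With this
   encoding E(r_e tau) = E(tau) and E(d_e tau) = E(tau) minus e hold literally,
   and "v is above v'" is inclusion of v in v'. *)
Definition above T : {set 'I_n} := [set:: tleaves T].

Fixpoint tedges T : seq {set 'I_n} :=
  match T with
  | Leaf _ => [::]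
  | Node s => above (Node s) :: flatten (map tedges s)
  end.

Fixpoint no_bivalent T : bool :=
  match T with
  | Leaf _ => true
  | Node s => (1 < size s)%N && all no_bivalent s
  end.

Fixpoint tbinary T : bool :=
  match T with
  | Leaf _ => true
  | Node s => (size s == 2%N) && all tbinary s
  end.

Definition word (s : seq (ptree n)) : seq 'I_n := flatten (map tleaves s).

Definition pforest :=
  {s : seq (ptree n) | all no_bivalent s && perm_eq (word s) (enum 'I_n)}.

Fixpoint mirror T : ptree n :=
  match T with
  | Leaf i => Leaf i
  | Node s => Node (rev (map mirror s))
  end.

Fixpoint reverse_at (e : {set 'I_n}) T : ptree n :=
  if above T == e then mirror T else
  match T with
  | Leaf i => Leaf i
  | Node s => Node (map (reverse_at e) s)
  end.

(* The sequence has one element, except when e is the trunk. *)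
Fixpoint collapse_at (e : {set 'I_n}) T : seq (ptree n) :=
  match T with
  | Leaf i => [:: Leaf i]
  | Node s => if above T == e then s
              else [:: Node (flatten (map (collapse_at e) s))]
  end.

Definition edge (tau : pforest) :=
  {e : {set 'I_n} | e \in flatten (map tedges (val tau))}.

Definition is_trunk (tau : pforest) (e : edge tau) : bool :=
  [forall e' : edge tau, ~~ (val e \proper val e')].

(* e' is the edge just below e. *)
Definition is_parent (tau : pforest) (e' e : edge tau) : bool :=
  (val e \proper val e') &&
  [forall e'' : edge tau,
     ~~ ((val e \proper val e'') && (val e'' \proper val e'))].

Definition same_tree (tau : pforest) (i j : 'I_n) : bool :=
  has (fun T => (i \in tleaves T) && (j \in tleaves T)) (val tau).

(* For two leaves of one tree; the edges below both form a chain. *)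
Definition meet (tau : pforest) (i j : 'I_n) : {set 'I_n} :=
  (\bigcap_(e : edge tau | (i \in val e) && (j \in val e)) val e)%SET.

Definition consecutive (tau : pforest) (i j : 'I_n) : bool :=
  infix [:: i; j] (word (val tau)).

Definition binary_forest (tau : pforest) : bool := all tbinary (val tau).

Definition forest_partition (tau : pforest) : {set {set 'I_n}} :=
  [set:: map above (val tau)].

End PlanarForests.

Section CubeComplex.
Variables (R : realType) (n : nat).

Definition cube (tau : pforest n) : topologicalType :=
  set_type [set t : {ptws edge tau -> R} | forall e, 0 <= t e <= 1].

Definition cubes : topologicalType := {tau : pforest n & cube tau}.

Definition agree (p q : cubes) : Prop :=
  forall (e : edge (projT1 p)) (e' : edge (projT1 q)), val e = val e' ->
    val (projT2 p) e = val (projT2 q) e'.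

Inductive cube_rel (p q : cubes) : Prop :=
| CubeReverse (e : edge (projT1 p)) of
    val (projT2 p) e = 0 &
    val (projT1 q) = map (reverse_at (val e)) (val (projT1 p)) & agree p q
| CubeCollapse (e : edge (projT1 p)) of
    val (projT2 p) e = 1 &
    val (projT1 q) = flatten (map (collapse_at (val e)) (val (projT1 p))) &
    agree p q
| CubePermute of perm_eq (val (projT1 p)) (val (projT1 q)) & agree p q.

(* The quotient defining D_n and the further one defining \hat D_n, at once. *)
Definition Dhat : topologicalType := quot cube_rel.

End CubeComplex.

Section Star.
Variables (R : realType) (n : nat).

Definition Xw_set (w : {perm 'I_n}) : set {ptws 'I_n -> R} := [set x |
  forall i j : 'I_n, j = i.+1 :> nat -> 0 <= x (w i) - x (w j) <= 1].

(* The preimage in R^n of the subspace X_n of R^n / R; translations are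
   quotiented out by star_rel, which relates all translates of a point. *)
Definition Xstar : topologicalType :=
  set_type [set x : {ptws 'I_n -> R} | exists w, Xw_set w x].

Definition joins_close (x : 'I_n -> R) (w : {perm 'I_n}) (S : setpart n) :=
  forall i j : 'I_n, j = i.+1 :> nat -> x (w i) - x (w j) < 1 ->
    same_part S (w i) (w j).

Definition determines (x : 'I_n -> R) (S : setpart n) : Prop :=
  exists w, [/\ Xw_set w x, joins_close x w S &
    forall S', joins_close x w S' ->
      forall i j, same_part S i j -> same_part S' i j].

Definition star_rel (x y : Xstar) : Prop :=
  exists S : setpart n, [/\ determines (val x) S, determines (val y) S &
    forall A, A \in val S -> exists c, forall i, i \in A ->
      val x i - val y i = c].

Definition Xhat : topologicalType := quot star_rel.

End Star.

(* f is a diffeomorphism [-1, 1] -> [-oo, +oo]: a homeomorphism, smooth with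
   smooth inverse between the interiors ]-1, 1[ and R.  Nothing is required of
   f outside [-1, 1], and no smooth structure is chosen at -oo and +oo. *)
Definition smooth_on (R : realType) (A : set R) (h : R -> R) : Prop :=
  forall k x, A x -> derivable (derive1n k h) x 1.

Definition increasing_diffeo (R : realType) (f : R -> \bar R) : Prop :=
  [/\ {in `[(-1)%R, 1%R] &, {homo f : x y / (x < y)%R >-> (x < y)%E}},
      {within `[(-1)%R, 1%R], continuous f},
      smooth_on `](-1)%R, 1%R[ (fine \o f) &
      exists g : \bar R -> R,
        [/\ forall y, g y \in `[(-1)%R, 1%R],
            {in `[(-1)%R, 1%R], cancel f g},
            cancel g f,
            continuous g &
            smooth_on setT (g \o EFin)]].

Section Maps.
Variables (R : realType) (n : nat) (f : R -> \bar R).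

Definition is_Theta (Theta : Xhat R n -> tbar R n) : Prop :=
  forall (x : Xstar R n) (w : {perm 'I_n}), Xw_set w (val x) ->
    forall i j : 'I_n, (i < j)%N ->
      let d := (\sum_(k : 'I_n * 'I_n | [&& (i <= k.1)%N, (k.1 < j)%N &
                                          k.2 == k.1.+1 :> nat])
                 f (val x (w k.1) - val x (w k.2))%R)%E in
      let nu := val (Theta (qclass (@star_rel R n) x)) in
      delta_at nu (w i) (w j) = P1_of_ereal d /\
      delta_at nu (w j) (w i) = P1_of_ereal (- d)%E.

Definition is_Gamma (Gamma : Dhat R n -> Xhat R n) : Prop :=
  forall p : cubes R n, let tau := projT1 p in
  exists (w : {perm 'I_n}) (x : Xstar R n),
    [/\ map w (enum 'I_n) = word (val tau),
        Xw_set w (val x),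
        forall i j, consecutive tau i j ->
          val x i - val x j =
          if same_tree tau i j then
            \prod_(e : edge tau | (i \in val e) && (j \in val e))
               val (projT2 p) e
          else 1 &
        Gamma (qclass (@cube_rel R n) p) = qclass (@star_rel R n) x].

Definition theta_admissible (p : cubes R n) : Prop :=
  binary_forest (projT1 p) /\
  forall e : edge (projT1 p), is_trunk e -> val (projT2 p) e <> 1.

(* The value prescribed for b_e when e is not a trunk. *)
Definition b_value (p : cubes R n) (e : edge (projT1 p)) : R :=
  let t : edge (projT1 p) -> R := val (projT2 p) in
  let P := \prod_(e' : edge (projT1 p) | val e \proper val e') t e' in
  if [forall e' : edge (projT1 p), (val e \proper val e') ==> (t e' != 0)]
  then fine (f (t e * P)) / fine (f P)
  else t e.

(* (z_k - z_x) / (z_k - z_l), which is mu_klx off the degenerate cases. *)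
Definition ratio (q : charts R n) (k l x : 'I_n) : R :=
  if x == k then 0 else if x == l then 1 else affine (chart_mu q k l x).

(* q is the point theta(tau, t) in the chart of the partition S given by the
   trees of tau.  The point lies in \tilde V_S, whose factor \tilde M_{S_j+1}
   has as coordinates the nu_ij and the mu_ijk with indices in S_j.  The next
   condition is that this factor is in W_{tau_j}; the last two prescribe b_e on
   trunks and on the other edges, where (z_i - z_j) / (z_k - z_l) is the
   difference of (z_k - z_j) / (z_k - z_l) and (z_k - z_i) / (z_k - z_l), both
   finite on W_{tau_j}. *)
Definition theta_chart (p : cubes R n) (q : charts R n) : Prop :=
  let tau := projT1 p in let S := projT1 q in
  [/\ val S = forest_partition tau,
      forall i j, i != j ->
        (delta_at (chart_nu q) i j <> P1inf <-> same_part S i j),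
      forall i j k, in_part S i j k -> meet tau i k \proper meet tau i j ->
        chart_mu q i j k <> P1inf,
      forall (e : edge tau) i j, is_trunk e ->
        consecutive tau i j -> same_tree tau i j -> meet tau i j = val e ->
        delta_at (chart_nu q) i j = P1_of_ereal (f (val (projT2 p) e)) &
      forall (e e' : edge tau) i j k l, is_parent e' e ->
        consecutive tau i j -> same_tree tau i j -> meet tau i j = val e ->
        consecutive tau k l -> same_tree tau k l -> meet tau k l = val e' ->
        ratio q k l j - ratio q k l i = b_value e].

Definition is_theta (theta : Dhat R n -> Fbar R n) : Prop :=
  (forall d, exists2 p, theta_admissible p & d = qclass (@cube_rel R n) p) /\
  (forall p, theta_admissible p -> exists2 q, theta_chart p q &
     theta (qclass (@cube_rel R n) p) = qclass (@glue R n) q).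

End Maps.

(* Main.v *)
(* A point of a cube is a planar forest whose edges carry numbers in [0, 1].  The
   product of the numbers below the meet of two consecutive leaves is the gap
   between them.  theta only depends on the positions of the leaves, where gaps
   are measured with F x = f x, and, above edges of value 0, on the positions
   measured with phi P x = F (P x) / F P, which stays continuous at P = 0 because
   F x = x psi x with psi positive.  Reversal and collapse do not change these
   positions, and permutations do not change them within a tree, so theta is well
   defined.  Conversely, the differences z_i - z_j determine the gaps up to the
   order of leaves at equal positions, and inside each cluster of such leaves the
   ratios mu_ijk do the same, recursively; a forest is recovered from its gaps
   by splitting at a largest gap.  This makes theta bijective.  It is continuous,
   its source is compact and its target is Hausdorff. *)
From HB Require Import structures.
From Stdlib Require Import Relation_Operators.
From mathcomp Require Import all_boot all_order all_algebra.
From mathcomp Require Import perm generic_quotient.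
From mathcomp Require Import all_classical all_reals all_analysis.
From mathcomp Require Import ring lra zify.
Require Import Defs.

Set Implicit Arguments.
Unset Strict Implicit.
Unset Printing Implicit Defensive.

Import Order.TTheory GRing.Theory Num.Theory.
Import numFieldNormedType.Exports.

Local Open Scope classical_set_scope.
Local Open Scope ring_scope.

(** * Decorated forests *)

Unset Elimination Schemes.

(** A vertex whose edge has value t rescales all gaps above it by t. Distances are therefore taken
    with respect to an arbitrary function F, and passing to a subtree replaces F by x => F (t x):
    one induction serves f itself, the functions phi P, the identity on a screen, and an indicator
    function that detects infinite distances. The obstacle is that f is infinite at 1: psi is
    controlled only on [0, 1), whereas a product P of edge values may be 1. Statements about mu_ijk
    therefore assume that i, j, k are at finite distance. This forces P < 1 at the vertex where the
    three labels part, and there the gap 1 between different children gives a nonzero distance.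
    Since phi P is not linear, ratios computed at different vertices have to be compared; this rests
    on the cocycle identity phi P (u x) = phi P u * phi (P u) x. The factors that occur vanish as
    soon as an edge on the way has value 0, which is why mu is kept as a pair of homogeneous
    coordinates and the relations of the cactus flower space are checked without dividing. *)

Inductive dtree (R I : Type) := DLeaf of I | DNode of R & seq (dtree R I).
Set Elimination Schemes.
Arguments DLeaf {R I}.
Arguments DNode {R I}.

Section DtreeChoice.
Variables (R I : choiceType).

Fixpoint dtree_code (T : dtree R I) : GenTree.tree (R + I) :=
  match T with
  | DLeaf i => GenTree.Leaf (inr i)
  | DNode t s => GenTree.Node 0 (GenTree.Leaf (inl t) :: map dtree_code s)
  end.

Fixpoint dtree_decode (t : GenTree.tree (R + I)) : option (dtree R I) :=
  match t with
  | GenTree.Leaf (inr i) => Some (DLeaf i)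
  | GenTree.Node _ (GenTree.Leaf (inl t) :: s) =>
      Some (DNode t (pmap dtree_decode s))
  | _ => None
  end.

Lemma dtree_codeK : pcancel dtree_code dtree_decode.
Proof.
rewrite /pcancel; fix loop 1; case=> [i|t s] //=.
congr (Some (DNode t _)); elim: s => [|T s IHs] //=.
by rewrite loop /= IHs.
Qed.

HB.instance Definition _ := Choice.copy (dtree R I) (pcan_type dtree_codeK).

End DtreeChoice.

Section DecoratedTrees.
Variables (R : realFieldType) (I : choiceType).
Implicit Types (T c : dtree R I) (s : seq (dtree R I)) (F G : R -> R) (P t : R).

Fixpoint dword T : seq I :=
  match T with DLeaf i => [:: i] | DNode _ s => flatten (map dword s) end.

Definition lword s : seq I := flatten (map dword s).

(* The gap in front of each leaf, relative to the edge below; in front of the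
   first leaf of every child, the gap 1 that separates it from its left
   neighbour. *)
Fixpoint dpre T : seq R :=
  match T with
  | DLeaf _ => [:: 1]
  | DNode t s => 1 :: map ( *%R t) (behead (flatten (map dpre s)))
  end.

Definition lpre s : seq R := flatten (map dpre s).

Fixpoint dvalid T : bool :=
  match T with
  | DLeaf _ => true
  | DNode t s => [&& (1 < size s)%N, 0 <= t <= 1 & all dvalid s]
  end.

Definition lvalid s : bool := all dvalid s.

Fixpoint dnodes T : nat :=
  match T with DLeaf _ => 0 | DNode _ s => (sumn (map dnodes s)).+1 end.

Definition lnodes s : nat := sumn (map dnodes s).

Lemma lnodes_in t s' s : DNode t s' \in s -> (lnodes s' < lnodes s)%N.
Proof.
elim: s => //= c s IH; rewrite inE /lnodes /= => /orP[/eqP<-|/IH] /=.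
  by rewrite ltnS leq_addr.
by rewrite /lnodes => h; apply: leq_trans h _; rewrite leq_addl.
Qed.

(** Statements are phrased for sequences of trees, so that the sequence of children of a node is
    again an instance and no mutual induction is needed. *)
Lemma list_tree_ind (Q : seq (dtree R I) -> Prop) :
  (forall s, (forall t s', DNode t s' \in s -> Q s') -> Q s) -> forall s, Q s.
Proof.
move=> IH s; have [m] := ubnP (lnodes s); elim: m s => // m IHm s; rewrite ltnS => sm.
by apply: IH => t s' /lnodes_in ss'; apply: IHm; apply: leq_trans ss' sm.
Qed.

Lemma lword_cons c s : lword (c :: s) = dword c ++ lword s.
Proof. by []. Qed.
Lemma lword_cat s1 s2 : lword (s1 ++ s2) = lword s1 ++ lword s2.
Proof. by rewrite /lword map_cat flatten_cat. Qed.
Lemma lpre_cat s1 s2 : lpre (s1 ++ s2) = lpre s1 ++ lpre s2.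
Proof. by rewrite /lpre map_cat flatten_cat. Qed.
Lemma lpre_cons c s : lpre (c :: s) = dpre c ++ lpre s.
Proof. by []. Qed.
Lemma lword1 c : lword [:: c] = dword c.
Proof. by rewrite lword_cons cats0. Qed.
Lemma lpre1 c : lpre [:: c] = dpre c.
Proof. by rewrite lpre_cons cats0. Qed.
Lemma lvalid_cat s1 s2 : lvalid (s1 ++ s2) = lvalid s1 && lvalid s2.
Proof. exact: all_cat. Qed.

Lemma dword_node t s : dword (DNode t s) = lword s.
Proof. by []. Qed.

Lemma mem_lword i s : (i \in lword s) = has (fun c => i \in dword c) s.
Proof. by elim: s => //= c s IH; rewrite lword_cons mem_cat IH. Qed.

Lemma mem_lword_sub c s i : c \in s -> i \in dword c -> i \in lword s.
Proof. by move=> cs ic; rewrite mem_lword; apply/hasP; exists c. Qed.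

Lemma lvalidP s t s' : lvalid s -> DNode t s' \in s ->
  [/\ (1 < size s')%N, 0 <= t <= 1 & lvalid s'].
Proof. by move=> /allP vs /vs /and3P[]. Qed.

Lemma dpre_behead c : dpre c = 1 :: behead (dpre c).
Proof. by case: c. Qed.

Lemma lvalid_size s : lvalid s -> size (lpre s) = size (lword s).
Proof.
elim/list_tree_ind: s => s IH vs.
have h c : c \in s -> size (dpre c) = size (dword c).
  case: c => // t s' cs; have [s2 _ vs'] := lvalidP vs cs.
  have e := IH _ _ cs vs'; rewrite /= size_map size_behead -/(lpre _) -/(lword _) e.
  apply: prednK; rewrite -e; case: (s') s2 => // c l _.
  by rewrite lpre_cons dpre_behead.
elim: s {IH vs} h => //= c s IHs h.
rewrite lpre_cons lword_cons !size_cat h ?mem_head // IHs // => c' cs.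
by apply: h; rewrite inE cs orbT.
Qed.

Lemma dvalid_size c : dvalid c -> size (dpre c) = size (dword c).
Proof. by move=> vc; rewrite -lpre1 -lword1 lvalid_size // /lvalid /= vc. Qed.

Lemma dword_neq0 c : dvalid c -> (0 < size (dword c))%N.
Proof. by move=> /dvalid_size <-; rewrite dpre_behead. Qed.

Lemma lpre_01 s : lvalid s -> {in lpre s, forall x, 0 <= x <= 1}.
Proof.
elim/list_tree_ind: s => s IH vs x /flatten_mapP[c cs].
case: c cs => [i|t s'] cs /=; first by rewrite inE => /eqP->; rewrite ler01 lexx.
have [s2 /andP[t0 t1] vs'] := lvalidP vs cs.
rewrite inE => /orP[/eqP->|/mapP[y /mem_behead /(IH _ _ cs vs') /andP[y0 y1] ->]].
  by rewrite ler01 lexx.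
by rewrite mulr_ge0 //= mulr_ile1.
Qed.

(* The position of the leaf i, where gaps are measured with F. *)
Definition lpos F s i : R :=
  \sum_(x <- take (index i (lword s)).+1 (lpre s)) F x.
Definition llen F s : R := \sum_(x <- lpre s) F x.
Definition dist F s i j : R := lpos F s j - lpos F s i.

Lemma lpos_catl F s1 s2 i : lvalid s1 -> i \in lword s1 ->
  lpos F (s1 ++ s2) i = lpos F s1 i.
Proof.
move=> v1 i1; rewrite /lpos lword_cat lpre_cat index_cat i1 takel_cat //.
by rewrite lvalid_size // index_mem.
Qed.

Lemma lpos_catr F s1 s2 i : lvalid s1 -> i \notin lword s1 ->
  lpos F (s1 ++ s2) i = llen F s1 + lpos F s2 i.
Proof.
move=> v1 /negPf i1; rewrite /lpos lword_cat lpre_cat index_cat i1 -addnS.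
by rewrite -lvalid_size // takeD drop_size_cat // take_size_cat // big_cat.
Qed.

Lemma llen_cat F s1 s2 : llen F (s1 ++ s2) = llen F s1 + llen F s2.
Proof. by rewrite /llen lpre_cat big_cat. Qed.

(** The first gap of [s] is the separator 1, which rescaling turns into t, whereas the gap in front
    of the node itself is 1. The summand [F 1 - F t] corrects this and cancels in [dist]. *)
Lemma lpos_node F t s i : lvalid s -> (0 < size s)%N ->
  lpos F [:: DNode t s] i = F 1 - F t + lpos (fun x => F (t * x)) s i.
Proof.
move=> vs s0; rewrite /lpos lword1 lpre1 /= -/(lpre s) -/(lword s) big_cons.
case: s s0 {vs} => // c s _; rewrite lpre_cons dpre_behead /= big_cons mulr1.
by rewrite addrA subrK -map_take big_map.
Qed.

Lemma llen_node F t s : lvalid s -> (0 < size s)%N ->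
  llen F [:: DNode t s] = F 1 - F t + llen (fun x => F (t * x)) s.
Proof.
move=> vs s0; rewrite /llen lpre1 /= -/(lpre s) big_cons.
case: s s0 {vs} => // c s _; rewrite lpre_cons dpre_behead /= big_cons mulr1.
by rewrite addrA subrK big_map.
Qed.

Lemma lpos_leaf F i : lpos F [:: DLeaf i] i = F 1.
Proof. by rewrite /lpos lpre1 /= big_seq1. Qed.

Lemma llen_leaf F i : llen F [:: DLeaf i] = F 1.
Proof. by rewrite /llen lpre1 /= big_seq1. Qed.

Lemma uniq_mid s1 c s2 i : uniq (lword (s1 ++ c :: s2)) -> i \in dword c ->
  i \notin lword s1 /\ i \notin lword s2.
Proof.
rewrite lword_cat lword_cons !cat_uniq => /and3P[_ /hasPn h1 /and3P[_ /hasPn h2 _]] ic.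
split; first by apply: h1; rewrite mem_cat ic.
by apply/negP => /h2; rewrite ic.
Qed.

Lemma uniq_child c s : uniq (lword s) -> c \in s -> uniq (dword c).
Proof.
move=> us cs; case/path.splitPr: cs us => s1 s2.
by rewrite lword_cat lword_cons !cat_uniq => /and3P[_ _ /and3P[]].
Qed.

Lemma uniq_in t s' s : uniq (lword s) -> DNode t s' \in s -> uniq (lword s').
Proof. exact: uniq_child. Qed.

Lemma child_eq s c c' i : uniq (lword s) -> c \in s -> c' \in s ->
  i \in dword c -> i \in dword c' -> c = c'.
Proof.
move=> us cs; case/path.splitPr: cs us => s1 s2 us c's ic ic'.
have [n1 n2] := uniq_mid us ic.
move: c's; rewrite mem_cat inE => /or3P[h|/eqP //|h].
  by rewrite (mem_lword_sub h ic') in n1.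
by rewrite (mem_lword_sub h ic') in n2.
Qed.

Lemma dist_child F s c i j : lvalid s -> uniq (lword s) -> c \in s ->
  i \in dword c -> j \in dword c -> dist F s i j = dist F [:: c] i j.
Proof.
move=> vs us cs ic jc; rewrite /dist.
case/path.splitPr: cs us vs => s1 s2 us.
rewrite lvalid_cat => /andP[v1 /andP[vc v2]].
have [i1 _] := uniq_mid us ic; have [j1 _] := uniq_mid us jc.
rewrite !(lpos_catr _ _ v1) // -[c :: s2]cat1s !lpos_catl /lvalid /= ?vc ?lword1 //.
by lra.
Qed.

Lemma dist_node F t s i j : lvalid s -> (0 < size s)%N ->
  dist F [:: DNode t s] i j = dist (fun x => F (t * x)) s i j.
Proof. by move=> vs s0; rewrite /dist !lpos_node //; lra. Qed.

Lemma dist_in F s t s' i j : lvalid s -> uniq (lword s) -> DNode t s' \in s ->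
  i \in lword s' -> j \in lword s' ->
  dist F s i j = dist (fun x => F (t * x)) s' i j.
Proof.
move=> vs us cs is' js'; have [s2 _ vs'] := lvalidP vs cs.
by rewrite (dist_child _ vs us cs) // dist_node // ltnW.
Qed.

Lemma eq_lpos F G s i : {in lpre s, F =1 G} -> lpos F s i = lpos G s i.
Proof.
move=> FG; rewrite /lpos big_seq [RHS]big_seq; apply: eq_bigr => x /mem_take.
exact: FG.
Qed.

Lemma eq_dist F G s i j : {in lpre s, F =1 G} -> dist F s i j = dist G s i j.
Proof. by move=> FG; rewrite /dist !(eq_lpos _ FG). Qed.

Lemma eq_dist01 F G s i j : lvalid s -> (forall x, 0 <= x <= 1 -> F x = G x) ->
  dist F s i j = dist G s i j.
Proof. by move=> vs FG; apply: eq_dist => x /(lpre_01 vs) /FG. Qed.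

Lemma distZ a F s i j : dist (fun x => a * F x) s i j = a * dist F s i j.
Proof. by rewrite /dist /lpos -!mulr_sumr mulrBr. Qed.

Lemma dist_trans F s i j k : dist F s i k = dist F s i j + dist F s j k.
Proof. by rewrite /dist; lra. Qed.

Lemma distii F s i : dist F s i i = 0.
Proof. by rewrite /dist subrr. Qed.

Lemma distC F s i j : dist F s j i = - dist F s i j.
Proof. by rewrite /dist opprB. Qed.

Definition nonneg01 F := forall x, 0 <= x <= 1 -> 0 <= F x.

Lemma dist_index F s i j : (index i (lword s) <= index j (lword s))%N ->
  dist F s i j =
  \sum_(x <- drop (index i (lword s)).+1 (take (index j (lword s)).+1 (lpre s))) F x.
Proof.
rewrite /dist /lpos => ij.
rewrite -{1}(cat_take_drop (index i (lword s)).+1 (take _ (lpre s))) big_cat /=.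
by rewrite take_takel // addrC addrK.
Qed.

Lemma lpos_le_len F s i : lvalid s -> nonneg01 F -> lpos F s i <= llen F s.
Proof.
move=> vs F0; rewrite /lpos /llen -{2}(cat_take_drop (index i (lword s)).+1 (lpre s)).
rewrite big_cat /= lerDl big_seq sumr_ge0 // => x /mem_drop.
by move=> /(lpre_01 vs) /F0.
Qed.

Lemma lpos_ge1 F s i : lvalid s -> nonneg01 F -> i \in lword s -> F 1 <= lpos F s i.
Proof.
move=> vs F0; rewrite /lpos; case: s vs => // c s vs _.
have h x : x \in dpre c ++ lpre s -> 0 <= F x.
  by rewrite -lpre_cons => /(lpre_01 vs) /F0.
move: h; rewrite lpre_cons dpre_behead /= big_cons lerDl => h.
by rewrite big_seq sumr_ge0 // => x /mem_take xx; apply: h; rewrite inE xx orbT.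
Qed.

(** The first leaf of [s2] is preceded by a separator 1, and all other gaps contribute
    nonnegatively. *)
Lemma dist_sep_lt F s1 s2 i j : lvalid (s1 ++ s2) -> uniq (lword (s1 ++ s2)) ->
  nonneg01 F -> i \in lword s1 -> j \in lword s2 -> F 1 <= dist F (s1 ++ s2) i j.
Proof.
rewrite lvalid_cat lword_cat cat_uniq => /andP[v1 v2] /and3P[_ /hasPn h _] F0 i1 j2.
rewrite /dist lpos_catr ?h // lpos_catl //.
have := lpos_le_len i v1 F0; have := lpos_ge1 v2 F0 j2; lra.
Qed.

Definition together s i j := has (fun c => (i \in dword c) && (j \in dword c)) s.

Lemma dist_sep F s i j : lvalid s -> uniq (lword s) -> nonneg01 F ->
  i \in lword s -> j \in lword s -> ~~ together s i j -> F 1 <= `|dist F s i j|.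
Proof.
move=> vs us F0 i0 j0 nt.
have : exists s1 s2, s = s1 ++ s2 /\ ((i \in lword s1) && (j \in lword s2)
    || (j \in lword s1) && (i \in lword s2)).
  elim: s i0 j0 nt {vs us} => // c s IH.
  rewrite !lword_cons !mem_cat /= negb_or.
  case ic: (i \in dword c); case jc: (j \in dword c) => //= i0 j0.
  - by move=> _; exists [:: c], s; rewrite lword1 ic j0.
  - by move=> _; exists [:: c], s; rewrite lword1 jc i0 orbT.
  move=> /IH [] // s1 [s2 [-> h]]; exists (c :: s1), s2.
  by rewrite lword_cons !mem_cat; split=> //; case/orP: h => /andP[-> ->]; rewrite !orbT.
move=> [s1 [s2 [es /orP[]/andP[]]]]; rewrite es in us vs * => h1 h2.
  by apply: le_trans (ler_norm _); apply: dist_sep_lt.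
by rewrite distC normrN; apply: le_trans (ler_norm _); apply: dist_sep_lt.
Qed.

End DecoratedTrees.
Arguments dword {R I}.
Arguments dpre {R I}.
Arguments dvalid {R I}.

(** * The ratios mu of a decorated forest *)

Section Screens.
Variables (R : realFieldType) (I : choiceType) (psi : R -> R).
Hypothesis psi_gt0 : forall x, 0 <= x < 1 -> 0 < psi x.
Implicit Types (T c : dtree R I) (s : seq (dtree R I)) (F G : R -> R) (P t : R).

Definition Fw x := x * psi x.
(* Fw (P * x) / Fw P, extended to P = 0. *)
Definition phi P x := x * psi (P * x) / psi P.

Lemma mul01 P x : 0 <= P < 1 -> 0 <= x <= 1 -> 0 <= P * x < 1.
Proof.
move=> /andP[P0 P1] /andP[x0 x1]; rewrite mulr_ge0 //=.
by apply: le_lt_trans P1; rewrite ler_piMr.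
Qed.

Lemma mul11 P x : 0 <= P <= 1 -> 0 <= x <= 1 -> 0 <= P * x <= 1.
Proof. by move=> /andP[P0 P1] /andP[x0 x1]; rewrite mulr_ge0 //= mulr_ile1. Qed.

(** The cocycle identity of the quotients F (P u x) / F P. It survives at P = 0 because only values
    of psi are divided by. *)
Lemma phiM P u x : 0 <= P < 1 -> 0 <= u <= 1 ->
  phi P (u * x) = phi P u * phi (P * u) x.
Proof.
move=> P01 u01; have := psi_gt0 (mul01 P01 u01); have := psi_gt0 P01.
rewrite /phi (mulrA P) => h1 h2; field; apply/andP; split; exact: lt0r_neq0.
Qed.

Lemma phi1 P : 0 <= P < 1 -> phi P 1 = 1.
Proof.
by move=> P01; rewrite /phi mulr1 mul1r divff // lt0r_neq0 // psi_gt0.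
Qed.

Lemma phi0 x : phi 0 x = x.
Proof.
by rewrite /phi mul0r mulfK // lt0r_neq0 // psi_gt0 // lexx ltr01.
Qed.

Lemma phi_at0 P : phi P 0 = 0.
Proof. by rewrite /phi !mul0r. Qed.

Lemma phi_ge0 P : 0 <= P < 1 -> nonneg01 (phi P).
Proof.
move=> P01 x x01; have := psi_gt0 (mul01 P01 x01); have := psi_gt0 P01.
by case/andP: x01 => x0 _ h1 h2; rewrite /phi divr_ge0 ?mulr_ge0 ?(ltW h2) ?(ltW h1).
Qed.

Lemma FwM P x : 0 <= P < 1 -> Fw (P * x) = Fw P * phi P x.
Proof. by move=> /psi_gt0 h; rewrite /Fw /phi; field; apply: lt0r_neq0. Qed.

Definition has3 c i j k := [&& i \in dword c, j \in dword c & k \in dword c].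

(** The pair (z_i - z_k, z_i - z_j), measured at the vertex where the three labels part. The [foldr]
    keeps the recursion structural; the pair (0, 0) at a leaf is reached only for i = j = k. *)
Fixpoint dmu P T i j k : R * R :=
  match T with
  | DLeaf _ => (0, 0)
  | DNode t s =>
      foldr (fun c r => if has3 c i j k then dmu (P * t) c i j k else r)
        (dist (phi (P * t)) s i k, dist (phi (P * t)) s i j) s
  end.

(* Homogeneous coordinates of mu_ijk, where P is the product of the values of
   the edges below the vertex whose children form s. *)
Definition lmu P s i j k : R * R :=
  foldr (fun c r => if has3 c i j k then dmu P c i j k else r)
    (dist (phi P) s i k, dist (phi P) s i j) s.

Lemma lmu_in P s t s' i j k : uniq (lword s) -> DNode t s' \in s ->
  i \in lword s' -> j \in lword s' -> k \in lword s' ->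
  lmu P s i j k = lmu (P * t) s' i j k.
Proof.
rewrite /lmu; move: (_, _) => z us cs i' j' k'.
have -> : foldr (fun c r => if has3 c i j k then dmu P c i j k else r) z s
    = dmu P (DNode t s') i j k.
  elim: s us cs => //= c s IH us; rewrite inE => /orP[/eqP<-|cs].
    by rewrite /has3 !dword_node i' j' k'.
  case: ifP => [/and3P[ic _ _]|_]; last first.
    by apply: IH => //; move: us; rewrite lword_cons cat_uniq => /and3P[].
  by rewrite (@child_eq _ _ (c :: s) c (DNode t s') i) ?mem_head // inE cs orbT.
by [].
Qed.

Lemma lmu_out P s i j k : ~~ has (fun c => has3 c i j k) s ->
  lmu P s i j k = (dist (phi P) s i k, dist (phi P) s i j).
Proof.
rewrite /lmu; move: (_, _) => z; elim: s => //= c s IH.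
by rewrite negb_or => /andP[/negPf-> /IH].
Qed.

Lemma has_node s i j (p : pred (dtree R I)) : i != j ->
  (forall c, p c -> (i \in dword c) && (j \in dword c)) -> has p s ->
  exists t s', DNode t s' \in s /\ p (DNode t s').
Proof.
move=> ij h /hasP[[x|t s'] cs px]; last by exists t, s'.
by move: (h _ px); rewrite /= !inE => /andP[/eqP ix /eqP jx]; rewrite ix jx eqxx in ij.
Qed.

Lemma lmu_swap P s i j k : lmu P s i k j = ((lmu P s i j k).2, (lmu P s i j k).1).
Proof.
have h T Q : dmu Q T i k j = ((dmu Q T i j k).2, (dmu Q T i j k).1).
  move: T Q; fix loop 1; case=> [x|t s'] Q //=.
  have : forall z z' : R * R, z' = (z.2, z.1) ->
    foldr (fun c r => if has3 c i k j then dmu (Q * t) c i k j else r) z' s' =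
    ((foldr (fun c r => if has3 c i j k then dmu (Q * t) c i j k else r) z s').2,
     (foldr (fun c r => if has3 c i j k then dmu (Q * t) c i j k else r) z s').1).
    move=> z z' zz'; elim: s' => //= c s' ->; rewrite {1}/has3 [X in _ && X]andbC.
    by rewrite -/(has3 c i j k); case: ifP => _; rewrite ?loop.
  by apply.
rewrite /lmu; move: (dist _ _ _ _) (dist _ _ _ _) => a b.
elim: s => //= c s ->; rewrite {1}/has3 [X in _ && X]andbC.
by rewrite -/(has3 c i j k); case: ifP => _; rewrite ?h.
Qed.

(** The relation mu_ijk + mu_jik = 1. The vertex where i, j, k part depends only on the set of the
    three labels, so both pairs are built from the same distances, and the relation is their
    additivity. *)
Lemma lmu_add P s i j k : lvalid s -> uniq (lword s) -> i != j ->
  let m := lmu P s i j k in let m' := lmu P s j i k in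
  m.1 * m'.2 + m'.1 * m.2 = m.2 * m'.2.
Proof.
elim/list_tree_ind: s P => s IH P vs us ij.
have [/(has_node ij)[c /and3P[-> ->] //|t [s' [cs /and3P[]]]]|h] :=
  boolP (has (fun c => has3 c i j k) s).
  rewrite !dword_node => i' j' k'; rewrite !(lmu_in P us cs) //.
  by apply: (IH _ _ cs) => //; [case: (lvalidP vs cs) | apply: uniq_in us cs].
rewrite !lmu_out //=; last first.
  by apply: contra h => /hasP[c cs /and3P[h1 h2 h3]]; apply/hasP; exists c => //; apply/and3P.
by rewrite /dist; ring.
Qed.

(** With the indicator of an absolute gap 1 in the role of F, infinite distance is itself detected
    by a distance: [close] inherits transitivity and the descent to subtrees from [dist]. *)
Definition chi P x : R := (P * x == 1)%:R.
(* All gaps between i and j are different from 1. *)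
Definition close P s i j := dist (chi P) s i j == 0.

Lemma close_sym P s i j : close P s i j = close P s j i.
Proof. by rewrite /close distC oppr_eq0. Qed.

Lemma close_trans P s i j k : close P s i j -> close P s j k -> close P s i k.
Proof.
by rewrite /close (dist_trans _ _ i j k) => /eqP-> /eqP->; rewrite addr0.
Qed.

Lemma close_refl P s i : close P s i i.
Proof. by rewrite /close distii. Qed.

Lemma chi_ge0 P : nonneg01 (chi P).
Proof. by move=> x _; rewrite /chi ler0n. Qed.

Lemma close_in P s t s' i j : lvalid s -> uniq (lword s) -> DNode t s' \in s ->
  i \in lword s' -> j \in lword s' -> close P s i j = close (P * t) s' i j.
Proof.
move=> vs us cs i' j'; rewrite /close (dist_in _ vs us cs) //.
by congr (_ == 0); apply: eq_dist => x _; rewrite /= /chi mulrA.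
Qed.

(** Labels of different trees are separated by a relative gap 1, whose absolute value is P. *)
Lemma close_apart P s i j : lvalid s -> uniq (lword s) ->
  i \in lword s -> j \in lword s -> close P s i j -> ~~ together s i j -> P != 1.
Proof.
move=> vs us i0 j0 /eqP cij nt; apply/eqP => P1.
have := dist_sep vs us (@chi_ge0 P) i0 j0 nt.
by rewrite cij normr0 /chi P1 mul1r eqxx ler10.
Qed.

Lemma close_lt1 P s i j : 0 <= P < 1 -> lvalid s -> close P s i j.
Proof.
(* The constant 0 is written as a product so that [distZ] evaluates it. *)
move=> P01 vs; rewrite /close (@eq_dist01 _ _ _ (fun _ => 0 * 0)) //.
  by rewrite distZ mul0r.
move=> x x01; rewrite /chi mul0r; have /andP[_ /lt_eqF->] // := mul01 P01 x01.
Qed.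

Lemma has3_together s i j k : uniq (lword s) -> together s i j -> together s i k ->
  has (fun c => has3 c i j k) s.
Proof.
move=> us /hasP[c cs /andP[ic jc]] /hasP[c' cs' /andP[ic' kc']].
apply/hasP; exists c => //; rewrite /has3 ic jc /=.
by rewrite (child_eq us cs cs' ic ic').
Qed.

Lemma lmu_neq0 P s i j k : 0 <= P <= 1 -> lvalid s -> uniq (lword s) ->
  i \in lword s -> j \in lword s -> k \in lword s -> i != j ->
  close P s i j -> close P s i k -> lmu P s i j k != (0, 0).
Proof.
elim/list_tree_ind: s P => s IH P P01 vs us i0 j0 k0 ij cij cik.
have [/(has_node ij)[c /and3P[-> ->] //|t [s' [cs /and3P[]]]]|h] :=
  boolP (has (fun c => has3 c i j k) s).
  rewrite !dword_node => i' j' k'; rewrite !(lmu_in P us cs) //.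
  have [_ t01 vs'] := lvalidP vs cs.
  apply: (IH _ _ cs) => //; rewrite -?(close_in _ vs us cs) ?mul11 //.
  exact: uniq_in us cs.
rewrite lmu_out //.
have : ~~ together s i j || ~~ together s i k.
  by rewrite -negb_and; apply: contra h => /andP[]; apply: has3_together.
have PP : P != 1 -> 0 <= P < 1.
  by case/andP: P01 => -> /=; rewrite lt_neqAle => -> ->.
apply: contraL => /eqP[eik eij]; rewrite negb_or !negbK; apply/andP; split.
  apply: contraT => nt; have P1 := PP (close_apart vs us i0 j0 cij nt).
  by have := dist_sep vs us (phi_ge0 P1) i0 j0 nt; rewrite eij normr0 phi1 // ler10.
apply: contraT => nt; have P1 := PP (close_apart vs us i0 k0 cik nt).
by have := dist_sep vs us (phi_ge0 P1) i0 k0 nt; rewrite eik normr0 phi1 // ler10.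
Qed.

(** By [phiM], the factor [a] is the product of the values of phi along the way to the vertex where
    the labels part; it vanishes if some edge on the way has value 0. *)
Lemma lmu_phi P s i j k : 0 <= P < 1 -> lvalid s -> uniq (lword s) -> i != j ->
  exists a, dist (phi P) s i k = a * (lmu P s i j k).1 /\
            dist (phi P) s i j = a * (lmu P s i j k).2.
Proof.
elim/list_tree_ind: s P => s IH P P01 vs us ij.
have [/(has_node ij)[c /and3P[-> ->] //|t [s' [cs /and3P[]]]]|h] :=
  boolP (has (fun c => has3 c i j k) s); last first.
  by exists 1; rewrite lmu_out // !mul1r.
rewrite !dword_node => i' j' k'; rewrite !(lmu_in P us cs) //.
have [_ t01 vs'] := lvalidP vs cs.
have [a [h1 h2]] := IH _ _ cs _ (mul01 P01 t01) vs' (uniq_in us cs) ij.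
exists (phi P t * a); rewrite !(dist_in _ vs us cs) // -!(mulrA (phi P t)) -h1 -h2 -!distZ.
by split; apply: eq_dist => x _; rewrite /= phiM.
Qed.

(** Behind the relation mu_ijk nu_ik = nu_ij. Here P = 1 is allowed: closeness makes the product
    less than 1 at the vertex where the labels part, and there [FwM] extracts a common factor. *)
Lemma lmu_Fw P s i j k : 0 <= P <= 1 -> lvalid s -> uniq (lword s) ->
  i \in lword s -> j \in lword s -> k \in lword s -> i != j ->
  close P s i j -> close P s i k ->
  exists a, dist (fun x => Fw (P * x)) s i k = a * (lmu P s i j k).1 /\
            dist (fun x => Fw (P * x)) s i j = a * (lmu P s i j k).2.
Proof.
elim/list_tree_ind: s P => s IH P P01 vs us i0 j0 k0 ij cij cik.
have [/(has_node ij)[c /and3P[-> ->] //|t [s' [cs /and3P[]]]]|h] :=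
  boolP (has (fun c => has3 c i j k) s).
  rewrite !dword_node => i' j' k'; rewrite !(lmu_in P us cs) //.
  have [_ t01 vs'] := lvalidP vs cs.
  have [] := IH _ _ cs (P * t) _ vs' (uniq_in us cs) i' j' k' ij.
  - by rewrite mul11.
  - by rewrite -(close_in _ vs us cs).
  - by rewrite -(close_in _ vs us cs).
  move=> a [h1 h2]; exists a; rewrite -h1 -h2 !(dist_in _ vs us cs) //.
  by split; apply: eq_dist => x _; rewrite /= mulrA.
have PP : 0 <= P < 1.
  case/andP: P01 => -> /=; rewrite le_eqVlt => /orP[/eqP P1|//].
  have : ~~ together s i j || ~~ together s i k.
    by rewrite -negb_and; apply: contra h => /andP[]; apply: has3_together.
  by case/orP=> nt; [have := close_apart vs us i0 j0 cij nt
    | have := close_apart vs us i0 k0 cik nt]; rewrite P1 eqxx.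
exists (Fw P); rewrite lmu_out //= -!distZ.
by split; apply: eq_dist => x _; rewrite /= FwM.
Qed.

(** The relation mu_ijk mu_ikl = mu_ijl. At the vertex where the four labels part, the three pairs
    give the distances from i up to factors a1, a2, a3. Nonzero factors can be cancelled. If one of
    them is 0, two of the three distances vanish while the third does not, and a zero coordinate
    appears on either side. *)
Lemma lmu_mul P s i j k l : 0 <= P <= 1 -> lvalid s -> uniq (lword s) ->
  i \in lword s -> j \in lword s -> k \in lword s -> l \in lword s ->
  i != j -> i != k ->
  close P s i j -> close P s i k -> close P s i l ->
  (lmu P s i j k).1 * (lmu P s i k l).1 * (lmu P s i j l).2 =
  (lmu P s i j l).1 * (lmu P s i j k).2 * (lmu P s i k l).2.
Proof.
elim/list_tree_ind: s P => s IH P P01 vs us i0 j0 k0 l0 ij ik cij cik cil.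
have [/(has_node ij)[c /and4P[-> -> _ _] //|t [s' [cs /and4P[]]]]|h] := boolP
  (has (fun c => [&& i \in dword c, j \in dword c, k \in dword c & l \in dword c]) s).
  rewrite !dword_node => i' j' k' l'; rewrite !(lmu_in P us cs) //.
  have [_ t01 vs'] := lvalidP vs cs.
  apply: (IH _ _ cs) => //; rewrite -?(close_in _ vs us cs) ?mul11 //.
  exact: uniq_in us cs.
have nt : [|| ~~ together s i j, ~~ together s i k | ~~ together s i l].
  rewrite -!negb_and; apply: contra h => /and3P[/hasP[c cs /andP[ic jc]] ].
  move=> /hasP[c' c's /andP[ic' kc']] /hasP[c'' c''s /andP[ic'' lc'']].
  apply/hasP; exists c => //; rewrite ic jc /=.
  by rewrite {1}(child_eq us cs c's ic ic') kc' (child_eq us cs c''s ic ic'').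
have PP : 0 <= P < 1.
  case/andP: P01 => -> /=; rewrite le_eqVlt => /orP[/eqP P1|//].
  by case/or3P: nt => nt; [have := close_apart vs us i0 j0 cij nt
    | have := close_apart vs us i0 k0 cik nt
    | have := close_apart vs us i0 l0 cil nt]; rewrite P1 eqxx.
have sep x : x \in lword s -> ~~ together s i x -> dist (phi P) s i x != 0.
  move=> x0 ntx; have := dist_sep vs us (phi_ge0 PP) i0 x0 ntx.
  by apply: contraTneq => ->; rewrite normr0 phi1 // ler10.
have [a1 [p1 q1]] := lmu_phi k PP vs us ij.
have [a2 [p2 q2]] := lmu_phi l PP vs us ik.
have [a3 [p3 q3]] := lmu_phi l PP vs us ij.
move: (lmu P s i j k) (lmu P s i k l) (lmu P s i j l) p1 q1 p2 q2 p3 q3.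
case=> [x1 y1] [x2 y2] [x3 y3] /= p1 q1 p2 q2 p3 q3.
have {nt} nt : [|| dist (phi P) s i j != 0, dist (phi P) s i k != 0
    | dist (phi P) s i l != 0].
  by case/or3P: nt => nt; rewrite (sep _ _ nt) ?orbT.
move: (dist _ _ _ _) (dist _ _ _ _) (dist _ _ _ _) p1 q1 p2 q2 p3 q3 nt.
move=> dk dj dl p1 q1 p2 q2 p3 q3.
have [a10|a1n] := eqVneq a1 0.
  move: p1 q1; rewrite a10 !mul0r => k00 j00; rewrite k00 j00 eqxx /= => lN.
  have /eqP : a2 * y2 = 0 by rewrite -q2.
  rewrite mulf_eq0 => /orP[/eqP a20|/eqP->]; first by rewrite p2 a20 mul0r eqxx in lN.
  have /eqP : a3 * y3 = 0 by rewrite -q3.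
  rewrite mulf_eq0 => /orP[/eqP a30|/eqP->]; first by rewrite p3 a30 mul0r eqxx in lN.
  by rewrite !mulr0.
have [a20|a2n] := eqVneq a2 0.
  move: p2 q2; rewrite a20 !mul0r => l00 k00; rewrite k00 l00 eqxx /= orbF => jN.
  have /eqP : a1 * x1 = 0 by rewrite -p1.
  rewrite mulf_eq0 (negPf a1n) /= => /eqP->.
  have /eqP : a3 * x3 = 0 by rewrite -p3.
  rewrite mulf_eq0 => /orP[/eqP a30|/eqP->]; first by rewrite q3 a30 mul0r eqxx in jN.
  by rewrite !mul0r.
have [a30|a3n] := eqVneq a3 0.
  move: p3 q3; rewrite a30 !mul0r => l00 j00.
  have /eqP : a1 * y1 = 0 by rewrite -q1.
  rewrite mulf_eq0 (negPf a1n) /= => /eqP-> _.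
  have /eqP : a2 * x2 = 0 by rewrite -p2.
  by rewrite mulf_eq0 (negPf a2n) /= => /eqP->; rewrite !(mulr0, mul0r).
move=> _; apply: (mulfI a1n); apply: (mulfI a2n); apply: (mulfI a3n).
have -> : a3 * (a2 * (a1 * (x1 * x2 * y3))) = (a1 * x1) * (a2 * x2) * (a3 * y3) by ring.
have -> : a3 * (a2 * (a1 * (x3 * y1 * y2))) = (a3 * x3) * (a1 * y1) * (a2 * y2) by ring.
by rewrite -p1 -p2 -p3 -q1 -q2 -q3; ring.
Qed.

End Screens.

(** * Reversal and collapse *)

Lemma index_rev (T : eqType) (w : seq T) (x : T) : uniq w -> x \in w ->
  index x (rev w) = (size w - (index x w).+1)%N.
Proof.
move=> uw xw; have iw : (index x w < size w)%N by rewrite index_mem.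
have lt : (size w - (index x w).+1 < size (rev w))%N by rewrite size_rev; lia.
rewrite -[X in index X _](nth_index x xw) -{1}(revK w) nth_rev size_rev //.
by rewrite index_uniq // rev_uniq.
Qed.

Section Steps.
Variables (R : realFieldType) (I : choiceType) (psi : R -> R).
Hypothesis psi_gt0 : forall x, 0 <= x < 1 -> 0 < psi x.
Implicit Types (T c : dtree R I) (s u : seq (dtree R I)) (F G : R -> R) (P t : R).

Fixpoint dmirror T : dtree R I :=
  match T with
  | DLeaf i => DLeaf i
  | DNode t s => DNode t (rev (map dmirror s))
  end.

Definition lmirror s := rev (map dmirror s).

Lemma lmirror_cons c s : lmirror (c :: s) = lmirror s ++ [:: dmirror c].
Proof. by rewrite /lmirror /= rev_cons -cats1. Qed.

Lemma mem_lmirror s t u : DNode t u \in s -> DNode t (lmirror u) \in lmirror s.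
Proof. by move=> us; rewrite /lmirror mem_rev; apply/mapP; exists (DNode t u). Qed.

Lemma dmirrorK : involutive dmirror.
Proof.
rewrite /involutive /cancel; fix loop 1; case=> [i|t s]; first exact: erefl.
rewrite /=; congr DNode; rewrite map_rev revK -map_comp.
elim: s => //= c s ->; by rewrite loop.
Qed.

Lemma lmirrorK : involutive lmirror.
Proof.
by move=> s; rewrite /lmirror map_rev revK -map_comp (eq_map (g := id)) ?map_id //; apply: dmirrorK.
Qed.

Lemma lword_mirror s : lword (lmirror s) = rev (lword s).
Proof.
elim/list_tree_ind: s => s IH.
have h c : c \in s -> dword (dmirror c) = rev (dword c).
  by case: c => // t u /IH.
elim: s {IH} h => // c s IHs h.
rewrite lmirror_cons lword_cat lword1 h ?mem_head //.
rewrite IHs ?lword_cons ?rev_cat // => c' c's.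
by apply: h; rewrite inE c's orbT.
Qed.

Lemma lvalid_mirror s : lvalid (lmirror s) = lvalid s.
Proof.
elim/list_tree_ind: s => s IH.
have h c : c \in s -> dvalid (dmirror c) = dvalid c.
  case: c => // t u /IH e; rewrite /= size_rev size_map.
  by congr [&& _, _ & _]; exact: e.
rewrite /lvalid all_rev all_map; apply: eq_in_all => c /h; exact.
Qed.

(** With a closing separator 1 appended, every leaf stands between two gaps and mirroring just
    reverses the sequence; otherwise the opening separator would have no counterpart. *)
Lemma lpre_mirror s : lvalid s -> rcons (lpre (lmirror s)) 1 = rev (rcons (lpre s) 1).
Proof.
elim/list_tree_ind: s => s IH vs.
have h c : c \in s -> rcons (dpre (dmirror c)) 1 = rev (rcons (dpre c) 1).
  case: c => [//|t u] us; have [u2 _ vu] := lvalidP vs us.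
  have := IH _ _ us vu; rewrite /= -/(lmirror u) -/(lpre (lmirror u)) -/(lpre u).
  case: u {IH us vu} u2 => // c u _; rewrite lpre_cons dpre_behead /=.
  have : size (lmirror (c :: u)) = (size u).+1 by rewrite size_rev size_map.
  case: (lmirror _) => // c' u' _; rewrite lpre_cons dpre_behead /=.
  rewrite !rev_cons !rev_rcons !rcons_cons.
  move=> -[/rcons_inj[-> ]]; by rewrite map_rev.
elim: s {IH vs} h => //= c s IHs h.
rewrite lmirror_cons lpre_cat lpre1 rcons_cat.
rewrite h ?mem_head // lpre_cons rcons_cat rev_cat -IHs; last first.
  by move=> c' c's; apply: h; rewrite inE c's orbT.
by rewrite rev_rcons cat_rcons.
Qed.

Lemma lpos_mirror F s i : lvalid s -> uniq (lword s) -> i \in lword s ->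
  lpos F (lmirror s) i = llen F s + F 1 - lpos F s i.
Proof.
move=> vs us iw; rewrite /lpos /llen lword_mirror index_rev //.
have ii : (index i (lword s) < size (lpre s))%N by rewrite lvalid_size ?index_mem.
have sz : size (lpre (lmirror s)) = size (lpre s).
  by rewrite !lvalid_size ?lvalid_mirror // lword_mirror size_rev.
have -> : take ((size (lword s) - (index i (lword s)).+1)).+1 (lpre (lmirror s)) =
    rev (drop (index i (lword s)).+1 (rcons (lpre s) 1)).
  rewrite -lvalid_size // subnSK // rev_drop -lpre_mirror // size_rcons subSS.
  by rewrite -cats1 takel_cat // sz leq_subr.
rewrite (perm_big _ (introT permPl (perm_rev _))).
rewrite -{2}(cat_take_drop (index i (lword s)).+1 (lpre s)) big_cat /=.
rewrite drop_rcons // -cats1 big_cat big_seq1 /=; ring.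
Qed.

Lemma dist_mirror F s i j : lvalid s -> uniq (lword s) -> i \in lword s ->
  j \in lword s -> dist F (lmirror s) i j = - dist F s i j.
Proof. by move=> vs us iw jw; rewrite /dist !lpos_mirror //; ring. Qed.

Definition scale2 (a : R) (p : R * R) := (a * p.1, a * p.2).

Lemma lmu_mirror P s i j k : lvalid s -> uniq (lword s) -> i \in lword s ->
  j \in lword s -> k \in lword s -> i != j ->
  lmu psi P (lmirror s) i j k = scale2 (-1) (lmu psi P s i j k).
Proof.
elim/list_tree_ind: s P => s IH P vs us iw jw kw ij.
have us' : uniq (lword (lmirror s)) by rewrite lword_mirror rev_uniq.
have [/(has_node ij)[c /and3P[-> ->] //|t [u [cs /and3P[]]]]|h] :=
  boolP (has (fun c => has3 c i j k) s).
  rewrite !dword_node => iu ju ku; rewrite (lmu_in psi P us cs) //.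
  rewrite (lmu_in psi P us' (mem_lmirror cs)) ?lword_mirror ?mem_rev //.
  by apply: (IH _ _ cs) => //; [case: (lvalidP vs cs)|apply: uniq_in us cs].
have h' : ~~ has (fun c => has3 c i j k) (lmirror s).
  apply: contra h => /(has_node ij)[c /and3P[-> ->] //|t [u [cs]]].
  rewrite /has3 !dword_node => h3; apply/hasP; exists (DNode t (lmirror u)).
    by rewrite -(lmirrorK s) mem_lmirror.
  by rewrite /has3 !dword_node !lword_mirror !mem_rev.
by rewrite !lmu_out // !dist_mirror // /scale2 /= !mulN1r.
Qed.

(** The relations of the cube complex, applied at any depth. At the lowest level [LCollapse]
    collapses a trunk and thereby splits its tree. Permutations of trees are kept apart, because
    they do change positions. *)
Inductive lstep : seq (dtree R I) -> seq (dtree R I) -> Prop :=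
| LFlip s1 s s2 : lstep (s1 ++ DNode 0 s :: s2) (s1 ++ DNode 0 (lmirror s) :: s2)
| LCollapse s1 s s2 : lstep (s1 ++ DNode 1 s :: s2) (s1 ++ s ++ s2)
| LInside s1 t s s' s2 : lstep s s' ->
    lstep (s1 ++ DNode t s :: s2) (s1 ++ DNode t s' :: s2).

Lemma lstep_ctx a b s s' : lstep s s' -> lstep (a ++ s ++ b) (a ++ s' ++ b).
Proof.
by case=> [s1 u s2|s1 u s2|s1 t u u' s2 uu']; rewrite -!catA !cat_cons ?(catA a);
  [exact: LFlip|exact: LCollapse|exact: LInside].
Qed.

Lemma lstep_word s s' : lstep s s' -> perm_eq (lword s) (lword s').
Proof.
elim=> [s1 u s2|s1 u s2|s1 t u u' s2 _ uu']; rewrite !lword_cat ?lword_cons perm_cat2l.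
- by rewrite perm_cat2r !dword_node lword_mirror perm_sym perm_rev.
- by rewrite ?lword_cat.
- by rewrite perm_cat2r.
Qed.

Lemma lpos_mid F s1 s2 u u' i : lvalid s1 -> lvalid u -> lvalid u' ->
  perm_eq (lword u) (lword u') -> llen F u = llen F u' ->
  {in lword u, lpos F u =1 lpos F u'} ->
  lpos F (s1 ++ u ++ s2) i = lpos F (s1 ++ u' ++ s2) i.
Proof.
move=> v1 vu vu' uu' eqlen eqpos.
have [i1|i1] := boolP (i \in lword s1); first by rewrite !lpos_catl.
rewrite !(lpos_catr _ _ v1) //; congr (_ + _).
have [iu|iu] := boolP (i \in lword u).
  by rewrite !lpos_catl // ?eqpos // -(perm_mem uu').
by rewrite !lpos_catr // -?(perm_mem uu') // eqlen.
Qed.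

Lemma lpos0 F s i : F =1 (fun=> 0) -> lpos F s i = 0.
Proof. by move=> F0; rewrite /lpos big1. Qed.

Lemma llen0 F s : F =1 (fun=> 0) -> llen F s = 0.
Proof. by move=> F0; rewrite /llen big1. Qed.

(* Flipping happens above an edge of value 0, where all gaps vanish. *)
Lemma lstep_pos F s s' : F 0 = 0 -> lvalid s -> lvalid s' -> lstep s s' ->
  lpos F s =1 lpos F s' /\ llen F s = llen F s'.
Proof.
move=> F0 vs vs' ss'; elim: ss' F F0 vs vs' => {s s'} [s1 u s2|s1 u s2|s1 t u u' s2 uu' IH] F F0.
- rewrite !lvalid_cat => /and3P[v1 vu v2] /and3P[_ vu' _].
  have /and3P[u2 _ vu0] := vu; have /and3P[u2' _ vu0'] := vu'.
  have z : (fun x => F (0 * x)) =1 (fun=> 0) by move=> x; rewrite mul0r.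
  have el : llen F [:: DNode 0 u] = llen F [:: DNode 0 (lmirror u)].
    by rewrite !llen_node ?(ltnW u2) ?(ltnW u2') // !llen0.
  split; last by rewrite -(cat1s (DNode 0 u)) -(cat1s (DNode 0 (lmirror u))) !llen_cat el.
  move=> i; rewrite -(cat1s (DNode 0 u)) -(cat1s (DNode 0 (lmirror u))).
  apply: lpos_mid; rewrite ?/(lvalid [:: _]) ?/lvalid /= ?andbT ?u2 ?u2' //.
  + by move: vu vu0; rewrite /= /lvalid => /and3P[_ -> _] ->.
  + by move: vu' vu0'; rewrite /= /lvalid => /and3P[_ -> _] ->.
  + by rewrite !lword1 !dword_node lword_mirror perm_sym perm_rev.
  + by move=> j _; rewrite !lpos_node ?(ltnW u2) ?(ltnW u2') // !lpos0.
- rewrite !lvalid_cat => /and3P[v1 vu v2] /and3P[_ vu' _].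
  have /and3P[u2 _ _] := vu.
  have vu1 : lvalid [:: DNode 1 u] by rewrite /lvalid /= andbT.
  have el : llen F [:: DNode 1 u] = llen F u.
    by rewrite llen_node ?(ltnW u2) // subrr add0r /llen; apply: eq_bigr => x _; rewrite mul1r.
  split; last by rewrite -(cat1s (DNode 1 u)) !llen_cat el.
  move=> i; rewrite -(cat1s (DNode 1 u)); apply: lpos_mid => //.
    by rewrite lword1.
  move=> j _; rewrite lpos_node ?(ltnW u2) // subrr add0r.
  by apply: eq_lpos => x _; rewrite mul1r.
- rewrite !lvalid_cat => /and3P[v1 vu v2] /and3P[_ vu' _].
  have /and3P[u2 t01 vu0] := vu; have /and3P[u2' _ vu0'] := vu'.
  have [|||ep el] := IH (fun x => F (t * x)); rewrite ?mulr0 //.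
  have {}el : llen F [:: DNode t u] = llen F [:: DNode t u'].
    by rewrite !llen_node ?(ltnW u2) ?(ltnW u2') // el.
  split; last by rewrite -(cat1s (DNode t u)) -(cat1s (DNode t u')) !llen_cat el.
  move=> i; rewrite -(cat1s (DNode t u)) -(cat1s (DNode t u')).
  apply: lpos_mid; rewrite ?/(lvalid [:: _]) ?/lvalid /= ?andbT ?u2 ?u2' ?t01 //.
  + by rewrite !lword1 !dword_node lstep_word.
  + by move=> j _; rewrite !lpos_node ?(ltnW u2) ?(ltnW u2') // ep.
Qed.

Lemma lstep_dist F s s' i j : F 0 = 0 -> lvalid s -> lvalid s' -> lstep s s' ->
  dist F s i j = dist F s' i j.
Proof. by move=> F0 vs vs' /(lstep_pos F0 vs vs')[e _]; rewrite /dist !e. Qed.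

Lemma scale21 p : scale2 1 p = p.
Proof. by rewrite /scale2 !mul1r -surjective_pairing. Qed.

(** A triple that lies in no single tree of the modified block either lies in an unmodified tree or
    parts at the present vertex, where only its distances matter. *)
Lemma lmu_mid P s1 s2 u u' i j k :
  let s := s1 ++ u ++ s2 in let s' := s1 ++ u' ++ s2 in
  uniq (lword s) -> uniq (lword s') -> i != j ->
  perm_eq (lword u) (lword u') ->
  dist (phi psi P) s i k = dist (phi psi P) s' i k ->
  dist (phi psi P) s i j = dist (phi psi P) s' i j ->
  ~~ has (fun c => has3 c i j k) u -> ~~ has (fun c => has3 c i j k) u' ->
  lmu psi P s i j k = lmu psi P s' i j k.
Proof.
move=> s s' us us' ij uu' eik eij hu hu'.
have [h|h] := boolP (has (fun c => has3 c i j k) (s1 ++ s2)).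
  move: h => /(has_node ij)[c /and3P[-> ->] //|t [v [cs /and3P[]]]].
  rewrite !dword_node => iv jv kv.
  have cs0 : DNode t v \in s.
    by rewrite /s !mem_cat; move: cs; rewrite mem_cat => /orP[]->; rewrite ?orbT.
  have cs1 : DNode t v \in s'.
    by rewrite /s' !mem_cat; move: cs; rewrite mem_cat => /orP[]->; rewrite ?orbT.
  by rewrite (lmu_in psi P us cs0) // (lmu_in psi P us' cs1).
move: h; rewrite has_cat negb_or => /andP[h1 h2].
by rewrite !lmu_out ?eik ?eij // !has_cat !negb_or h1 h2 ?hu ?hu'.
Qed.

(** Distances with respect to phi P do not change, as phi P 0 = 0. Hence only triples inside a
    reversed tree are affected; their distances change sign, so that [a] is 1 or -1. *)
Lemma lstep_mu s s' : lvalid s -> lvalid s' -> uniq (lword s) -> lstep s s' ->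
  forall P i j k, i != j -> i \in lword s -> j \in lword s -> k \in lword s ->
  exists2 a, a != 0 & lmu psi P s' i j k = scale2 a (lmu psi P s i j k).
Proof.
move=> vs vs' us ss'; have us' : uniq (lword s') by rewrite -(perm_uniq (lstep_word ss')).
move=> P i j k ij.
have dik := lstep_dist i k (phi_at0 psi P) vs vs' ss'.
have dij := lstep_dist i j (phi_at0 psi P) vs vs' ss'.
elim: ss' P vs vs' us us' dik dij => {s s'} [s1 u s2|s1 u s2|s1 t u u' s2 uu' IH] P.
- move=> vs vs' us us' dik dij i0 j0 k0.
  have cs : DNode 0 u \in s1 ++ DNode 0 u :: s2 by rewrite mem_cat mem_head orbT.
  have cs' : DNode 0 (lmirror u) \in s1 ++ DNode 0 (lmirror u) :: s2.
    by rewrite mem_cat mem_head orbT.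
  have [/and3P[]|h] := boolP (has3 (DNode 0 u) i j k).
    rewrite !dword_node => iu ju ku; have [_ _ vu] := lvalidP vs cs.
    exists (-1); first by rewrite oppr_eq0 oner_eq0.
    rewrite (lmu_in psi P us cs) // (lmu_in psi P us' cs') ?lword_mirror ?mem_rev //.
    by rewrite lmu_mirror // (uniq_in us cs).
  exists 1; rewrite ?oner_eq0 // scale21; move: dik dij us us'.
  rewrite -(cat1s (DNode 0 u)) -(cat1s (DNode 0 (lmirror u))) => dik dij us us'.
  apply/esym/lmu_mid => //; rewrite ?has_seq1 //.
    by rewrite !lword1 !dword_node lword_mirror perm_sym perm_rev.
  by move: h; rewrite /has3 !dword_node !lword_mirror !mem_rev.
- move=> vs vs' us us' dik dij i0 j0 k0; exists 1; rewrite ?oner_eq0 // scale21.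
  have cs : DNode 1 u \in s1 ++ DNode 1 u :: s2 by rewrite mem_cat mem_head orbT.
  have uu := uniq_in us cs; have [_ _ vu] := lvalidP vs cs.
  have [/and3P[]|h] := boolP (has3 (DNode 1 u) i j k).
    rewrite !dword_node => iu ju ku; rewrite (lmu_in psi P us cs) // mulr1.
    have [/(has_node ij)[c /and3P[-> ->] //|t [v [cv /and3P[]]]]|h] :=
      boolP (has (fun c => has3 c i j k) u).
      rewrite !dword_node => iv jv kv; rewrite (lmu_in psi P uu cv) //.
      by rewrite (lmu_in psi P us' (t := t) (s' := v)) // !mem_cat cv orbT.
    rewrite (lmu_out psi P h) lmu_out; last first.
      rewrite !has_cat (negPf h) /= negb_or; apply/andP; split.
        apply/hasPn => c c1; apply: contraL iu => /and3P[ic _ _].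
        move: us; rewrite lword_cat cat_uniq => /and3P[_ /hasPn hh _].
        apply/negP => iu; have := hh i; rewrite lword_cons mem_cat dword_node iu => /(_ isT).
        by rewrite (mem_lword_sub c1).
      apply/hasPn => c c2; apply: contraL iu => /and3P[ic _ _].
      move: us; rewrite lword_cat lword_cons !cat_uniq => /and5P[_ _ _ /hasPn hh _].
      by apply: hh; rewrite (mem_lword_sub c2).
    rewrite -dik -dij !(dist_in _ vs us cs) //.
    by congr (_, _); apply: eq_dist => x _; rewrite mul1r.
  move: dik dij us us'; rewrite -(cat1s (DNode 1 u)) => dik dij us us'.
  apply/esym/lmu_mid => //; rewrite ?has_seq1 ?lword1 //.
  apply: contra h => /hasP[c cu /and3P[ic jc kc]].
  by rewrite /has3 !dword_node !(mem_lword_sub cu).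
- move=> vs vs' us us' dik dij i0 j0 k0.
  have cs : DNode t u \in s1 ++ DNode t u :: s2 by rewrite mem_cat mem_head orbT.
  have cs' : DNode t u' \in s1 ++ DNode t u' :: s2 by rewrite mem_cat mem_head orbT.
  have [_ _ vu] := lvalidP vs cs; have [_ _ vu'] := lvalidP vs' cs'.
  have wuu' := lstep_word uu'.
  have [/and3P[]|h] := boolP (has3 (DNode t u) i j k).
    rewrite !dword_node => iu ju ku; rewrite (lmu_in psi P us cs) //.
    rewrite (lmu_in psi P us' cs') -?(perm_mem wuu') //.
    apply: IH => //; first exact: uniq_in us cs.
    - exact: uniq_in us' cs'.
    - exact: lstep_dist (phi_at0 _ _) vu vu' uu'.
    - exact: lstep_dist (phi_at0 _ _) vu vu' uu'.
  exists 1; rewrite ?oner_eq0 // scale21; move: dik dij us us'.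
  rewrite -(cat1s (DNode t u)) -(cat1s (DNode t u')) => dik dij us us'.
  apply/esym/lmu_mid => //; rewrite ?has_seq1 ?lword1 //.
  by move: h; rewrite /has3 !dword_node -!(perm_mem wuu').
Qed.

(** [m] bounds the number of trees from below: 2 for the children of a node, 1 for a single tree, 0
    for a forest. Validity is required at both ends of every step, so that an equivalence between
    sequences of children lifts to one between nodes. *)
Definition lok m s := lvalid s && (m <= size s)%N.
Definition vstep m s s' : Prop := [/\ lok m s, lok m s' & lstep s s'].
Definition leqv m := clos_refl_sym_trans _ (vstep m).

Lemma leqv_map m m' (g : seq (dtree R I) -> seq (dtree R I)) s s' :
  (forall x, lok m x -> lok m' (g x)) ->
  (forall x y, lok m x -> lok m y -> lstep x y -> lstep (g x) (g y)) ->
  leqv m s s' -> leqv m' (g s) (g s').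
Proof.
move=> ok gs; elim=> [x y [vx vy xy]|x|x y _|x y z _ xy _].
- by apply: rst_step; split; [apply: ok|apply: ok|apply: gs].
- exact: rst_refl.
- exact: rst_sym.
- exact: rst_trans xy.
Qed.

Lemma leqv_ctx m m' s1 s2 s s' : lvalid s1 -> lvalid s2 ->
  (m' <= m + size s1 + size s2)%N ->
  leqv m s s' -> leqv m' (s1 ++ s ++ s2) (s1 ++ s' ++ s2).
Proof.
move=> v1 v2 mm'; apply: (@leqv_map _ _ (fun x => s1 ++ x ++ s2)) => [x|x y _ _].
  rewrite /lok !lvalid_cat v1 v2 !size_cat => /andP[-> mx] /=; lia.
exact: lstep_ctx.
Qed.

Lemma leqv_node m' s1 t s2 s s' : lvalid s1 -> lvalid s2 -> 0 <= t <= 1 ->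
  (m' <= (size s1 + size s2).+1)%N ->
  leqv 2 s s' -> leqv m' (s1 ++ DNode t s :: s2) (s1 ++ DNode t s' :: s2).
Proof.
move=> v1 v2 t01 mm'; apply: (@leqv_map _ _ (fun x => s1 ++ DNode t x :: s2)) => [x|x y _ _].
  rewrite /lok !lvalid_cat v1 /= v2 t01 !size_cat /lvalid => /andP[-> ->] /=; lia.
exact: LInside.
Qed.

End Steps.
Arguments dmirror {R I}.

(** * Gap sequences determine forests *)

Section Items.
Variables (R : realFieldType) (I : choiceType) (psi : R -> R).
Hypothesis psi_gt0 : forall x, 0 <= x < 1 -> 0 < psi x.
Implicit Types (T c : dtree R I) (s u its : seq (dtree R I)) (F G : R -> R) (P t : R).

(* Leaves and subtrees above an edge of value 0 are the points of a screen. *)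
Definition is_item c := if c is DNode t _ then t == 0 else true.

(** The descent stops at edges of value 0. What lies above such an edge is invisible to distances
    with F 0 = 0, so items are the points that positions can tell apart, and the gaps collected by
    [cpre] are positive. *)
Fixpoint citems T : seq (dtree R I) :=
  match T with
  | DLeaf i => [:: DLeaf i]
  | DNode t s => if t == 0 then [:: DNode t s] else flatten (map citems s)
  end.

Fixpoint cpre T : seq R :=
  match T with
  | DLeaf i => [:: 1]
  | DNode t s =>
      if t == 0 then [:: 1] else 1 :: map ( *%R t) (behead (flatten (map cpre s)))
  end.

Definition litems s := flatten (map citems s).
Definition lcpre s := flatten (map cpre s).

Lemma citems_item c : is_item c -> citems c = [:: c].
Proof. by case: c => //= t s ->. Qed.
Lemma cpre_item c : is_item c -> cpre c = [:: 1].
Proof. by case: c => //= t s ->. Qed.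

Lemma cpre_behead c : cpre c = 1 :: behead (cpre c).
Proof. by case: c => //= t s; case: eqP. Qed.

Lemma litems_cons c s : litems (c :: s) = citems c ++ litems s.
Proof. by []. Qed.
Lemma lcpre_cons c s : lcpre (c :: s) = cpre c ++ lcpre s.
Proof. by []. Qed.
Lemma litems_cat s1 s2 : litems (s1 ++ s2) = litems s1 ++ litems s2.
Proof. by rewrite /litems map_cat flatten_cat. Qed.
Lemma lcpre_cat s1 s2 : lcpre (s1 ++ s2) = lcpre s1 ++ lcpre s2.
Proof. by rewrite /lcpre map_cat flatten_cat. Qed.

Lemma items_valid s : lvalid s -> lvalid (litems s) && all is_item (litems s).
Proof.
elim/list_tree_ind: s => s IH vs.
rewrite /litems; have : all (fun c => all dvalid (citems c) && all is_item (citems c)) s.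
  apply/allP; case=> // t u us; have [u2 t01 vu] := lvalidP vs us.
  rewrite /=; case: eqP => t0; last by rewrite -/(litems u); apply: (IH _ _ us).
  by rewrite /= u2 t01 t0 eqxx !andbT; apply: vu.
elim: s {IH vs} => //= c s IHs /andP[/andP[h1 h2] /IHs /andP[h3 h4]].
by rewrite /lvalid !all_cat h1 h2 h4 -/(lvalid _) h3.
Qed.

Lemma litems_word s : lword (litems s) = lword s.
Proof.
elim/list_tree_ind: s => s IH.
have h c : c \in s -> lword (citems c) = dword c.
  case: c => [i //|t u /IH e] /=; case: eqP => _; first by rewrite lword1.
  by rewrite -/(litems u) e.
elim: s {IH} h => // c s IHs h; rewrite litems_cons lword_cat lword_cons h ?mem_head //.
by rewrite IHs // => c' c's; apply: h; rewrite inE c's orbT.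
Qed.

Lemma size_lcpre s : lvalid s -> size (lcpre s) = size (litems s).
Proof.
elim/list_tree_ind: s => s IH vs.
have h c : c \in s -> size (cpre c) = size (citems c).
  case: c => [i //|t u us] /=; have [u2 t01 vu] := lvalidP vs us.
  case: eqP => //= _; rewrite size_map size_behead -(IH _ _ us vu) prednK //.
  by case: (u) u2 => // c' u' _; rewrite /= cpre_behead.
elim: s {IH vs} h => // c s IHs h.
rewrite litems_cons lcpre_cons !size_cat h ?mem_head // IHs // => c' c's.
by apply: h; rewrite inE c's orbT.
Qed.

Lemma size_cpre c : dvalid c -> size (cpre c) = size (citems c).
Proof.
move=> vc; have := @size_lcpre [:: c]; rewrite lcpre_cons litems_cons !cats0.
by apply; rewrite /lvalid /= vc.
Qed.

Lemma lcpre_01 s x : lvalid s -> x \in lcpre s -> 0 < x <= 1.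
Proof.
elim/list_tree_ind: s x => s IH x vs /flatten_mapP[c cs].
case: c cs => [i|t u] cs /=; first by rewrite inE => /eqP->; rewrite ltr01 lexx.
have [u2 /andP[t0 t1] vu] := lvalidP vs cs.
case: eqP => tn; first by rewrite inE => /eqP->; rewrite ltr01 lexx.
rewrite inE => /orP[/eqP->|]; first by rewrite ltr01 lexx.
move=> /mapP[y /mem_behead /(IH _ _ cs _ vu) /andP[y0 y1] ->].
by rewrite mulr_gt0 ?mulr_ile1 ?(ltW y0) // lt_neqAle t0 andbT eq_sym; apply/eqP.
Qed.

Lemma cpre_1 s : (1 < size s)%N -> 1 \in behead (lcpre s).
Proof.
case: s => [|a [|b s]] // _; rewrite /lcpre /= (cpre_behead a) /= mem_cat.
by rewrite (cpre_behead b) mem_head orbT.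
Qed.

Definition ipos F its (gs : seq R) i : R :=
  \sum_(x <- take (find (fun c => i \in dword c) its).+1 gs) F x.

Lemma ipos_catl F its its' gs gs' i : size gs = size its -> i \in lword its ->
  ipos F (its ++ its') (gs ++ gs') i = ipos F its gs i.
Proof.
rewrite mem_lword => e h.
by rewrite /ipos find_cat h takel_cat // e -has_find.
Qed.

Lemma ipos_catr F its its' gs gs' i : size gs = size its -> i \notin lword its ->
  ipos F (its ++ its') (gs ++ gs') i = \sum_(x <- gs) F x + ipos F its' gs' i.
Proof.
rewrite mem_lword => e /negPf h.
by rewrite /ipos find_cat h -addnS -e takeD drop_size_cat // take_size_cat // big_cat.
Qed.

(** Gaps inside an item are multiplied by 0, so all its leaves share one position. *)
Lemma lpos_items F s : F 0 = 0 -> lvalid s ->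
  {in lword s, lpos F s =1 ipos F (litems s) (lcpre s)} /\
  llen F s = \sum_(x <- lcpre s) F x.
Proof.
elim/list_tree_ind: s F => s IH F F0 vs.
have h c : c \in s -> {in dword c, lpos F [:: c] =1 ipos F (citems c) (cpre c)} /\
    llen F [:: c] = \sum_(x <- cpre c) F x.
  case: c => [i|t u] cs.
    split; last by rewrite llen_leaf /= big_seq1.
    by move=> j; rewrite /= inE => /eqP->; rewrite lpos_leaf /ipos /= big_seq1.
  have [u2 t01 vu] := lvalidP vs cs.
  have u0 : (0 < size u)%N by apply: ltnW.
  split=> [i iu|]; rewrite ?lpos_node ?llen_node //=; case: eqP => t0.
  - rewrite t0 F0 subr0 lpos0; last by move=> x; rewrite mul0r.
    by rewrite addr0 /ipos /= big_seq1.
  - have [|-> // _] := IH _ _ cs (fun x => F (t * x)) _ vu; first by rewrite mulr0.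
    rewrite -/(litems u) -/(lcpre u) /ipos.
    case: u u0 {cs u2 vu iu} => // c u _; rewrite lcpre_cons cpre_behead /= !big_cons.
    by rewrite -map_take big_map mulr1; ring.
  - by rewrite t0 F0 subr0 llen0 ?addr0 ?big_seq1 // => x; rewrite mul0r.
  have [|_ ->] := IH _ _ cs (fun x => F (t * x)) _ vu; first by rewrite mulr0.
  rewrite -/(lcpre u); case: u u0 {cs u2 vu} => // c u _.
  by rewrite lcpre_cons cpre_behead /= !big_cons big_map mulr1; ring.
elim: s {IH} vs h => [|c s IHs] vs h; first by split=> //; rewrite /llen !big_nil.
have /andP[vc vs'] : dvalid c && lvalid s := vs.
have {}IHs := IHs vs' (fun c' c's => h c' (mem_behead (s := c :: s) c's)).
have [hp hl] := h c (mem_head _ _); have [ip il] := IHs.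
have v1 : lvalid [:: c] by rewrite /lvalid /= vc.
split; last by rewrite -cat1s llen_cat lcpre_cons big_cat /= hl il.
move=> i; rewrite lword_cons litems_cons lcpre_cons -cat1s.
have wc : lword (citems c) = dword c by have := litems_word [:: c]; rewrite litems_cons cats0 lword1.
have [ic _|ic] := boolP (i \in dword c).
  by rewrite lpos_catl ?lword1 // hp // ipos_catl ?size_cpre ?wc.
rewrite mem_cat (negPf ic) orFb => is0.
by rewrite lpos_catr ?lword1 // ipos_catr ?size_cpre ?wc // hl ip.
Qed.

Lemma litems_child d s : DNode 0 d \in litems s ->
  DNode 0 d \in s \/ exists t u, DNode t u \in s /\ DNode 0 d \in litems u.
Proof.
move=> /flatten_mapP[[i|t u] cs] /=; first by rewrite inE => /eqP.
case: eqP => t0; first by rewrite inE => /eqP[_ ->]; left; rewrite -t0.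
by move=> dn; right; exists t, u.
Qed.

(** Inside an item the product of the values below is 0, whatever P is, so only the screens of the
    item enter. *)
Lemma lmu_item P s d i j k : uniq (lword s) -> DNode 0 d \in litems s ->
  i \in lword d -> j \in lword d -> k \in lword d ->
  lmu psi P s i j k = lmu psi 0 d i j k.
Proof.
elim/list_tree_ind: s P => s IH P us /litems_child h id jd kd.
case: h => [cs|[t [u [cs du]]]]; first by rewrite (lmu_in psi P us cs) // mulr0.
have w x : x \in lword d -> x \in lword u.
  by move=> xd; rewrite -litems_word (mem_lword_sub du).
by rewrite (lmu_in psi P us cs) ?w // (IH _ _ cs) // (uniq_in us cs).
Qed.

(** Unique parsing: neither block contains 1, and what follows a block is empty or starts with 1. *)
Lemma sep_inj (a b u v : seq R) : 1 \notin a -> 1 \notin b ->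
  (forall x y, u = x :: y -> x = 1) -> (forall x y, v = x :: y -> x = 1) ->
  a ++ u = b ++ v -> a = b /\ u = v.
Proof.
elim: a b => [|x a IH] [|y b] //=; rewrite ?inE ?negb_or.
- by move=> _ /andP[/eqP y1 _] hu _ /hu /esym.
- by move=> /andP[/eqP x1 _] _ _ hv /esym /hv /esym.
move=> /andP[_ na] /andP[_ nb] hu hv [-> /(IH _ na nb hu hv) [-> ->]].
by [].
Qed.

Lemma lcpre_head s x y : lcpre s = x :: y -> x = 1.
Proof. by case: s => // c s; rewrite lcpre_cons cpre_behead => -[]. Qed.

Definition teq c c' := leqv 1 [:: c] [:: c'].

(** Trees are replaced one at a time; in the induction a prefix [p] collects those already
    replaced. *)
Lemma leqv_all m s s' : lvalid s -> lvalid s' -> (m <= size s)%N ->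
  List.Forall2 teq s s' -> leqv m s s'.
Proof.
move=> vs vs' ms h; rewrite -[s](cat0s) -[s'](cat0s).
have : @lvalid R I [::] by []; have : (m <= @size (dtree R I) [::] + size s)%N by [].
elim: h {ms} [::] vs vs' => {s s'} [|c c' s s' cc' ss' IH] p; first by move=> *; apply: rst_refl.
rewrite /= => /andP[vc vs] /andP[vc' vs'] ms vp.
apply: (@rst_trans _ _ _ (p ++ c' :: s)).
  have h : leqv m (p ++ [:: c] ++ s) (p ++ [:: c'] ++ s).
    by apply: (leqv_ctx vp vs _ cc'); move: ms; rewrite /=; lia.
  exact: h.
rewrite -!cat_rcons; apply: IH => //; first by rewrite size_rcons; move: ms => /=; lia.
by rewrite -cats1 lvalid_cat vp /lvalid /= vc'.
Qed.

Lemma teq_refl c : teq c c.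
Proof. exact: rst_refl. Qed.

Lemma leqv_collapse m s1 u s2 : lvalid (s1 ++ DNode 1 u :: s2) ->
  (m <= size (s1 ++ DNode 1%R u :: s2))%N ->
  leqv m (s1 ++ DNode 1 u :: s2) (s1 ++ u ++ s2) /\ lvalid (s1 ++ u ++ s2) /\
  (m <= size (s1 ++ u ++ s2))%N.
Proof.
move=> vs ms; have cs : DNode 1 u \in s1 ++ DNode 1 u :: s2 by rewrite mem_cat mem_head orbT.
have [u2 _ vu] := lvalidP vs cs.
have vs' : lvalid (s1 ++ u ++ s2).
  by move: vs; rewrite !lvalid_cat => /and3P[v1 _ v2]; rewrite v1 vu; exact: v2.
have ms' : (m <= size (s1 ++ u ++ s2))%N by move: ms; rewrite !size_cat /=; lia.
split=> //; apply: rst_step; split; rewrite /lok ?vs ?vs' //.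
exact: LCollapse.
Qed.

Lemma items_collapse s1 u s2 :
  litems (s1 ++ DNode 1 u :: s2) = litems (s1 ++ u ++ s2) /\
  (lvalid u -> (0 < size u)%N -> lcpre (s1 ++ DNode 1 u :: s2) = lcpre (s1 ++ u ++ s2)).
Proof.
rewrite !litems_cat !lcpre_cat litems_cons lcpre_cons /= oner_eq0; split=> // _.
case: u => // c u _; rewrite -/(lcpre _) lcpre_cons cpre_behead /=.
by rewrite (eq_map (g := id)) ?map_id // => x; rewrite mul1r.
Qed.

Lemma lnodes_cat s1 s2 : lnodes (s1 ++ s2) = (lnodes s1 + lnodes s2)%N.
Proof. by rewrite /lnodes map_cat sumn_cat. Qed.

Definition has_one s := has (fun c => if c is DNode t _ then t == 1 else false) s.

Lemma has_oneP s : has_one s -> exists s1 u s2, s = s1 ++ DNode 1 u :: s2.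
Proof.
move=> /hasP[[//|t u] cs /eqP t1]; rewrite t1 in cs.
by case/path.splitPr: cs => s1 s2; exists s1, u, s2.
Qed.

(** Once all trunks of value 1 are collapsed, the entries 1 of the gap sequence mark exactly the
    beginnings of the trees and cut it into the sequences of the single trees. For a tree that is
    not an item, the trunk value is the largest inner gap, because its children are separated by
    relative gaps 1; dividing by it leaves the same problem for the children. *)
Lemma leqv_unique m s s' : lvalid s -> lvalid s' -> (m <= size s)%N ->
  (m <= size s')%N -> List.Forall2 teq (litems s) (litems s') -> lcpre s = lcpre s' ->
  leqv m s s'.
Proof.
have [N] := ubnP (lnodes s + lnodes s').
elim: N m s s' => // N IHN m s s' sN vs vs' ms ms' eit egs.
have [/has_oneP[s1 [u [s2 es]]]|n1] := boolP (has_one s).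
  rewrite es in vs ms eit egs sN.
  have cs : DNode 1 u \in s1 ++ DNode 1 u :: s2 by rewrite mem_cat mem_head orbT.
  have [u2 _ vu] := lvalidP vs cs.
  have [st [vs1 ms1]] := leqv_collapse vs ms.
  have [e1 /(_ vu (ltnW u2)) e2] := items_collapse s1 u s2.
  rewrite es; apply: rst_trans st _; apply: IHN => //; rewrite -?e1 -?e2 //.
  by move: sN; rewrite !lnodes_cat /lnodes /=; lia.
have [/has_oneP[s1 [u [s2 es]]]|n1'] := boolP (has_one s').
  rewrite es in vs' ms' eit egs sN.
  have cs : DNode 1 u \in s1 ++ DNode 1 u :: s2 by rewrite mem_cat mem_head orbT.
  have [u2 _ vu] := lvalidP vs' cs.
  have [st [vs1 ms1]] := leqv_collapse vs' ms'.
  have [e1 /(_ vu (ltnW u2)) e2] := items_collapse s1 u s2.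
  rewrite es; apply: (@rst_trans _ _ _ (s1 ++ u ++ s2)); last exact: rst_sym.
  apply: IHN => //; rewrite -?e1 -?e2 //.
  by move: sN; rewrite !lnodes_cat /lnodes /=; lia.
apply: leqv_all => //.
elim: s s' {ms ms'} vs vs' sN eit egs n1 n1' => [|c s IHs] [|c' s'].
- by move=> *; constructor.
- by move=> _ _ _ _; rewrite lcpre_cons cpre_behead.
- by move=> _ _ _ _; rewrite lcpre_cons cpre_behead.
rewrite /= => /andP[vc vs] /andP[vc' vs'] sN; rewrite !litems_cons !lcpre_cons.
move=> eit egs; rewrite !negb_or => /andP[c1 n1] /andP[c1' n1'].
(* A trunk value below 1 keeps every inner gap of the tree below 1. *)
have nb b : dvalid b -> ~~ (if b is DNode t _ then t == 1 else false) ->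
    1 \notin behead (cpre b).
  case: b => //= t u /and3P[u2 /andP[t0 t1] vu] tn1; case: eqP => //= tn0.
  apply/mapP => -[y /mem_behead]; rewrite -/(lcpre u) => /(lcpre_01 vu) /andP[y0 y1] e.
  have : t < 1 by rewrite lt_neqAle tn1.
  by rewrite ltNge {1}e ler_piMr.
move: egs; rewrite (cpre_behead c) (cpre_behead c') /= => -[].
move=> /(sep_inj (nb _ vc c1) (nb _ vc' c1') (@lcpre_head s) (@lcpre_head s')) [ec es].
have {}ec : cpre c = cpre c' by rewrite cpre_behead ec -cpre_behead.
have [i1 [i2 [h1 [h2 e]]]] := List.Forall2_app_inv_l _ _ eit.
have sz : size (citems c') = size i1.
  by rewrite -size_cpre // -ec size_cpre //; have := List.Forall2_length h1.
move/eqP: e; rewrite eqseq_cat // => /andP[/eqP e1 /eqP e2]; rewrite -{}e1 -{}e2 in h1 h2.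
constructor; last by apply: IHs => //; move: sN; rewrite /lnodes /=; lia.
have size1 b : dvalid b -> ~~ is_item b -> (1 < size (cpre b))%N.
  case: b => //= t u /and3P[u2 _ vu] /negPf->; rewrite /= size_map size_behead.
  by case: u u2 {vu} => [|x [|y u]] //= _; rewrite (cpre_behead x) (cpre_behead y) /= !size_cat /=; lia.
have [ic|nc] := boolP (is_item c).
  have ic' : is_item c'.
    by apply: contraT => /(size1 _ vc'); rewrite -ec cpre_item.
  by move: h1; rewrite !citems_item // => h1; inversion h1.
have nc' : ~~ is_item c'.
  by apply: contra nc => ic'; apply: contraT => /(size1 _ vc); rewrite ec cpre_item.
case: c c' vc vc' nc nc' ec h1 sN {c1 c1' sz eit nb size1} => [//|t u] [//|t' u'].
rewrite /= => /and3P[u2 /andP[t0 t1] vu] /and3P[u2' /andP[t0' t1'] vu'] nt nt'.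
rewrite (negPf nt) (negPf nt') => -[] eg h1 sN.
(* The trunk value [a] occurs among the inner gaps of its tree, while every inner gap of the other
   tree is at most its trunk value [b]. *)
have le1 (a b : R) (v v' : seq (dtree R I)) : lvalid v' -> 0 <= b -> (1 < size v)%N ->
    map ( *%R a) (behead (lcpre v)) = map ( *%R b) (behead (lcpre v')) -> a <= b.
  move=> vv' b0 v2 e; have : a \in map ( *%R a) (behead (lcpre v)).
    by apply/mapP; exists 1; rewrite ?mulr1 // cpre_1.
  rewrite e => /mapP[x /mem_behead /(lcpre_01 vv') /andP[_ x1] ->].
  by rewrite ler_piMr.
have tt' : t = t'.
  by apply/eqP; rewrite eq_le (le1 _ _ _ _ vu' t0' u2 eg) (le1 _ _ _ _ vu t0 u2' (esym eg)).
rewrite -tt' in eg *.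
have {}eg := inj_map (mulfI nt) eg.
have {}eg : lcpre u = lcpre u'.
  have hd v : (1 < size v)%N -> lcpre v = 1 :: behead (lcpre v).
    by case: v => // x v _; rewrite lcpre_cons cpre_behead.
  by rewrite hd // [RHS]hd // eg.
apply: (@leqv_node _ _ 1 [::] t [::]) => //; first by rewrite t0.
apply: IHN => //; move: sN; rewrite /lnodes /=; move: (sumn _) (sumn _) => a b; clear; lia.
Qed.

(** * Binary trees with prescribed items and gaps *)

Fixpoint dbinary T : bool :=
  match T with
  | DLeaf _ => true
  | DNode _ s => (size s == 2%N) && all dbinary s
  end.

Lemma seq_max (g : seq R) : g != [::] -> exists2 m, m \in g & {in g, forall x, x <= m}.
Proof.
elim: g => // x g IH _; case: (g =P [::]) => [->|/eqP /IH[m mg hm]].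
  by exists x; rewrite ?mem_head // => y; rewrite inE => /eqP->.
have [xm|mx] := leP x m.
  by exists m; rewrite ?inE ?mg ?orbT // => y; rewrite inE => /orP[/eqP->|/hm].
exists x; rewrite ?mem_head // => y; rewrite inE => /orP[/eqP->|/hm] //.
by move=> /le_trans; apply; apply: ltW.
Qed.

(** A largest gap [m] becomes the trunk value, and the gaps on either side of it, divided by [m],
    stay in (0, 1]. The last clause records that the trunk value is a largest gap, by which trunk
    values are controlled later. *)
Lemma tree_of_items its (g : seq R) : size its = (size g).+1 ->
  all is_item its -> lvalid its -> all dbinary its -> {in g, forall x, 0 < x <= 1} ->
  exists T, [/\ dvalid T, dbinary T, citems T = its, cpre T = 1 :: g &
    if g is [::] then its = [:: T]
    else exists m s, [/\ T = DNode m s, m \in g & {in g, forall x, x <= m}]].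
Proof.
have [N] := ubnP (size g); elim: N its g => // N IH its g gN sz itm vi bi g01.
case: (g =P [::]) => [g0|/eqP gn].
  move: sz; rewrite g0 /=; case: its itm vi bi => [|T [|? ?]] //=.
  rewrite !andbT => itm vT bT _; exists T.
  by split => //; rewrite ?citems_item ?cpre_item.
have [m mg hm] := seq_max gn.
have /andP[m0 m1] := g01 _ mg.
have [g1 [g2 eg]] : exists g1 g2, g = g1 ++ m :: g2.
  by case/path.splitPr: mg => g1 g2; exists g1, g2.
have sz' : (size its = (size g1).+1 + (size g2).+1)%N by rewrite sz eg size_cat /=; lia.
set i1 := take (size g1).+1 its; set i2 := drop (size g1).+1 its.
have e12 : its = i1 ++ i2 by rewrite cat_take_drop.
have s1 : size i1 = (size g1).+1 by rewrite size_takel // sz' leq_addr.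
have s2 : size i2 = (size g2).+1 by rewrite size_drop sz'; lia.
move: itm vi bi; rewrite e12 lvalid_cat !all_cat => /andP[it1 it2] /andP[v1 v2] /andP[b1 b2].
have mul_div h : map ( *%R m) (map (fun x => x / m) h) = h.
  rewrite -map_comp (eq_map (g := id)) ?map_id // => x /=.
  by rewrite mulrC divfK // gt_eqF.
have div01 h : {subset h <= g} -> {in map (fun x => x / m) h, forall x, 0 < x <= 1}.
  move=> hg _ /mapP[x /hg xg ->]; have /andP[x0 x1] := g01 _ xg.
  by rewrite divr_gt0 //= ler_pdivrMr // mul1r hm.
have sub1 : {subset g1 <= g} by move=> x xg; rewrite eg mem_cat xg.
have sub2 : {subset g2 <= g} by move=> x xg; rewrite eg mem_cat inE xg !orbT.
have [||A [vA bA iA gA _]] := IH i1 (map (fun x => x / m) g1) _ _ it1 v1 b1 (div01 _ sub1).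
- move: gN; rewrite eg size_cat size_map /=; move: (size g1) (size g2) => a b; clear; lia.
- by rewrite size_map.
have [||B [vB bB iB gB _]] := IH i2 (map (fun x => x / m) g2) _ _ it2 v2 b2 (div01 _ sub2).
- move: gN; rewrite eg size_cat size_map /=; move: (size g1) (size g2) => a b; clear; lia.
- by rewrite size_map.
exists (DNode m [:: A; B]); split.
- by rewrite /= vA vB (ltW m0) m1.
- by rewrite /= bA bB.
- by rewrite /= gt_eqF // iA iB cats0.
- by rewrite /= gt_eqF // gA gB /= cats0 map_cat /= mulr1 !mul_div eg.
case eg' : g => [|x y]; first by rewrite eg' in gn.
by exists m, [:: A; B]; rewrite -eg'.
Qed.

End Items.
Arguments is_item {R I}.
Arguments citems {R I}.
Arguments cpre {R I}.
Arguments dbinary {R I}.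
Arguments teq {R I}.

(** * Ratios determine forests *)

Lemma Forall2_mem (A B : eqType) (r q : A -> B -> Prop) (l : seq A) (l' : seq B) :
  (forall a b, a \in l -> b \in l' -> r a b -> q a b) ->
  List.Forall2 r l l' -> List.Forall2 q l l'.
Proof.
move=> h h0; elim: h0 h => {l l'} [|a b l l' ab _ IH] h; first by constructor.
constructor; first by apply: h; rewrite ?mem_head.
by apply: IH => x y xl yl; apply: h; rewrite inE ?xl ?yl orbT.
Qed.

Section Reconstruction.
Variables (R : realFieldType) (I : choiceType) (psi : R -> R).
Hypothesis psi_gt0 : forall x, 0 <= x < 1 -> 0 < psi x.
Implicit Types (T c : dtree R I) (s u v d its : seq (dtree R I)) (F G : R -> R) (P t : R).

Lemma ipos_cons F c its g (gs : seq R) i : ipos F (c :: its) (g :: gs) i =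
  if i \in dword c then F g else F g + ipos F its gs i.
Proof. by rewrite /ipos /=; case: ifP => _; rewrite ?take0 ?big_seq1 // big_cons. Qed.

Lemma ipos_gt0 F its (gs : seq R) i : {in gs, forall x, 0 < F x} -> (0 < size gs)%N ->
  0 < ipos F its gs i.
Proof.
case: gs => // g gs h _; rewrite /ipos /= big_cons ltr_wpDr ?h ?mem_head //.
by rewrite big_seq sumr_ge0 // => x /mem_take xg; rewrite ltW // h // inE xg orbT.
Qed.

Definition same_labels c c' := dword c =i dword c'.

(** Reading from the left: the labels at the smallest position form the first item of both lists,
    and injectivity of F recovers the gap to the next one. Positions are known only up to the
    translation [a], hence nothing is said about the opening gaps. *)
Lemma screen_unique (D : pred R) F its its' (gs gs' : seq R) a :
  {in D, forall x, 0 < F x} -> {in D &, injective F} ->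
  size gs = size its -> size gs' = size its' ->
  uniq (lword its) -> uniq (lword its') -> lvalid its -> lvalid its' ->
  lword its =i lword its' -> all D (behead gs) -> all D (behead gs') ->
  {in lword its, forall i, ipos F its gs i = ipos F its' gs' i + a} ->
  behead gs = behead gs' /\ List.Forall2 same_labels its its'.
Proof.
move=> D0 Dinj; have ex c : dvalid c -> exists i, i \in dword c.
  by move=> /dword_neq0; case: (dword c) => // i w _; exists i; rewrite mem_head.
elim: its its' gs gs' a => [|c its IH] [|c' its'] [|g gs] [|g' gs'] // a.
- by move=> _ _ _ _ _ /andP[/ex[i ic] _] /(_ i); rewrite lword_cons mem_cat ic.
- by move=> _ _ _ _ /andP[/ex[i ic] _] _ /(_ i); rewrite lword_cons mem_cat ic.
move=> [sg] [sg'] uw uw' vi vi' ww Dg Dg' h.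
have /andP[vc vits] := vi; have /andP[vc' vits'] := vi'.
have pos (its0 : seq (dtree R I)) (gs0 : seq R) i : size gs0 = size its0 -> all D gs0 ->
    i \in lword its0 -> 0 < ipos F its0 gs0 i.
  move=> e /allP Dgs iw; apply: ipos_gt0 => [x /Dgs /D0 //|].
  by rewrite e; case: its0 iw {e}.
have head_le (c0 : dtree R I) its0 g0 gs0 i j : size gs0 = size its0 -> all D gs0 ->
    i \in dword c0 -> j \in lword (c0 :: its0) -> j \notin dword c0 ->
    ipos F (c0 :: its0) (g0 :: gs0) i < ipos F (c0 :: its0) (g0 :: gs0) j.
  move=> e Dg0 ic; rewrite lword_cons mem_cat => jw jc; rewrite !ipos_cons ic (negPf jc).
  by rewrite (negPf jc) in jw; rewrite ltrDl pos.
have head_le' (c0 : dtree R I) its0 g0 gs0 i j : size gs0 = size its0 -> all D gs0 ->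
    i \in dword c0 -> j \in lword (c0 :: its0) ->
    ipos F (c0 :: its0) (g0 :: gs0) i <= ipos F (c0 :: its0) (g0 :: gs0) j.
  move=> e Dg0 ic jw; have [jc|jc] := boolP (j \in dword c0).
    by rewrite !ipos_cons ic jc.
  by rewrite ltW // head_le.
have inw (c0 : dtree R I) its0 i : i \in dword c0 -> i \in lword (c0 :: its0).
  by rewrite lword_cons mem_cat => ->.
have cc' : dword c =i dword c'.
  (* A label of one first item outside the other would lie strictly to the right of some [j] for one
     list and not to the right of [j] for the other. *)
  move=> i; apply/idP/idP => ic; apply: contraT => nic.
    have [j jc] := ex _ vc'.
    have := head_le c' its' g' gs' j i sg' Dg' jc; rewrite -ww inw // => /(_ isT nic).
    have := head_le' c its g gs i j sg Dg ic; rewrite ww inw // => /(_ isT).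
    have := h i (inw _ _ _ ic); have := h j; rewrite ww inw // => /(_ isT).
    move: (ipos _ _ _ _) (ipos _ _ _ _) (ipos _ _ _ _) (ipos _ _ _ _) => x y z t.
    lra.
  have [j jc] := ex _ vc.
  have := head_le c its g gs j i sg Dg jc; rewrite ww inw // => /(_ isT nic).
  have := head_le' c' its' g' gs' i j sg' Dg' ic; rewrite -ww inw // => /(_ isT).
  have := h j (inw _ _ _ jc); have := h i; rewrite ww inw // => /(_ isT).
  move: (ipos _ _ _ _) (ipos _ _ _ _) (ipos _ _ _ _) (ipos _ _ _ _) => x y z t.
  lra.
have [i0 i0c] := ex _ vc.
have ea : a = F g - F g'.
  have := h i0 (inw _ _ _ i0c); rewrite !ipos_cons i0c -cc' i0c; lra.
have uc : uniq (dword c ++ lword its) := uw; have uc' : uniq (dword c' ++ lword its') := uw'.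
move: uc uc'; rewrite !cat_uniq => /and3P[_ /hasPn n1 u1] /and3P[_ /hasPn n2 u2].
have w1 : lword its =i lword its'.
  move=> i; have := ww i; rewrite !lword_cons !mem_cat cc'.
  case ic : (i \in dword c'); last by [].
  move=> _; rewrite (contraTF (n1 i)) ?negbK ?[_ \in _]cc' //.
  by rewrite (contraTF (n2 i)) ?negbK.
have h1 : {in lword its, forall i, ipos F its gs i = ipos F its' gs' i + 0}.
  move=> i iw; have := h i; rewrite lword_cons mem_cat iw orbT => /(_ isT).
  rewrite !ipos_cons -cc'; have /negPf-> := n1 _ iw; rewrite ea; lra.
have Db (l : seq R) : all D l -> all D (behead l) by case: l => //= x l /andP[].
have [e1 e2] := IH its' gs gs' 0 sg sg' u1 u2 vits vits' w1 (Db _ Dg) (Db _ Dg') h1.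
split; last by constructor.
rewrite /=; case: gs gs' sg sg' e1 Dg Dg' h1 {h IH} => [|x gs] [|y gs'] //=.
- by case: its e2 {vi uw vits ww n1 u1 w1} => // e2; inversion e2.
- by case: its e2 {vi uw vits ww n1 u1 w1} => // c0 its1 e2; inversion e2 => //; subst.
move=> sg sg' -> /andP[Dx _] /andP[Dy _] h1; congr (_ :: _); apply: Dinj => //.
case: its its' sg e2 h1 vits {sg' vi vi' uw uw' ww n1 n2 u1 u2 w1 vits'} => //.
move=> d its [|d' its'] _ e2; first by inversion e2.
have dd' : same_labels d d' by inversion e2.
move=> h1 /andP[/ex[i id] _].
by have := h1 i (inw _ _ _ id); rewrite !ipos_cons id -dd' id addr0.
Qed.

Lemma ipos_item F its (gs : seq R) c i j : uniq (lword its) -> c \in its ->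
  i \in dword c -> j \in dword c -> ipos F its gs i = ipos F its gs j.
Proof.
move=> ui ci ic jc; rewrite /ipos; congr (\sum_(x <- take _.+1 _) _).
apply: eq_in_find => c' c'i; apply/idP/idP => h.
  by rewrite -(child_eq ui ci c'i ic h).
by rewrite -(child_eq ui ci c'i jc h).
Qed.

Lemma dist_item F s c i j : F 0 = 0 -> lvalid s -> uniq (lword s) -> c \in litems s ->
  i \in dword c -> j \in dword c -> dist F s i j = 0.
Proof.
move=> F0 vs us cs ic jc; have [h _] := lpos_items F0 vs.
have w x : x \in dword c -> x \in lword s.
  by rewrite -litems_word; apply: mem_lword_sub.
by rewrite /dist !h ?w // (@ipos_item _ _ _ c i j) ?subrr // litems_word.
Qed.

Lemma litems_lnodes s d : DNode 0 d \in litems s -> (lnodes d < lnodes s)%N.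
Proof.
elim/list_tree_ind: s => s IH /litems_child[/lnodes_in //|[t [u [us du]]]].
exact: ltn_trans (IH _ _ us du) (lnodes_in us).
Qed.

Lemma teq_node t d d' : 0 <= t <= 1 -> leqv 2 d d' -> teq (DNode t d) (DNode t d').
Proof. by move=> t01 dd'; apply: (@leqv_node _ _ 1 [::] t [::]). Qed.

Lemma teq_flip d : lok 2 d -> teq (DNode 0 (lmirror d)) (DNode 0 d).
Proof.
move=> /andP[vd d2]; rewrite -{2}(lmirrorK d); apply: rst_step; split.
- by rewrite /lok /lvalid /= lexx ler01 size_rev size_map d2 andbT; have := lvalid_mirror d; rewrite vd /lvalid => ->.
- by rewrite lmirrorK /lok /lvalid /= lexx ler01 d2 /= !andbT; exact: vd.
by apply: (@LFlip _ _ [::] _ [::]).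
Qed.

Lemma lok_size2 s : lok 2 s -> (1 < size (lword s))%N.
Proof.
case: s => [|a [|b s]]; rewrite /lok /lvalid /= ?andbF // => /andP[/and3P[/dword_neq0 a0 /dword_neq0 b0 _] _].
by rewrite !lword_cons !size_cat; lia.
Qed.

(** Items with equal labels are of the same kind, because a node has at least two labels. A node of
    value 0 may be reversed, so it is enough to know its children up to mirror image. *)
Lemma items_teq s s' : lvalid s -> lvalid s' -> uniq (lword s) -> uniq (lword s') ->
  (forall d d', DNode 0 d \in litems s -> DNode 0 d' \in litems s' ->
     lok 2 d -> lok 2 d' -> lword d =i lword d' ->
     leqv 2 d d' \/ leqv 2 d (lmirror d')) ->
  List.Forall2 same_labels (litems s) (litems s') ->
  List.Forall2 teq (litems s) (litems s').
Proof.
move=> vs vs' us us' h; apply: Forall2_mem => c c' ci c'i cc'.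
have [/allP vi /allP ii] := andP (items_valid vs).
have [/allP vi' /allP ii'] := andP (items_valid vs').
have uc : uniq (dword c) by apply: uniq_child ci; rewrite litems_word.
have uc' : uniq (dword c') by apply: uniq_child c'i; rewrite litems_word.
have sz : size (dword c) = size (dword c') by apply: perm_size; apply: uniq_perm.
have := vi _ ci; have := vi' _ c'i; have := ii _ ci; have := ii' _ c'i.
case: c c' ci c'i cc' {uc uc'} sz => [i|t d] [i'|t' d'] ci c'i cc' sz //=.
- by have := cc' i; rewrite /= !inE eqxx => /esym/eqP-> *; apply: teq_refl.
- move=> _ _ /and3P[d2 _ vd] _; have := @lok_size2 d'; rewrite -(dword_node t' d').
  by rewrite -sz /lok /lvalid vd d2 => /(_ isT).
- move=> _ _ _ /and3P[d2 _ vd]; have := @lok_size2 d; rewrite -(dword_node t d).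
  by rewrite sz /lok /lvalid vd d2 => /(_ isT).
move=> /eqP t'0 /eqP t0; subst t t' => /and3P[d2' _ vd'] /and3P[d2 _ vd].
have ok : lok 2 d by rewrite /lok d2 andbT.
have ok' : lok 2 d' by rewrite /lok d2' andbT.
have [dd'|dd'] := h d d' ci c'i ok ok' cc'.
  by apply: teq_node dd'; rewrite lexx ler01.
apply: rst_trans (teq_flip ok'); apply: teq_node dd'; rewrite lexx ler01 //.
Qed.

Definition prop2 (p q : R * R) := p.1 * q.2 = p.2 * q.1.

Lemma two_children s : lok 2 s -> uniq (lword s) ->
  exists i j, [/\ i \in lword s, j \in lword s & ~~ together s i j].
Proof.
case: s => [|a [|b s]]; rewrite /lok /lvalid /= ?andbF // => /andP[/and3P[/dword_neq0 a0 /dword_neq0 b0 vs] _] us.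
have [i ia] : exists i, i \in dword a by case: (dword a) a0 => // i w _; exists i; rewrite mem_head.
have [j jb] : exists i, i \in dword b by case: (dword b) b0 => // x w _; exists x; rewrite mem_head.
exists i, j; split; [by rewrite lword_cons mem_cat ia| |].
  by rewrite !lword_cons !mem_cat jb orbT.
apply/negP => tij; have /hasP[c cs /andP[ic jc]] : together [:: a, b & s] i j := tij.
have bs : b \in a :: b :: s by rewrite !inE eqxx orbT.
have := child_eq us cs bs jc jb; have := child_eq us cs (mem_head _ _) ic ia => -> ab.
move: us; rewrite ab !lword_cons cat_uniq => /and3P[_ /hasPn hh _].
by have := hh j; rewrite mem_cat jb => /(_ isT).
Qed.

Lemma id_ge0 : nonneg01 (@id R).
Proof. by move=> x /andP[]. Qed.

Lemma lcpre_behead s : lvalid s -> (0 < size s)%N -> lcpre s = 1 :: behead (lcpre s).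
Proof. by case: s => // c s _ _; rewrite lcpre_cons cpre_behead. Qed.

(** A positive factor preserves the order of the items, so the gaps agree up to the factor. It
    equals 1, since neighbouring trees are separated by a gap 1, which is the largest gap in both
    sequences. *)
Lemma leqv_scaled (a : R) s s' : 0 < a -> lok 2 s -> lok 2 s' ->
  uniq (lword s) -> uniq (lword s') -> lword s =i lword s' ->
  {in lword s &, forall i j, dist id s i j = a * dist id s' i j} ->
  (forall d d', DNode 0 d \in litems s -> DNode 0 d' \in litems s' ->
     lok 2 d -> lok 2 d' -> lword d =i lword d' ->
     leqv 2 d d' \/ leqv 2 d (lmirror d')) ->
  leqv 2 s s'.
Proof.
move=> a0 /andP[vs s2] /andP[vs' s2'] us us' ww hd hit.
have [[/andP[vi _] /andP[vi' _]]] := (items_valid vs, items_valid vs').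
have [i0 i0s] : exists i, i \in lword s.
  have := @lok_size2 s; rewrite /lok vs s2 => /(_ isT).
  by case: (lword s) => // i w _; exists i; rewrite mem_head.
have [p _] := lpos_items (F := @id R) erefl vs.
have [p' _] := lpos_items (F := @id R) erefl vs'.
have ge0 v x : lvalid v -> x \in behead (lcpre v) -> 0 < x <= 1.
  by move=> vv /mem_behead /(lcpre_01 vv).
have [eg eit] : behead (lcpre s) = behead (map ( *%R a) (lcpre s')) /\
    List.Forall2 same_labels (litems s) (litems s').
  apply: (@screen_unique [pred x | 0 < x] id _ _ _ _ (lpos id s i0 - a * lpos id s' i0)) => //.
  - exact: size_lcpre.
  - by rewrite size_map size_lcpre.
  - by rewrite litems_word.
  - by rewrite litems_word.
  - by move=> i; rewrite !litems_word.
  - by apply/allP => x /(ge0 _ _ vs) /andP[].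
  - rewrite behead_map all_map; apply/allP => x /(ge0 _ _ vs') /andP[x0 _] /=.
    by rewrite mulr_gt0.
  move=> i; rewrite litems_word => iw.
  have -> : ipos id (litems s') (map ( *%R a) (lcpre s')) i = a * lpos id s' i.
    by rewrite p' -?ww // /ipos -map_take big_map mulr_sumr.
  by rewrite -p //; have := hd _ _ i0s iw; rewrite /dist; lra.
have a1 : a = 1.
  apply/eqP; rewrite eq_le; apply/andP; split.
    have : a \in behead (lcpre s).
      by rewrite eg behead_map; apply/mapP; exists 1; rewrite ?mulr1 // cpre_1.
    by move=> /(ge0 _ _ vs) /andP[].
  have := cpre_1 s2; rewrite eg behead_map => /mapP[x /(ge0 _ _ vs') /andP[x0 x1] ->].
  by rewrite ler_piMr // ltW.
apply: leqv_unique => //; first exact: items_teq.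
rewrite (lcpre_behead vs) ?(ltnW s2) // (lcpre_behead vs') ?(ltnW s2') //.
by rewrite eg behead_map a1 (eq_map (g := id)) ?map_id // => x; rewrite mul1r.
Qed.

Lemma dist_phi0 s i j : dist (phi psi 0) s i j = dist id s i j.
Proof. by apply: eq_dist => x _; rewrite phi0. Qed.

(** For labels i, j of different trees of [s], the ratio mu_ijk expresses every distance from i
    through the distance from i to j, and [a] is the quotient of the latter in the two forests. Its
    sign remains open, as mirror images have equal ratios. *)
Lemma same_mu_scale s s' : lok 2 s -> lok 2 s' -> uniq (lword s) -> uniq (lword s') ->
  lword s =i lword s' ->
  (forall i j k, uniq [:: i; j; k] -> i \in lword s -> j \in lword s ->
     k \in lword s -> prop2 (lmu psi 0 s i j k) (lmu psi 0 s' i j k)) ->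
  exists2 a, a != 0 & {in lword s &, forall i j, dist id s i j = a * dist id s' i j}.
Proof.
move=> ok ok' us us' ww h; have [/andP[vs _] /andP[vs' _]] := (ok, ok').
have [i [j [iw jw nij]]] := two_children ok us.
have [i' [j' [iw' jw' nij']]] := two_children ok' us'.
have sep v a b : lvalid v -> uniq (lword v) -> a \in lword v -> b \in lword v ->
    ~~ together v a b -> dist id v a b != 0.
  move=> vv uv av bv nt; have := dist_sep vv uv id_ge0 av bv nt.
  by apply: contraTneq => ->; rewrite normr0 ler10.
have Yij := sep _ _ _ vs us iw jw nij.
have Yij' := sep _ _ _ vs' us' iw' jw' nij'.
have P0 : 0 <= (0 : R) < 1 by rewrite lexx ltr01.
have ij : i != j by apply: contraNneq Yij => ->; rewrite distii.
have mu k v : lvalid v -> uniq (lword v) -> exists b, dist id v i k = b * (lmu psi 0 v i j k).1 /\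
   dist id v i j = b * (lmu psi 0 v i j k).2.
  by move=> vv uv; have := lmu_phi psi_gt0 k P0 vv uv ij; rewrite !dist_phi0.
(* Otherwise some mu_ijk would be infinite for [s'] and finite for [s]. *)
have Y'ij : dist id s' i j != 0.
  apply/negP => /eqP Y0.
  have [k kw Yk] : exists2 k, k \in lword s' & dist id s' i k != 0.
    case: (eqVneq (dist id s' i i') 0) => [e|]; last by exists i'.
    by exists j' => //; rewrite (dist_trans _ _ i i' j') e add0r.
  have ik : i != k by apply: contraNneq Yk => ->; rewrite distii.
  have jk : j != k by apply: contraNneq Yk => <-; rewrite Y0.
  have := h i j k; rewrite /= !inE negb_or ij ik jk (ww k) kw iw jw => /(_ isT isT isT isT).
  have [b [h1 h2]] := mu k s vs us; have [b' [h1' h2']] := mu k s' vs' us'.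
  rewrite /prop2; move: Yij Yk; rewrite h1' h2 !mulf_eq0 !negb_or => /andP[_ m2] /andP[b'0 m1'].
  move: Y0; rewrite h2' => /eqP; rewrite mulf_eq0 (negPf b'0) /= => /eqP->.
  by move/esym/eqP; rewrite mulr0 mulf_eq0 (negPf m2) (negPf m1').
have key k : k \in lword s -> dist id s i k * dist id s' i j = dist id s i j * dist id s' i k.
  move=> kw; have [->|ik] := eqVneq k i; first by rewrite !distii mul0r mulr0.
  have [->|jk] := eqVneq k j; first by rewrite mulrC.
  have := h i j k; rewrite /= !inE negb_or ij eq_sym ik eq_sym jk iw jw kw => /(_ isT isT isT isT).
  have [b [h1 h2]] := mu k s vs us; have [b' [h1' h2']] := mu k s' vs' us'.
  rewrite /prop2 h1 h2 h1' h2' => e; rewrite mulrACA e; ring.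
exists (dist id s i j / dist id s' i j); first by rewrite mulf_neq0 // invr_eq0.
have key' k : k \in lword s ->
    dist id s i k = dist id s i j / dist id s' i j * dist id s' i k.
  by move=> /key e; rewrite mulrAC -e mulfK.
move=> k l kw lw; rewrite (dist_trans _ s k i l) (dist_trans _ s' k i l).
by rewrite (distC _ s i k) (distC _ s' i k) (key' k) // (key' l) //; ring.
Qed.

(** The sign of the factor decides between [s'] and its mirror image. The same alternative recurs
    inside every item, where a reversal above the edge of value 0 absorbs it. *)
Lemma leqv_of_mu s s' : lok 2 s -> lok 2 s' -> uniq (lword s) -> uniq (lword s') ->
  lword s =i lword s' ->
  (forall i j k, uniq [:: i; j; k] -> i \in lword s -> j \in lword s ->
     k \in lword s -> prop2 (lmu psi 0 s i j k) (lmu psi 0 s' i j k)) ->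
  leqv 2 s s' \/ leqv 2 s (lmirror s').
Proof.
have [N] := ubnP (lnodes s); elim: N s s' => // N IH s s' sN ok ok' us us' ww h.
have [a a0 ha] := same_mu_scale ok ok' us us' ww h.
have sub v : lok 2 v -> uniq (lword v) -> lword s =i lword v ->
    (forall i j k, uniq [:: i; j; k] -> i \in lword s -> j \in lword s ->
       k \in lword s -> prop2 (lmu psi 0 s i j k) (lmu psi 0 v i j k)) ->
  (forall d d', DNode 0 d \in litems s -> DNode 0 d' \in litems v ->
     lok 2 d -> lok 2 d' -> lword d =i lword d' ->
     leqv 2 d d' \/ leqv 2 d (lmirror d')).
  move=> okv uv wv hv d d' di d'i okd okd' ww'.
  have ud : uniq (lword d) by apply: (uniq_in _ di); rewrite litems_word.
  have ud' : uniq (lword d') by apply: (uniq_in _ d'i); rewrite litems_word.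
  have ds x : x \in lword d -> x \in lword s.
    by rewrite -(litems_word s) -(dword_node 0 d); apply: mem_lword_sub.
  apply: IH => //; first by apply: leq_trans (litems_lnodes di) _; rewrite -ltnS.
  move=> i j k uijk id jd kd.
  have := hv i j k uijk (ds _ id) (ds _ jd) (ds _ kd).
  rewrite (lmu_item psi 0 us di) // (lmu_item psi 0 uv d'i) -?ww' //.
have [an|ap|an] := ltgtP a 0; last by rewrite an eqxx in a0.
  right; have um : uniq (lword (lmirror s')) by rewrite lword_mirror rev_uniq.
  have [/andP[vs s2] /andP[vs' s2']] := (ok, ok').
  have okm : lok 2 (lmirror s') by rewrite /lok lvalid_mirror vs' size_rev size_map s2'.
  have wm : lword s =i lword (lmirror s') by move=> i; rewrite lword_mirror mem_rev.
  have an' : 0 < - a by rewrite oppr_gt0.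
  apply: (leqv_scaled an') => //.
    move=> i j iw jw; rewrite ha // dist_mirror -?ww //; ring.
  apply: sub => // i j k uijk iw jw kw.
  have ij : i != j by move: uijk; rewrite /= !inE negb_or -andbA => /andP[].
  rewrite lmu_mirror -?ww //; have := h _ _ _ uijk iw jw kw.
  rewrite /prop2 /scale2 /= => e; rewrite mulrCA e; ring.
by left; apply: (leqv_scaled ap) => //; apply: sub.
Qed.

(** On the lowest level the distances themselves are given, which leaves neither a scale nor a
    mirror image open, and gaps below 1 are recovered by injectivity of F. Only inside the items are
    ratios compared. *)
Lemma leqv_of_positions s s' : {in [pred x | 0 < x < 1] &, injective (Fw psi)} ->
  lok 1 s -> lok 1 s' -> uniq (lword s) -> uniq (lword s') -> lword s =i lword s' ->
  all (fun x => x < 1) (behead (lcpre s)) -> all (fun x => x < 1) (behead (lcpre s')) ->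
  {in lword s &, forall i j, dist (Fw psi) s i j = dist (Fw psi) s' i j} ->
  (forall i j k, uniq [:: i; j; k] -> i \in lword s -> j \in lword s ->
     k \in lword s -> dist (Fw psi) s i j = 0 -> dist (Fw psi) s i k = 0 ->
     prop2 (lmu psi 1 s i j k) (lmu psi 1 s' i j k)) ->
  leqv 1 s s'.
Proof.
move=> Finj /andP[vs s1] /andP[vs' s1'] us us' ww lt1 lt1' hd hmu.
have [[/andP[vi _] /andP[vi' _]]] := (items_valid vs, items_valid vs').
have F0 : Fw psi 0 = 0 by rewrite /Fw mul0r.
have [p _] := lpos_items F0 vs; have [p' _] := lpos_items F0 vs'.
have D v : lvalid v -> all (fun x => x < 1) (behead (lcpre v)) ->
    all [pred x | 0 < x < 1] (behead (lcpre v)).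
  move=> vv /allP h; apply/allP => x xv; rewrite inE h // andbT.
  by have /andP[] := lcpre_01 vv (mem_behead xv).
have [i0 i0s] : exists i, i \in lword s.
  case: (s) s1 vs => // c v _ /andP[/dword_neq0 c0 _].
  by case: (dword c) (lword_cons c v) c0 => // i w -> _; exists i; rewrite mem_head.
have [eg eit] : behead (lcpre s) = behead (lcpre s') /\
    List.Forall2 same_labels (litems s) (litems s').
  apply: (@screen_unique [pred x | 0 < x < 1] (Fw psi) _ _ _ _
    (lpos (Fw psi) s i0 - lpos (Fw psi) s' i0)) => //.
  - move=> x /andP[x0 x1]; rewrite /Fw mulr_gt0 // psi_gt0 // x1 (ltW x0) //.
  - exact: size_lcpre.
  - exact: size_lcpre.
  - by rewrite litems_word.
  - by rewrite litems_word.
  - by move=> i; rewrite !litems_word.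
  - exact: D.
  - exact: D.
  move=> i; rewrite litems_word => iw.
  by rewrite -p // -p' -?ww //; have := hd _ _ i0s iw; rewrite /dist; lra.
apply: leqv_unique => //; last by rewrite (lcpre_behead vs) // (lcpre_behead vs') // eg.
apply: items_teq => // d d' di d'i okd okd' wd.
have ud : uniq (lword d) by apply: (uniq_in _ di); rewrite litems_word.
have ud' : uniq (lword d') by apply: (uniq_in _ d'i); rewrite litems_word.
have ds x : x \in lword d -> x \in lword s.
  by rewrite -(litems_word s) -(dword_node 0 d); apply: mem_lword_sub.
apply: leqv_of_mu => // i j k uijk id jd kd.
have := hmu i j k uijk (ds _ id) (ds _ jd) (ds _ kd).
rewrite !(dist_item F0 vs us di) // => /(_ erefl erefl).
by rewrite (lmu_item psi 1 us di) // (lmu_item psi 1 us' d'i) -?wd.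
Qed.

End Reconstruction.
Arguments same_labels {R I}.

(** * Quotients and the projective line *)

Section QuotientTopology.
Variables (T : topologicalType) (r : T -> T -> Prop).

Lemma qclass_continuous : continuous (qclass r).
Proof. exact: (@pi_continuous T {eq_quot gen_equiv_rel r}%qT). Qed.

Lemma quot_openP (A : set (quot r)) : open A <-> open (qclass r @^-1` A).
Proof. by []. Qed.

Lemma quot_continuous (Z : topologicalType) (h : quot r -> Z) :
  continuous (h \o qclass r) -> continuous h.
Proof. by move/(@quotient_continuous T {eq_quot gen_equiv_rel r}%qT Z h). Qed.

(** Made for the ratios mu_ijk, which are continuous only on an open part of the quotient. *)
Lemma quot_continuous_at (Z : topologicalType) (h : quot r -> Z) (A : set (quot r)) :
  open A -> (forall x, A (qclass r x) -> {for x, continuous (h \o qclass r)}) ->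
  forall z, A z -> {for z, continuous h}.
Proof.
move=> oA ch z Az U; rewrite nbhsE => -[V [oV Vz] VU].
suff oW : open (A `&` h @^-1` V).
  have : nbhs z (A `&` h @^-1` V) by apply: open_nbhs_nbhs.
  by apply: filterS => y [_ /VU].
apply/quot_openP; rewrite openE => x [/= Ax Vx].
apply: filterI.
  by apply: open_nbhs_nbhs; split=> //; apply: open_comp => // y _; apply: qclass_continuous.
exact: (ch _ Ax V (open_nbhs_nbhs (conj oV Vx))).
Qed.

Lemma quot_lift (Z : Type) (h : T -> Z) :
  (forall x y, r x y -> h x = h y) -> forall x, h (qrepr (qclass r x)) = h x.
Proof.
move=> hr x; have /qclass_eqP : qclass r (qrepr (qclass r x)) = qclass r x.
  by rewrite qreprK.
move: (qrepr _) => y; by elim=> // ? ? ? _ -> _ ->.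
Qed.

End QuotientTopology.

Lemma set_type_open (X : topologicalType) (A : set X) (U : set (set_type A)) :
  open U -> exists2 V : set X, open V & U = val @^-1` V.
Proof. by case=> V oV <-; exists V. Qed.

Lemma set_val_continuous (X : topologicalType) (A : set X) :
  continuous (val : set_type A -> X).
Proof. exact: (@initial_continuous A X val). Qed.

Lemma ptws_continuous_at (X : topologicalType) (I : eqType) (K : topologicalType)
    (F : X -> {ptws I -> K}) (x : X) :
  (forall i, {for x, continuous (fun y => F y i)}) -> {for x, continuous F}.
Proof.
move=> h; apply/cvg_sup => i A [_ [[B oB <-] /= Bx sBA]].
have hB : nbhs x ((fun y => F y i) @^-1` B) := h i B (open_nbhs_nbhs (conj oB Bx)).
suff : nbhs x (F @^-1` A) by [].
by apply: filterS hB => y /sBA.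
Qed.

Lemma ptws_proj_continuous (I : eqType) (K : topologicalType) (i : I) :
  continuous (fun f : {ptws I -> K} => f i).
Proof. exact: (@proj_continuous I (fun=> K) i). Qed.

Lemma set_type_compact (X : topologicalType) (A : set X) :
  compact A -> compact [set: set_type A].
Proof.
move=> cA F PF _; have FA : (val @ F) A.
  have FA : F (val @^-1` A) by apply: (@filterS _ F _ setT) => [x _|]; [exact: set_mem (valP x)|exact: filterT].
  exact: FA.
have [x [Ax clx]] := cA _ _ FA.
exists (exist _ x (mem_set Ax)); split=> // U V FU /= [_ [[B oB <-] /= Bx sBV]].
have [] := clx (val @` U) B; first by apply: (@filterS _ F _ U) => [y Uy|]; [exists y|].
  exact: open_nbhs_nbhs.
by move=> _ [[y Uy <-] By]; exists y; split=> //; apply: sBV.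
Qed.

Lemma compact_homeomorphism (X Y : topologicalType) (h : X -> Y) (g : Y -> X) :
  compact [set: X] -> hausdorff_space Y -> continuous h ->
  cancel h g -> cancel g h -> homeomorphism h.
Proof.
move=> cX hY ch hg gh; split=> //; exists g; split=> //.
apply/continuous_closedP => C clC.
have -> : g @^-1` C = h @` C.
  apply/seteqP; split=> [y Cy|_ [x Cx <-]] /=; first by exists (g y).
  by rewrite hg.
apply: compact_closed => //; apply: continuous_compact.
  exact: continuous_subspaceT.
exact: (subclosed_compact clC cX).
Qed.

Lemma hausdorff_by_functions (X Y : topologicalType) : hausdorff_space Y ->
  (forall x y : X, x <> y -> exists A (h : X -> Y), [/\ open A, A x, A y,
     forall z, A z -> {for z, continuous h} & h x <> h y]) ->
  hausdorff_space X.
Proof.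
move=> hY hX x y clxy; apply: contrapT => /hX[A [h [oA Ax Ay ch]]]; apply.
apply: hY => U V Ux Vy.
have [z [Uz Vz]] := clxy _ _ (ch _ Ax _ Ux) (ch _ Ay _ Vy).
by exists (h z).
Qed.

Section P1.
Variable R : realType.
Implicit Types (v w : R * R) (p q : P1 R).

(** Total in the vector, so that continuity and polynomial identities can be stated without carrying
    a proof of nonvanishing; the zero vector goes to infinity. *)
Definition pt v : P1 R :=
  match boolP (v != 0) with AltTrue h => P1mk h | AltFalse _ => P1inf end.

Lemma pt_P1mk v (hv : v != 0) : pt v = P1mk hv.
Proof.
rewrite /pt; case: {-}_ / boolP => [h|h]; last by rewrite hv in h.
by rewrite (bool_irrelevance h hv).
Qed.

Lemma proportional_refl x : @proportional R x x.
Proof. by exists 1; rewrite ?oner_eq0 // !mul1r -surjective_pairing. Qed.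

Lemma proportional_sym x y : @proportional R x y -> proportional y x.
Proof.
move=> [c c0 e]; exists c^-1; rewrite ?invr_eq0 // e /= !mulKf //.
exact: surjective_pairing.
Qed.

Lemma proportional_trans x y z :
  @proportional R x y -> proportional y z -> proportional x z.
Proof.
move=> [c c0 e] [d d0 e']; exists (d * c); first by rewrite mulf_neq0.
by rewrite e' e /= !mulrA.
Qed.

Lemma proportionalP x y :
  qclass (@proportional R) x = qclass (@proportional R) y <-> proportional x y.
Proof.
split=> [/qclass_eqP|h]; last by apply/qclass_eqP/rst_step.
elim=> [//|? |? ? _ /proportional_sym //|a b c _ ab _ bc].
  exact: proportional_refl.
exact: proportional_trans ab bc.
Qed.

Lemma hxy_neq0 p : (hx p, hy p) != 0.
Proof.
have /eqP pN0 := set_mem (valP (qrepr p)); apply/eqP => e; apply: pN0.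
by rewrite [LHS]surjective_pairing.
Qed.

Lemma hxyK p : pt (hx p, hy p) = p.
Proof.
rewrite (pt_P1mk (hxy_neq0 p)) -[RHS]qreprK; congr (qclass _ _).
by apply: val_inj; rewrite /= [RHS]surjective_pairing.
Qed.

Lemma ptP v : v != 0 -> exists2 c, c != 0 & hx (pt v) = c * v.1 /\ hy (pt v) = c * v.2.
Proof.
move=> v0; rewrite (pt_P1mk v0); have : P1mk v0 = qclass _ (qrepr (P1mk v0)).
  by rewrite qreprK.
by move/proportionalP => [c c0 e]; exists c; rewrite // /hx /hy e.
Qed.

Lemma pair_neq0 v : (v != 0) = ((v.1 != 0) || (v.2 != 0)).
Proof. by rewrite -negb_and. Qed.

Lemma cross_eq_scale v w : v != 0 -> w != 0 -> v.1 * w.2 = v.2 * w.1 ->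
  exists2 c, c != 0 & w = (c * v.1, c * v.2).
Proof.
case: v w => [a b] [c d]; rewrite !pair_neq0 /= => h1 h2 e.
have [a0|a0] := eqVneq a 0.
  move: e h1; rewrite a0 eqxx mul0r /= => /esym/eqP; rewrite mulf_eq0 => /orP[/eqP->|/eqP c0 b0].
    by rewrite eqxx.
  move: h2; rewrite c0 eqxx /= => d0.
  by exists (d / b); rewrite ?mulf_neq0 ?invr_eq0 //= mulr0 divfK.
have c0 : c != 0.
  apply: contraTneq h2 => c0; move/eqP: e; rewrite c0 mulr0 mulf_eq0 (negPf a0) /= => ->.
  by rewrite eqxx.
exists (c / a); rewrite ?mulf_neq0 ?invr_eq0 //= divfK //; congr pair.
by apply: (mulfI a0); rewrite e; field.
Qed.

Lemma pt_eqP v w : v != 0 -> w != 0 -> pt v = pt w <-> v.1 * w.2 = v.2 * w.1.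
Proof.
move=> v0 w0; rewrite (pt_P1mk v0) (pt_P1mk w0); split.
  by move/proportionalP => [c c0 /= ->] /=; ring.
by move=> /(cross_eq_scale v0 w0) ?; apply/proportionalP.
Qed.

Lemma P1_eqP p q : p = q <-> hx p * hy q = hy p * hx q.
Proof. by rewrite -[in X in X <-> _](hxyK p) -(hxyK q) pt_eqP ?hxy_neq0 // !hxyK. Qed.

Lemma pt_scale c v : c != 0 -> pt (c * v.1, c * v.2) = pt v.
Proof.
move=> c0; have [->|v0] := eqVneq v 0; first by rewrite /= mulr0.
apply/pt_eqP => //=; last by ring.
by move: v0; rewrite !pair_neq0 /= !mulf_eq0 (negPf c0).
Qed.

Lemma P1fin_pt (a : R) : P1fin a = pt (a, 1).
Proof. by rewrite (pt_P1mk (fin_neq0 a)). Qed.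

Lemma P1inf_pt : P1inf = pt (1, 0).
Proof. by rewrite (pt_P1mk (inf_neq0 R)). Qed.

Lemma swap_pt_neq0 v : v != 0 -> (v.2, v.1) != 0.
Proof. by rewrite !pair_neq0 orbC. Qed.

Lemma P1inv_pt v : v != 0 -> P1inv (pt v) = pt (v.2, v.1).
Proof.
move=> v0; rewrite /P1inv -(pt_P1mk (swap_neq0 _)); have [c c0 [-> ->]] := ptP v0.
exact: (@pt_scale c (v.2, v.1)).
Qed.

Lemma P1invK p : P1inv (P1inv p) = p.
Proof.
rewrite -(hxyK p) P1inv_pt ?hxy_neq0 // P1inv_pt //.
exact: swap_pt_neq0 (hxy_neq0 p).
Qed.

Lemma eq_P1inf p : p = P1inf <-> hy p = 0.
Proof.
rewrite P1inf_pt -[in X in X <-> _](hxyK p) pt_eqP ?hxy_neq0 ?inf_neq0 //=.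
by rewrite mulr0 mulr1; split=> /esym.
Qed.

Lemma eq_P1fin0 p : p = P1fin 0 <-> hx p = 0.
Proof.
by rewrite P1fin_pt -[in X in X <-> _](hxyK p) pt_eqP ?hxy_neq0 ?fin_neq0 //= mulr0 mulr1.
Qed.

Lemma affine_pt v : v != 0 -> affine (pt v) = v.1 / v.2.
Proof.
move=> v0; have [c c0 [h1 h2]] := ptP v0.
by rewrite /affine h1 h2 -mulf_div divff // mul1r.
Qed.

Lemma pt_continuous (X : topologicalType) (a b : X -> R) (x : X) :
  {for x, continuous a} -> {for x, continuous b} -> (a x, b x) != 0 ->
  {for x, continuous (fun y => pt (a y, b y))}.
Proof.
move=> ca cb v0.
have cv : {for x, continuous (fun y => (a y, b y))} by exact: (cvg_pair ca cb).
have op : open [set v : R * R | v != 0].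
  have -> : [set v : R * R | v != 0] = (fst @^-1` [set~ 0]) `|` (snd @^-1` [set~ 0]).
    apply/seteqP; split=> v /=; rewrite pair_neq0.
      by case/orP => /eqP; [left|right].
    by case=> /eqP ->; rewrite ?orbT.
  have on0 : open [set~ (0 : R)].
    exact/closed_openC/accessible_closed_set1/hausdorff_accessible/Rhausdorff.
  by apply: openU; apply: open_comp => // z _; [exact: cvg_fst|exact: cvg_snd].
move=> O nO; suff : \forall y \near x, O (pt (a y, b y)) by [].
have : nbhs (pt (a x, b x)) O := nO; rewrite nbhsE => -[W [oW Wx] sO].
have [U oU eU] := set_type_open oW.
have Ux : U (a x, b x).
  have : (@qclass (nonzero_vec R) (@proportional R) @^-1` W) (exist _ (a x, b x) (mem_set v0)).
    by move: Wx; rewrite (pt_P1mk v0).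
  by rewrite eU.
have n1 : \forall y \near x, U (a y, b y) := cv U (open_nbhs_nbhs (conj oU Ux)).
have n2 : \forall y \near x, (a y, b y) != 0.
  exact: (cv [set v | v != 0] (open_nbhs_nbhs (conj op v0))).
near=> y; apply: sO; have Uy : U (a y, b y) by near: y.
have y0 : (a y, b y) != 0 by near: y.
rewrite (pt_P1mk y0).
have : (val @^-1` U) (exist _ (a y, b y) (mem_set y0) : nonzero_vec R) by [].
by rewrite -eU.
Unshelve. all: by end_near.
Qed.

(* Together with affine coordinates these functions describe the topology. *)
Definition quad (a b c : R) p : R :=
  (a * hx p ^+ 2 + b * (hx p * hy p) + c * hy p ^+ 2) / (hx p ^+ 2 + hy p ^+ 2).

Lemma sqr_sum_neq0 v : v != 0 -> v.1 ^+ 2 + v.2 ^+ 2 != 0.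
Proof.
by rewrite paddr_eq0 ?sqr_ge0 // !sqrf_eq0 pair_neq0 -negb_and.
Qed.

Lemma quad_continuous a b c : continuous (quad a b c).
Proof.
pose g (w : nonzero_vec R) := (a * (val w).1 ^+ 2 + b * ((val w).1 * (val w).2)
  + c * (val w).2 ^+ 2) / ((val w).1 ^+ 2 + (val w).2 ^+ 2).
have gE (y z : nonzero_vec R) : proportional y z -> g y = g z.
  move=> [d d0 e]; have := sqr_sum_neq0 (set_mem (valP y)); rewrite /g e /=.
  move: (val y).1 (val y).2 => x x' n0.
  by field; rewrite n0 /= !exprMn -mulrDr mulf_neq0 // expf_neq0.
have -> : quad a b c = g \o @qrepr _ _ by [].
apply: quot_continuous => w.
have -> : (g \o @qrepr _ _) \o qclass (@proportional R) = g.
  by apply/funext => y; apply: quot_lift gE y.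
have c1 : {for w, continuous (fun w : nonzero_vec R => (val w).1)}.
  by apply: (cvg_comp _ _ (@set_val_continuous _ _ w)); exact: cvg_fst.
have c2 : {for w, continuous (fun w : nonzero_vec R => (val w).2)}.
  by apply: (cvg_comp _ _ (@set_val_continuous _ _ w)); exact: cvg_snd.
have n0 := sqr_sum_neq0 (set_mem (valP w)).
have h : {for w, continuous (fun w : nonzero_vec R =>
    a * (val w).1 ^+ 2 + b * ((val w).1 * (val w).2) + c * (val w).2 ^+ 2)}.
  by exact: (cvgD (cvgD (cvgM (cvg_cst a) (cvgM c1 c1)) (cvgM (cvg_cst b) (cvgM c1 c2)))
    (cvgM (cvg_cst c) (cvgM c2 c2))).
have d : {for w, continuous (fun w : nonzero_vec R => ((val w).1 ^+ 2 + (val w).2 ^+ 2)^-1)}.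
  by exact: (cvgV n0 (cvgD (cvgM c1 c1) (cvgM c2 c2))).
by exact: (cvgM h d).
Qed.

(* (p_1 q_2 - p_2 q_1)^2 / (q_1^2 + q_2^2) vanishes only at q = p. *)
Lemma P1_hausdorff : hausdorff_space (P1 R).
Proof.
apply: (@hausdorff_by_functions _ R^o); first exact: Rhausdorff.
move=> p q pq; exists setT, (quad (hy p ^+ 2) (- 2 * hx p * hy p) (hx p ^+ 2)).
split=> //; first exact: openT.
  by move=> z _; apply: quad_continuous.
have qE r : quad (hy p ^+ 2) (- 2 * hx p * hy p) (hx p ^+ 2) r =
    (hx p * hy r - hy p * hx r) ^+ 2 / (hx r ^+ 2 + hy r ^+ 2).
  by rewrite /quad; congr (_ / _); ring.
rewrite !qE (mulrC (hx p) (hy p)) subrr expr0n /= mul0r => /esym/eqP.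
rewrite mulf_eq0 invr_eq0 sqrf_eq0 subr_eq0 (negPf (sqr_sum_neq0 (hxy_neq0 q))) orbF.
by move=> /eqP e; apply: pq; apply/P1_eqP.
Qed.

Lemma P1_pt_closed p : closed [set p].
Proof. exact/accessible_closed_set1/hausdorff_accessible/P1_hausdorff. Qed.

Definition P1div p q := pt (hx p * hy q, hx q * hy p).

(** [hx] and [hy] belong to chosen representatives and need not be continuous. A suitable factor [k]
    turns both entries of the vector into products of functions [quad], which are continuous. There
    are two choices of [k], and at least one of them is nonzero at [x]. *)
Lemma P1div_continuous (X : topologicalType) (u v : X -> P1 R) (x : X) :
  {for x, continuous u} -> {for x, continuous v} ->
  (hx (u x) * hy (v x), hx (v x) * hy (u x)) != 0 ->
  {for x, continuous (fun y => P1div (u y) (v y))}.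
Proof.
move=> cu cv n0.
have cq a b c (w : X -> P1 R) : {for x, continuous w} ->
    {for x, continuous (fun y => quad a b c (w y))}.
  by move=> cw; apply: (continuous_comp cw); exact: quad_continuous.
have qn p := sqr_sum_neq0 (hxy_neq0 p).
have key (a b : X -> R) (k : X -> R) : {for x, continuous a} -> {for x, continuous b} ->
    (a x, b x) != 0 -> (forall y, (a y, b y) = (k y * (hx (u y) * hy (v y)), k y * (hx (v y) * hy (u y)))) ->
    {for x, continuous (fun y => P1div (u y) (v y))}.
  move=> ca cb ab0 hk; have ck := pt_continuous ca cb ab0.
  have e y : (a y, b y) != 0 -> pt (a y, b y) = P1div (u y) (v y).
    rewrite hk /P1div => kn; apply: (@pt_scale _ (_, _)).
    by apply: contraNneq kn => ->; rewrite !mul0r.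
  suff : P1div (u y) (v y) @[y --> x] --> P1div (u x) (v x) by [].
  rewrite -e //; apply: cvg_trans ck; apply: near_eq_cvg.
  have m0 : (a x != 0) || (b x != 0) by move: ab0; rewrite pair_neq0.
  have nz (c : X -> R) : {for x, continuous c} -> c x != 0 -> \forall y \near x, c y != 0.
    by move=> cc c0; apply: (cc [set z | z != 0]); apply: open_nbhs_nbhs; split=> //; exact: open_neq.
  case/orP: m0 => m0.
    by have := nz _ ca m0; apply: filterS => y yn; rewrite e // pair_neq0 yn.
  by have := nz _ cb m0; apply: filterS => y yn; rewrite e // pair_neq0 yn orbT.
have [l0|l0] := eqVneq (hx (u x) * hy (v x)) 0.
  apply: (key (fun y => quad 0 1 0 (u y) * quad 0 1 0 (v y))
    (fun y => quad 0 0 1 (u y) * quad 1 0 0 (v y))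
    (fun y => (hy (u y) * hx (v y)) / ((hx (u y) ^+ 2 + hy (u y) ^+ 2) * (hx (v y) ^+ 2 + hy (v y) ^+ 2)))).
  - by exact: (cvgM (cq _ _ _ _ cu) (cq _ _ _ _ cv)).
  - by exact: (cvgM (cq _ _ _ _ cu) (cq _ _ _ _ cv)).
  - move: n0; rewrite !pair_neq0 /= l0 eqxx /= mulf_eq0 negb_or => /andP[h1 h2].
    rewrite [X in _ || X](_ : _ = true) ?orbT // /quad !(mul0r, mul1r, add0r, addr0).
    by rewrite mulf_neq0 // mulf_neq0 ?invr_eq0 ?expf_neq0 // qn.
  by move=> y; rewrite /quad; congr pair; field; rewrite !qn.
apply: (key (fun y => quad 1 0 0 (u y) * quad 0 0 1 (v y))
  (fun y => quad 0 1 0 (u y) * quad 0 1 0 (v y))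
  (fun y => (hx (u y) * hy (v y)) / ((hx (u y) ^+ 2 + hy (u y) ^+ 2) * (hx (v y) ^+ 2 + hy (v y) ^+ 2)))).
- by exact: (cvgM (cq _ _ _ _ cu) (cq _ _ _ _ cv)).
- by exact: (cvgM (cq _ _ _ _ cu) (cq _ _ _ _ cv)).
- move: l0; rewrite pair_neq0 /= mulf_eq0 negb_or => /andP[h1 h2].
  rewrite [X in X || _](_ : _ = true) // /quad !(mul0r, mul1r, add0r, addr0).
  by rewrite mulf_neq0 // mulf_neq0 ?invr_eq0 ?expf_neq0 // qn.
by move=> y; rewrite /quad; congr pair; field; rewrite !qn.
Qed.

End P1.

(** * The diffeomorphism f *)

(** The function psi with f x = x psi x on [0, 1), completed at 0 by the derivative. As [fine] sends
    infinity to 0, the value at 1 is 0 when f 1 is infinite, so the facts about psi below stop short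
    of 1. *)
Definition slope (R : realType) (f : R -> \bar R) (x : R) : R :=
  if x == 0 then (fine \o f)^`()%classic 0 else fine (f x) / x.

Section Diffeo.
Variables (R : realType) (f : R -> \bar R).
Hypothesis f_diffeo : increasing_diffeo f.
Hypothesis f_zero : f 0 = 0%E.

Local Notation h := (fine \o f).

Lemma diffeo_lt x y : -1 <= x -> x < y -> y <= 1 -> (f x < f y)%E.
Proof.
case: f_diffeo => mono _ _ _ x1 xy y1; apply: mono => //; rewrite in_itv /=.
  by rewrite x1 (le_trans (ltW xy)).
by rewrite y1 andbT (le_trans x1) // ltW.
Qed.

Lemma diffeo1 : f 1 = +oo%E.
Proof.
case: f_diffeo => _ _ _ [g [g01 _ gK _ _]].
have := g01 +oo%E; rewrite in_itv /= => /andP[h1 h2].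
have e := gK +oo%E; move: h2; rewrite le_eqVlt => /orP[/eqP e1|lt1]; first by rewrite -e1.
have := diffeo_lt h1 lt1 (lexx 1); rewrite e.
by rewrite ltNge leey.
Qed.

Lemma diffeo_fin x : -1 < x < 1 -> f x = (h x)%:E.
Proof.
move=> /andP[x0 x1]; rewrite /= fineK // fin_numE.
have := diffeo_lt (lexx _) x0 (ltW x1); have := diffeo_lt (ltW x0) x1 (lexx _).
by rewrite diffeo1 => h1 h2; rewrite (lt_eqF h1) andbT gt_eqF // (le_lt_trans _ h2) // leNye.
Qed.

Lemma fine_lt x y : -1 < x -> x < y -> y < 1 -> h x < h y.
Proof.
move=> x0 xy y1; rewrite -lte_fin -!diffeo_fin ?x0 ?y1 ?(lt_trans x0 xy) ?(lt_trans xy y1) //.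
by rewrite diffeo_lt // ltW.
Qed.

Lemma fine0 : h 0 = 0.
Proof. by rewrite /= f_zero. Qed.

Lemma fine_derivable x : -1 < x < 1 -> derivable h x 1.
Proof.
by case: f_diffeo => _ _ sm _ xi; apply: (sm 0%N); rewrite /= in_itv.
Qed.

Lemma fine_continuous x : -1 < x < 1 -> {for x, continuous h}.
Proof.
by move=> /fine_derivable /derivable1_diffP /differentiable_continuous.
Qed.

Lemma near_in (x : R) : -1 < x < 1 -> \forall y \near x, -1 < y < 1.
Proof.
move=> xi; have : nbhs x `](-1)%R, 1%R[%classic.
  by apply: open_nbhs_nbhs; split; [exact: interval_open|rewrite /= in_itv].
by apply: filterS => y; rewrite /= in_itv.
Qed.

Lemma slope_pos x : -1 < x < 1 -> x != 0 -> 0 < slope f x.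
Proof.
move=> /andP[x0 x1] xn; rewrite /slope (negPf xn).
have [xlt|xgt|x00] := ltgtP x 0; last by rewrite x00 eqxx in xn.
  by have := fine_lt x0 xlt ltr01; rewrite fine0 => hx; rewrite nmulr_rgt0 // invr_lt0.
have := fine_lt (ltrN10 _) xgt x1; rewrite fine0 => hx; by rewrite divr_gt0.
Qed.

Lemma zero_in : -1 < (0 : R) < 1.
Proof. by rewrite ltrN10 ltr01. Qed.

Lemma slope_continuous x : -1 < x < 1 -> {for x, continuous (slope f)}.
Proof.
move=> xi; have [x0|x0] := eqVneq x 0; last first.
  have e : \forall y \near x, h y / y = slope f y.
    have := @open_neq R 0; rewrite openE => /(_ x x0); apply: filterS => y.
    by rewrite /= /slope => /negPf->.
  have ex : h x / x = slope f x by rewrite /slope (negPf x0).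
  suff : slope f y @[y --> x] --> slope f x by [].
  rewrite -ex; apply: cvg_trans (near_eq_cvg e) _.
  by exact: (cvgM (fine_continuous xi) (cvgV x0 cvg_id)).
(* At 0, continuity is the convergence of the difference quotient of f. *)
rewrite x0 in xi *; have /cvg_ex[l hl] := fine_derivable xi.
have d0 : slope f 0 = l.
  rewrite /slope eqxx derive1E; exact: cvg_lim hl.
have hl' : slope f y @[y --> 0^'] --> l.
  apply: cvg_trans hl; apply: near_eq_cvg; near=> y.
  have y0 : y != 0 by near: y; exact: nbhs_dnbhs_neq.
  by rewrite /= /slope (negPf y0) scaler1 addr0 f_zero subr0 mulrC.
suff : slope f y @[y --> 0] --> slope f 0 by [].
rewrite d0; apply/cvgrPdist_lt => e e0.
move/cvgrPdist_lt/(_ e e0): hl'; rewrite near_withinE; apply: filterS => y hy.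
have [->|/hy //] := eqVneq y 0; by rewrite d0 subrr normr0.
Unshelve. all: by end_near.
Qed.

(** The chain rule for the composite of f and its inverse; this is where differentiability of the
    inverse enters. *)
Lemma slope0_neq0 : slope f 0 != 0.
Proof.
rewrite /slope eqxx; case: f_diffeo => _ _ _ [g [_ gK _ _ sg]].
have dh := fine_derivable zero_in.
have dg : derivable (g \o EFin) (h 0) 1 by apply: (sg 0%N).
have := derive1_comp dh dg; rewrite [LHS](_ : _ = 1).
  by move=> e; apply: contra_eq_neq e => ->; rewrite mulr0 oner_neq0.
rewrite derive1E -[RHS](derive_id (0 : R) (1 : R)); apply: near_eq_derive.
near=> y; rewrite /= -diffeo_fin ?gK //; last by near: y; exact: near_in zero_in.
have /andP[y0 y1] : -1 < y < 1 by near: y; exact: near_in zero_in.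
by rewrite in_itv /= !ltW.
Unshelve. all: by end_near.
Qed.

(** Away from 0, f x has the sign of x. At 0, a negative value would persist nearby by continuity,
    and the value 0 is excluded. *)
Lemma slope_gt0 x : 0 <= x < 1 -> 0 < slope f x.
Proof.
move=> /andP[x0 x1]; have [->|xn] := eqVneq x 0; last first.
  by apply: slope_pos => //; rewrite x1 (lt_le_trans (ltrN10 R)).
rewrite lt_neqAle eq_sym slope0_neq0 /= leNgt; apply/negP => neg.
have := slope_continuous zero_in; rewrite /continuous_at => c0.
have n1 : \forall y \near (0 : R), slope f y < 0.
  by apply: (c0 [set z | z < 0]); apply: open_nbhs_nbhs; split; [exact: open_lt|].
have n2 : \forall y \near (0 : R)^', slope f y < 0 by apply: nbhs_dnbhs.
have [y [y1 [y2 y3]]] : exists y : R, slope f y < 0 /\ y != 0 /\ -1 < y < 1.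
  have n3 : \forall y \near (0 : R)^', slope f y < 0 /\ y != 0 /\ -1 < y < 1.
    near=> y; split; first by near: y.
    split; first by near: y; exact: nbhs_dnbhs_neq.
    by near: y; apply: nbhs_dnbhs; exact: near_in zero_in.
  by have /= [y Hy] := @filter_ex _ _ (Proper_dnbhs_numFieldType 0) _ n3; exists y.
by have := slope_pos y3 y2; rewrite ltNge (ltW y1).
Unshelve. all: by end_near.
Qed.

Lemma slopeE x : 0 <= x < 1 -> f x = (x * slope f x)%:E.
Proof.
move=> /andP[x0 x1]; rewrite diffeo_fin ?x1 ?(lt_le_trans (ltrN10 R)) //.
rewrite /slope; case: eqP => [->|/eqP xn]; first by rewrite mul0r fine0.
by rewrite mulrC divfK.
Qed.

Lemma slope_fine x : fine (f x) = x * slope f x.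
Proof.
rewrite /slope; case: eqP => [->|/eqP xn]; first by rewrite mul0r f_zero.
by rewrite mulrC divfK.
Qed.

Lemma slope_inj : {in [pred x | 0 < x < 1] &, injective (fun x => x * slope f x)}.
Proof.
move=> x y /andP[x0 x1] /andP[y0 y1]; rewrite -!slope_fine => e.
have [xy|xy|//] := ltgtP x y.
  by have := fine_lt (lt_trans (ltrN10 R) x0) xy y1; rewrite /= e ltxx.
by have := fine_lt (lt_trans (ltrN10 R) y0) xy x1; rewrite /= e ltxx.
Qed.

Lemma slope_surj y : 0 <= y -> exists2 x, 0 <= x < 1 & x * slope f x = y.
Proof.
move=> y0; case: f_diffeo => _ _ _ [g [g01 gK1 gK _ _]].
have e := gK y%:E; have := g01 y%:E; rewrite in_itv /= => /andP[h1 h2].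
exists (g y%:E); last by rewrite -slope_fine e.
apply/andP; split.
  rewrite leNgt; apply/negP => neg; have := diffeo_lt h1 neg ler01.
  by rewrite e f_zero lte_fin ltNge y0.
rewrite lt_neqAle h2 andbT; apply/eqP => e1; move: e; rewrite e1 diffeo1 => /eqP.
by [].
Qed.

(** f takes the value |M| at some [d] below 1 and increases from there on. *)
Lemma slope_unbounded M : exists2 d, d < 1 & forall x, d < x -> x < 1 -> M < x * slope f x.
Proof.
have [d /andP[d0 d1] e] := slope_surj (normr_ge0 M).
exists d => // x dx x1; apply: le_lt_trans (ler_norm M) _.
rewrite -e -!slope_fine; apply: fine_lt => //; exact: lt_le_trans (ltrN10 R) d0.
Qed.

End Diffeo.

(** * Points of the cactus flower space *)

Section FbarPoints.
Variables (R : realType) (n : nat).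
Local Notation I := 'I_n.
Implicit Types (i j k l : I) (p q : charts R n) (S : setpart n).

Definition mk_nu (g : I -> I -> P1 R) : nu_space R n :=
  fun x : pairs n => g (val x).1 (val x).2.
Definition mk_mu S (g : I -> I -> I -> P1 R) : mu_space R S :=
  fun x : triples S => g (val x).1.1 (val x).1.2 (val x).2.

Arguments mk_mu : clear implicits.

Lemma nu_at_val (nu : nu_space R n) (x : pairs n) :
  nu_at nu (val x).1 (val x).2 = nu x.
Proof. by rewrite /nu_at -surjective_pairing valK. Qed.

Lemma nu_at_mk g i j : i != j -> nu_at (mk_nu g) i j = g i j.
Proof. by move=> ij; rewrite /nu_at insubT. Qed.

Lemma mu_at_mk S g i j k : in_part S i j k -> mu_at (mk_mu S g) i j k = g i j k.
Proof. by move=> ijk; rewrite /mu_at insubT. Qed.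

Lemma nu_ext (nu nu' : nu_space R n) :
  (forall i j, i != j -> nu_at nu i j = nu_at nu' i j) -> nu = nu'.
Proof.
move=> h; apply/funext => x; rewrite -!nu_at_val; apply: h.
by case: x.
Qed.

Lemma nu_at_continuous i j : continuous (fun nu : nu_space R n => nu_at nu i j).
Proof.
rewrite /nu_at; case: (insub _) => [x|] nu; last exact: cst_continuous.
exact: (@ptws_proj_continuous _ _ x).
Qed.

Lemma mu_at_continuous S i j k : continuous (fun mu : mu_space R S => mu_at mu i j k).
Proof.
rewrite /mu_at; case: (insub _) => [x|] nu; last exact: cst_continuous.
exact: (@ptws_proj_continuous _ _ x).
Qed.

Lemma chart_nu_continuous : continuous (@chart_nu R n).
Proof.
move=> [S x]; rewrite /chart_nu.
have h : continuous (fun y : Utilde R S => (val y).1).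
  move=> y; apply: (cvg_comp _ _ (@set_val_continuous _ _ y)); exact: cvg_fst.
exact: h x.
Qed.

Lemma same_partP S i j : same_part S i j = (j \in finset.pblock (val S) i).
Proof.
have /and3P[/eqP cS tS _] := valP S.
by rewrite /same_part eq_pblock // cS inE.
Qed.

Lemma same_part_refl S i : same_part S i i.
Proof. by rewrite /same_part. Qed.
Lemma same_part_sym S i j : same_part S i j = same_part S j i.
Proof. by rewrite /same_part eq_sym. Qed.
Lemma same_part_trans S i j k : same_part S i j -> same_part S j k -> same_part S i k.
Proof. by rewrite /same_part => /eqP->. Qed.

Lemma setpart_of_rel (e : rel I) : equivalence_rel e ->
  {S : setpart n | forall i j, same_part S i j = e i j}.
Proof.
move=> ee.
have ee' : {in [set: I]%SET & &, equivalence_rel e} by move=> i j k _ _ _; apply: ee.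
exists (exist (fun S : {set {set I}} => finset.partition S [set: I]%SET) _
  (equivalence_partitionP ee')) => i j.
by rewrite same_partP /= pblock_equivalence_partition // inE.
Qed.

Lemma in_partP S i j k :
  in_part S i j k = [&& uniq [:: i; j; k], same_part S i j & same_part S i k].
Proof. by []. Qed.

Lemma chart_U p : U_set (projT1 p) (chart_nu p).
Proof. by case: (set_mem (valP (projT2 p))). Qed.

Lemma same_part_nu p i j : i != j ->
  if same_part (projT1 p) i j then nu_at (chart_nu p) i j <> P1fin 0
  else nu_at (chart_nu p) i j <> P1inf.
Proof. by case: (chart_U p) => _; apply. Qed.

Lemma chart_mu_nu p i j k : in_part (projT1 p) i j k ->
  hx (chart_mu p i j k) * (hx (nu_at (chart_nu p) i k) * hy (nu_at (chart_nu p) i j)) =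
  hy (chart_mu p i j k) * (hx (nu_at (chart_nu p) i j) * hy (nu_at (chart_nu p) i k)).
Proof.
case: (set_mem (valP (projT2 p))) => _ _ _ _ h /h.
by rewrite -/(chart_nu p) -/(chart_mu p i j k) => e; rewrite !mulrA e; ring.
Qed.

(** The locus z_i = z_j = z_k. Only here is mu_ijk an independent coordinate; elsewhere
    [chart_mu_det] expresses it by the nu. *)
Definition both_inf (nu : nu_space R n) i j k :=
  nu_at nu i j = P1inf /\ nu_at nu i k = P1inf.

Definition ratio_vec (nu : nu_space R n) i j k :=
  (hx (nu_at nu i j) * hy (nu_at nu i k), hx (nu_at nu i k) * hy (nu_at nu i j)).

Lemma ratio_vec_neq0 p i j k : in_part (projT1 p) i j k ->
  ~ both_inf (chart_nu p) i j k -> ratio_vec (chart_nu p) i j k != 0.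
Proof.
rewrite in_partP /= !inE negb_or => /and3P[/andP[/andP[ij ik] _] sij sik] nb.
have := same_part_nu p ij; have := same_part_nu p ik; rewrite sij sik.
move=> /eq_P1fin0/eqP h2 /eq_P1fin0/eqP h1; rewrite pair_neq0 /= !mulf_eq0.
rewrite (negPf h1) (negPf h2) /= -negb_and; apply/negP => /andP[/eqP e1 /eqP e2].
by apply: nb; split; apply/eq_P1inf.
Qed.

Lemma chart_mu_det p i j k : in_part (projT1 p) i j k ->
  ~ both_inf (chart_nu p) i j k ->
  chart_mu p i j k = P1div (nu_at (chart_nu p) i j) (nu_at (chart_nu p) i k).
Proof.
move=> ijk nb; have v0 := ratio_vec_neq0 ijk nb.
rewrite -[LHS]hxyK; apply/pt_eqP; rewrite ?hxy_neq0 //=.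
exact: chart_mu_nu.
Qed.

(** The gluing relation without its partitions. Where nu_ij and nu_ik are infinite, i, j, k lie in
    one part of every chart containing the point, so comparing just these mu_ijk makes transitivity
    visible. *)
Definition same_point p q := chart_nu p = chart_nu q /\
  forall i j k, uniq [:: i; j; k] -> both_inf (chart_nu p) i j k ->
    chart_mu p i j k = chart_mu q i j k.

Lemma inf_same_part p i j : i != j -> nu_at (chart_nu p) i j = P1inf ->
  same_part (projT1 p) i j.
Proof. by move=> ij h; have := same_part_nu p ij; case: ifP => // _ /(_ h). Qed.

Lemma both_inf_part p i j k : uniq [:: i; j; k] -> both_inf (chart_nu p) i j k ->
  in_part (projT1 p) i j k.
Proof.
rewrite in_partP => uijk [h1 h2]; rewrite uijk.
move: uijk; rewrite /= !inE negb_or => /andP[/andP[ij ik] _].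
by rewrite !inf_same_part.
Qed.

Lemma glueP p q : glue p q <-> same_point p q.
Proof.
split=> -[enu emu]; split=> // i j k.
  move=> uijk bi; apply: emu; first exact: both_inf_part.
  by apply: both_inf_part => //; rewrite -enu.
move=> hp hq; have uijk : uniq [:: i; j; k] by move: hp; rewrite in_partP => /and3P[].
have [bi|nb] := pselect (both_inf (chart_nu p) i j k); first exact: emu.
by rewrite !chart_mu_det // -enu.
Qed.

Lemma same_point_sym p q : same_point p q -> same_point q p.
Proof. by move=> [e1 e2]; split=> // i j k u; rewrite -e1 => /(e2 _ _ _ u). Qed.

Lemma same_point_trans p q r : same_point p q -> same_point q r -> same_point p r.
Proof.
move=> [e1 e2] [e3 e4]; split=> [|i j k u bi]; first by rewrite e1.
by rewrite e2 // e4 // -e1.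
Qed.

Lemma FbarP p q : qclass (@glue R n) p = qclass (@glue R n) q <-> same_point p q.
Proof.
split=> [/qclass_eqP|h]; last by apply/qclass_eqP/rst_step/glueP.
elim=> [x y /glueP //|//|x y _ /same_point_sym //|x y z _ xy _ yz].
exact: same_point_trans xy yz.
Qed.

Definition nu_of i j (z : Fbar R n) : P1 R := nu_at (chart_nu (qrepr z)) i j.

Lemma nu_of_qclass i j p : nu_of i j (qclass (@glue R n) p) = nu_at (chart_nu p) i j.
Proof.
rewrite /nu_of; have /FbarP[-> _] : qclass (@glue R n) (qrepr (qclass (@glue R n) p)) =
  qclass (@glue R n) p by rewrite qreprK.
by [].
Qed.

Lemma nu_of_continuous i j : continuous (nu_of i j).
Proof.
apply: quot_continuous => p.
rewrite (_ : nu_of i j \o _ = fun p => nu_at (chart_nu p) i j); last first.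
  by apply/funext => y; apply: nu_of_qclass.
exact: (continuous_comp (@chart_nu_continuous p) (@nu_at_continuous i j _)).
Qed.

(** mu_ijk on all charts at once, given by nu_ij / nu_ik where i, j, k are not in one part. It
    respects the gluing and is continuous where nu_ij and nu_ik are nonzero, which is a
    neighbourhood of the locus where both are infinite. *)
Definition mu_ext i j k p : P1 R :=
  if in_part (projT1 p) i j k then chart_mu p i j k
  else P1div (nu_at (chart_nu p) i j) (nu_at (chart_nu p) i k).

Lemma mu_ext_same i j k p q : uniq [:: i; j; k] -> same_point p q ->
  mu_ext i j k p = mu_ext i j k q.
Proof.
move=> uijk pq; have [e1 e2] := pq; rewrite /mu_ext.
have [bi|nb] := pselect (both_inf (chart_nu p) i j k).
  by rewrite !both_inf_part ?e2 // -e1.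
have nb' : ~ both_inf (chart_nu q) i j k by rewrite -e1.
by case: ifP => h; case: ifP => h'; rewrite ?chart_mu_det // e1.
Qed.

(** In a chart that does not join i, j, k, the coordinates nu_ij and nu_ik are not both infinite; if
    both are nonzero, their quotient is well defined. *)
Lemma mu_ext_continuous i j k p : uniq [:: i; j; k] ->
  nu_at (chart_nu p) i j <> P1fin 0 -> nu_at (chart_nu p) i k <> P1fin 0 ->
  {for p, continuous (mu_ext i j k)}.
Proof.
case: p => S x uijk /eq_P1fin0/eqP h1 /eq_P1fin0/eqP h2.
suff h : {for x, continuous (fun y : Utilde R S => mu_ext i j k (existT _ S y))}.
  exact: h.
have cn i' j' : {for x, continuous (fun y : Utilde R S => nu_at (val y).1 i' j')}.
  have c1 : {for x, continuous (fun y : Utilde R S => (val y).1)}.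
    by apply: (cvg_comp _ _ (@set_val_continuous _ _ x)); exact: cvg_fst.
  exact: (continuous_comp c1 (@nu_at_continuous i' j' _)).
rewrite /mu_ext /=; case h : (in_part S i j k).
  have c2 : {for x, continuous (fun y : Utilde R S => (val y).2)}.
    by apply: (cvg_comp _ _ (@set_val_continuous _ _ x)); exact: cvg_snd.
  exact: (continuous_comp c2 (@mu_at_continuous S i j k _)).
apply: P1div_continuous => //; rewrite pair_neq0 /= !mulf_eq0.
rewrite (negPf h1) (negPf h2) /= -negb_and; apply/negP => /andP[/eqP e1 /eqP e2].
move: h; rewrite (_ : in_part S i j k) //.
apply: (@both_inf_part (existT _ S x)) => //; split; exact/eq_P1inf.
Qed.

(** Two points differ in some nu_ij or, with equal nu, in some mu_ijk over the locus where nu_ij and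
    nu_ik are infinite. In the second case [mu_ext] separates them on an open set. *)
Lemma Fbar_hausdorff : hausdorff_space (Fbar R n).
Proof.
apply: (hausdorff_by_functions (@P1_hausdorff R)) => x y.
rewrite -(qreprK x) -(qreprK y); move: (qrepr x) (qrepr y) => p q pq.
have [enu|nnu] := pselect (chart_nu p = chart_nu q); last first.
  have [i [j nij]] : exists i j, nu_at (chart_nu p) i j <> nu_at (chart_nu q) i j.
    apply: contrapT => /forallNP h; apply: nnu; apply: nu_ext => i j ij.
    by have /forallNP/(_ j)/contrapT := h i.
  exists setT, (nu_of i j); split=> //; first exact: openT.
    by move=> z _; apply: nu_of_continuous.
  by rewrite !nu_of_qclass.
have [i [j [k [uijk bi nmu]]]] : exists i j k, [/\ uniq [:: i; j; k],
    both_inf (chart_nu p) i j k & chart_mu p i j k <> chart_mu q i j k].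
  apply: contrapT => h; apply: pq; apply/FbarP; split=> // i j k uijk bi.
  by apply: contrapT => ne; apply: h; exists i, j, k.
pose A := [set z : Fbar R n | nu_of i j z <> P1fin 0 /\ nu_of i k z <> P1fin 0].
have oA : open A.
  have o i' j' : open [set z : Fbar R n | nu_of i' j' z <> P1fin 0].
    apply: (@open_comp _ _ (nu_of i' j') [set~ P1fin 0]).
      by move=> z _; apply: nu_of_continuous.
    exact/closed_openC/P1_pt_closed.
  exact: openI (o i j) (o i k).
have inf0 : @P1inf R <> P1fin 0.
  by move/eq_P1fin0/eqP; have /P1_eqP := erefl (@P1inf R); have := hxy_neq0 (@P1inf R);
    rewrite pair_neq0 /= (iffLR (eq_P1inf P1inf) erefl) eqxx orbF => /negPf->.
have hq (h := fun z : Fbar R n => mu_ext i j k (qrepr z)) r :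
    h (qclass (@glue R n) r) = mu_ext i j k r.
  by apply: mu_ext_same => //; apply/FbarP; rewrite qreprK.
exists A, (fun z => mu_ext i j k (qrepr z)); split=> //.
- by rewrite /A /= !nu_of_qclass; case: bi => -> ->.
- by rewrite /A /= !nu_of_qclass -enu; case: bi => -> ->.
- apply: (quot_continuous_at oA) => r [/= A1 A2].
  rewrite !nu_of_qclass in A1 A2.
  rewrite (_ : _ \o _ = mu_ext i j k); first exact: mu_ext_continuous.
  by apply/funext => z; apply: hq.
rewrite !hq /mu_ext !both_inf_part // -?enu //.
Qed.

End FbarPoints.
Arguments mk_mu {R n}.

(** * The point of a decorated forest *)

Section DistNu.
Variables (R : realType) (n : nat).
Local Notation I := 'I_n.
Variables (cl : rel I) (D : I -> I -> R).

(** nu is the inverse of the distance, so a finite distance D gives (1 : D) and an infinite one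
    gives 0. Finiteness and distance are left abstract, to serve forests and points of the star
    alike. *)
Definition dist_nu i j : P1 R := if cl i j then pt (1, D i j) else P1fin 0.

Lemma one_neq0 (a : R) : (1, a) != 0 :> R * R.
Proof. by rewrite pair_neq0 oner_neq0. Qed.

Lemma hxy_dist_nu i j : cl i j -> exists2 c, c != 0 &
  hx (dist_nu i j) = c /\ hy (dist_nu i j) = c * D i j.
Proof.
move=> cij; rewrite /dist_nu cij; have [c c0 [-> ->]] := ptP (one_neq0 (D i j)).
by exists c; rewrite // mulr1.
Qed.

Lemma hx_dist_nu0 i j : ~~ cl i j -> hx (dist_nu i j) = 0.
Proof. by move=> /negPf h; rewrite /dist_nu h; apply/eq_P1fin0. Qed.

(** For finite distances the cubic relation is additivity with denominators cleared. If one distance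
    of a triple is infinite, then at least two are, and every term contains a factor 0. *)
Lemma dist_nu_tbar : symmetric cl -> (forall i j k, cl i j -> cl j k -> cl i k) ->
  (forall i j k, D i k = D i j + D j k) -> tbar_set (mk_nu dist_nu).
Proof.
move=> cl_sym cl_trans D_trans; have Dii i : D i i = 0.
  by apply: (@addrI _ (D i i)); rewrite -D_trans addr0.
have DC i j : D j i = - D i j.
  by apply: (@addrI _ (D i j)); rewrite -D_trans subrr.
split=> [i j ij|i j k].
  rewrite !nu_at_mk // 1?eq_sym //.
  have [cij|cij] := boolP (cl i j); last first.
    by rewrite !hx_dist_nu0 ?mul0r ?addr0 // cl_sym.
  have [c c0 [-> ->]] := hxy_dist_nu cij; rewrite cl_sym in cij.
  have [d d0 [-> ->]] := hxy_dist_nu cij; rewrite DC; ring.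
rewrite /= !inE negb_or => /andP[/andP[ij ik] /andP[jk _]]; rewrite !nu_at_mk //.
have [cij|nij] := boolP (cl i j).
  have [cik|nik] := boolP (cl i k).
    have cjk : cl j k by apply: cl_trans cik; rewrite cl_sym.
    have [c c0 [-> ->]] := hxy_dist_nu cij; have [d d0 [-> ->]] := hxy_dist_nu cik.
    have [e e0 [-> ->]] := hxy_dist_nu cjk; rewrite (D_trans i j k); ring.
  have njk : ~~ cl j k by apply: contra nik; apply: cl_trans.
  by rewrite (hx_dist_nu0 nik) (hx_dist_nu0 njk) !(mul0r, mulr0) addr0.
rewrite (hx_dist_nu0 nij) !mul0r addr0.
have [cik|nik] := boolP (cl i k); last by rewrite (hx_dist_nu0 nik) !mul0r.
have njk : ~~ cl j k.
  by apply: contra nij => cjk; apply: cl_trans cik _; rewrite cl_sym.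
by rewrite (hx_dist_nu0 njk) mulr0 mul0r.
Qed.

End DistNu.

Section PointOfForest.
Variables (R : realType) (n : nat) (psi : R -> R).
Hypothesis psi_gt0 : forall x, 0 <= x < 1 -> 0 < psi x.
Local Notation I := 'I_n.
Implicit Types (i j k l : I) (q : charts R n) (S : setpart n) (s : seq (dtree R I)).

Definition forest_ok s := lvalid s && perm_eq (lword s) (enum I).

Lemma ok_valid s : forest_ok s -> lvalid s.
Proof. by case/andP. Qed.
Lemma ok_uniq s : forest_ok s -> uniq (lword s).
Proof. by case/andP => _ /perm_uniq->; apply: enum_uniq. Qed.
Lemma ok_mem s i : forest_ok s -> i \in lword s.
Proof. by case/andP => _ /perm_mem->; rewrite mem_enum. Qed.

Definition gnu s i j : P1 R :=
  if close 1 s i j then pt (1, dist (Fw psi) s i j) else P1fin 0.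
Definition gmu s i j k : P1 R := pt (lmu psi 1 s i j k).

Lemma close_gnu s i j : close 1 s i j <-> gnu s i j <> P1fin 0.
Proof.
rewrite /gnu; case: ifP => // _; split=> // _; rewrite P1fin_pt => /pt_eqP.
by rewrite one_neq0 fin_neq0 => /(_ isT isT) /= /eqP; rewrite mulr0 mulr1 oner_eq0.
Qed.

Lemma hxy_gnu s i j : close 1 s i j -> exists2 c, c != 0 &
  hx (gnu s i j) = c /\ hy (gnu s i j) = c * dist (Fw psi) s i j.
Proof. exact: (hxy_dist_nu (cl := close 1 s)). Qed.

Lemma gnu_inf s i j : gnu s i j = P1inf <-> close 1 s i j /\ dist (Fw psi) s i j = 0.
Proof.
split=> [e|[cij d0]]; last first.
  have [c c0 [h1 h2]] := hxy_gnu cij; apply/eq_P1inf; by rewrite h2 d0 mulr0.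
have cij : close 1 s i j.
  apply/close_gnu; rewrite e P1fin_pt P1inf_pt => /pt_eqP.
  by rewrite inf_neq0 fin_neq0 /= => /(_ isT isT)/eqP; rewrite mulr0 mulr1 oner_eq0.
split=> //; have [c c0 [h1 h2]] := hxy_gnu cij.
move/eq_P1inf: e; rewrite h2 => /eqP; by rewrite mulf_eq0 (negPf c0) => /eqP.
Qed.

Lemma gnu_tbar s : tbar_set (mk_nu (gnu s)).
Proof.
apply: dist_nu_tbar => [i j|i j k|i j k]; [exact: close_sym|exact: close_trans|].
exact: dist_trans.
Qed.

Lemma part_close S s i j : U_set S (mk_nu (gnu s)) -> same_part S i j -> close 1 s i j.
Proof.
move=> [_ hU] sij; have [->|ij] := eqVneq i j; first exact: close_refl.
by have := hU i j ij; rewrite sij nu_at_mk // => /close_gnu.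
Qed.

Lemma close_mul1 s i j : dist (fun x => Fw psi (1 * x)) s i j = dist (Fw psi) s i j.
Proof. by apply: eq_dist => x _; rewrite mul1r. Qed.

Lemma one01 : 0 <= (1 : R) <= 1.
Proof. by rewrite ler01 lexx. Qed.

Lemma hxy_gmu s i j k : forest_ok s -> i != j -> close 1 s i j -> close 1 s i k ->
  exists2 c, c != 0 & hx (gmu s i j k) = c * (lmu psi 1 s i j k).1 /\
    hy (gmu s i j k) = c * (lmu psi 1 s i j k).2.
Proof.
move=> ok ij cij cik; apply: ptP; apply: (lmu_neq0 psi_gt0 one01) => //.
- exact: ok_valid.
- exact: ok_uniq.
- exact: ok_mem.
- exact: ok_mem.
- exact: ok_mem.
Qed.

Lemma gnu_Utilde S s : forest_ok s -> U_set S (mk_nu (gnu s)) ->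
  @Utilde_set R n S (mk_nu (gnu s), mk_mu S (gmu s)).
Proof.
move=> ok hU; have vs := ok_valid ok; have us := ok_uniq ok.
have mem i := ok_mem i ok.
have inP i j k : in_part S i j k ->
    [/\ i != j, i != k, j != k, close 1 s i j & close 1 s i k].
  rewrite in_partP => /and3P[/=]; rewrite !inE negb_or => /andP[/andP[ij ik] /andP[jk _]].
  by move=> /(part_close hU) cij /(part_close hU) cik.
have inC i j k : in_part S i j k -> in_part S i k j.
  rewrite !in_partP /= !inE !negb_or (eq_sym k j).
  by move=> /and3P[/andP[/andP[-> ->] /andP[-> _]] -> ->].
have inR i j k : in_part S i j k -> in_part S j i k.
  rewrite !in_partP /= !inE !negb_or (eq_sym j i) (same_part_sym S j i).
  move=> /and3P[/andP[/andP[-> ->] /andP[-> _]] sij sik]; rewrite sij /=.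
  by apply: same_part_trans sik; rewrite same_part_sym.
split=> //=.
- move=> i j k ijk; rewrite !mu_at_mk //; last exact: inC.
  have [ij ik jk cij cik] := inP _ _ _ ijk.
  have [c c0 [-> ->]] := hxy_gmu ok ij cij cik; have [d d0 [-> ->]] := hxy_gmu ok ik cik cij.
  rewrite lmu_swap /=; ring.
- move=> i j k ijk; rewrite !mu_at_mk //; last exact: inR.
  have [ij ik jk cij cik] := inP _ _ _ ijk; have [ji _ _ cji cjk] := inP _ _ _ (inR _ _ _ ijk).
  have [c c0 [-> ->]] := hxy_gmu ok ij cij cik; have [d d0 [-> ->]] := hxy_gmu ok ji cji cjk.
  have /= e := lmu_add psi 1 k vs us ij.
  rewrite !(mulrACA c _ d) (mulrACA d _ c) (mulrC d c) -mulrDr e //; ring.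
- move=> i j k l ijk ijl kl.
  have [ij ik jk cij cik] := inP _ _ _ ijk; have [_ il jl _ cil] := inP _ _ _ ijl.
  have ikl : in_part S i k l.
    move: ijk ijl; rewrite !in_partP /= !inE !negb_or ij ik il kl /=.
    by move=> /and3P[_ _ ->] /and3P[_ _ ->].
  rewrite !mu_at_mk //.
  have [c c0 [-> ->]] := hxy_gmu ok ij cij cik; have [d d0 [-> ->]] := hxy_gmu ok ik cik cil.
  have [e e0 [-> ->]] := hxy_gmu ok ij cij cil.
  have := lmu_mul psi_gt0 one01 vs us (mem i) (mem j) (mem k) (mem l) ij ik cij cik cil.
  case: (lmu _ _ _ i j k) => a1 b1; case: (lmu _ _ _ i k l) => a2 b2.
  case: (lmu _ _ _ i j l) => a3 b3 /= h.
  have -> : c * a1 * (d * a2) * (e * b3) = c * d * e * (a1 * a2 * b3) by ring.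
  rewrite h; ring.
move=> i j k ijk; have [ij ik jk cij cik] := inP _ _ _ ijk.
rewrite !mu_at_mk // !nu_at_mk //.
have [c c0 [-> ->]] := hxy_gmu ok ij cij cik; have [d d0 [-> ->]] := hxy_gnu cij.
have [e e0 [-> ->]] := hxy_gnu cik.
have [a [h1 h2]] := lmu_Fw psi_gt0 one01 vs us (mem i) (mem j) (mem k) ij cij cik.
rewrite -!close_mul1 h1 h2; ring.
Qed.

(** A relation rather than a function, because the point has a representative in every chart whose
    open set contains it. *)
Definition is_point s q := chart_nu q = mk_nu (gnu s) /\
  forall i j k, in_part (projT1 q) i j k -> chart_mu q i j k = gmu s i j k.

Lemma point_exists s S : forest_ok s -> U_set S (mk_nu (gnu s)) ->
  exists2 q, projT1 q = S & is_point s q.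
Proof.
move=> ok hU.
exists (existT _ S (exist _ (mk_nu (gnu s), mk_mu S (gmu s)) (mem_set (gnu_Utilde ok hU)))) => //.
by split=> // i j k ijk; rewrite /chart_mu /= mu_at_mk.
Qed.

(** The parts are the classes of finite distance. By [part_close], the parts of any other chart
    containing the point are contained in these. *)
Lemma finest_part s : exists2 S, (forall i j, same_part S i j = close 1 s i j) &
  U_set S (mk_nu (gnu s)).
Proof.
have ee : equivalence_rel (fun i j => close 1 s i j).
  move=> i j k; rewrite close_refl; split=> // cij; apply/idP/idP; last exact: close_trans.
  by apply: close_trans; rewrite close_sym.
have [S hS] := setpart_of_rel ee; exists S => //; split; first exact: gnu_tbar.
move=> i j ij; rewrite hS nu_at_mk //; case: ifP => h; first exact/close_gnu.
by move=> /gnu_inf[]; rewrite h.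
Qed.

Lemma point_exists0 s : forest_ok s -> exists2 q,
  (forall i j, same_part (projT1 q) i j = close 1 s i j) & is_point s q.
Proof.
move=> ok; have [S hS hU] := finest_part s.
by have [q qS hq] := point_exists ok hU; exists q => // i j; rewrite qS.
Qed.

Lemma point_part_close s q i j : is_point s q -> same_part (projT1 q) i j -> close 1 s i j.
Proof. by move=> [e _]; apply: part_close; rewrite -e; apply: chart_U. Qed.

Lemma point_unique s q q' : is_point s q -> is_point s q' -> same_point q q'.
Proof.
move=> [e1 e2] [e3 e4]; split=> [|i j k u bi]; first by rewrite e1.
by rewrite e2 ?e4 //; apply: both_inf_part; rewrite // ?e3 -?e1.
Qed.

Lemma same_data s s' q : is_point s q ->
  (forall i j, i != j -> gnu s i j = gnu s' i j) ->
  (forall i j k, uniq [:: i; j; k] -> close 1 s i j -> close 1 s i k ->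
     gmu s i j k = gmu s' i j k) -> is_point s' q.
Proof.
move=> hq; have [e1 e2] := hq; move=> h1 h2; split.
  by rewrite e1; apply: nu_ext => i j ij; rewrite !nu_at_mk ?h1.
move=> i j k ijk; rewrite e2 //; move: ijk; rewrite in_partP => /and3P[u sij sik].
by apply: h2 => //; apply: point_part_close hq _.
Qed.

Lemma lstep_close_dist s s' : lvalid s -> lvalid s' -> lstep s s' ->
  (forall i j, close 1 s i j = close 1 s' i j) /\
  (forall F i j, F 0 = 0 -> dist F s i j = dist F s' i j).
Proof.
move=> vs vs' ss'; split=> [i j|F i j F0]; last exact: lstep_dist.
by rewrite /close (lstep_dist _ _ _ vs vs' ss') // /chi mulr0 eq_sym oner_eq0.
Qed.

Lemma lstep_point s s' q : forest_ok s -> forest_ok s' -> lstep s s' ->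
  is_point s q -> is_point s' q.
Proof.
move=> ok ok' ss' hq; have [vs vs'] := (ok_valid ok, ok_valid ok').
have us := ok_uniq ok; have [cE dE] := lstep_close_dist vs vs' ss'.
apply: (same_data hq) => [i j ij|i j k u _ _].
  by rewrite /gnu cE dE // /Fw mul0r.
have ij : i != j by move: u; rewrite /= !inE negb_or -andbA => /andP[].
have [a a0 ea] := lstep_mu psi vs vs' us ss' 1 ij (ok_mem i ok) (ok_mem j ok) (ok_mem k ok).
by rewrite /gmu ea /scale2 pt_scale.
Qed.

Lemma close_together s i j : forest_ok s -> close 1 s i j -> together s i j.
Proof.
move=> ok cij; apply: contraT => nt.
by have := close_apart (ok_valid ok) (ok_uniq ok) (ok_mem i ok) (ok_mem j ok) cij nt; rewrite eqxx.
Qed.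

Lemma perm_ok s s' : forest_ok s -> perm_eq s s' -> forest_ok s'.
Proof.
move=> /andP[vs ws] ss'; rewrite /forest_ok /lvalid -(perm_all _ ss') -/(lvalid s) vs /=.
by apply: perm_trans ws; rewrite perm_sym; apply/perm_flatten/perm_map.
Qed.

(** Relative positions change only between labels of different trees, and these are at infinite
    distance. *)
Lemma perm_close_dist s s' : forest_ok s -> perm_eq s s' ->
  (forall i j, close 1 s i j = close 1 s' i j) /\
  (forall F i j, close 1 s i j -> dist F s i j = dist F s' i j).
Proof.
move=> ok ss'; have [vs us] := (ok_valid ok, ok_uniq ok).
have ok' := perm_ok ok ss'; have [vs' us'] := (ok_valid ok', ok_uniq ok').
have dE F i j : together s i j -> dist F s i j = dist F s' i j.
  move=> /hasP[c cs /andP[ic jc]]; rewrite (dist_child F vs us cs) //.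
  by rewrite (dist_child F vs' us' (c := c)) // -(perm_mem ss').
split=> [i j|F i j /(close_together ok)]; last exact: dE.
have [t|t] := boolP (together s i j); first by rewrite /close dE.
rewrite (contraNF (close_together ok) t) (contraNF (close_together ok')) //.
by rewrite /together -(perm_has _ ss').
Qed.

Lemma perm_point s s' q : forest_ok s -> perm_eq s s' -> is_point s q -> is_point s' q.
Proof.
move=> ok ss' hq; have [vs us] := (ok_valid ok, ok_uniq ok).
have us' := ok_uniq (perm_ok ok ss'); have [cE dE] := perm_close_dist ok ss'.
apply: (same_data hq) => [i j ij|i j k u cij cik].
  by rewrite /gnu -cE; case: ifP => // cij; rewrite dE.
have ij : i != j by move: u; rewrite /= !inE negb_or -andbA => /andP[].
have /(has_node ij)[c /and3P[-> ->] //|t [u' [cs /and3P[]]]] :=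
  has3_together us (close_together ok cij) (close_together ok cik).
rewrite !dword_node => iu ju ku; rewrite /gmu (lmu_in psi 1 us cs) //.
by rewrite (lmu_in psi 1 us' (t := t) (s' := u')) // -(perm_mem ss').
Qed.

Lemma point_same s s' q q' : is_point s q -> is_point s' q' -> same_point q q' ->
  (forall i j, i != j -> gnu s i j = gnu s' i j) /\
  (forall i j k, uniq [:: i; j; k] -> gnu s i j = P1inf -> gnu s i k = P1inf ->
     gmu s i j k = gmu s' i j k).
Proof.
move=> [e1 e2] [e3 e4] [e5 e6].
have h i j : i != j -> gnu s i j = gnu s' i j.
  move=> ij; have := congr1 (fun nu => nu_at nu i j) e5.
  by rewrite e1 e3 !nu_at_mk.
split=> // i j k u h1 h2; have := u; rewrite /= !inE negb_or => /andP[/andP[ij ik] _].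
have bi : both_inf (chart_nu q) i j k by rewrite e1 /both_inf !nu_at_mk.
rewrite -e2 ?e6 -?e4 //; apply: both_inf_part => //.
by rewrite -e5.
Qed.

End PointOfForest.

(** * Planar forests and cubes *)

Section PlanarTrees.
Variable n : nat.
Local Notation I := 'I_n.
Implicit Types (T c : ptree n) (s u : seq (ptree n)) (e : {set I}).

Definition ledges s : seq {set I} := flatten (map (@tedges n) s).

Fixpoint pnodes T : nat :=
  match T with Leaf _ => 0 | Node s => (sumn (map pnodes s)).+1 end.

Lemma ptree_list_ind (Q : seq (ptree n) -> Prop) :
  (forall s, (forall u, Node u \in s -> Q u) -> Q s) -> forall s, Q s.
Proof.
move=> IH s; have [m] := ubnP (sumn (map pnodes s)).
elim: m s => // m IHm s; rewrite ltnS => sm.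
apply: IH => u us; apply: IHm; apply: leq_trans sm.
elim: s us => //= c s IHs; rewrite inE => /orP[/eqP<-|/IHs h] /=.
  by rewrite ltnS leq_addr.
by apply: leq_trans h _; rewrite leq_addl.
Qed.

Definition pvalid s := all (@no_bivalent n) s.

Lemma pvalidP s u : pvalid s -> Node u \in s -> (1 < size u)%N /\ pvalid u.
Proof. by move=> /allP vs /vs /andP[]. Qed.

Lemma word_cons c s : word (c :: s) = tleaves c ++ word s.
Proof. by []. Qed.
Lemma word_cat s1 s2 : word (s1 ++ s2) = word s1 ++ word s2.
Proof. by rewrite /word map_cat flatten_cat. Qed.
Lemma word1 c : word [:: c] = tleaves c.
Proof. exact: cats0. Qed.
Lemma ledges_cat s1 s2 : ledges (s1 ++ s2) = ledges s1 ++ ledges s2.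
Proof. by rewrite /ledges map_cat flatten_cat. Qed.
Lemma ledges_cons c s : ledges (c :: s) = tedges c ++ ledges s.
Proof. by []. Qed.

Lemma mem_word c s i : c \in s -> i \in tleaves c -> i \in word s.
Proof. by move=> cs ic; apply/flatten_mapP; exists c. Qed.

Lemma tleaves_neq0 s c : pvalid s -> c \in s -> exists i, i \in tleaves c.
Proof.
elim/ptree_list_ind: s c => s IH [i|u] vs cs; first by exists i; rewrite mem_head.
have [u2 vu] := pvalidP vs cs; case: u u2 vu cs => // c u _ vu cs.
have [i ic] := IH _ cs c vu (mem_head _ _); exists i.
by rewrite /= mem_cat ic.
Qed.

Lemma tedges_sub s e : pvalid s -> e \in ledges s ->
  exists c i, [/\ c \in s, e \in tedges c, i \in e & forall j, j \in e -> j \in tleaves c].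
Proof.
elim/ptree_list_ind: s e => s IH e vs /flatten_mapP[[//|u] us].
have [u2 vu] := pvalidP vs us; rewrite inE => /orP[/eqP->|eu].
  have [i iu] := tleaves_neq0 vs us; exists (Node u), i; split=> //=.
  - by rewrite mem_head.
  - by rewrite inE.
  - by move=> j; rewrite inE.
have [c [i [cu ec ie h]]] := IH _ us _ vu eu.
exists (Node u), i; split=> //; first by rewrite inE eu orbT.
by move=> j /h jc; apply: mem_word jc.
Qed.

Lemma pchild_eq s c c' i : uniq (word s) -> c \in s -> c' \in s ->
  i \in tleaves c -> i \in tleaves c' -> c = c'.
Proof.
elim: s => // a s IH; rewrite word_cons cat_uniq => /and3P[_ /hasPn h us].
have hh x y : x \in s -> i \in tleaves x -> i \in tleaves a -> x = y.
  by move=> xs ix ia; have := h i (mem_word xs ix); rewrite ia.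
rewrite !inE => /orP[/eqP->|cs] /orP[/eqP->|c's] // ic ic'.
- by apply/esym; apply: hh c's ic' ic.
- by apply: hh cs ic ic'.
exact: IH.
Qed.

Lemma uniq_pchild s u : uniq (word s) -> Node u \in s -> uniq (word u).
Proof.
move=> us cs; case/path.splitPr: cs us => s1 s2.
by rewrite word_cat word_cons !cat_uniq => /and3P[_ _ /and3P[]].
Qed.

(** An edge above a child of the vertex carries only labels of that child, and another child
    contributes further ones. *)
Lemma above_notin s u : pvalid s -> uniq (word s) -> Node u \in s ->
  above (Node u) \notin ledges u.
Proof.
move=> vs us cs; have [u2 vu] := pvalidP vs cs; have uu := uniq_pchild us cs.
apply/negP => /(tedges_sub vu)[c [i [cu ec ie h]]].
have [c' c'u cc'] : exists2 c', c' \in u & c' != c.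
  move: uu; case: (u) u2 vu {cs h ec} cu => [|a [|b v]] // _ vu cu uu.
  have [e|ne] := eqVneq a c; last by exists a; rewrite ?mem_head.
  exists b; first by rewrite !inE eqxx orbT.
  apply/eqP => ebc; move: uu; rewrite e ebc !word_cons cat_uniq => /and3P[_ /hasPn hh _].
  by have [j jc] := tleaves_neq0 vu cu; have := hh j; rewrite mem_cat jc => /(_ isT).
have [j jc'] := tleaves_neq0 vu c'u.
have jc : j \in tleaves c by apply: h; rewrite inE; apply: (mem_word c'u).
by move: cc'; rewrite (pchild_eq uu c'u cu jc' jc) eqxx.
Qed.

Lemma edge_sibling s c c' e : pvalid s -> uniq (word s) -> c \in s -> c' \in s ->
  e \in tedges c -> e \in tedges c' -> c = c'.
Proof.
move=> vs us cs c's ec ec'.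
have sub1 d : d \in s -> e \in tedges d -> exists2 i, i \in e & forall j, j \in e -> j \in tleaves d.
  move=> ds ed; have [||d' [i [d1 _ ie h]]] := @tedges_sub [:: d] e.
  - by rewrite /pvalid /= andbT; apply: (allP vs).
  - by rewrite /ledges /= cats0.
  by move: d1; rewrite inE => /eqP <-; exists i.
have [i ie h] := sub1 c cs ec; have [_ _ h'] := sub1 c' c's ec'.
exact: pchild_eq us cs c's (h _ ie) (h' _ ie).
Qed.

(** Faithfulness of the encoding of edges by label sets; thanks to it [reverse_at] and [collapse_at]
    act at a single place. *)
Lemma ledges_uniq s : pvalid s -> uniq (word s) -> uniq (ledges s).
Proof.
elim/ptree_list_ind: s => s IH vs us.
have hc c : c \in s -> uniq (tedges c).
  case: c => // u cs; have [_ vu] := pvalidP vs cs.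
  by rewrite /= (above_notin vs us cs) /=; apply: IH cs vu (uniq_pchild us cs).
elim: s {IH} vs us hc => // c s IHs vs us hc.
rewrite ledges_cons cat_uniq hc ?mem_head //=; apply/andP; split; last first.
  apply: IHs => [||c' c's].
  - by case/andP: vs.
  - by move: us; rewrite word_cons cat_uniq => /and3P[].
  by apply: hc; rewrite inE c's orbT.
apply/hasPn => e /flatten_mapP[c' c's ec']; apply/negP => ec.
have cc' : c = c'.
  by apply: (edge_sibling vs us _ _ ec ec'); rewrite ?mem_head // inE c's orbT.
have [i ic] : exists i, i \in tleaves c by apply: tleaves_neq0 vs (mem_head _ _).
move: us; rewrite word_cons cat_uniq => /and3P[_ /hasPn h _].
by have := h i; rewrite (mem_word c's) -?cc' // ic => /(_ isT).
Qed.

Lemma reverse_id e s : e \notin ledges s -> map (reverse_at e) s = s.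
Proof.
elim/ptree_list_ind: s => s IH es.
rewrite -[RHS]map_id; apply/eq_in_map => -[i|u] cs.
  by rewrite /=; case: ifP.
have eu : e \notin tedges (Node u).
  by apply: contra es => h; apply/flatten_mapP; exists (Node u).
move: eu; rewrite /= inE negb_or eq_sym => /andP[/negPf-> /(IH _ cs) ->].
by [].
Qed.

Lemma collapse_id e s : e \notin ledges s -> flatten (map (collapse_at e) s) = s.
Proof.
elim/ptree_list_ind: s => s IH es.
have -> : map (collapse_at e) s = map (fun c => [:: c]) s.
  apply/eq_in_map => -[i|u] cs //.
  have eu : e \notin tedges (Node u).
    by apply: contra es => h; apply/flatten_mapP; exists (Node u).
  by move: eu; rewrite /= inE negb_or eq_sym => /andP[/negPf-> /(IH _ cs) ->].
by elim: (s) => //= c s' ->.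
Qed.

Lemma above_eq u u' : word u =i word u' -> above (Node u) = above (Node u').
Proof. by move=> h; apply/setP => i; rewrite !inE; apply: h. Qed.

Lemma word_mirror s : word (rev (map (@mirror n) s)) = rev (word s).
Proof.
elim/ptree_list_ind: s => s IH.
have h c : c \in s -> tleaves (mirror c) = rev (tleaves c) by case: c => // u /IH.
elim: s {IH} h => // c s IHs h.
rewrite map_cons rev_cons -cats1 word_cat IHs.
  by rewrite word1 h ?mem_head // word_cons rev_cat.
by move=> c' c's; apply: h; rewrite inE c's orbT.
Qed.

Lemma above_mirror T : above (mirror T) = above T.
Proof.
by case: T => // u; apply: above_eq => i; rewrite word_mirror mem_rev.
Qed.

Lemma ledges_mirror s : ledges (map (@mirror n) s) =i ledges s.
Proof.
elim/ptree_list_ind: s => s IH e.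
have h c : c \in s -> tedges (mirror c) =i tedges c.
  case: c => // u us e'; rewrite /= !inE (above_mirror (Node u)); congr (_ || _).
  rewrite -(IH _ us) /ledges map_rev; apply: perm_mem; apply: perm_flatten.
  by rewrite perm_rev.
by apply/flatten_mapP/flatten_mapP => [[_ /mapP[c cs ->]]|[c cs]];
  rewrite ?h // => ec; [exists c|exists (mirror c); rewrite ?h ?map_f].
Qed.

Lemma word_reverse e s : word (map (reverse_at e) s) =i word s.
Proof.
elim/ptree_list_ind: s => s IH i.
have h c : c \in s -> tleaves (reverse_at e c) =i tleaves c.
  case: c => [j|u] us x; rewrite /=; case: ifP => _ //; last exact: IH.
  by rewrite -[LHS]/(x \in word (rev (map (@mirror n) u))) word_mirror mem_rev.
by apply/flatten_mapP/flatten_mapP => [[_ /mapP[c cs ->]]|[c cs]];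
  rewrite ?h // => ec; [exists c|exists (reverse_at e c); rewrite ?h ?map_f].
Qed.

Lemma ledges_reverse e s : ledges (map (reverse_at e) s) =i ledges s.
Proof.
elim/ptree_list_ind: s => s IH e'.
have h c : c \in s -> tedges (reverse_at e c) =i tedges c.
  case: c => [j|u] us x; rewrite /=; case: ifP => _ //.
    have := ledges_mirror [:: Node u] x; rewrite /ledges /= !cats0; exact.
  rewrite /= !inE (above_eq (word_reverse e u)); congr (_ || _).
  exact: IH.
by apply/flatten_mapP/flatten_mapP => [[_ /mapP[c cs ->]]|[c cs]];
  rewrite ?h // => ec; [exists c|exists (reverse_at e c); rewrite ?h ?map_f].
Qed.

Lemma word_collapse e s : word (flatten (map (collapse_at e) s)) = word s.
Proof.
elim/ptree_list_ind: s => s IH.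
have h c : c \in s -> word (collapse_at e c) = tleaves c.
  case: c => [j|u] us //=; case: ifP => _ //.
  by rewrite word1; apply: IH.
elim: s {IH} h => // c s IHs h; rewrite map_cons /= word_cat IHs ?h ?mem_head //.
by move=> c' c's; apply: h; rewrite inE c's orbT.
Qed.

Lemma ledges_collapse e s : {subset ledges (flatten (map (collapse_at e) s)) <= ledges s}.
Proof.
elim/ptree_list_ind: s => s IH e'.
have h c : c \in s -> {subset ledges (collapse_at e c) <= tedges c}.
  case: c => [j|u] us x //=; case: ifP => _; first by rewrite inE => xu; apply/orP; right.
  rewrite /ledges /= cats0 !inE (above_eq (u' := u)); last by move=> i; rewrite word_collapse.
  by case/orP => [->//|/(IH _ us) xu]; apply/orP; right.
move=> /flatten_mapP[c /flatten_mapP[c0 c0s cc0] ec].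
apply/flatten_mapP; exists c0 => //; apply: (h _ c0s).
by apply/flatten_mapP; exists c.
Qed.

End PlanarTrees.

(** * Points of cubes as decorated forests *)

Section Decoration.
Variables (R : realType) (n : nat).
Local Notation I := 'I_n.
Implicit Types (T : ptree n) (u : seq (ptree n)) (e : {set I}).
Implicit Types (c : dtree R I) (s : seq (dtree R I)) (tv : {set I} -> R).
Implicit Types (p q : cubes R n).

Fixpoint decorate tv T : dtree R I :=
  match T with
  | Leaf i => DLeaf i
  | Node s => DNode (tv (above (Node s))) (map (decorate tv) s)
  end.

Fixpoint erase c : ptree n :=
  match c with DLeaf i => Leaf i | DNode _ s => Node (map erase s) end.

Lemma erase_map tv u : map erase (map (decorate tv) u) = u.
Proof.
elim/ptree_list_ind: u => u IH; rewrite -map_comp -[RHS]map_id.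
by apply/eq_in_map => -[i|v] // /IH h; rewrite /= h.
Qed.

Lemma eq_decorate tv tv' u : {in ledges u, tv =1 tv'} ->
  map (decorate tv) u = map (decorate tv') u.
Proof.
elim/ptree_list_ind: u => u IH h; apply/eq_in_map => -[i|v] vu //=.
congr DNode.
  by apply: h; apply/flatten_mapP; exists (Node v); rewrite // mem_head.
apply: IH => // e ev; apply: h; apply/flatten_mapP; exists (Node v) => //.
by rewrite inE ev orbT.
Qed.

Lemma lword_decorate tv u : lword (map (decorate tv) u) = word u.
Proof.
elim/ptree_list_ind: u => u IH; rewrite /lword /word -map_comp.
by congr flatten; apply/eq_in_map => -[i|v] // /IH.
Qed.

Lemma lvalid_decorate tv u : pvalid u -> {in ledges u, forall e, 0 <= tv e <= 1} ->
  lvalid (map (decorate tv) u).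
Proof.
elim/ptree_list_ind: u => u IH vu h; apply/allP => c /mapP[[i|v] vv -> //].
have [v2 vv'] := pvalidP vu vv; rewrite /= size_map v2 /= h /=; last first.
  by apply/flatten_mapP; exists (Node v); rewrite // mem_head.
apply: IH => // e ev; apply: h; apply/flatten_mapP; exists (Node v) => //.
by rewrite inE ev orbT.
Qed.

(** An association list keyed by label sets. It links decorated forests, whose values sit at the
    nodes, with cubes, whose points are functions on edges. *)
Fixpoint dvals c : seq ({set I} * R) :=
  match c with
  | DLeaf _ => [::]
  | DNode t s => (above (erase (DNode t s)), t) :: flatten (map dvals s)
  end.
Definition lvals s := flatten (map dvals s).

Lemma lvals_cat s1 s2 : lvals (s1 ++ s2) = lvals s1 ++ lvals s2.
Proof. by rewrite /lvals map_cat flatten_cat. Qed.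
Lemma lvals_cons c s : lvals (c :: s) = dvals c ++ lvals s.
Proof. by []. Qed.

Lemma lvals_keys s : map fst (lvals s) = ledges (map erase s).
Proof.
elim/list_tree_ind: s => s IH; rewrite /lvals /ledges map_flatten -!map_comp.
congr flatten; apply/eq_in_map => -[i|t v] // /IH h.
by rewrite /= -[in RHS]/(ledges _) -h.
Qed.

Lemma word_erase s : word (map erase s) = lword s.
Proof.
elim/list_tree_ind: s => s IH; rewrite /lword /word -map_comp.
by congr flatten; apply/eq_in_map => -[i|t v] // /IH.
Qed.

Lemma pvalid_erase s : lvalid s -> pvalid (map erase s).
Proof.
elim/list_tree_ind: s => s IH vs; apply/allP => _ /mapP[[i|t v] vv -> //].
have [v2 _ vv'] := lvalidP vs vv; rewrite /= size_map v2 /=.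
exact: (IH _ _ vv vv').
Qed.

Lemma assoc_fun (A B : eqType) (l : seq (A * B)) a b b' : uniq (map fst l) ->
  (a, b) \in l -> (a, b') \in l -> b = b'.
Proof.
elim: l => // -[x y] l IH /= /andP[xl ul]; rewrite !inE !xpair_eqE.
case/orP => [/andP[/eqP-> /eqP->]|h1]; case/orP => [/andP[/eqP e /eqP->]|h2] //.
- by move: xl; rewrite (map_f fst h2).
- by move: xl; rewrite -e (map_f fst h1).
exact: IH.
Qed.

Lemma lvals_fun s e x y : lvalid s -> uniq (lword s) -> (e, x) \in lvals s ->
  (e, y) \in lvals s -> x = y.
Proof.
move=> vs us; apply: assoc_fun; rewrite lvals_keys; apply: ledges_uniq.
  exact: pvalid_erase.
by rewrite word_erase.
Qed.

Lemma lvals_decorate tv u e x : (e, x) \in lvals (map (decorate tv) u) -> x = tv e.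
Proof.
elim/ptree_list_ind: u => u IH; rewrite /lvals -map_comp => /flatten_mapP[[//|v] vu] /=.
rewrite erase_map inE xpair_eqE => /orP[/andP[/eqP-> /eqP-> //]|].
exact: IH.
Qed.

Lemma decorate_erase tv s : (forall e x, (e, x) \in lvals s -> tv e = x) ->
  map (decorate tv) (map erase s) = s.
Proof.
elim/list_tree_ind: s => s IH h; rewrite -map_comp -[RHS]map_id.
apply/eq_in_map => -[i|t v] vs //=; congr DNode.
  by apply: h; apply/flatten_mapP; exists (DNode t v); rewrite // mem_head.
apply: (IH _ _ vs) => e x ev; apply: h; apply/flatten_mapP; exists (DNode t v) => //.
by rewrite inE ev orbT.
Qed.

Lemma lvals_01 s e x : lvalid s -> (e, x) \in lvals s -> 0 <= x <= 1.
Proof.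
elim/list_tree_ind: s => s IH vs /flatten_mapP[[//|t v] vv].
have [_ t01 vv'] := lvalidP vs vv.
by rewrite inE xpair_eqE => /orP[/andP[_ /eqP-> //]|]; apply: (IH _ _ vv).
Qed.

(** Extending the values by 1 off the edges keeps them in [0, 1] for every argument, so that bounds
    and continuity hold without distinguishing cases. *)
Definition cube_val p e : R :=
  if insub e is Some e' then val (projT2 p) (e' : edge (projT1 p)) else 1.

Definition dforest p := map (decorate (cube_val p)) (val (projT1 p)).

Lemma cube_valE p (e : edge (projT1 p)) : cube_val p (val e) = val (projT2 p) e.
Proof. by rewrite /cube_val valK. Qed.

Lemma cube_val_01 p e : 0 <= cube_val p e <= 1.
Proof.
rewrite /cube_val; case: insub => [x|]; last by rewrite ler01 lexx.
exact: (set_mem (valP (projT2 p))).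
Qed.

Lemma forest_valid (tau : pforest n) : pvalid (val tau) /\ perm_eq (word (val tau)) (enum I).
Proof. by case: tau => u /= /andP[]. Qed.

Lemma forest_uniq (tau : pforest n) : uniq (word (val tau)).
Proof. by have [_ /perm_uniq->] := forest_valid tau; apply: enum_uniq. Qed.

Lemma dforest_ok p : forest_ok (dforest p).
Proof.
have [vt pt] := forest_valid (projT1 p); rewrite /forest_ok lword_decorate pt andbT.
by apply: lvalid_decorate => // e _; apply: cube_val_01.
Qed.

Lemma erase_dforest p : map erase (dforest p) = val (projT1 p).
Proof. exact: erase_map. Qed.

(** The value of an edge is looked up in [lvals], where by [lvals_fun] it occurs with one value
    only. *)
Lemma dforest_surj s : forest_ok s -> exists p, dforest p = s.
Proof.
move=> ok; have [vs us] := (ok_valid ok, ok_uniq ok).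
have tok : all (@no_bivalent n) (map erase s) && perm_eq (word (map erase s)) (enum I).
  by rewrite word_erase; case/andP: (ok) => _ ->; rewrite andbT; apply: pvalid_erase.
pose tau : pforest n := exist _ (map erase s) tok.
have ex e : e \in ledges (map erase s) -> exists x, (e, x) \in lvals s.
  by rewrite -lvals_keys => /mapP[[e' x] h ->]; exists x.
pose t (e : edge tau) : R := xget 0 [set x | (val e, x) \in lvals s].
have tP (e : edge tau) : (val e, t e) \in lvals s.
  have [x h] := ex _ (valP e); exact: (@xgetPex _ 0 [set x | (val e, x) \in lvals s] (ex_intro _ x h)).
have t01 : [set t : {ptws edge tau -> R} | forall e : edge tau, 0 <= t e <= 1] t.
  by move=> e; apply: lvals_01 vs (tP e).
exists (existT _ tau (exist _ t (mem_set t01))).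
apply: decorate_erase => e x ex0.
have ee : e \in ledges (map erase s) by rewrite -lvals_keys; apply/mapP; exists (e, x).
rewrite /cube_val (insubT (fun e => e \in flatten (map (@tedges n) (val tau))) ee) /=.
exact: lvals_fun vs us (tP (exist _ e ee)) ex0.
Qed.

Lemma mem_lvals_dforest p (e : edge (projT1 p)) :
  (val e, val (projT2 p) e) \in lvals (dforest p).
Proof.
have : val e \in map fst (lvals (dforest p)) by rewrite lvals_keys erase_dforest; apply: valP.
move=> /mapP[[e' x] h /= ee']; have := lvals_decorate h.
by rewrite -ee' cube_valE => <-; rewrite ee'.
Qed.

Lemma agree_lvals p q : {subset lvals (dforest q) <= lvals (dforest p)} -> agree p q.
Proof.
move=> h e e' ee'; have := h _ (mem_lvals_dforest e'); rewrite -ee'.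
by have := dforest_ok p => ok; apply: lvals_fun (ok_valid ok) (ok_uniq ok) (mem_lvals_dforest e).
Qed.

Lemma siblings_notin s1 c s2 e : lvalid (s1 ++ c :: s2) -> uniq (lword (s1 ++ c :: s2)) ->
  e \in tedges (erase c) -> e \notin ledges (map erase s1) /\ e \notin ledges (map erase s2).
Proof.
move=> vs us ec; have uk : uniq (ledges (map erase (s1 ++ c :: s2))).
  by apply: ledges_uniq; [apply: pvalid_erase|rewrite word_erase].
move: uk; rewrite map_cat map_cons ledges_cat ledges_cons !cat_uniq.
move=> /and3P[_ /hasPn h1 /and3P[_ /hasPn h2 _]]; split.
  by apply/negP => e1; have := h1 e; rewrite mem_cat ec e1 => /(_ isT).
by apply/negP => e2; have := h2 _ e2; rewrite ec.
Qed.

Lemma erase_mirror s : map erase (lmirror s) = rev (map (@mirror n) (map erase s)).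
Proof.
elim/list_tree_ind: s => s IH; rewrite /lmirror map_rev -!map_comp; congr rev.
by apply/eq_in_map => -[i|t v] // /IH h; rewrite /= -h.
Qed.

Lemma lvals_mirror s : lvals (lmirror s) =i lvals s.
Proof.
elim/list_tree_ind: s => s IH.
have h c : c \in s -> dvals (dmirror c) =i dvals c.
  case: c => // t v vs x; rewrite /= !inE; congr (_ || _); last exact: IH vs x.
  congr (_ == (_, _)); apply: above_eq => i.
  by rewrite -[rev _]/(lmirror v) !word_erase lword_mirror mem_rev.
move=> x; rewrite /lvals /lmirror map_rev (perm_mem (perm_flatten (introT permPl (perm_rev _)))).
by apply/flatten_mapP/flatten_mapP => [[_ /mapP[c cs ->]]|[c cs]];
  rewrite ?h // => ec; [exists c|exists (dmirror c); rewrite ?h ?map_f].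
Qed.

(** A step deep inside the forest is an operation [reverse_at] or [collapse_at] on the whole forest:
    the edge concerned occurs neither among the siblings nor at the node around it, so the operation
    passes through them. *)
Lemma lstep_erase s s' : lvalid s -> lvalid s' -> uniq (lword s) -> lstep s s' ->
  {subset lvals s' <= lvals s} /\
  ((exists2 e, (e, 0) \in lvals s & map erase s' = map (reverse_at e) (map erase s)) \/
   (exists2 e, (e, 1) \in lvals s &
      map erase s' = flatten (map (collapse_at e) (map erase s)))).
Proof.
move=> vs vs' us ss'; elim: ss' vs vs' us => {s s'} [s1 v s2|s1 v s2|s1 t v v' s2 vv' IH] vs vs' us.
- split.
    move=> x; rewrite !lvals_cat !lvals_cons !mem_cat /= !inE.
    rewrite -/(lvals v) -/(lvals (lmirror v)) lvals_mirror.
    rewrite (above_eq (u' := map erase v)) // => i.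
    by rewrite !word_erase lword_mirror mem_rev.
  left; exists (above (erase (DNode 0 v))).
    by rewrite lvals_cat lvals_cons !mem_cat /= mem_head !orbT.
  have ec : above (erase (DNode 0 v)) \in tedges (erase (DNode 0 v)) by rewrite /= mem_head.
  have [n1 n2] := siblings_notin vs us ec.
  by rewrite !map_cat !map_cons (reverse_id n1) (reverse_id n2) /= eqxx erase_mirror.
- split.
    by move=> x; rewrite !lvals_cat lvals_cons !mem_cat /= inE -/(lvals v) => /or3P[]->; rewrite ?orbT.
  right; exists (above (erase (DNode 1 v))).
    by rewrite lvals_cat lvals_cons !mem_cat /= mem_head !orbT.
  have ec : above (erase (DNode 1 v)) \in tedges (erase (DNode 1 v)) by rewrite /= mem_head.
  have [n1 n2] := siblings_notin vs us ec.
  by rewrite !map_cat !map_cons flatten_cat (collapse_id n1) /= eqxx (collapse_id n2).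
have cs : DNode t v \in s1 ++ DNode t v :: s2 by rewrite mem_cat mem_head orbT.
have cs' : DNode t v' \in s1 ++ DNode t v' :: s2 by rewrite mem_cat mem_head orbT.
have [v2 _ vv] := lvalidP vs cs; have [_ _ vv1] := lvalidP vs' cs'.
have uv := uniq_in us cs; have [sub alt] := IH vv vv1 uv.
have ab : above (Node (map erase v')) = above (Node (map erase v)).
  by apply: above_eq => i; rewrite !word_erase (perm_mem (lstep_word vv')).
have ein e x : (e, x) \in lvals v -> [/\ (e, x) \in lvals (s1 ++ DNode t v :: s2),
    e != above (Node (map erase v)) & e \in tedges (erase (DNode t v))].
  move=> ex; have exs : (e, x) \in lvals (s1 ++ DNode t v :: s2).
    by rewrite lvals_cat lvals_cons !mem_cat /= inE -/(lvals v) ex !orbT.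
  have ek : e \in ledges (map erase v) by rewrite -lvals_keys; apply/mapP; exists (e, x).
  split=> //; last by rewrite /= inE -/(ledges _) ek orbT.
  apply: contraTneq ek => ->; apply: (@above_notin n (map erase (s1 ++ DNode t v :: s2))).
  - exact: pvalid_erase.
  - by rewrite word_erase.
  - by apply/mapP; exists (DNode t v).
split.
  move=> x; rewrite !lvals_cat !lvals_cons !mem_cat /= !inE -/(lvals v) -/(lvals v') ab.
  by case/or3P => [->//|/orP[->|/sub->]|->]; rewrite ?orbT.
case: alt => -[e ev ee]; have [e1 e2 e3] := ein _ _ ev; have [n1 n2] := siblings_notin vs us e3.
  left; exists e => //.
  by rewrite !map_cat !map_cons (reverse_id n1) (reverse_id n2) /= eq_sym (negPf e2) ee.
right; exists e => //.
by rewrite !map_cat !map_cons flatten_cat (collapse_id n1) /= eq_sym (negPf e2) /= (collapse_id n2) ee.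
Qed.

Lemma lstep_cube p q : lstep (dforest p) (dforest q) -> cube_rel p q.
Proof.
move=> pq; have [okp okq] := (dforest_ok p, dforest_ok q).
have [sub alt] := lstep_erase (ok_valid okp) (ok_valid okq) (ok_uniq okp) pq.
have ag := agree_lvals sub.
have ee e x : (e, x) \in lvals (dforest p) -> e \in ledges (val (projT1 p)).
  by move=> h; rewrite -erase_dforest -lvals_keys; apply/mapP; exists (e, x).
case: alt => -[e ev]; rewrite !erase_dforest => eq.
  apply: (@CubeReverse _ _ p q (exist _ e (ee _ _ ev))) => //.
  by rewrite -cube_valE /= -(lvals_decorate ev).
apply: (@CubeCollapse _ _ p q (exist _ e (ee _ _ ev))) => //.
by rewrite -cube_valE /= -(lvals_decorate ev).
Qed.

Lemma perm_cube p q : perm_eq (dforest p) (dforest q) -> cube_rel p q.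
Proof.
move=> pq; apply: CubePermute; first by rewrite -!erase_dforest perm_map.
by apply: agree_lvals => x; rewrite (perm_mem (perm_flatten (perm_map _ pq))).
Qed.

Lemma decorate_mirror tv u :
  map (decorate tv) (rev (map (@mirror n) u)) = lmirror (map (decorate tv) u).
Proof.
elim/ptree_list_ind: u => u IH; rewrite /lmirror map_rev -!map_comp; congr rev.
apply/eq_in_map => -[i|v] // /IH h; rewrite /= h; congr DNode.
by congr tv; apply: above_mirror (Node v).
Qed.

Lemma decorate_mirror_node tv u : decorate tv (mirror (Node u)) =
  DNode (tv (above (Node u))) (lmirror (map (decorate tv) u)).
Proof. by rewrite /= decorate_mirror -(above_mirror (Node u)). Qed.

Lemma split_edge u e : e \in ledges u -> exists u1 v u2, u = u1 ++ Node v :: u2 /\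
  e \in tedges (Node v).
Proof.
move=> /flatten_mapP[[//|v] vu ev]; case/path.splitPr: vu => u1 u2.
by exists u1, v, u2.
Qed.

Lemma edge_context u1 v u2 e : pvalid (u1 ++ Node v :: u2) ->
  uniq (word (u1 ++ Node v :: u2)) -> e \in tedges (Node v) ->
  [/\ e \notin ledges u1, e \notin ledges u2, pvalid v & uniq (word v)].
Proof.
move=> vu uu ev; have vin : Node v \in u1 ++ Node v :: u2 by rewrite mem_cat mem_head orbT.
have [_ vv] := pvalidP vu vin; have uv := uniq_pchild uu vin.
have := ledges_uniq vu uu; rewrite ledges_cat ledges_cons !cat_uniq.
move=> /and3P[_ /hasPn h1 /and3P[_ /hasPn h2 _]]; split=> //.
  by apply/negP => e1; have := h1 e; rewrite mem_cat ev e1 => /(_ isT).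
by apply/negP => e2; have := h2 _ e2; rewrite ev.
Qed.

Lemma reverse_lstep tv u e : pvalid u -> uniq (word u) -> e \in ledges u -> tv e = 0 ->
  lstep (map (decorate tv) u) (map (decorate tv) (map (reverse_at e) u)).
Proof.
move=> vu uu eu te; elim/ptree_list_ind: u vu uu eu => u IH vu uu eu.
have [u1 [v [u2 [e12 ev]]]] := split_edge eu.
rewrite e12 in IH vu uu *; have [n1 n2 vv uv] := edge_context vu uu ev.
rewrite !map_cat !map_cons (reverse_id n1) (reverse_id n2) /=.
case: ifP => [/eqP ab|ab].
  by rewrite -[decorate tv (Node _)]/(decorate tv (mirror (Node v))) decorate_mirror_node
    ab te; exact: LFlip.
move: ev; rewrite /= inE eq_sym ab /= => ev.
rewrite /= (above_eq (word_reverse e v)); apply: LInside; apply: IH => //.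
by rewrite mem_cat mem_head orbT.
Qed.

Lemma collapse_lstep tv u e : pvalid u -> uniq (word u) -> e \in ledges u -> tv e = 1 ->
  lstep (map (decorate tv) u) (map (decorate tv) (flatten (map (collapse_at e) u))).
Proof.
move=> vu uu eu te; elim/ptree_list_ind: u vu uu eu => u IH vu uu eu.
have [u1 [v [u2 [e12 ev]]]] := split_edge eu.
rewrite e12 in IH vu uu *; have [n1 n2 vv uv] := edge_context vu uu ev.
rewrite !map_cat !map_cons flatten_cat (collapse_id n1) /= (collapse_id n2) !map_cat /=.
case: ifP => [/eqP ab|ab]; first by rewrite ab te; apply: LCollapse.
move: ev; rewrite /= inE eq_sym ab /= => ev.
rewrite /= (above_eq (u' := v)); last by move=> i; rewrite word_collapse.
apply: LInside; apply: IH => //.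
by rewrite mem_cat mem_head orbT.
Qed.

Lemma dforest_agree p q : agree p q ->
  {subset ledges (val (projT1 q)) <= ledges (val (projT1 p))} ->
  dforest q = map (decorate (cube_val p)) (val (projT1 q)).
Proof.
move=> ag sub; apply: eq_decorate => e eq0; have ep := sub _ eq0.
have := @ag (exist _ e ep) (exist _ e eq0) erefl; rewrite -!cube_valE /= => ->.
by [].
Qed.

Lemma cube_rel_lstep p q : cube_rel p q ->
  lstep (dforest p) (dforest q) \/ perm_eq (dforest p) (dforest q).
Proof.
have [vp _] := forest_valid (projT1 p); have up := forest_uniq (projT1 p).
case=> [e e0 eq ag|e e1 eq ag|pq ag].
- left; rewrite (dforest_agree ag) eq; last by move=> x; rewrite ledges_reverse.
  by apply: reverse_lstep => //; [apply: valP|rewrite cube_valE].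
- left; rewrite (dforest_agree ag) eq; last exact: ledges_collapse.
  by apply: collapse_lstep => //; [apply: valP|rewrite cube_valE].
right; rewrite (dforest_agree ag); first exact: perm_map.
by move=> x; rewrite /ledges (perm_mem (perm_flatten (perm_map _ pq))).
Qed.

Lemma leqv_ok m s s' : leqv m s s' -> forest_ok s <-> forest_ok s'.
Proof.
elim=> [x y [/andP[vx _] /andP[vy _] xy]|//|x y _ -> //|x y z _ -> _ -> //].
by rewrite /forest_ok vx vy; split=> /=; apply: perm_trans; rewrite 1?perm_sym;
  have := lstep_word xy; rewrite // perm_sym.
Qed.

(** All forests of a chain of steps are again given by points of cubes, by [dforest_surj]. *)
Lemma leqv_cube m s s' p q : leqv m s s' -> dforest p = s -> dforest q = s' ->
  clos_refl_sym_trans _ (@cube_rel R n) p q.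
Proof.
move=> ss'; elim: ss' p q => {s s'} [x y [_ _ xy]|x|x y _ IH|x y z xy IH1 _ IH2] p q px qy.
- by apply/rst_step/lstep_cube; rewrite px qy.
- by apply/rst_step/perm_cube; rewrite px qy.
- by apply: rst_sym; apply: IH.
have [|r ry] := @dforest_surj y; first by apply/(leqv_ok xy); rewrite -px dforest_ok.
exact: rst_trans (IH1 _ _ px ry) (IH2 _ _ ry qy).
Qed.

End Decoration.

(** * Injectivity of theta *)

Section ThetaInjective.
Variables (R : realType) (n : nat) (psi : R -> R).
Hypothesis psi_gt0 : forall x, 0 <= x < 1 -> 0 < psi x.
Hypothesis psi_inj : {in [pred x | 0 < x < 1] &, injective (Fw psi)}.
Local Notation I := 'I_n.
Implicit Types (i j k l : I) (c : dtree R I) (s : seq (dtree R I)) (p : cubes R n).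

Definition theta_cube p : Fbar R n :=
  qclass (@glue R n) (s2val (cid2 (point_exists0 psi_gt0 (dforest_ok p)))).

Lemma theta_cubeE p q : is_point psi (dforest p) q -> theta_cube p = qclass (@glue R n) q.
Proof.
move=> hq; apply/FbarP; have := s2valP' (cid2 (point_exists0 psi_gt0 (dforest_ok p))) => hq'.
exact: point_unique hq' hq.
Qed.

Lemma theta_cube_rel p p' : cube_rel p p' -> theta_cube p = theta_cube p'.
Proof.
move=> pp'; have [q _ hq] := point_exists0 psi_gt0 (dforest_ok p).
rewrite (theta_cubeE hq); apply/esym/theta_cubeE.
have [st|pe] := cube_rel_lstep pp'; first exact: (lstep_point (dforest_ok p) (dforest_ok p') st hq).
exact: (perm_point (dforest_ok p) pe hq).
Qed.

Definition theta (d : Dhat R n) : Fbar R n := theta_cube (qrepr d).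

Lemma theta_qclass p : theta (qclass (@cube_rel R n) p) = theta_cube p.
Proof. exact: quot_lift theta_cube_rel p. Qed.

(** Every collapse removes a vertex, so the process ends. Afterwards the trees are exactly the
    classes of finite distance. *)
Lemma collapse_trunks s : forest_ok s -> exists s1, [/\ leqv 0 s s1, forest_ok s1,
  ~~ has_one s1 & forall q, is_point psi s q -> is_point psi s1 q].
Proof.
have [N] := ubnP (lnodes s); elim: N s => // N IH s sN ok.
have [/has_oneP[s1 [u [s2 es]]]|n1] := boolP (has_one s); last first.
  by exists s; split=> //; apply: rst_refl.
have vs := ok_valid ok; rewrite es in vs.
have [st [vs1 _]] := leqv_collapse (m := 0) vs isT.
have ok1 : forest_ok (s1 ++ u ++ s2) by apply/(leqv_ok st); rewrite -es.
have [|s' [h1 h2 h3 h4]] := IH (s1 ++ u ++ s2) _ ok1.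
  by move: sN; rewrite es !lnodes_cat /lnodes /=; lia.
exists s'; split=> //; first by rewrite es; apply: rst_trans st h1.
move=> q hq; apply: h4; apply: (lstep_point ok ok1 _ hq).
by rewrite es; apply: LCollapse.
Qed.

Lemma trunk_lt1 s t u : lvalid s -> ~~ has_one s -> DNode t u \in s -> 0 <= t < 1.
Proof.
move=> vs n1 cs; have [_ /andP[-> t1] _] := lvalidP vs cs.
by rewrite lt_neqAle t1 andbT /=; apply: contra n1 => t1'; apply/hasP; exists (DNode t u).
Qed.

(** A trunk value below 1 keeps all gaps inside the tree below 1. *)
Lemma together_close s i j : forest_ok s -> ~~ has_one s -> together s i j -> close 1 s i j.
Proof.
move=> ok n1 /hasP[[x|t u] cs]; rewrite ?dword_node /= => /andP[].
  by rewrite !inE => /eqP-> /eqP->; apply: close_refl.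
move=> iu ju; rewrite (close_in 1 (ok_valid ok) (ok_uniq ok) cs) // mul1r.
have [_ _ vu] := lvalidP (ok_valid ok) cs.
exact: close_lt1 (trunk_lt1 (ok_valid ok) n1 cs) vu.
Qed.

(** The trees of both forests are the classes of the same relation, so a permutation pairs those
    with equal labels. *)
Lemma align_trees s s' : lvalid s -> lvalid s' -> uniq (lword s) -> uniq (lword s') ->
  lword s =i lword s' ->
  (forall i j, i \in lword s -> j \in lword s -> together s i j = together s' i j) ->
  exists2 s'', perm_eq s' s'' & List.Forall2 same_labels s s''.
Proof.
elim: s s' => [|c s IH] s' vs vs' us us' ww h.
  case: s' vs' ww {h us'} => [|c s'] /=; first by exists [::]; constructor.
  move=> /andP[/dword_neq0 c0 _] ww; have := ww; case ec: (dword c) c0 => [//|i w] _ /(_ i).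
  by rewrite lword_cons ec mem_head.
have /andP[vc vs0] := vs.
have [i ic] : exists i, i \in dword c.
  by case: (dword c) (dword_neq0 vc) => // i w _; exists i; rewrite mem_head.
have iw : i \in lword (c :: s) by rewrite lword_cons mem_cat ic.
have [c' c's ic'] : exists2 c', c' \in s' & i \in dword c'.
  by move: iw; rewrite ww => /flatten_mapP[c' c's ic']; exists c'.
have cc' : same_labels c c'.
  move=> j; have e (v : seq (dtree R I)) d : uniq (lword v) -> d \in v -> i \in dword d ->
      (j \in dword d) = together v i j.
    move=> uv dv id; apply/idP/hasP => [jd|[d' d'v /andP[id' jd']]].
      by exists d; rewrite ?id.
    by rewrite (child_eq uv dv d'v id id').
  rewrite (e _ _ us (mem_head _ _) ic) (e _ _ us' c's ic').
  have [jw|jw] := boolP (j \in lword (c :: s)); first exact: h.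
  have nt (v : seq (dtree R I)) : j \notin lword v -> together v i j = false.
    by apply: contraNF => /hasP[d dv /andP[_ jd]]; apply: mem_lword_sub jd.
  by rewrite !nt // -ww.
case/path.splitPr: c's vs' us' ww h => a b vs' us' ww h.
have ab x : (x \in lword (a ++ b)) = (x \in lword (a ++ c' :: b)) && (x \notin dword c').
  rewrite !lword_cat lword_cons !mem_cat.
  have [xc|xc] := boolP (x \in dword c'); rewrite /= ?andbT //.
  by have [/negPf-> /negPf->] := uniq_mid us' xc; rewrite andbF.
have s0 x : (x \in lword s) = (x \in lword (c :: s)) && (x \notin dword c).
  rewrite lword_cons mem_cat; have [xc|xc] := boolP (x \in dword c); rewrite /= ?andbT //.
  by have [_ /negPf->] := @uniq_mid _ _ [::] c s x us xc.
have [|||||s'' h1 h2] := IH (a ++ b) vs0.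
- by move: vs'; rewrite !lvalid_cat => /andP[-> /andP[_ vb]]; exact: vb.
- by move: us; rewrite lword_cons cat_uniq => /and3P[].
- by move: us'; rewrite !lword_cat lword_cons uniq_catCA cat_uniq => /and3P[].
- by move=> x; rewrite s0 ab ww cc'.
- move=> x y xs ys; have := xs; have := ys; rewrite !s0 => /andP[yw yc] /andP[xw xc].
  have := h x y xw yw; rewrite /together !has_cat /= (negPf xc) -cc' (negPf xc) /=.
  by move=> ->.
exists (c' :: s''); last by constructor.
by rewrite -cat1s perm_catCA /= perm_cons.
Qed.

Lemma behead_lt1 s c : lvalid s -> ~~ has_one s -> c \in s ->
  all (fun x => x < 1) (behead (lcpre [:: c])).
Proof.
move=> vs n1; rewrite /lcpre /= cats0; case: c => // t u cs /=; case: eqP => //= tn.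
have /andP[t0 t1] := trunk_lt1 vs n1 cs; have [_ _ vu] := lvalidP vs cs.
rewrite all_map; apply/allP => x /mem_behead /(lcpre_01 vu) /andP[x0 x1] /=.
by apply: le_lt_trans t1; rewrite ler_piMr.
Qed.

Lemma lmu_single P s c i j k : uniq (lword s) -> c \in s -> i != j ->
  i \in dword c -> j \in dword c -> k \in dword c ->
  lmu psi P [:: c] i j k = lmu psi P s i j k.
Proof.
move=> us; case: c => [x|t u] cs ij.
  by rewrite !inE => /eqP ix /eqP jx; rewrite ix jx eqxx in ij.
rewrite !dword_node => iu ju ku; rewrite (lmu_in psi P us cs) // (@lmu_in _ _ _ P _ t u) //.
  by rewrite lword1; apply: uniq_child us cs.
by rewrite mem_head.
Qed.

(** With trunks of value 1 collapsed, the trees are the classes of finite distance, which the nu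
    coordinates know; after a permutation they correspond. Inside a class, nu gives the distances,
    and the mu_ijk with i, j, k at one position give the screens, which is what [leqv_of_positions]
    asks for. *)
Lemma theta_cube_inj p p' : theta_cube p = theta_cube p' ->
  clos_refl_sym_trans _ (@cube_rel R n) p p'.
Proof.
have [q _ hq] := point_exists0 psi_gt0 (dforest_ok p).
have [q' _ hq'] := point_exists0 psi_gt0 (dforest_ok p').
rewrite (theta_cubeE hq) (theta_cubeE hq') => /FbarP qq'.
have [s [ps oks n1 hs]] := collapse_trunks (dforest_ok p).
have [s' [ps' oks' n1' hs']] := collapse_trunks (dforest_ok p').
have {hs} hs := hs _ hq; have {hs'} hs' := hs' _ hq'.
have [g1 g2] := point_same hs hs' qq'.
have [[vs us] [vs' us']] := ((ok_valid oks, ok_uniq oks), (ok_valid oks', ok_uniq oks')).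
have ctE i j : together s i j = close 1 s i j.
  by apply/idP/idP; [apply: together_close|apply: close_together].
have ctE' i j : together s' i j = close 1 s' i j.
  by apply/idP/idP; [apply: together_close|apply: close_together].
have cc i j : close 1 s i j = close 1 s' i j.
  have [->|ij] := eqVneq i j; first by rewrite !close_refl.
  by apply/idP/idP => /(close_gnu psi) h; apply/(close_gnu psi); rewrite ?(g1 _ _ ij) // -(g1 _ _ ij).
have [||||||s2 pe2 al] := @align_trees s s'.
- exact: vs.
- exact: vs'.
- exact: us.
- exact: us'.
- by move=> i; rewrite !ok_mem.
- by move=> i j _ _; rewrite ctE ctE' cc.
have hs2 := perm_point oks' pe2 hs'.
have oks2 : forest_ok s2.
  rewrite /forest_ok /lvalid -(perm_all _ pe2) -/(lvalid s') vs' /=.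
  have [_ h] := andP oks'; apply: perm_trans h; rewrite perm_sym.
  by apply: perm_flatten; apply: perm_map.
have n2 : ~~ has_one s2 by rewrite /has_one -(perm_has _ pe2).
have [{}g1 {}g2] := point_same hs hs2 qq'.
have [vs2 us2] := (ok_valid oks2, ok_uniq oks2).
have dd i j : close 1 s i j -> close 1 s2 i j -> dist (Fw psi) s i j = dist (Fw psi) s2 i j.
  move=> c1 c2; have [->|ij] := eqVneq i j; first by rewrite !distii.
  have := g1 _ _ ij; rewrite /gnu c1 c2 => /pt_eqP; rewrite !one_neq0 => /(_ isT isT) /=.
  by rewrite mul1r mulr1.
have teqs : List.Forall2 teq s s2.
  apply: Forall2_mem al => c c2 cs c2s lab.
  have vc : lvalid [:: c] by rewrite /lvalid /= (allP vs).
  have vc2 : lvalid [:: c2] by rewrite /lvalid /= (allP vs2).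
  have close1 i j : i \in dword c -> j \in dword c -> close 1 s i j.
    by move=> ic jc; apply: together_close => //; apply/hasP; exists c; rewrite ?ic.
  have close2 i j : i \in dword c -> j \in dword c -> close 1 s2 i j.
    by move=> ic jc; apply: together_close => //; apply/hasP; exists c2; rewrite -?lab ?ic.
  apply: (leqv_of_positions psi_gt0 psi_inj).
  - by rewrite /lok vc.
  - by rewrite /lok vc2.
  - by rewrite lword1 (uniq_child us cs).
  - by rewrite lword1 (uniq_child us2 c2s).
  - by move=> i; rewrite !lword1.
  - exact: behead_lt1 vs n1 cs.
  - exact: behead_lt1 vs2 n2 c2s.
  - move=> i j; rewrite lword1 => ic jc.
    rewrite -(dist_child _ vs us cs) // -(dist_child _ vs2 us2 c2s) -?lab //.
    by apply: dd; [apply: close1|apply: close2].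
  move=> i j k uijk; rewrite lword1 => ic jc kc.
  have ij : i != j by move: uijk; rewrite /= !inE negb_or -andbA => /andP[].
  rewrite -!(dist_child _ vs us cs) // => dij dik.
  rewrite (lmu_single _ us cs) // (lmu_single _ us2 c2s) -?lab //.
  have hij : gnu psi s i j = P1inf by apply/gnu_inf; split=> //; apply: close1.
  have hik : gnu psi s i k = P1inf by apply/gnu_inf; split=> //; apply: close1.
  have m1 : lmu psi 1 s i j k != (0, 0).
    by apply: (lmu_neq0 psi_gt0 (one01 R) vs us) => //; rewrite ?ok_mem ?close1.
  have m2 : lmu psi 1 s2 i j k != (0, 0).
    by apply: (lmu_neq0 psi_gt0 (one01 R) vs2 us2) => //; rewrite ?ok_mem ?close2.
  by have /(pt_eqP m1 m2) := g2 i j k uijk hij hik.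
have ss2 : leqv 0 s s2 by apply: leqv_all.
have [r er] := dforest_surj oks'; have [r2 er2] := dforest_surj oks2.
apply: (@rst_trans _ _ _ r2).
  have h : leqv 0 (dforest p) s2 by apply: rst_trans ps ss2.
  exact: (leqv_cube h erefl er2).
apply: rst_sym; apply: (@rst_trans _ _ _ r); first exact: (leqv_cube ps' erefl er).
by apply: rst_step; apply: perm_cube; rewrite er er2.
Qed.

End ThetaInjective.

(** * Surjectivity of theta *)

(** The level sets of h in increasing order, with smallest value [m] and successive differences [g].
    The induction splits off the level set of the minimum. *)
Lemma clusters (R : realFieldType) (T : choiceType) (A : seq T) (h : T -> R) :
  A != [::] -> exists m Is (g : seq R),
  [/\ perm_eq (flatten Is) A, all (fun X => X != [::]) Is, size Is = (size g).+1,
      all (fun x => 0 < x) g /\ {in Is, forall X, {in X &, forall i j, h i = h j}} &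
      {in A, forall i, h i = m + \sum_(x <- take (find (fun X => i \in X) Is) g) x}].
Proof.
have [N] := ubnP (size A); elim: N A => // N IH A AN A0.
have [_ /mapP[a aA ->] hmin] := @seq_max R (map (fun i => - h i) A) ltac:(by case: (A) A0).
have {}hmin i : i \in A -> h a <= h i.
  by move=> iA; have := hmin _ (map_f (fun i => - h i) iA); rewrite lerN2.
pose A1 := [seq i <- A | h i == h a]; pose A2 := [seq i <- A | h i != h a].
have a1 : a \in A1 by rewrite mem_filter eqxx.
have pA : perm_eq (A1 ++ A2) A by apply: permEl; apply: perm_filterC.
have [e2|n2] := eqVneq A2 [::].
  have cst i : i \in A -> h i = h a.
    move=> iA; apply/eqP; apply: contraT => hi.
    have : i \in A2 by rewrite mem_filter hi.
    by rewrite e2.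
  exists (h a), [:: A], [::]; split=> //=; rewrite ?cats0 ?A0 //.
    by split=> // X; rewrite inE => /eqP-> i j /cst-> /cst->.
  by move=> i /cst->; rewrite big_nil addr0.
have sz : (size A2 < N)%N.
  have s1 : (0 < size A1)%N by case: (A1) a1.
  apply: leq_trans (_ : size A <= N)%N; last by rewrite -ltnS.
  by rewrite -(perm_size pA) size_cat -add1n leq_add2r.
have [m [Is [g [h1 h2 h3 [h4 h6] h5]]]] := IH A2 sz n2.
have [b b2] : exists b, b \in A2 by case: (A2) n2 => // b w _; exists b; rewrite mem_head.
have mA : h a < m.
  case: Is h1 h2 h3 h5 {h6} => [|X Is] // h1 /andP[X0 _] _ h5.
  have [c cX] : exists c, c \in X by case: (X) X0 => // c w _; exists c; rewrite mem_head.
  have cA2 : c \in A2 by rewrite -(perm_mem h1) /= mem_cat cX.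
  have := h5 _ cA2; rewrite /= cX take0 big_nil addr0 => <-.
  move: cA2; rewrite mem_filter => /andP[ne /hmin le]; by rewrite lt_neqAle eq_sym ne.
exists (h a), (A1 :: Is), (m - h a :: g); split=> //=.
- apply: perm_trans pA; by rewrite perm_cat2l.
- by rewrite h2 andbT; case: (A1) a1.
- by rewrite h3.
- rewrite subr_gt0 mA; split=> // X; rewrite inE => /orP[/eqP->|/h6 //] i j.
  by rewrite !mem_filter => /andP[/eqP-> _] /andP[/eqP-> _].
move=> i iA; have [hi|hi] := boolP (i \in A1).
  by rewrite take0 big_nil addr0; move: hi; rewrite mem_filter => /andP[/eqP].
have i2 : i \in A2 by move: iA; rewrite -(perm_mem pA) mem_cat (negPf hi).
by rewrite /= big_cons (h5 _ i2); lra.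
Qed.

Lemma pick_list (A B : eqType) (P : A -> B -> Prop) (l : seq A) :
  (forall a, a \in l -> exists b, P a b) -> exists l', List.Forall2 P l l'.
Proof.
elim: l => [|a l IH] h; first by exists [::].
have [b ab] := h a (mem_head _ _); have [l' ll'] := IH (fun x xl => h x (mem_behead (s := a :: l) xl)).
by exists (b :: l'); constructor.
Qed.

Section Assemble.
Variables (R : realFieldType) (I : choiceType).
Implicit Types (c T : dtree R I) (cs : seq (dtree R I)) (X : seq I) (Is : seq (seq I)).

Definition item_for X c := [/\ is_item c, dvalid c, dbinary c & perm_eq (dword c) X].

Lemma items_for_facts Is cs : List.Forall2 item_for Is cs ->
  [/\ size Is = size cs, all is_item cs, lvalid cs, all dbinary cs &
   perm_eq (lword cs) (flatten Is)] /\
  forall i, find (fun c => i \in dword c) cs = find (fun X => i \in X) Is.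
Proof.
elim=> [|X c Is' cs' [h1 h2 h3 h4] _ [[e1 e2 e3 e4 e5] e6]]; first by split.
split; first split.
- by rewrite /= e1.
- by rewrite /= h1.
- by rewrite /lvalid /= h2.
- by rewrite /= h3.
- by rewrite lword_cons /=; apply: perm_cat.
by move=> i; rewrite /= (perm_mem h4) e6.
Qed.

Lemma assemble Is cs (g : seq R) : List.Forall2 item_for Is cs ->
  size Is = (size g).+1 -> {in g, forall x, 0 < x <= 1} ->
  exists T, [/\ dvalid T, dbinary T, perm_eq (dword T) (flatten Is), citems T = cs &
    (forall F : R -> R, F 0 = 0 -> {in flatten Is, forall i,
      lpos F [:: T] i = F 1 + \sum_(x <- take (find (fun X => i \in X) Is) g) F x})] /\
    if g is [::] then is_item T
    else exists m s, [/\ T = DNode m s, m \in g & {in g, forall x, x <= m}].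
Proof.
move=> /items_for_facts[[e1 e2 e3 e4 e5] e6] sz g01.
have [|T [vT bT iT gT hT]] := @tree_of_items _ _ cs g _ e2 e3 e4 g01; first by rewrite -e1.
have vl : lvalid [:: T] by rewrite /lvalid /= vT.
have wT : perm_eq (dword T) (flatten Is).
  by apply: perm_trans e5; rewrite -iT -[citems T]cats0 -[_ ++ _]/(litems [:: T]) litems_word lword1.
exists T; split; first split=> //.
  move=> F F0 i iw; have [h _] := lpos_items F0 vl.
  rewrite h; last by rewrite lword1 (perm_mem wT).
  by rewrite /ipos /litems /lcpre /= !cats0 iT gT /= big_cons e6.
case: g sz g01 hT gT => [|x g] sz g01 hT gT; last exact: hT.
by move: e2; rewrite hT /= andbT.
Qed.

End Assemble.

(** * Affine coordinates on a screen of a given point *)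

Section ScreenOfPoint.
Variables (R : realType) (n : nat) (psi : R -> R).
Hypothesis psi_gt0 : forall x, 0 <= x < 1 -> 0 < psi x.
Local Notation I := 'I_n.
Variable q : charts R n.
Implicit Types (a b c i j k l : I) (X : seq I).

Local Notation nu := (nu_at (chart_nu q)).
Local Notation mu := (chart_mu q).
Local Notation mx i j k := (hx (mu i j k)).
Local Notation my i j k := (hy (mu i j k)).
Local Notation inS := (in_part (projT1 q)).

Lemma chart_eqs :
  [/\ forall i j k, inS i j k -> mx i j k * mx i k j = my i j k * my i k j,
   forall i j k, inS i j k ->
     mx i j k * my j i k + mx j i k * my i j k = my i j k * my j i k &
   forall i j k l, inS i j k -> inS i j l -> k != l ->
     mx i j k * mx i k l * my i j l = mx i j l * my i j k * my i k l].
Proof. by case: (set_mem (valP (projT2 q))). Qed.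

Lemma mxy_neq0 i j k : (mx i j k != 0) || (my i j k != 0).
Proof. by rewrite -(pair_neq0 (mx i j k, my i j k)) hxy_neq0. Qed.

Variable X : seq I.
Hypothesis X_part : {in X &, forall i j, same_part (projT1 q) i j}.

Lemma X_in i j k : i \in X -> j \in X -> k \in X -> i != j -> i != k -> j != k -> inS i j k.
Proof.
move=> iX jX kX ij ik jk; rewrite in_partP /= !inE negb_or ij ik jk /=.
by rewrite !X_part.
Qed.

(* For fixed i, k <= l iff mu_ikl is finite defines a total preorder. *)
Lemma finite_direction i (L : seq I) : i \in X -> i \notin L -> {subset L <= X} ->
  L != [::] -> exists2 j, j \in L & {in L, forall k, k != j -> my i j k != 0}.
Proof.
have [E1 _ E3] := chart_eqs.
move=> iX; elim: L => // l L IH; rewrite inE negb_or => /andP[il iL] LX _.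
have lX : l \in X by apply: LX; rewrite mem_head.
have L'X : {subset L <= X} by move=> x xL; apply: LX; rewrite inE xL orbT.
have [->|L0] := eqVneq L [::].
  by exists l; rewrite ?mem_head // => k; rewrite inE => /eqP->; rewrite eqxx.
have [j jL hj] := IH iL L'X L0.
have ij : i != j by apply: contraNneq iL => ->.
have [jl|jl] := eqVneq l j.
  exists j; first by rewrite inE jL orbT.
  by move=> k; rewrite inE => /orP[/eqP->|/hj //]; rewrite jl eqxx.
have jX := L'X _ jL.
have [yjl|yjl] := eqVneq (my i j l) 0; last first.
  exists j; first by rewrite inE jL orbT.
  by move=> k; rewrite inE => /orP[/eqP-> //|/hj].
have xjl : mx i j l != 0 by have := mxy_neq0 i j l; rewrite yjl eqxx orbF.
have xlj : mx i l j = 0.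
  have /eqP := E1 i j l (X_in iX jX lX ij il ltac:(by rewrite eq_sym)).
  by rewrite yjl mul0r mulf_eq0 (negPf xjl) => /eqP.
have ylj : my i l j != 0 by have := mxy_neq0 i l j; rewrite xlj eqxx.
exists l; first by rewrite mem_head.
move=> k; rewrite inE => /orP[/eqP->|kL kl]; first by rewrite eqxx.
have [->//|kj] := eqVneq k j.
have kX := L'X _ kL; have ik : i != k by apply: contraNneq iL => ->.
have lk : l != k by rewrite eq_sym.
have := E3 i l j k (X_in iX lX jX il ij jl) (X_in iX lX kX il ik lk).
rewrite eq_sym kj => /(_ isT) /esym/eqP; rewrite xlj !mul0r !mulf_eq0.
rewrite (negPf ylj) (negPf (hj _ kL kj)) !orbF => /eqP x0.
by have := mxy_neq0 i l k; rewrite x0 eqxx.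
Qed.

Variables (i0 j0 : I).
Hypothesis i0X : i0 \in X.
Hypothesis j0X : j0 \in X.
Hypothesis ij0 : i0 != j0.
Hypothesis fin0 : {in X, forall k, k != i0 -> k != j0 -> my i0 j0 k != 0}.

(** The coordinate (z_i0 - z_k) / (z_i0 - z_j0) on the screen of [X], normalized to 0 at i0 and 1 at
    j0. By [fin0] no label is at infinity. *)
Definition screen_pos k : R :=
  if k == i0 then 0 else if k == j0 then 1 else affine (mu i0 j0 k).

Local Notation u := screen_pos.
Local Notation K a b c := (mx a b c * (u b - u a) = my a b c * (u c - u a)).

Lemma screen_pos_i0 : u i0 = 0.
Proof. by rewrite /screen_pos eqxx. Qed.

Lemma screen_pos_j0 : u j0 = 1.
Proof. by rewrite /screen_pos eq_sym (negPf ij0) eqxx. Qed.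

Lemma screen_pos_mu k : k \in X -> k != i0 -> k != j0 -> mx i0 j0 k = u k * my i0 j0 k.
Proof.
by move=> kX ki kj; rewrite /screen_pos (negPf ki) (negPf kj) /affine divfK // fin0.
Qed.

(** [K a b c] says that mu_abc is the ratio of u c - u a to u b - u a, and says nothing if both
    vanish. For a = i0 it comes from the product relation of mu_{i0 j0 b} and mu_{i0 b c}. *)
Lemma screen_first b c : b \in X -> c \in X -> i0 != b -> i0 != c -> b != c -> K i0 b c.
Proof.
have [E1 _ E3] := chart_eqs.
move=> bX cX ib ic bc; rewrite screen_pos_i0 !subr0.
have [bj|bj] := eqVneq b j0.
  rewrite bj in bc *; rewrite screen_pos_j0 mulr1 screen_pos_mu 1?eq_sym //.
  by rewrite mulrC.
have yb : my i0 j0 b != 0 by apply: fin0 => //; rewrite eq_sym.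
have xb : mx i0 j0 b = u b * my i0 j0 b by apply: screen_pos_mu; rewrite // eq_sym.
have jb : j0 != b by rewrite eq_sym.
have [cj|cj] := eqVneq c j0.
  rewrite cj screen_pos_j0 mulr1; apply: (mulfI yb).
  have := E1 i0 j0 b (X_in i0X j0X bX ij0 ib jb); rewrite xb => e.
  by rewrite -e; ring.
have yc : my i0 j0 c != 0 by apply: fin0 => //; rewrite eq_sym.
have xc : mx i0 j0 c = u c * my i0 j0 c by apply: screen_pos_mu; rewrite // eq_sym.
have jc : j0 != c by rewrite eq_sym.
have := E3 i0 j0 b c (X_in i0X j0X bX ij0 ib jb) (X_in i0X j0X cX ij0 ic jc) bc.
rewrite xb xc => e; apply: (mulfI yb); apply: (mulfI yc).
have -> : my i0 j0 c * (my i0 j0 b * (mx i0 b c * u b)) =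
  u b * my i0 j0 b * mx i0 b c * my i0 j0 c by ring.
by rewrite e; ring.
Qed.

(** From mu_{i0 a c} + mu_{a i0 c} = 1 if the first term is finite; if it is infinite, then u a = 0
    and both sides vanish. *)
Lemma screen_second a c : a \in X -> c \in X -> i0 != a -> i0 != c -> a != c -> K a i0 c.
Proof.
have [_ E2 _] := chart_eqs.
move=> aX cX ia ic ac; have := screen_first aX cX ia ic ac.
rewrite screen_pos_i0 !subr0 sub0r => Kf.
have := E2 i0 a c (X_in i0X aX cX ia ic ac).
have [y0|y0] := eqVneq (my i0 a c) 0 => e.
  have x0 : mx i0 a c != 0 by have := mxy_neq0 i0 a c; rewrite y0 eqxx orbF.
  move: Kf; rewrite y0 mul0r => /eqP; rewrite mulf_eq0 (negPf x0) => /eqP ua.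
  move: e; rewrite y0 mulr0 mul0r addr0 => /eqP; rewrite mulf_eq0 (negPf x0) => /eqP ya.
  by rewrite ya mul0r ua oppr0 mulr0.
apply: (mulfI y0).
have -> : my i0 a c * (mx a i0 c * - u a) = - (u a * (mx a i0 c * my i0 a c)) by ring.
have -> : mx a i0 c * my i0 a c = my i0 a c * my a i0 c - mx i0 a c * my a i0 c.
  by rewrite -e; ring.
have -> : - (u a * (my i0 a c * my a i0 c - mx i0 a c * my a i0 c)) =
   my a i0 c * (mx i0 a c * u a - my i0 a c * u a) by ring.
by rewrite Kf; ring.
Qed.

Lemma screen_swap a b c : a \in X -> b \in X -> c \in X -> a != b -> a != c -> b != c ->
  K a c b -> K a b c.
Proof.
have [E1 _ _] := chart_eqs.
move=> aX bX cX ab ac bc Kc; have := E1 a b c (X_in aX bX cX ab ac bc).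
have [y0|y0] := eqVneq (my a c b) 0 => e.
  have x0 : mx a c b != 0 by have := mxy_neq0 a c b; rewrite y0 eqxx orbF.
  move: Kc; rewrite y0 mul0r => /eqP; rewrite mulf_eq0 (negPf x0) => /eqP uc.
  move: e; rewrite y0 mulr0 => /eqP; rewrite mulf_eq0 (negPf x0) orbF => /eqP xb.
  by rewrite xb uc mul0r mulr0.
apply: (mulfI y0).
have -> : my a c b * (mx a b c * (u b - u a)) = mx a b c * (my a c b * (u b - u a)) by ring.
rewrite -Kc.
have -> : mx a b c * (mx a c b * (u c - u a)) = mx a b c * mx a c b * (u c - u a) by ring.
by rewrite e; ring.
Qed.

(** If a is apart from i0 on the screen, both factors mu_{a i0 b} and mu_{a i0 c} of the product
    relation with mu_abc are finite and known from [screen_second]. *)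
Lemma screen_generic a b c : a \in X -> b \in X -> c \in X -> a != b -> a != c -> b != c ->
  i0 != a -> i0 != b -> i0 != c -> u a != 0 -> K a b c.
Proof.
have [_ _ E3] := chart_eqs.
move=> aX bX cX ab ac bc ia ib ic ua.
have ai : a != i0 by rewrite eq_sym.
have := screen_second aX bX ia ib ab; have := screen_second aX cX ia ic ac.
rewrite screen_pos_i0 sub0r => Kc Kb.
have yN z : mx a i0 z * - u a = my a i0 z * (u z - u a) -> my a i0 z != 0.
  move=> Kz; apply/negP => /eqP y0; have := mxy_neq0 a i0 z; rewrite y0 eqxx orbF => x0.
  by move/eqP: Kz; rewrite y0 mul0r mulf_eq0 (negPf x0) oppr_eq0 (negPf ua).
have yb := yN _ Kb; have yc := yN _ Kc.
have := E3 a i0 b c (X_in aX i0X bX ai ab ib) (X_in aX i0X cX ai ac ic) bc => e.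
have ua' : - u a != 0 by rewrite oppr_eq0.
apply: (mulfI ua'); apply: (mulfI yb); apply: (mulfI yc).
have -> : my a i0 c * (my a i0 b * (- u a * (mx a b c * (u b - u a)))) =
  mx a b c * my a i0 c * - u a * (my a i0 b * (u b - u a)) by ring.
rewrite -Kb.
have -> : mx a b c * my a i0 c * - u a * (mx a i0 b * - u a) =
  (mx a i0 b * mx a b c * my a i0 c) * (u a * u a) by ring.
rewrite e.
have -> : mx a i0 c * my a i0 b * my a b c * (u a * u a) =
  my a i0 b * my a b c * - u a * (mx a i0 c * - u a) by ring.
by rewrite Kc; ring.
Qed.

(** If a coincides with i0 on the screen but b does not, the roles of a and b are exchanged by
    mu_abc + mu_bac = 1. *)
Lemma screen_half a b c : a \in X -> b \in X -> c \in X -> a != b -> a != c -> b != c ->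
  i0 != a -> i0 != b -> i0 != c -> u a = 0 -> u b != 0 -> K a b c.
Proof.
have [_ E2 _] := chart_eqs.
move=> aX bX cX ab ac bc ia ib ic ua ub; rewrite ua !subr0.
have ba : b != a by rewrite eq_sym.
have := screen_generic bX aX cX ba bc ac ib ia ic ub; rewrite ua sub0r => Kb.
have yb : my b a c != 0.
  apply/negP => /eqP y0; have := mxy_neq0 b a c; rewrite y0 eqxx orbF => x0.
  by move/eqP: Kb; rewrite y0 mul0r mulf_eq0 (negPf x0) oppr_eq0 (negPf ub).
have := E2 a b c (X_in aX bX cX ab ac bc) => e.
apply: (mulfI yb).
have -> : my b a c * (mx a b c * u b) = u b * (mx a b c * my b a c) by ring.
have -> : mx a b c * my b a c = my a b c * my b a c - mx b a c * my a b c.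
  by rewrite -e; ring.
have -> : u b * (my a b c * my b a c - mx b a c * my a b c) =
   my a b c * (mx b a c * - u b + my b a c * u b) by ring.
by rewrite Kb; ring.
Qed.

Lemma screenP a b c : a \in X -> b \in X -> c \in X -> a != b -> a != c -> b != c -> K a b c.
Proof.
move=> aX bX cX ab ac bc.
have [ia|ia] := eqVneq i0 a.
  by rewrite -ia in aX ab ac *; apply: screen_first.
have [ib|ib] := eqVneq i0 b.
  by rewrite -ib in bX ab bc *; apply: screen_second; rewrite // eq_sym.
have [ic|ic] := eqVneq i0 c.
  by rewrite -ic in cX ac bc *; apply: screen_swap => //; apply: screen_second.
have [ua|ua] := eqVneq (u a) 0; last exact: screen_generic.
have [ub|ub] := eqVneq (u b) 0; last exact: screen_half.
have cb : c != b by rewrite eq_sym.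
have [uc|uc] := eqVneq (u c) 0; first by rewrite ua ub uc subrr !mulr0.
by apply: screen_swap => //; apply: screen_half.
Qed.

End ScreenOfPoint.

Lemma Forall2_memr (A B : eqType) (P : A -> B -> Prop) l l' b :
  List.Forall2 P l l' -> b \in l' -> exists2 a, a \in l & P a b.
Proof.
elim=> // a b' l0 l0' ab _ IH; rewrite inE => /orP[/eqP->|/IH[x xl xb]].
  by exists a; rewrite ?mem_head.
by exists x; rewrite // inE xl orbT.
Qed.

Lemma sum_take_lt (R : realFieldType) (g : seq R) (k l : nat) : all (fun x => 0 < x) g ->
  (k < l)%N -> (l <= size g)%N -> \sum_(x <- take k g) x < \sum_(x <- take l g) x.
Proof.
move=> /allP g0 kl lg; rewrite -(cat_take_drop k (take l g)) big_cat /= take_takel ?(ltnW kl) //.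
rewrite ltrDl; case ed : (drop k (take l g)) => [|x d].
  have := size_drop k (take l g); rewrite ed /= size_takel //; lia.
have dg y : y \in drop k (take l g) -> 0 < y by move=> /mem_drop /mem_take /g0.
rewrite big_cons ltr_wpDr ?dg ?ed ?mem_head // big_seq sumr_ge0 // => y yd.
by rewrite ltW // dg // ed inE yd orbT.
Qed.

(** The partial sums of positive gaps increase strictly, so the value of h determines the
    cluster. *)
Lemma same_find (T : choiceType) (R : realFieldType) (Is : seq (seq T)) (g : seq R) (A : seq T)
    (h : T -> R) m i j : size Is = (size g).+1 -> all (fun x => 0 < x) g ->
  perm_eq (flatten Is) A ->
  {in A, forall i, h i = m + \sum_(x <- take (find (fun X => i \in X) Is) g) x} ->
  i \in A -> j \in A -> h i = h j ->
  find (fun X => i \in X) Is = find (fun X => j \in X) Is.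
Proof.
move=> sz g0 pA hf iA jA; rewrite !hf // => /addrI e.
have lt k : k \in A -> (find (fun X => k \in X) Is <= size g)%N.
  rewrite -(perm_mem pA) => /flattenP[X XI kX]; rewrite -ltnS -sz -has_find.
  by apply/hasP; exists X.
apply/eqP; apply: contraT; rewrite neq_ltn => /orP[] /(sum_take_lt g0).
  by move=> /(_ (lt _ jA)); rewrite e ltxx.
by move=> /(_ (lt _ iA)); rewrite e ltxx.
Qed.

Lemma blocks (T : choiceType) (e : rel T) (L : seq T) : uniq L -> equivalence_rel e ->
  exists Bs, [/\ perm_eq (flatten Bs) L, all (fun B => B != [::]) Bs &
    {in Bs, forall B, {in B & L, forall i j, (j \in B) = e i j}}].
Proof.
move=> uL ee; have er i : e i i by have [] := ee i i i.
have et i j k : e i j -> e i k = e j k by move=> eij; have [_ ->] := ee i j k.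
have es i j : e i j = e j i by apply/idP/idP => h; rewrite -(et _ _ _ h) er.
have [N] := ubnP (size L); elim: N L uL => // N IH [|a L] uL LN.
  by exists [::].
pose B := [seq j <- a :: L | e a j]; pose L' := [seq j <- a :: L | ~~ e a j].
have sz : (size L' < N)%N.
  move: LN; rewrite ltnS /= => LN; apply: leq_trans LN; rewrite /L' /= er ltnS.
  by rewrite size_filter count_size.
have uL' : uniq L' by apply: filter_uniq.
have [Bs [h1 h2 h3]] := IH L' uL' sz; exists (B :: Bs); split.
- apply: perm_trans (permEl (perm_filterC (e a) (a :: L))).
  by rewrite -[flatten _]/(B ++ flatten Bs) perm_cat2l.
- by rewrite /= h2 andbT /B /= er.
move=> C; rewrite inE => /orP[/eqP->|CB] i j.
  by rewrite !mem_filter => /andP[ai _] ->; rewrite andbT (et _ _ _ ai).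
move=> iC jL; have iL' : i \in L' by rewrite -(perm_mem h1); apply/flattenP; exists C.
have [jL'|jL'] := boolP (j \in L'); first exact: h3 CB _ _ iC jL'.
have aj : e a j by move: jL'; rewrite mem_filter jL andbT negbK.
have nai : ~~ e a i by move: iL'; rewrite mem_filter => /andP[].
transitivity false.
  by apply: contraNF jL' => jC; rewrite -(perm_mem h1); apply/flattenP; exists C.
by apply/esym/negbTE; apply: contra nai => eij; rewrite (et _ _ _ aj) es.
Qed.

(** * Forests realizing a given point *)

Section Surjective.
Variables (R : realType) (n : nat) (psi : R -> R).
Hypothesis psi_gt0 : forall x, 0 <= x < 1 -> 0 < psi x.
Hypothesis psi_surj : forall y, 0 <= y -> exists2 x, 0 <= x < 1 & Fw psi x = y.
Local Notation I := 'I_n.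
Variable q : charts R n.
Implicit Types (a b c i j k l : I) (X Y : seq I) (T : dtree R I).

Local Notation nu := (nu_at (chart_nu q)).
Local Notation mu := (chart_mu q).

Definition mu_item X T := item_for X T /\ forall i j k, uniq [:: i; j; k] ->
  i \in X -> j \in X -> k \in X -> pt (lmu psi 0 [:: T] i j k) = mu i j k.

Lemma mu_items_for Is cs : List.Forall2 mu_item Is cs -> List.Forall2 (@item_for R I) Is cs.
Proof. by elim=> [|X T Is' cs' [h _] _ IH]; constructor. Qed.

Lemma uniq3 i j k : uniq [:: i; j; k] = [&& i != j, i != k & j != k].
Proof. by rewrite /= !inE negb_or andbT andbA. Qed.

(** The item at the common index has at least two labels, hence is a node of value 0 and not a
    leaf. *)
Lemma find_item Is (cs : seq (dtree R I)) i j k : List.Forall2 mu_item Is cs ->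
  uniq [:: i; j; k] -> i \in flatten Is ->
  find (fun X => i \in X) Is = find (fun X => j \in X) Is ->
  find (fun X => i \in X) Is = find (fun X => k \in X) Is ->
  exists d, [/\ DNode 0 d \in cs, i \in lword d, j \in lword d, k \in lword d &
     pt (lmu psi 0 [:: DNode 0 d] i j k) = mu i j k].
Proof.
move=> h u iI eij eik; have [[e1 e2 _ _ e5] e6] := items_for_facts (mu_items_for h).
pose f := find (fun X => i \in X) Is.
have fs : has (fun T => i \in dword T) cs.
  by rewrite -(mem_lword _ cs) (perm_mem e5).
pose T := nth (DLeaf i) cs f.
have nth_in x : find (fun X => x \in X) Is = f -> x \in dword T.
  move=> ex; have : has (fun T => x \in dword T) cs.
    by rewrite has_find e6 ex /f -e6 -has_find.
  by move/(nth_find (DLeaf i)); rewrite e6 ex.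
have Tcs : T \in cs by rewrite mem_nth // /f -e6 -has_find.
have [X XI [[i1 _ _ pX] hX]] := Forall2_memr h Tcs.
have iT : i \in dword T by apply: nth_in.
have jT : j \in dword T by apply: nth_in; rewrite -eij.
have kT : k \in dword T by apply: nth_in; rewrite -eik.
have := hX i j k u; rewrite -!(perm_mem pX) => /(_ iT jT kT).
move: Tcs i1 iT jT kT; case: (T) => [x|t d] /=.
  by move=> _ _; rewrite !inE => /eqP ix /eqP jx; move: u; rewrite uniq3 ix jx eqxx.
move=> dcs /eqP t0; rewrite t0 in dcs *; exists d; split=> //.
Qed.

(** The screen coordinate splits X into at least two clusters, each of which is an item by
    induction; its differences, scaled to maximum 1, become the gaps between the items. Triples
    inside one cluster are covered by the induction, all others by [screenP]. *)
Lemma zero_item X : uniq X -> X != [::] ->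
  {in X &, forall i j, i != j -> nu i j = P1inf} -> exists T, mu_item X T.
Proof.
have [N] := ubnP (size X); elim: N X => // N IH X XN uX X0 inf.
have part : {in X &, forall i j, same_part (projT1 q) i j}.
  move=> i j iX jX; have [->|ij] := eqVneq i j; first exact: same_part_refl.
  by apply: inf_same_part => //; apply: inf.
case eX : X => [|i0 L]; first by rewrite eX in X0.
have [L0|L0] := eqVneq L [::].
  rewrite L0; exists (DLeaf i0); split; first by split.
  move=> i j k; rewrite uniq3 !inE => /andP[ij _] /eqP ei /eqP ej.
  by rewrite ei ej eqxx in ij.
rewrite -eX; have i0X : i0 \in X by rewrite eX mem_head.
have i0L : i0 \notin L by move: uX; rewrite eX => /andP[].
have LX : {subset L <= X} by move=> x xL; rewrite eX inE xL orbT.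
have [j0 j0L hj0] := finite_direction part i0X i0L LX L0.
have j0X := LX _ j0L.
have ij0 : i0 != j0 by apply: contraNneq i0L => ->.
have fin0 : {in X, forall k, k != i0 -> k != j0 -> hy (mu i0 j0 k) != 0}.
  by move=> k; rewrite eX inE => /orP[/eqP->|kL _]; [rewrite eqxx|apply: hj0].
pose u := screen_pos q i0 j0.
have K := @screenP R n q X part i0 j0 i0X j0X ij0 fin0.
have [m [Is [g [h1 h2 h3 [h4 h6] h5]]]] := clusters u X0.
(* The labels i0 and j0 have coordinates 0 and 1, so there is more than one cluster. *)
have gN : g != [::].
  apply: contraTneq (@ler01 R) => g0; have := h5 _ i0X; have := h5 _ j0X.
  rewrite /u screen_pos_i0 screen_pos_j0 // g0 !big_nil addr0 => <- /eqP.
  by rewrite eq_sym oner_eq0.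
(* Ratios fix the gaps only up to scale; dividing by the largest one accounts for the gap 1 that
   separates children. *)
have [M Mg hM] := seq_max gN; have M0 : 0 < M := allP h4 _ Mg.
have uF : uniq (flatten Is) by rewrite (perm_uniq h1).
have [cs hcs] : exists cs, List.Forall2 mu_item Is cs.
  apply: pick_list => Y YI; have Y0 := allP h2 _ YI.
  have YX : {subset Y <= X}.
    by move=> y yY; rewrite -(perm_mem h1); apply/flattenP; exists Y.
  have [I1 [I2 eI]] : exists I1 I2, Is = I1 ++ Y :: I2.
    by case/path.splitPr: YI => I1 I2; exists I1, I2.
  have uY : uniq Y.
    by move: uF; rewrite eI flatten_cat /= !cat_uniq => /and3P[_ _ /and3P[]].
  apply: IH => //; last by move=> i j iY jY; apply: inf; apply: YX.
  apply: leq_trans (_ : size X <= N)%N; last by rewrite -ltnS.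
  rewrite -(perm_size h1) eI flatten_cat /= !size_cat.
  have : (1 < size Is)%N by rewrite h3; case: (g) gN.
  rewrite eI in h2 *; move: h2; rewrite all_cat /= => /andP[h21 /andP[_ h22]].
  have pos (Js : seq (seq I)) : all (fun X => X != [::]) Js -> (size Js <= size (flatten Js))%N.
    elim: Js => //= J Js IHJ /andP[J0 /IHJ h]; rewrite size_cat; case: J J0 => //= x J _.
    by rewrite addSn ltnS (leq_trans h) // leq_addl.
  rewrite size_cat /=; move: (pos _ h21) (pos _ h22).
  move: (size I1) (size I2) (size (flatten I1)) (size (flatten I2)) (size Y).
  by clear; move=> ? ? ? ? ?; lia.
have itm := mu_items_for hcs.
pose g' := map (fun x => x / M) g.
have g'01 : {in g', forall x, 0 < x <= 1}.
  move=> _ /mapP[x xg ->]; rewrite divr_gt0 ?(allP h4 _ xg) //= ler_pdivrMr // mul1r.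
  exact: hM.
have sz' : size Is = (size g').+1 by rewrite size_map.
have [T [[vT bT wT iT posT] tT]] := assemble itm sz' g'01.
(* The largest scaled gap is 1, so the assembled tree has trunk value 1. Its children [s] are reused
   below an edge of value 0. *)
have [s eT] : exists s, T = DNode 1 s.
  have one : 1 \in g' by apply/mapP; exists M; rewrite // divff // gt_eqF.
  move: tT one g'01; rewrite /g'; case: (map _ _) => // x y [m' [s [-> mg mx]]] one g'01.
  exists s; congr DNode; apply/eqP; rewrite eq_le mx //.
  by have /andP[_ ->] := g'01 _ mg.
rewrite eT in vT bT wT iT posT.
have /and3P[s2 _ vs] : dvalid (DNode 1 s) := vT.
have wX : perm_eq (lword s) X by apply: perm_trans h1.
have us : uniq (lword s) by rewrite (perm_uniq wX).
have dE i j : i \in X -> j \in X -> dist id s i j = (u j - u i) / M.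
  move=> iX jX; have := @dist_node _ _ id 1 s i j vs (ltnW s2).
  rewrite (@eq_dist _ _ (fun x => id (1 * x)) id); last by move=> x _; rewrite mul1r.
  move=> <-; rewrite /dist !posT ?(perm_mem h1) //.
  have sumE k : k \in X -> \sum_(x <- take (find (fun X => k \in X) Is) g') x = (u k - m) / M.
    by move=> kX; rewrite /g' -map_take big_map -mulr_suml h5 // addrAC subrr add0r.
  by rewrite !sumE //; ring.
exists (DNode 0 s); split.
  by split; rewrite //= ?lexx ?ler01 ?s2.
move=> a b c uabc aX bX cX.
have /and3P[ab ac bc] : [&& a != b, a != c & b != c] by rewrite -uniq3.
have mw x : x \in X -> x \in lword s by rewrite (perm_mem wX).
have -> : lmu psi 0 [:: DNode 0 s] a b c = lmu psi 0 s a b c.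
  by rewrite (@lmu_in _ _ _ 0 _ 0 s) ?mulr0 ?lword1 ?mem_head ?mw.
have zero01 : 0 <= (0 : R) < 1 by rewrite lexx ltr01.
have [e [p1 p2]] := lmu_phi psi_gt0 c zero01 vs us ab.
rewrite !dist_phi0 // !dE // in p1 p2.
have [v0|v0] := eqVneq (u c - u a, u b - u a) 0; last first.
  have M1 : M^-1 != 0 by rewrite invr_eq0 gt_eqF.
  have e0 : e != 0.
    apply: contraNneq v0 => e0; rewrite e0 !mul0r in p1 p2.
    move/eqP: p1; rewrite mulf_eq0 (negPf M1) orbF => /eqP->.
    by move/eqP: p2; rewrite mulf_eq0 (negPf M1) orbF => /eqP->.
  rewrite -(pt_scale _ e0) -p1 -p2 ![_ / M]mulrC (@pt_scale _ _ (u c - u a, u b - u a)) //.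
  rewrite -[RHS]hxyK; apply/pt_eqP => //=; first exact: hxy_neq0.
  rewrite mulrC [RHS]mulrC; apply/esym; exact: K.
case: v0 => /eqP; rewrite subr_eq0 => /eqP uc /eqP; rewrite subr_eq0 => /eqP ub.
have fE x : x \in X -> u a = u x ->
    find (fun X => a \in X) Is = find (fun X => x \in X) Is.
  by move=> xX ux; apply: (same_find h3 h4 h1 h5 aX xX ux).
have aF : a \in flatten Is by rewrite (perm_mem h1).
have [d [dcs ad bd cd <-]] := find_item hcs uabc aF (fE _ bX (esym ub)) (fE _ cX (esym uc)).
have ds : DNode 0 d \in litems s by move: iT; rewrite /= oner_eq0 -/(litems s) => ->.
rewrite (lmu_item psi 0 us ds) // (@lmu_in _ _ _ 0 _ 0 d) ?mulr0 ?lword1 ?mem_head //.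
by apply: (uniq_in _ ds); rewrite litems_word.
Qed.

(** The diagonal, which is not covered by the nu coordinates, is put in by hand: then finiteness is
    an equivalence relation and [delta] is additive on its classes. *)
Definition finite_dist i j := (i == j) || (hx (nu i j) != 0).
Definition delta i j : R := if i == j then 0 else hy (nu i j) / hx (nu i j).

Lemma nu_anti i j : i != j -> hx (nu i j) * hy (nu j i) + hx (nu j i) * hy (nu i j) = 0.
Proof. by move=> ij; case: (chart_tbar q) => h _; apply: h. Qed.

Lemma nu_add i j k : uniq [:: i; j; k] -> hx (nu i j) * hx (nu j k) * hy (nu i k) =
  hx (nu i k) * hx (nu j k) * hy (nu i j) + hx (nu i j) * hx (nu i k) * hy (nu j k).
Proof. by case: (chart_tbar q) => _; apply. Qed.

Lemma nuxy_neq0 i j : (hx (nu i j) != 0) || (hy (nu i j) != 0).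
Proof. by rewrite -(pair_neq0 (hx (nu i j), hy (nu i j))) hxy_neq0. Qed.

Lemma finite_sym i j : finite_dist i j -> finite_dist j i.
Proof.
rewrite /finite_dist eq_sym; case: (eqVneq j i) => //= ji xij.
apply/negP => /eqP x0; have := nu_anti ji; rewrite x0 mul0r add0r => /eqP.
rewrite mulf_eq0 (negPf xij) /= => /eqP y0.
by have := nuxy_neq0 j i; rewrite x0 y0 eqxx.
Qed.

Lemma finite_trans i j k : finite_dist i j -> finite_dist j k -> finite_dist i k.
Proof.
have [->//|ij] := eqVneq i j; have [->//|jk] := eqVneq j k.
have [<-|ik] := eqVneq i k; first by rewrite /finite_dist eqxx.
rewrite /finite_dist (negPf ij) (negPf jk) (negPf ik) /= => xij xjk.
apply/negP => /eqP x0; have := @nu_add i j k; rewrite uniq3 ij ik jk => /(_ isT).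
rewrite x0 mulr0 !mul0r addr0 => /eqP; rewrite !mulf_eq0 (negPf xij) (negPf xjk) /= => /eqP y0.
by have := nuxy_neq0 i k; rewrite x0 y0 eqxx.
Qed.

Lemma finite_equiv : equivalence_rel finite_dist.
Proof.
move=> i j k; rewrite {1}/finite_dist eqxx; split=> // ij; apply/idP/idP => h.
  exact: finite_trans (finite_sym ij) h.
exact: finite_trans ij h.
Qed.

Lemma delta_add i j k : finite_dist i j -> finite_dist j k ->
  delta i k = delta i j + delta j k.
Proof.
move=> fij fjk; have fik := finite_trans fij fjk; move: fij fjk fik.
rewrite /finite_dist /delta.
have [->|ij] /= := eqVneq i j; first by rewrite add0r.
have [<-|jk] /= := eqVneq j k; first by rewrite (negPf ij) addr0.
have [<-|ik] /= := eqVneq i k.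
  move=> xij xji _; apply/esym.
  apply: (mulfI xij); apply: (mulfI xji); rewrite !mulr0.
  have := nu_anti ij => h.
  have -> : hx (nu j i) * (hx (nu i j) * (hy (nu i j) / hx (nu i j) + hy (nu j i) / hx (nu j i)))
    = hx (nu i j) * hy (nu j i) + hx (nu j i) * hy (nu i j).
    by field; rewrite xij xji.
  by rewrite h.
move=> xij xjk xik; have := @nu_add i j k; rewrite uniq3 ij ik jk => /(_ isT) h.
have e : hy (nu i k) = (hx (nu i k) * hx (nu j k) * hy (nu i j)
   + hx (nu i j) * hx (nu i k) * hy (nu j k)) / (hx (nu i j) * hx (nu j k)).
  by rewrite -h; field; rewrite xij xjk.
by rewrite e; field; rewrite xij xjk xik.
Qed.

Lemma delta_inf i j : i != j -> finite_dist i j -> delta i j = 0 -> nu i j = P1inf.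
Proof.
rewrite /delta /finite_dist => /negPf-> /= x0 /eqP; rewrite mulf_eq0 invr_eq0 (negPf x0) orbF.
by move=> /eqP y0; apply/eq_P1inf.
Qed.

Lemma inf_delta i j : nu i j = P1inf -> delta i j = 0.
Proof. by rewrite /delta => /eq_P1inf->; rewrite mul0r if_same. Qed.

(** On a class of finite distance the delta_ij are differences of a function h. Its level sets
    become items by [zero_item], and its successive differences become gaps through the inverse [fi]
    of F; these lie strictly between 0 and 1, so the trunk value is below 1. *)
Lemma block_tree X : uniq X -> X != [::] -> {in X &, forall i j, finite_dist i j} ->
  exists T, [/\ dvalid T /\ dbinary T, perm_eq (dword T) X,
    ~~ has_one [:: T], {in X &, forall i j, dist (Fw psi) [:: T] i j = delta i j} &
    forall i j k, uniq [:: i; j; k] -> i \in X -> j \in X -> k \in X ->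
      nu i j = P1inf -> nu i k = P1inf -> pt (lmu psi 1 [:: T] i j k) = mu i j k].
Proof.
move=> uX X0 fX; have [i0 i0X] : exists i, i \in X.
  by case: (X) X0 => // i w _; exists i; rewrite mem_head.
pose h := delta i0.
have hE i j : i \in X -> j \in X -> delta i j = h j - h i.
  by move=> iX jX; rewrite /h (@delta_add i0 i j) ?fX //; ring.
have [m [Is [g [h1 h2 h3 [h4 h6] h5]]]] := clusters h X0.
have uF : uniq (flatten Is) by rewrite (perm_uniq h1).
have [cs hcs] : exists cs, List.Forall2 mu_item Is cs.
  apply: pick_list => Y YI; have Y0 := allP h2 _ YI.
  have YX : {subset Y <= X}.
    by move=> y yY; rewrite -(perm_mem h1); apply/flattenP; exists Y.
  apply: zero_item => //.
    have [I1 [I2 eI]] : exists I1 I2, Is = I1 ++ Y :: I2.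
      by case/path.splitPr: YI => I1 I2; exists I1, I2.
    by move: uF; rewrite eI flatten_cat /= !cat_uniq => /and3P[_ _ /and3P[]].
  move=> i j iY jY ij; apply: delta_inf => //; first by apply: fX; apply: YX.
  by rewrite hE ?YX // (h6 _ YI _ _ iY jY) subrr.
have itm := mu_items_for hcs.
pose fi y : R := xget 0 [set x | 0 <= x < 1 /\ Fw psi x = y].
have fiP y : 0 < y -> 0 < fi y < 1 /\ Fw psi (fi y) = y.
  move=> y0; have [x x1 x2] := psi_surj (ltW y0).
  have [/andP[f0 f1] f2] := @xgetPex _ 0 [set x | 0 <= x < 1 /\ Fw psi x = y]
    (ex_intro _ x (conj x1 x2)).
  split=> //; rewrite f1 andbT lt_neqAle f0 andbT; apply/eqP => e.
  by move: y0; rewrite -f2 -/(fi y) -e /Fw mul0r ltxx.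
pose g' := map fi g.
have g'01 : {in g', forall x, 0 < x <= 1}.
  move=> _ /mapP[x xg ->]; have [/andP[-> f1] _] := fiP _ (allP h4 _ xg).
  by rewrite ltW.
have sz' : size Is = (size g').+1 by rewrite size_map.
have [T [[vT bT wT iT posT] tT]] := assemble itm sz' g'01.
have wX : perm_eq (dword T) X by apply: perm_trans h1.
exists T; split=> //.
- rewrite /has_one /= orbF; case: T tT {vT bT wT iT posT wX} => // t s tT.
  move: tT; rewrite /g'; case eg : (map _ _) => [|x y] /=.
    by move=> /eqP->; rewrite eq_sym oner_eq0.
  move=> [m' [s' [[-> _] mg _]]]; rewrite -eg in mg; case/mapP: mg => z zg ->.
  by have [/andP[_ f1] _] := fiP _ (allP h4 _ zg); rewrite lt_eqF.
- move=> i j iX jX; rewrite /dist !posT ?(perm_mem h1) //; try by rewrite /Fw mul0r.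
  have sumE k : k \in X -> \sum_(x <- take (find (fun X => k \in X) Is) g') Fw psi x = h k - m.
    move=> kX; rewrite /g' -map_take big_map h5 // addrAC subrr add0r.
    rewrite big_seq [RHS]big_seq; apply: eq_bigr => x /mem_take xg.
    by have [] := fiP _ (allP h4 _ xg).
  by rewrite !sumE // hE //; ring.
move=> i j k u iX jX kX nij nik.
have e x : x \in X -> nu i x = P1inf -> h i = h x.
  by move=> xX /inf_delta; rewrite hE // => /eqP; rewrite subr_eq0 => /eqP.
have fE x : x \in X -> nu i x = P1inf ->
    find (fun X => i \in X) Is = find (fun X => x \in X) Is.
  by move=> xX nx; apply: (same_find h3 h4 h1 h5 iX xX (e _ xX nx)).
have iF : i \in flatten Is by rewrite (perm_mem h1).
have [d [dcs id jd kd <-]] := find_item hcs u iF (fE _ jX nij) (fE _ kX nik).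
have uT : uniq (lword [:: T]) by rewrite lword1 (perm_uniq wX).
have ds : DNode 0 d \in litems [:: T] by rewrite /litems /= cats0 iT.
rewrite (lmu_item psi 1 uT ds) // (@lmu_in _ _ _ 0 _ 0 d) ?mulr0 ?lword1 ?mem_head //.
by apply: (uniq_in _ ds); rewrite litems_word.
Qed.

Lemma forest_of_point : exists s, [/\ forest_ok s, all dbinary s, ~~ has_one s,
  forall i j, i != j -> gnu psi s i j = nu i j &
  forall i j k, uniq [:: i; j; k] -> nu i j = P1inf -> nu i k = P1inf ->
    gmu psi s i j k = mu i j k].
Proof.
have [Bs [b1 b2 b3]] := blocks (enum_uniq I) finite_equiv.
have memI i : i \in enum I by rewrite mem_enum.
have uF : uniq (flatten Bs) by rewrite (perm_uniq b1) enum_uniq.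
pose P X T := [/\ dvalid T /\ dbinary T, perm_eq (dword T) X,
    ~~ has_one [:: T], {in X &, forall i j, dist (Fw psi) [:: T] i j = delta i j} &
    forall i j k, uniq [:: i; j; k] -> i \in X -> j \in X -> k \in X ->
      nu i j = P1inf -> nu i k = P1inf -> pt (lmu psi 1 [:: T] i j k) = mu i j k].
have [s hs] : exists s, List.Forall2 P Bs s.
  apply: pick_list => X XB; apply: block_tree.
  - have [I1 [I2 eI]] : exists I1 I2, Bs = I1 ++ X :: I2.
      by case/path.splitPr: XB => I1 I2; exists I1, I2.
    by move: uF; rewrite eI flatten_cat /= !cat_uniq => /and3P[_ _ /and3P[]].
  - exact: (allP b2 _ XB).
  by move=> i j iX jX; rewrite -(b3 _ XB) // memI.
have ws : perm_eq (lword s) (flatten Bs).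
  elim: hs => // X T Bs' s' [_ wT _ _ _] _ IH; rewrite lword_cons /=; exact: perm_cat.
have all1 (p : pred (dtree R I)) : (forall X T, P X T -> p T) -> all p s.
  by move=> h; elim: hs => //= X T Bs' s' /h -> _ ->.
have vs : lvalid s by apply: all1 => X T [[]].
have ok : forest_ok s by rewrite /forest_ok vs; apply: perm_trans b1.
have n1 : ~~ has_one s.
  have := all1 (fun T => ~~ has_one [:: T]) (fun X T h => let: And5 _ _ h3 _ _ := h in h3).
  by rewrite /has_one /= => /allP h; apply/hasPn => T /h; rewrite /= orbF.
have us := ok_uniq ok.
have tree i : exists X T, [/\ X \in Bs, T \in s, i \in X, i \in dword T & P X T].
  have : i \in lword s by apply: ok_mem.
  move=> /flatten_mapP[T Ts iT]; have [X XB PX] := Forall2_memr hs Ts.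
  by exists X, T; split=> //; case: PX => _ /perm_mem <-.
have fT i j : together s i j = finite_dist i j.
  have [X [T [XB Ts iX iT PX]]] := tree i; have wT : dword T =i X.
    by case: PX => _ /perm_mem.
  rewrite -(b3 _ XB _ _ iX (memI j)) -wT; apply/hasP/idP => [[T' T's /andP[iT' jT']]|jT].
    by rewrite (child_eq us Ts T's iT iT').
  by exists T; rewrite ?iT.
have cE i j : close 1 s i j = finite_dist i j.
  rewrite -fT; apply/idP/idP; first exact: close_together.
  exact: together_close.
exists s; split=> //; first by apply: all1 => X T [[]].
  move=> i j ij; rewrite /gnu cE; case: ifP => fij; last first.
    apply/esym/eq_P1fin0; move: fij; rewrite /finite_dist (negPf ij) /=.
    by move=> /negbFE/eqP.
  have [X [T [XB Ts iX iT PX]]] := tree i.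
  have jX : j \in X by rewrite (b3 _ XB _ _ iX (memI j)).
  have [_ wT _ dT _] := PX; rewrite (dist_child _ vs us Ts) // ?(perm_mem wT) //.
  rewrite dT //; move: fij; rewrite /finite_dist /delta (negPf ij) /= => x0.
  rewrite -[RHS]hxyK; apply/pt_eqP => /=; rewrite ?one_neq0 ?hxy_neq0 //.
  by rewrite mul1r divfK.
move=> i j k u nij nik; have [X [T [XB Ts iX iT PX]]] := tree i.
have inf x : nu i x = P1inf -> x \in X.
  move=> e; rewrite (b3 _ XB _ _ iX (memI x)) /finite_dist.
  case: eqP => //= _; apply/eqP => x0; have /eq_P1inf y0 := e.
  by have := nuxy_neq0 i x; rewrite x0 y0 eqxx.
have [_ wT _ _ mT] := PX; have := mT i j k u iX (inf _ nij) (inf _ nik) nij nik.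
move: (u); rewrite uniq3 => /and3P[ij _ _].
by rewrite (lmu_single _ _ us Ts) ?(perm_mem wT) ?iX ?(inf _ nij) ?(inf _ nik).
Qed.

End Surjective.

Section ThetaSurjective.
Variables (R : realType) (n : nat) (psi : R -> R).
Hypothesis psi_gt0 : forall x, 0 <= x < 1 -> 0 < psi x.
Hypothesis psi_surj : forall y, 0 <= y -> exists2 x, 0 <= x < 1 & Fw psi x = y.
Local Notation I := 'I_n.

Lemma binary_erase (s : seq (dtree R I)) : all dbinary s -> all (@tbinary n) (map (@erase R n) s).
Proof.
elim/list_tree_ind: s => s IH /allP h; apply/allP => _ /mapP[[i|t u] us -> //].
have /andP[u2 bu] := h _ us; rewrite /= size_map u2; exact: IH us bu.
Qed.

Definition mk_edge (tau : pforest n) e (h : e \in ledges (val tau)) : edge tau := exist _ e h.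

Lemma trunk_value (p : cubes R n) (e : edge (projT1 p)) : is_trunk e ->
  exists u, DNode (val (projT2 p) e) u \in dforest p /\ val e = above (Node (map (@erase R n) u)).
Proof.
move=> /forallP tr; have [vt _] := forest_valid (projT1 p).
have ee : val e \in ledges (val (projT1 p)) := valP e.
have [[j|v] [i [vin ev ie sub]]] := tedges_sub vt ee; first by [].
have av : above (Node v) \in ledges (val (projT1 p)).
  by apply/flatten_mapP; exists (Node v); rewrite // mem_head.
have eE : val e = above (Node v).
  have := tr (mk_edge av); rewrite /proper /= negb_and negbK => /orP[|/fintype.subsetP h].
    by move/negP; case; apply/fintype.subsetP => x /sub; rewrite inE.
  apply/setP => x; apply/idP/idP => [/sub|]; first by rewrite inE.
  exact: h.
exists (map (decorate (cube_val p)) v); split; last by rewrite erase_map.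
rewrite -cube_valE eE.
by apply/mapP; exists (Node v).
Qed.

Lemma theta_cube_surj (z : Fbar R n) : exists p, theta_admissible p /\ theta_cube psi_gt0 p = z.
Proof.
rewrite -(qreprK z); move: (qrepr z) => q.
have [s [ok bs n1 h1 h2]] := forest_of_point psi_gt0 psi_surj q.
have [p ps] := dforest_surj ok; exists p; split.
  split; first by rewrite /binary_forest -(erase_dforest p) ps; apply: binary_erase.
  move=> e /trunk_value[u [us _]] e1; rewrite e1 ps in us.
  by move: n1; apply/negP/negPn/hasP; exists (DNode 1 u); rewrite //= eqxx.
have [q' _ hq'] := point_exists0 psi_gt0 (dforest_ok p).
rewrite (theta_cubeE _ hq'); apply/FbarP; rewrite ps in hq'.
have [e1 e2] := hq'; have enu : chart_nu q' = chart_nu q.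
  by rewrite e1; apply: nu_ext => i j ij; rewrite nu_at_mk // h1.
split=> // i j k u bi; rewrite e2; last exact: both_inf_part.
by apply: h2 => //; move: bi; rewrite enu => -[].
Qed.

End ThetaSurjective.

(** * Continuity of theta and compactness *)

Section Gaps.
Variables (R : realFieldType) (I : choiceType).
Implicit Types (s : seq (dtree R I)) (F : R -> R) (w : seq I).

(** The gap with index k stands in front of the leaf with index k, so the index of the left leaf is
    excluded and that of the right leaf included. *)
Definition between w i j k :=
  ((index i w < k <= index j w) || (index j w < k <= index i w))%N.

Lemma sum_take F l m :
  \sum_(x <- take m l) F x = \sum_(k < size l | (k < m)%N) F (nth 0 l k).
Proof.
elim: l m => [|a l IH] [|m]; rewrite ?take0 /= ?big_nil ?big_ord0 //.
  by rewrite big_pred0.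
by rewrite big_cons IH [RHS]big_mkcond big_ord_recl -big_mkcond.
Qed.

(** Over a single cube the word is constant. In this form neither the sign nor the index set depends
    on the point, and continuity reduces to that of the gaps. *)
Lemma dist_between F s i j : dist F s i j =
  (-1) ^+ (index j (lword s) < index i (lword s))%N *
  \sum_(k < size (lpre s) | between (lword s) i j k) F (nth 0 (lpre s) k).
Proof.
set w := lword s; have half a b : (index a w <= index b w)%N -> dist F s a b =
    \sum_(k < size (lpre s) | (index a w < k <= index b w)%N) F (nth 0 (lpre s) k).
  move=> ab; rewrite /dist /lpos !sum_take (bigID (fun k : 'I__ => k <= index a w)%N) /=.
  rewrite addrAC [X in X - _](_ : _ = \sum_(k < size (lpre s) | (k < (index a w).+1)%N)
    F (nth 0 (lpre s) k)).
    rewrite subrr add0r; apply: eq_bigl => k.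
    by rewrite -ltnNge ltnS andbC.
  apply: eq_bigl => k; rewrite !ltnS; apply: andb_idl => h; exact: leq_trans h ab.
have [ij|ji] := leqP (index i w) (index j w).
  rewrite mul1r half //; apply: eq_bigl => k; rewrite /between -/w.
  by apply/esym/orb_idr => /andP[h1 h2]; have := leq_trans h1 (leq_trans h2 ij); rewrite ltnn.
rewrite mulN1r distC half ?(ltnW ji) //; congr (- _); apply: eq_bigl => k; rewrite /between -/w.
by apply/esym/orb_idl => /andP[h1 h2]; have := ltn_trans (leq_trans h1 h2) ji; rewrite ltnn.
Qed.

Lemma between_size s i j k : lvalid s -> i \in lword s -> j \in lword s ->
  between (lword s) i j k -> (k < size (lpre s))%N.
Proof.
move=> vs iw jw; rewrite lvalid_size //.
by case/orP => /andP[_ h]; apply: leq_ltn_trans h _; rewrite index_mem.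
Qed.

Lemma closeP P s i j : lvalid s -> i \in lword s -> j \in lword s ->
  reflect (forall k, between (lword s) i j k -> P * nth 0 (lpre s) k != 1) (close P s i j).
Proof.
move=> vs iw jw; rewrite /close dist_between mulf_eq0 signr_eq0 /=.
rewrite psumr_eq0; last by move=> k _; apply: ler0n.
apply: (iffP allP) => h k.
  move=> b; have ks := between_size vs iw jw b.
  have := h (Ordinal ks) (mem_index_enum _); rewrite /= b /= /chi pnatr_eq0 eqb0.
  by [].
by move=> _; apply/implyP => b; rewrite /chi pnatr_eq0 eqb0; apply: h.
Qed.

Lemma gap_01 s k : lvalid s -> 0 <= nth 0 (lpre s) k <= 1.
Proof.
move=> vs; have [ks|ks] := ltnP k (size (lpre s)); last by rewrite nth_default ?lexx ?ler01.
by apply: lpre_01 vs _ _; apply: mem_nth.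
Qed.

Lemma dist_ge_gap F s i j k : lvalid s -> i \in lword s -> j \in lword s ->
  (forall k', between (lword s) i j k' -> 0 <= F (nth 0 (lpre s) k')) ->
  between (lword s) i j k -> F (nth 0 (lpre s) k) <= `|dist F s i j|.
Proof.
move=> vs iw jw F0 b; have ks := between_size vs iw jw b.
rewrite dist_between normrM normr_sign mul1r.
apply: le_trans (ler_norm _); rewrite (bigD1 (Ordinal ks)) //= lerDl.
by apply: sumr_ge0 => k' /andP[/F0].
Qed.

End Gaps.

(** * Continuous families of decorations of a fixed planar forest *)

Section ForestContinuity.
Variables (R : realType) (n : nat) (psi : R -> R).
Hypothesis psi_gt0 : forall x, 0 <= x < 1 -> 0 < psi x.
Hypothesis psi_continuous : forall x, 0 <= x < 1 -> {for x, continuous psi}.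
Hypothesis psi_unbounded : forall M, exists2 d, d < 1 &
  forall x, d < x -> x < 1 -> M < Fw psi x.
Local Notation I := 'I_n.
Variables (X : topologicalType) (x0 : X) (tv : X -> {set I} -> R).
Hypothesis tv_continuous : forall e, {for x0, continuous (tv ^~ e)}.
Hypothesis tv01 : forall x e, 0 <= tv x e <= 1.
Implicit Types (u : seq (ptree n)) (i j : I).

Lemma eq_continuous_at (Y : topologicalType) (g h : X -> Y) : {for x0, continuous h} -> g =1 h ->
  {for x0, continuous g}.
Proof. by move=> ch /funext->. Qed.

Lemma sum_continuous (A : Type) (r : seq A) (Q : pred A) (g : A -> X -> R) :
  (forall a, Q a -> {for x0, continuous (g a)}) ->
  {for x0, continuous (fun x => \sum_(a <- r | Q a) g a x)}.
Proof.
move=> h; elim: r => [|a r IH].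
  apply: (@eq_continuous_at _ _ (cst 0)); first exact: cst_continuous.
  by move=> x; rewrite big_nil.
case Qa : (Q a); last first.
  by apply: (eq_continuous_at IH) => x; rewrite big_cons Qa.
apply: (@eq_continuous_at _ _ (fun x => g a x + \sum_(a <- r | Q a) g a x)).
  by apply: cvgD; [exact: (h a Qa)|exact: IH].
by move=> x; rewrite big_cons Qa.
Qed.

Local Notation deco u x := (map (decorate (tv x)) u).

Lemma deco_valid u x : pvalid u -> lvalid (deco u x).
Proof. by move=> vu; apply: lvalid_decorate. Qed.

Definition pointwise_continuous (l : X -> seq R) :=
  (exists m, forall x, size (l x) = m) /\
  forall k, {for x0, continuous (fun x => nth 0 (l x) k)}.

Lemma pointwise_cat l1 l2 : pointwise_continuous l1 -> pointwise_continuous l2 ->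
  pointwise_continuous (fun x => l1 x ++ l2 x).
Proof.
move=> [[m1 e1] h1] [[m2 e2] h2]; split.
  by exists (m1 + m2)%N => x; rewrite size_cat e1 e2.
move=> k; have [km|km] := ltnP k m1.
  by apply: (eq_continuous_at (h1 k)) => x; rewrite nth_cat e1 km.
by apply: (eq_continuous_at (h2 (k - m1)%N)) => x; rewrite nth_cat e1 ltnNge km.
Qed.

Lemma gap_continuous u : pointwise_continuous (fun x => lpre (deco u x)).
Proof.
elim/ptree_list_ind: u => u IH.
have h c : c \in u -> pointwise_continuous (fun x => dpre (decorate (tv x) c)).
  case: c => [i|v] vu.
    split; first by exists 1%N.
    by move=> k; apply: cst_continuous.
  have [[m e] c] := IH v vu; split.
    by exists m.-1.+1 => x; rewrite /= size_map size_behead -/(lpre _) e.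
  case=> [|k] /=; first exact: cst_continuous.
  have [km|km] := ltnP k m.-1.
    apply: (@eq_continuous_at _ _
        (fun x => tv x (above (Node v)) * nth 0 (lpre (deco v x)) k.+1)).
      by apply: cvgM; [exact: tv_continuous|exact: (c k.+1)].
    by move=> x; rewrite (nth_map 0) ?size_behead -/(lpre _) ?e // nth_behead.
  apply: (@eq_continuous_at _ _ (cst 0)); first exact: cst_continuous.
  by move=> x; rewrite nth_default // size_map size_behead -/(lpre _) e.
elim: u {IH} h => [|c u IH] h.
  by split; [exists 0%N|move=> k; apply: cst_continuous].
apply: (@pointwise_cat (fun x => dpre (decorate (tv x) c)) (fun x => lpre (deco u x))).
  by apply: h; rewrite mem_head.
by apply: IH => c' c'u; apply: h; rewrite inE c'u orbT.
Qed.

Lemma dist_continuous (F : X -> R -> R) u i j : pvalid u ->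
  (forall k, between (word u) i j k ->
     {for x0, continuous (fun x => F x (nth 0 (lpre (deco u x)) k))}) ->
  {for x0, continuous (fun x => dist (F x) (deco u x) i j)}.
Proof.
move=> vu h; apply: (@eq_continuous_at _ _ (fun x =>
  (-1) ^+ (index j (word u) < index i (word u))%N *
  \sum_(k < size (word u) | between (word u) i j k) F x (nth 0 (lpre (deco u x)) k))).
  have h' := @sum_continuous _ (index_enum 'I_(size (word u)))
    (fun k => between (word u) i j (val k)) (fun k x => F x (nth 0 (lpre (deco u x)) k))
    (fun k => h k).
  by apply: cvgM; [exact: cvg_cst|exact: h'].
move=> x; rewrite dist_between lword_decorate lvalid_size ?lword_decorate //.
exact: deco_valid.
Qed.

Lemma Fw_continuous x : 0 <= x < 1 -> {for x, continuous (Fw psi)}.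
Proof. by move=> h; exact: (cvgM cvg_id (psi_continuous h)). Qed.

Lemma near_close u i j : pvalid u -> i \in word u -> j \in word u ->
  close 1 (deco u x0) i j -> \forall x \near x0, close 1 (deco u x) i j.
Proof.
move=> vu iw jw /(closeP _ (deco_valid _ vu)); rewrite !lword_decorate => /(_ iw jw) h.
have : \forall x \near x0, forall k : 'I_(size (word u)), between (word u) i j k ->
    nth 0 (lpre (deco u x)) k != 1.
  apply: filter_forall => k; have [b|b] := boolP (between (word u) i j k); last exact: nearW.
  have [_ /(_ k) c] := gap_continuous u.
  have := h _ b; rewrite mul1r => n1.
  have cN : \forall x \near x0, nth 0 (lpre (deco u x)) k != 1.
    exact: c _ (open_nbhs_nbhs (conj (@open_neq R 1) n1)).
  by apply: filterS cN => x hx _.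
apply: filterS => x hx; apply/closeP; rewrite ?lword_decorate //; first exact: deco_valid.
move=> k b; rewrite mul1r.
have ks : (k < size (word u))%N.
  have := @between_size _ _ (deco u x) i j k (deco_valid _ vu).
  by rewrite lvalid_size ?lword_decorate ?deco_valid //; apply.
exact: (hx (Ordinal ks) b).
Qed.

(* When a gap between i and j tends to 1, their distance tends to infinity and
   nu_ij to 0. *)
Lemma gnu_continuous u i j : pvalid u -> i \in word u -> j \in word u ->
  {for x0, continuous (fun x => gnu psi (deco u x) i j)}.
Proof.
move=> vu iw jw; have [cl|ncl] := boolP (close 1 (deco u x0) i j).
  suff : pt (1, dist (Fw psi) (deco u x) i j) @[x --> x0] --> gnu psi (deco u x0) i j.
    apply: cvg_trans; apply: near_eq_cvg; apply: filterS (near_close vu iw jw cl) => x.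
    by rewrite /gnu => ->.
  rewrite /gnu cl.
  suff cD : {for x0, continuous (fun x => dist (Fw psi) (deco u x) i j)}.
    by have c1 := @cst_continuous X R 1 x0; exact: (pt_continuous c1 cD (one_neq0 _)).
  apply: (@dist_continuous (fun=> Fw psi)) => // k b.
  have [_ /(_ k) c] := gap_continuous u.
  apply: continuous_comp; first exact: c.
  apply: Fw_continuous; have /andP[-> h1] := gap_01 k (deco_valid x0 vu).
  rewrite lt_neqAle h1 andbT; move/closeP: cl; rewrite !lword_decorate.
  by move=> /(_ (deco_valid _ vu) iw jw k b); rewrite mul1r.
have [k b0 k1] : exists2 k, between (word u) i j k & nth 0 (lpre (deco u x0)) k = 1.
  apply: contrapT => h; move/negP: ncl; apply; apply/closeP; rewrite ?lword_decorate ?deco_valid //.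
  by move=> k b; rewrite mul1r; apply/eqP => e; apply: h; exists k.
have [_ /(_ k) ck] := gap_continuous u.
pose D x := dist (Fw psi) (deco u x) i j.
pose b x : R := if close 1 (deco u x) i j then (D x)^-1 else 0.
have big M : \forall x \near x0, close 1 (deco u x) i j -> M < `|D x|.
  have [d d1 hd] := psi_unbounded M.
  have : \forall x \near x0, d < nth 0 (lpre (deco u x)) k.
    by apply: (cvgr_gt (nth 0 (lpre (deco u x0)) k)) => //; rewrite k1.
  apply: filterS => x dx /closeP; rewrite !lword_decorate => /(_ (deco_valid _ vu) iw jw) h.
  have gap1 k' : between (word u) i j k' -> 0 <= nth 0 (lpre (deco u x)) k' < 1.
    move=> /h; have /andP[-> h1] := gap_01 k' (deco_valid x vu).
    by rewrite mul1r lt_neqAle h1 andbT.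
  have /andP[_ lt1] := gap1 _ b0.
  apply: lt_le_trans (hd _ dx lt1) _.
  apply: dist_ge_gap; rewrite ?lword_decorate ?deco_valid // => k' /gap1 g1.
  by rewrite /Fw mulr_ge0 ?(ltW (psi_gt0 g1)) //; case/andP: g1.
have e : \forall x \near x0, pt (b x, 1) = gnu psi (deco u x) i j.
  apply: filterS (big 0) => x; rewrite /b /gnu; case: ifP => cx; last by rewrite -P1fin_pt.
  move=> /(_ isT); rewrite normr_gt0 => D0; apply/pt_eqP => /=.
  - by rewrite pair_neq0 /= oner_eq0 orbT.
  - exact: one_neq0.
  by rewrite mulVf // mulr1.
suff : pt (b x, 1) @[x --> x0] --> gnu psi (deco u x0) i j.
  by apply: cvg_trans; apply: near_eq_cvg.
have b00 : b x0 = 0 by rewrite /b (negPf ncl).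
have -> : gnu psi (deco u x0) i j = pt (b x0, 1).
  by rewrite /gnu (negPf ncl) b00 P1fin_pt.
suff cb : {for x0, continuous b}.
  have c1 := @cst_continuous X R 1 x0; apply: (pt_continuous cb c1).
  by rewrite pair_neq0 /= oner_eq0 orbT.
suff : b x @[x --> x0] --> b x0 by []; rewrite b00; apply/cvgrPdist_lt => eps e0.
apply: filterS (big eps^-1) => x hx; rewrite sub0r normrN /b; case: ifP => cx.
  have D1 := hx cx; have D0 : 0 < `|D x| by apply: lt_trans D1; rewrite invr_gt0.
  by rewrite normfV invf_plt // posrE.
by rewrite normr0.
Qed.

Lemma phi_continuous (P g : X -> R) : {for x0, continuous P} -> {for x0, continuous g} ->
  0 <= P x0 < 1 -> 0 <= g x0 <= 1 -> {for x0, continuous (fun x => phi psi (P x) (g x))}.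
Proof.
move=> cP cg P1 g1; have cPg : {for x0, continuous (fun x => P x * g x)} by apply: cvgM; [exact: cP|exact: cg].
have c1 : {for x0, continuous (psi \o P)}.
  by apply: continuous_comp => //; apply: psi_continuous.
have c2 : {for x0, continuous (psi \o (fun x => P x * g x))}.
  by apply: continuous_comp => //; apply: psi_continuous; apply: mul01.
have n0 : (psi \o P) x0 != 0 by apply: lt0r_neq0; apply: psi_gt0.
by apply: cvgM; [apply: cvgM; [exact: cg|exact: c2]|apply: cvgV; [exact: n0|exact: c1]].
Qed.

Lemma has3_decorate x c i j k : has3 (decorate (tv x) c) i j k =
  [&& i \in tleaves c, j \in tleaves c & k \in tleaves c].
Proof. by rewrite /has3 -(lword1 (decorate _ c)) -[[:: _]]/(deco [:: c] x) lword_decorate word1. Qed.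

(** The vertex where i, j, k part depends on the planar forest and not on the values, so the pair is
    given by one formula throughout. Closeness at x0 makes the product at this vertex less than 1
    there, which is what [phi_continuous] requires. *)
Lemma lmu_continuous u (P : X -> R) i j k : pvalid u -> uniq (word u) -> i != j ->
  i \in word u -> j \in word u -> k \in word u ->
  {for x0, continuous P} -> (forall x, 0 <= P x <= 1) ->
  close (P x0) (deco u x0) i j -> close (P x0) (deco u x0) i k ->
  {for x0, continuous (fun x => (lmu psi (P x) (deco u x) i j k).1)} /\
  {for x0, continuous (fun x => (lmu psi (P x) (deco u x) i j k).2)}.
Proof.
elim/ptree_list_ind: u P => u IH P vu uu ij iu ju ku cP P01 cij cik.
have ud x : uniq (lword (deco u x)) by rewrite lword_decorate.
have vd x := deco_valid x vu.
have [/hasP[[a|v] cu /and3P[ic jc kc]]|h] :=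
    boolP (has (fun c => [&& i \in tleaves c, j \in tleaves c & k \in tleaves c]) u).
  by move: ic jc ij; rewrite !inE => /eqP-> /eqP->; rewrite eqxx.
- have cd x : DNode (tv x (above (Node v))) (deco v x) \in deco u x.
    by apply/mapP; exists (Node v).
  have lE x : lmu psi (P x) (deco u x) i j k =
      lmu psi (P x * tv x (above (Node v))) (deco v x) i j k.
    by apply: lmu_in (cd x) _ _ _; rewrite ?lword_decorate.
  have [_ vv] := pvalidP vu cu.
  have [||||c1 c2] := IH v cu (fun x => P x * tv x (above (Node v))) vv
    (uniq_pchild uu cu) ij ic jc kc.
  + by apply: cvgM; [exact: cP|exact: tv_continuous].
  + by move=> x; apply: mul11.
  + by rewrite -(close_in _ (vd x0) (ud x0) (cd x0)) ?lword_decorate.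
  + by rewrite -(close_in _ (vd x0) (ud x0) (cd x0)) ?lword_decorate.
  by split; [apply: (eq_continuous_at c1)|apply: (eq_continuous_at c2)] => x; rewrite lE.
have h' x : ~~ has (fun c => has3 c i j k) (deco u x).
  apply: contra h; rewrite has_map => /hasP[c cu]; rewrite /= has3_decorate => hc.
  by apply/hasP; exists c.
have P1 : 0 <= P x0 < 1.
  have /andP[-> p1] := P01 x0; rewrite lt_neqAle p1 andbT /=.
  have : ~~ together (deco u x0) i j || ~~ together (deco u x0) i k.
    by rewrite -negb_and; apply: contra (h' x0) => /andP[]; apply: has3_together.
  by case/orP => nt; [apply: close_apart cij nt|apply: close_apart cik nt];
    rewrite ?lword_decorate.
have cd a b : {for x0, continuous (fun x => dist (phi psi (P x)) (deco u x) a b)}.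
  apply: (@dist_continuous (fun x => phi psi (P x))) => // m _.
  apply: phi_continuous => //; last exact: gap_01.
  by have [_] := gap_continuous u; apply.
by split; [apply: (eq_continuous_at (cd i k))|apply: (eq_continuous_at (cd i j))] => x;
  rewrite lmu_out.
Qed.

Lemma gmu_continuous u i j k : pvalid u -> uniq (word u) -> i != j ->
  i \in word u -> j \in word u -> k \in word u ->
  close 1 (deco u x0) i j -> close 1 (deco u x0) i k ->
  {for x0, continuous (fun x => gmu psi (deco u x) i j k)}.
Proof.
move=> vu uu ij iu ju ku cij cik.
have [||c1 c2] := @lmu_continuous u (cst 1) i j k vu uu ij iu ju ku _ _ cij cik.
- exact: cst_continuous.
- by move=> x; apply: one01.
have n0 : lmu psi 1 (deco u x0) i j k != (0, 0).
  by apply: lmu_neq0; rewrite ?lword_decorate ?one01 //; apply: deco_valid.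
apply: (@eq_continuous_at _ _ (fun x => pt ((lmu psi 1 (deco u x) i j k).1,
  (lmu psi 1 (deco u x) i j k).2))); last by move=> x; rewrite -surjective_pairing.
by apply: (pt_continuous c1 c2); rewrite -surjective_pairing.
Qed.

End ForestContinuity.

(** * Finiteness of the set of planar forests *)

Section PlanarForestsFinite.
Variable n : nat.
Local Notation I := 'I_n.

(** Candidates with at most m leaves. A node is split into its first child and the remaining ones;
    each share has fewer leaves because no vertex is bivalent. *)
Fixpoint planar_enum m : seq (ptree n) * seq (seq (ptree n)) :=
  if m is m'.+1 then
    let: (Ts, Fs) := planar_enum m' in
    let Ts' := map Leaf (enum I) ++ [seq Node (c :: s) | c <- Ts, s <- Fs] in
    (Ts', [::] :: [seq c :: s | c <- Ts', s <- Fs])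
  else ([::], [:: [::]]).

Lemma planar_enumP m :
  (forall c : ptree n, no_bivalent c -> (size (tleaves c) <= m)%N -> c \in (planar_enum m).1) /\
  (forall s : seq (ptree n), pvalid s -> (size (word s) <= m)%N -> s \in (planar_enum m).2).
Proof.
have gt0 (c : ptree n) : no_bivalent c -> (0 < size (tleaves c))%N.
  move=> vc; have [||i] := @tleaves_neq0 n [:: c] c; rewrite ?mem_head ?/pvalid /= ?vc //.
  by case: (tleaves c).
have sz (c : ptree n) s : size (word (c :: s)) = (size (tleaves c) + size (word s))%N.
  by rewrite word_cons size_cat.
elim: m => [|m] /=.
  split=> [c /gt0|[//|c s]]; first by case: size.
  by rewrite sz => /andP[/gt0 c0 _]; case: size c0.
case: (planar_enum m) => Ts Fs [hT hF]; set Ts' := map _ _ ++ _.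
have hT' (c : ptree n) : no_bivalent c -> (size (tleaves c) <= m.+1)%N -> c \in Ts'.
  case: c => [i|[//|a [//|b s]]]; first by rewrite mem_cat map_f ?mem_enum.
  rewrite -[tleaves _]/(word (a :: b :: s)) sz => /= /and3P[va vb vs] sm.
  rewrite mem_cat; apply/orP; right; apply: allpairs_f.
    by apply: hT => //; move: (gt0 _ vb) sm; rewrite sz; lia.
  by apply: hF; rewrite ?/pvalid /= ?vb //; move: (gt0 _ va) sm; lia.
split=> // -[|c s]; first by rewrite mem_head.
rewrite sz => /andP[vc vs] sm; rewrite inE; apply/orP; right; apply: allpairs_f.
  by apply: hT' => //; apply: leq_trans sm; rewrite leq_addr.
by apply: hF => //; move: (gt0 _ vc) sm; lia.
Qed.

Lemma finite_pforest : finite_set [set: pforest n].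
Proof.
apply: (@sub_finite_set _ _ [set` (pmap insub (planar_enum n).2 : seq (pforest n))]);
  last exact: finite_seq.
move=> tau _ /=; rewrite mem_pmap_sub.
have [vt wt] := forest_valid tau; have [_ h] := planar_enumP n.
by apply: h => //; rewrite (perm_size wt) size_enum_ord.
Qed.

End PlanarForestsFinite.

(** * Compactness of the cube complex and the homeomorphism *)

Section ThetaHomeomorphism.
Variables (R : realType) (n : nat) (psi : R -> R).
Hypothesis psi_gt0 : forall x, 0 <= x < 1 -> 0 < psi x.
Hypothesis psi_continuous : forall x, 0 <= x < 1 -> {for x, continuous psi}.
Hypothesis psi_unbounded : forall M, exists2 d, d < 1 &
  forall x, d < x -> x < 1 -> M < Fw psi x.
Hypothesis psi_inj : {in [pred x | 0 < x < 1] &, injective (Fw psi)}.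
Hypothesis psi_surj : forall y, 0 <= y -> exists2 x, 0 <= x < 1 & Fw psi x = y.
Local Notation I := 'I_n.

Lemma cube_compact (tau : pforest n) : compact [set: cube R tau].
Proof.
apply: set_type_compact.
have -> : [set t : {ptws edge tau -> R} | forall e, 0 <= t e <= 1] =
    [set t | forall e, `[0, 1]%classic (t e)].
  by apply/seteqP; split=> t h e; have := h e; rewrite /= in_itv.
exact: (@tychonoff _ (fun=> R) (fun=> `[0, 1]%classic) (fun=> @segment_compact _ 0 1)).
Qed.

Lemma Dhat_compact : compact [set: Dhat R n].
Proof.
have -> : [set: Dhat R n] = qclass (@cube_rel R n) @` [set: cubes R n].
  by apply/esym; rewrite -subTset => d _; exists (qrepr d); rewrite ?qreprK.
apply: continuous_compact.
  by apply: continuous_subspaceT; apply: qclass_continuous.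
exact: sigT_compact (finite_pforest n) cube_compact.
Qed.

Lemma cube_val_continuous (tau : pforest n) e :
  continuous (fun t : cube R tau => cube_val (existT _ tau t) e).
Proof.
move=> t; rewrite /cube_val /=.
have [ee|ne] := boolP (e \in flatten (map (@tedges n) (val tau))); last first.
  by rewrite insubN //; apply: cst_continuous.
rewrite insubT; pose e' : edge tau := exist _ e ee.
have c1 := @set_val_continuous _ [set t : {ptws edge tau -> R} | forall e, 0 <= t e <= 1] t.
exact: (continuous_comp c1 (@ptws_proj_continuous _ _ e' _)).
Qed.

Lemma near_U_set (tau : pforest n) (t0 : cube R tau) S :
  let nu t := mk_nu (gnu psi (dforest (existT _ tau t))) in
  U_set S (nu t0) -> \forall t \near t0, U_set S (nu t).
Proof.
move=> nu [_ h0]; have [vt _] := forest_valid tau.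
have iw : forall i, i \in word (val tau).
  by move=> i; have [_ /perm_mem->] := forest_valid tau; rewrite mem_enum.
have cnu i j : {for t0, continuous (fun t => gnu psi (dforest (existT (@cube R n) tau t)) i j)}.
  apply: (@gnu_continuous _ _ psi _ _ _ _ t0 (fun t => cube_val (existT (@cube R n) tau t))) => //.
  + by move=> e; apply: cube_val_continuous.
  + by move=> t e; apply: cube_val_01.
have away i j a : gnu psi (dforest (existT (@cube R n) tau t0)) i j <> a ->
    \forall t \near t0, gnu psi (dforest (existT (@cube R n) tau t)) i j <> a.
  move=> na; have oa : open (~` [set a]) by apply: closed_openC; apply: P1_pt_closed.
  exact: (cnu i j _ (open_nbhs_nbhs (conj oa na))).
have : \forall t \near t0, forall p : I * I, p.1 != p.2 ->
    if same_part S p.1 p.2 then gnu psi (dforest (existT (@cube R n) tau t)) p.1 p.2 <> P1fin 0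
    else gnu psi (dforest (existT (@cube R n) tau t)) p.1 p.2 <> P1inf.
  pose Q (p : I * I) (t : cube R tau) := p.1 != p.2 ->
    if same_part S p.1 p.2 then gnu psi (dforest (existT (@cube R n) tau t)) p.1 p.2 <> P1fin 0
    else gnu psi (dforest (existT (@cube R n) tau t)) p.1 p.2 <> P1inf.
  apply: (@filter_forall _ _ Q (nbhs t0) _) => -[i j]; rewrite /Q /=.
  have [->|ij] := eqVneq i j; first exact: nearW.
  have := h0 _ _ ij; rewrite nu_at_mk //; case: ifP => _ /away; apply: filterS => t ht _; exact: ht.
apply: filterS => t ht; split; first exact: gnu_tbar.
by move=> i j ij; rewrite nu_at_mk //; apply: (ht (i, j)).
Qed.

(** The chart is that of the classes S of finite distance at t0. Nearby points may have more
    infinite distances or fewer coincidences, but by [near_U_set] they stay in this chart, where the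
    coordinates are continuous functions of t. *)
Lemma theta_cube_continuous (tau : pforest n) :
  continuous (fun t : cube R tau => theta_cube psi_gt0 (existT _ tau t)).
Proof.
move=> t0; pose s t := dforest (existT (@cube R n) tau t).
have iw i : i \in word (val tau).
  by have [_ /perm_mem->] := forest_valid tau; rewrite mem_enum.
have [vt _] := forest_valid tau; have ut := forest_uniq tau.
have [S SE US] := finest_part psi (s t0).
pose data t := (mk_nu (gnu psi (s t)), mk_mu S (gmu psi (s t))).
have ok t : forest_ok (s t) by apply: dforest_ok.
have UU t (h : U_set S (mk_nu (gnu psi (s t)))) := gnu_Utilde psi_gt0 (ok t) h.
(* Away from U_S the value at t0 serves as a default, to obtain a total function into the chart. *)
pose G t : Utilde R S := match pselect (U_set S (mk_nu (gnu psi (s t)))) with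
  | left h => exist _ (data t) (mem_set (UU t h))
  | right _ => exist _ (data t0) (mem_set (UU t0 US)) end.
have GE t : U_set S (mk_nu (gnu psi (s t))) -> val (G t) = data t.
  by rewrite /G; case: pselect.
have nU := near_U_set US.
have cdata : {for t0, continuous data}.
  have c1 : {for t0, continuous (fun t => mk_nu (gnu psi (s t)))}.
    apply: ptws_continuous_at => -[[i j] ij].
    apply: (@gnu_continuous _ _ psi _ _ _ _ t0 (fun t => cube_val (existT (@cube R n) tau t))) => //.
    + by move=> e; apply: cube_val_continuous.
    + by move=> t e; apply: cube_val_01.
  have c2 : {for t0, continuous (fun t => mk_mu S (gmu psi (s t)))}.
    apply: ptws_continuous_at => -[[[i j] k] ijk]; rewrite /mk_mu /=.
    have := ijk; rewrite in_partP !SE uniq3 => /and3P[/and3P[ij _ _] cij cik].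
    apply: (@gmu_continuous _ _ psi _ _ _ t0 (fun t => cube_val (existT (@cube R n) tau t))) => //.
    + by move=> e; apply: cube_val_continuous.
    + by move=> t e; apply: cube_val_01.
  exact: (cvg_pair c1 c2).
have cG : {for t0, continuous G}.
  move=> O nO; suff : \forall t \near t0, O (G t) by [].
  have := nO : nbhs (G t0) O; rewrite nbhsE => -[B [oB BG] sBO].
  have [V oV eV] := set_type_open oB.
  have Vd : V (data t0) by rewrite -(GE t0 US); move: BG; rewrite eV.
  have nV : \forall t \near t0, V (data t) := cdata V (open_nbhs_nbhs (conj oV Vd)).
  apply: filterS2 nU nV => t Ut Vt; apply: sBO; rewrite eV /=.
  by rewrite /preimage /= GE.
have eG : \forall t \near t0, qclass (@glue R n) (existT _ S (G t)) =
    theta_cube psi_gt0 (existT _ tau t).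
  apply: filterS nU => t Ut; apply/esym/theta_cubeE.
  split; first by rewrite /chart_nu /= GE.
  by move=> i j k ijk; rewrite /chart_mu /= GE // mu_at_mk.
suff : qclass (@glue R n) (existT _ S (G t)) @[t --> t0] -->
    theta_cube psi_gt0 (existT _ tau t0).
  by apply: cvg_trans; apply: (near_eq_cvg eG).
rewrite -(nbhs_singleton eG).
have c1 := continuous_comp cG (@existT_continuous _ _ S (G t0)).
exact: (continuous_comp c1 (@qclass_continuous _ _ _)).
Qed.

Lemma theta_homeomorphism : homeomorphism (@theta R n psi psi_gt0).
Proof.
have surj (z : Fbar R n) : exists d, theta psi_gt0 d = z.
  have [p [_ <-]] := theta_cube_surj psi_gt0 psi_surj z.
  by exists (qclass (@cube_rel R n) p); apply: theta_qclass.
have inj (d d' : Dhat R n) : theta psi_gt0 d = theta psi_gt0 d' -> d = d'.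
  rewrite -(qreprK d) -(qreprK d') !theta_qclass => /(theta_cube_inj psi_inj) h.
  exact/qclass_eqP.
pose g z := sval (cid (surj z)).
have gK : cancel g (theta psi_gt0) by move=> z; exact: svalP (cid (surj z)).
apply: (@compact_homeomorphism _ _ _ g) => //.
- exact: Dhat_compact.
- exact: Fbar_hausdorff.
- apply: quot_continuous.
  have := @sigT_continuous _ (@cube R n) _ _ theta_cube_continuous.
  have <- // : @theta R n psi psi_gt0 \o qclass (@cube_rel R n) =
    unstable.sigT_fun (fun tau t => theta_cube psi_gt0 (existT (@cube R n) tau t)).
  by apply/funext => -[tau t]; apply: theta_qclass.
by move=> d; apply: inj; rewrite gK.
Qed.

End ThetaHomeomorphism.

(** * The coordinates b_e *)

Section Consecutive.
Variables (R : realFieldType) (I : choiceType).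
Implicit Types (s : seq (dtree R I)) (F : R -> R) (i j : I).

Definition consec (w : seq I) i j := [&& i \in w, j \in w & index j w == (index i w).+1].

Lemma infix_consec w i j : uniq w -> infix [:: i; j] w -> consec w i j.
Proof.
move=> uw /infixP[w1 [w2 ew]]; move: uw; rewrite ew cat_uniq => /and3P[_ /hasPn h uij].
have ni : i \notin w1 by apply: h; rewrite /= mem_head.
have nj : j \notin w1 by apply: h; rewrite /= !inE eqxx orbT.
have ij : i != j by case/andP: uij; rewrite inE negb_or => /andP[].
rewrite /consec !mem_cat !index_cat (negPf ni) (negPf nj) /= !eqxx (negPf ij) !inE !eqxx orbT /=.
by rewrite addn1 addn0.
Qed.

Lemma consec_dist F s i j : lvalid s -> consec (lword s) i j ->
  dist F s i j = F (nth 0 (lpre s) (index j (lword s))).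
Proof.
move=> vs /and3P[iw jw /eqP ij]; rewrite dist_index ij // (take_nth 0).
  by rewrite -cats1 drop_size_cat ?big_seq1 // size_take lvalid_size // -ij index_mem jw.
by rewrite lvalid_size // -ij index_mem.
Qed.

Lemma consec_child s c i j : uniq (lword s) -> c \in s -> i \in dword c -> j \in dword c ->
  consec (lword s) i j -> consec (dword c) i j.
Proof.
move=> us cs ic jc; case/path.splitPr: cs us => s1 s2 us.
have [i1 _] := uniq_mid us ic; have [j1 _] := uniq_mid us jc.
rewrite /consec lword_cat lword_cons ic jc !index_cat (negPf i1) (negPf j1) ic jc.
by move=> /and3P[_ _]; rewrite -addnS eqn_add2l.
Qed.

(** The leaf j is the first one of its tree, in front of which [dpre] puts the gap 1. *)
Lemma consec_apart s i j : lvalid s -> uniq (lword s) -> consec (lword s) i j ->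
  ~~ together s i j -> nth 0 (lpre s) (index j (lword s)) = 1.
Proof.
move=> vs us /and3P[iw jw /eqP ij] nt; have [c cs ic] := flatten_mapP iw.
have jc : j \notin dword c.
  by apply: contra nt => jc; apply/hasP; exists c; rewrite ?ic.
case/path.splitPr: cs us vs ij jw {nt iw} => s1 s2 us.
have [/negPf i1 _] := uniq_mid us ic.
rewrite lvalid_cat => /andP[v1 /andP[vc v2]].
rewrite lword_cat lword_cons lpre_cat lpre_cons !index_cat i1 ic (negPf jc) !mem_cat (negPf jc) /=.
have ci : (index i (dword c) < size (dword c))%N by rewrite index_mem.
case: ifP => [j1 e _|j1 e /= j2].
  by move: j1; rewrite -index_mem e -addnS ltnNge leq_addr.
have e2 : index j (lword s2) = 0%N.
  move: e ci; rewrite -addnS => /addnI; move: (index j _) (index i _) (size _) => a b m; lia.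
rewrite e2 addn0 -(lvalid_size v1) -(dvalid_size vc) nth_cat ltnNge leq_addr /= addKn.
rewrite nth_cat ltnn subnn; case: (s2) j2 => // c2 s3 _.
by rewrite lpre_cons dpre_behead.
Qed.

End Consecutive.

Arguments erase {R n}.

Section EdgeProducts.
Variables (R : realType) (n : nat).
Local Notation I := 'I_n.
Implicit Types (s u : seq (dtree R I)) (F : R -> R) (i j k l : I) (C : pred {set I}).

(** Products of edge values for decorated forests, where one can induct on subtrees; [eprod_edges]
    leads back to products over [edge]. *)
Definition eprod s C : R := \prod_(ex <- lvals s | C ex.1) ex.2.
Definition both i j : pred {set I} := fun e => (i \in e) && (j \in e).

Lemma tleaves_erase (c : dtree R I) : tleaves (erase c) = dword c.
Proof. by rewrite -word1 -lword1 -word_erase. Qed.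

Lemma lvals_child s e x : lvalid s -> (e, x) \in lvals s ->
  exists2 c, c \in s & forall j, j \in e -> j \in dword c.
Proof.
move=> vs ex; have ee : e \in ledges (map erase s) by rewrite -lvals_keys; apply/mapP; exists (e, x).
have [_ [i [/mapP[c cs ->] _ _ h]]] := tedges_sub (pvalid_erase vs) ee.
by exists c => // j /h; rewrite tleaves_erase.
Qed.

Lemma lvals_together s e x i j : lvalid s -> (e, x) \in lvals s -> i \in e -> j \in e ->
  together s i j.
Proof.
by move=> vs /(lvals_child vs)[c cs h] ie je; apply/hasP; exists c; rewrite ?h.
Qed.

Lemma eprod_none s C : (forall e x, (e, x) \in lvals s -> ~~ C e) -> eprod s C = 1.
Proof.
move=> h; rewrite /eprod big_seq_cond big_pred0 // => -[e x].
by apply/negP => /andP[/h /negP].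
Qed.

Lemma eprod_child s t u i C : lvalid s -> uniq (lword s) -> DNode t u \in s ->
  i \in lword u -> (forall e, C e -> i \in e) ->
  eprod s C = (if C [set:: lword u]%SET then t else 1) * eprod u C.
Proof.
move=> vs us cs iu Ci; case/path.splitPr: cs vs us => s1 s2 vs us.
have [i1 i2] := uniq_mid us iu.
move: vs; rewrite lvalid_cat => /andP[v1 /andP[_ v2]].
have none v : lvalid v -> i \notin lword v -> eprod v C = 1.
  move=> vv iv; apply: eprod_none => e x ex; apply: contra iv => /Ci.
  by have [c cv h] := lvals_child vv ex; move=> /h; apply: mem_lword_sub.
rewrite /eprod lvals_cat lvals_cons !big_cat /= -!/(eprod _ C) (none s1) // (none s2) //.
rewrite big_cons /= (_ : above _ = [set:: lword u]%SET).
  by case: ifP => _; rewrite ?mul1r ?mulr1.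
by rewrite /above /= -[flatten _]/(word (map erase u)) word_erase.
Qed.

Lemma mem_above u i : (i \in [set:: lword u]%SET) = (i \in lword u).
Proof. by rewrite inE. Qed.

Lemma eprod_both s t u i j : lvalid s -> uniq (lword s) -> DNode t u \in s ->
  i \in lword u -> j \in lword u -> eprod s (both i j) = t * eprod u (both i j).
Proof.
move=> vs us cs iu ju; rewrite (eprod_child vs us cs iu) => [|e /andP[]//].
by rewrite /both !mem_above iu ju.
Qed.

Lemma eprod_apart s i j : lvalid s -> ~~ together s i j -> eprod s (both i j) = 1.
Proof.
move=> vs nt; apply: eprod_none => e x ex; apply: contra nt => /andP[].
exact: lvals_together vs ex.
Qed.

(** A single gap lies between consecutive leaves: the separator 1 at their meet, multiplied by the
    values of all edges below the meet. *)
Lemma consec_gap F s i j : lvalid s -> uniq (lword s) -> consec (lword s) i j ->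
  dist F s i j = F (eprod s (both i j)).
Proof.
elim/list_tree_ind: s F => s IH F vs us cij.
have ij : i != j.
  by case/and3P: cij => _ _ /eqP e; apply: contraPneq e => ->; apply/eqP; rewrite neq_ltn ltnSn.
have [/(has_node ij)[//|t [u [cs /andP[iu ju]]]]|nt] := boolP (together s i j).
  have [_ _ vu] := lvalidP vs cs.
  rewrite (dist_in _ vs us cs) // (eprod_both vs us cs) // (IH _ _ cs) //.
    exact: uniq_in us cs.
  exact: (consec_child us cs).
by rewrite consec_dist // (consec_apart vs us cij nt) eprod_apart.
Qed.

Variable psi : R -> R.
Hypothesis psi_gt0 : forall x, 0 <= x < 1 -> 0 < psi x.

(** The edge [e] carries i and k but not j. Hence where the labels part, j is in another tree than
    i, and their distance is nonzero. *)
Lemma lmu_finite P s i j k e : 0 <= P <= 1 -> lvalid s -> uniq (lword s) ->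
  i \in lword s -> j \in lword s -> k \in lword s -> close P s i j ->
  e \in ledges (map (@erase R n) s) -> i \in e -> k \in e -> j \notin e ->
  (lmu psi P s i j k).2 != 0.
Proof.
elim/list_tree_ind: s P => s IH P P01 vs us iw jw kw cij ee ie ke je.
have [_ [_ [/mapP[c cs ->] ec _ h]]] := tedges_sub (pvalid_erase vs) ee.
case: c cs ec h => [//|t u] cs ec h.
have [iu ku] : i \in lword u /\ k \in lword u.
  by split; rewrite -(dword_node t) -tleaves_erase h.
have [ju|ju] := boolP (j \in lword u).
  have [_ t01 vu] := lvalidP vs cs.
  rewrite (lmu_in psi P us cs) //; apply: (IH _ _ cs) => //.
  - exact: mul11.
  - exact: uniq_in us cs.
  - by rewrite -(close_in _ vs us cs).
  move: ec; rewrite /= inE => /orP[/eqP eu|//].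
  by move: je; rewrite eu inE /= -[flatten _]/(word (map erase u)) word_erase ju.
have nt : ~~ together s i j.
  apply: contra ju => /hasP[c c's /andP[ic jc]].
  by have e2 : c = DNode t u := child_eq us c's cs ic iu; move: jc; rewrite e2.
have P1 : 0 <= P < 1.
  by case/andP: P01 => -> p1; rewrite lt_neqAle p1 (close_apart vs us iw jw cij nt).
rewrite lmu_out /=; last first.
  by apply: contra nt => /hasP[c c's /and3P[ic jc _]]; apply/hasP; exists c; rewrite ?ic.
have := dist_sep vs us (phi_ge0 psi_gt0 P1) iw jw nt.
by apply: contraTneq => ->; rewrite normr0 phi1 // ler10.
Qed.

Definition lratio P s k l x : R := if x == k then 0 else if x == l then 1 else
  (lmu psi P s k l x).1 / (lmu psi P s k l x).2.

(* At the vertex where k and l part, the gap between them is 1, so that lratio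
   measures distances from k. *)
Lemma lratio_gap P s i j k l : 0 <= P <= 1 -> lvalid s -> uniq (lword s) ->
  consec (lword s) i j -> consec (lword s) k l -> close P s k l ->
  (forall e x, (e, x) \in lvals s -> both k l e -> both i j e) ->
  lratio P s k l j - lratio P s k l i =
  phi psi (P * eprod s (both k l)) (eprod s [pred e | both i j e && ~~ both k l e]).
Proof.
elim/list_tree_ind: s P => s IH P P01 vs us cij ckl clkl h.
have [iw jw _] := and3P cij; have [kw lw klE] := and3P ckl.
have kl : k != l.
  by apply: contraTneq klE => ->; rewrite neq_ltn ltnSn.
have [/(has_node kl)[//|t [u [cs /andP[ku lu]]]]|nt] := boolP (together s k l).
  have [_ t01 vu] := lvalidP vs cs; have uu := uniq_in us cs.
  have lu' : (above (erase (DNode t u)), t) \in lvals s.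
    by apply/flatten_mapP; exists (DNode t u); rewrite // mem_head.
  have aE y : (y \in above (erase (DNode t u))) = (y \in lword u).
    by rewrite inE tleaves_erase.
  have /andP[iu ju] : both i j (above (erase (DNode t u))).
    by apply: h lu' _; rewrite /both !aE ku lu.
  rewrite !aE in iu ju.
  have E x : x \in lword u -> lratio P s k l x = lratio (P * t) u k l x.
    by move=> xu; rewrite /lratio (lmu_in psi P us cs).
  rewrite !E // (IH _ _ cs) ?mul11 //.
  - rewrite (eprod_both vs us cs) // mulrA; congr (phi psi _ _).
    rewrite [RHS](eprod_child vs us cs iu) => [|e /andP[/andP[]]//].
    by rewrite /= /both !mem_above ku lu andbF mul1r.
  - exact: (consec_child us cs).
  - exact: (consec_child us cs).
  - by rewrite -(close_in _ vs us cs).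
  by move=> e x ex; apply: h; apply/flatten_mapP; exists (DNode t u); rewrite // inE; apply/orP; right; exact: ex.
have P1 : 0 <= P < 1.
  by case/andP: P01 => -> p1; rewrite lt_neqAle p1 (close_apart vs us kw lw clkl nt).
have dkl : dist (phi psi P) s k l = 1.
  by rewrite consec_gap // eprod_apart // phi1.
have E x : lratio P s k l x = dist (phi psi P) s k x.
  rewrite /lratio; case: eqP => [->|_]; first by rewrite distii.
  case: eqP => [->//|_]; rewrite lmu_out /= ?dkl ?divr1 //.
  by apply: contra nt => /hasP[c c's /and3P[ic jc _]]; apply/hasP; exists c; rewrite ?ic.
rewrite !E (dist_trans _ _ k i j) [X in X - _]addrC addrK consec_gap //.
rewrite (eprod_apart vs nt) mulr1; congr (phi psi P _).
rewrite /eprod big_seq_cond [RHS]big_seq_cond; apply: eq_bigl => -[e x] /=.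
case ex : (_ \in _) => //=; rewrite andb_idr // => _.
by apply: contra nt => /andP[]; apply: lvals_together vs ex.
Qed.

End EdgeProducts.

Section ThetaChart.
Variables (R : realType) (n : nat).
Local Notation I := 'I_n.
Implicit Types (p : cubes R n) (i j k l : I) (u : seq (ptree n)).

Lemma lvals_dforest p :
  lvals (dforest p) = [seq (e, cube_val p e) | e <- ledges (val (projT1 p))].
Proof.
rewrite -[in RHS]erase_dforest -lvals_keys -map_comp -[LHS]map_id.
by apply/eq_in_map => -[e x] /lvals_decorate ->.
Qed.

Lemma eprod_edges p (C : pred {set I}) : eprod (dforest p) C =
  \prod_(e : edge (projT1 p) | C (val e)) val (projT2 p) e.
Proof.
rewrite /eprod lvals_dforest big_map /= big_mkcond big_uniq /=; last first.
  by have [vt _] := forest_valid (projT1 p); apply: ledges_uniq => //; apply: forest_uniq.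
rewrite (big_sub (mem (flatten (map (@tedges n) (val (projT1 p)))))) [RHS]big_mkcond.
by apply: eq_bigr => e _; case: ifP => // _; apply: cube_valE.
Qed.

Lemma laminar u e e' x : pvalid u -> uniq (word u) -> e \in ledges u -> e' \in ledges u ->
  x \in e -> x \in e' -> (e \subset e')%SET || (e' \subset e)%SET.
Proof.
elim/ptree_list_ind: u => u IH vu uu eu e'u xe xe'.
have [c [_ [cu ec _ h]]] := tedges_sub vu eu; have [c' [_ [c'u ec' _ h']]] := tedges_sub vu e'u.
have cc' : c = c' by apply: (pchild_eq uu cu c'u (h _ xe) (h' _ xe')).
move: ec'; rewrite -cc' in h' *; case: c cu ec h h' {cc'} => // v cu ec h h' ec'.
have sub (d : {set I}) : (forall j, j \in d -> j \in tleaves (Node v)) ->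
    (d \subset above (Node v))%SET.
  by move=> hd; apply/fintype.subsetP => j /hd; rewrite inE.
move: ec; rewrite /= inE => /orP[/eqP->|ev]; first by rewrite (sub e') ?orbT.
move: ec'; rewrite /= inE => /orP[/eqP->|e'v]; first by rewrite (sub e).
have [_ vv] := pvalidP vu cu.
exact: (IH _ cu vv (uniq_pchild uu cu)).
Qed.

Section Edges.
Variable tau : pforest n.
Implicit Types e : edge tau.

Lemma edge_laminar e e' x : x \in val e -> x \in val e' ->
  (val e \subset val e')%SET || (val e' \subset val e)%SET.
Proof.
have [vt _] := forest_valid tau.
exact: laminar vt (forest_uniq tau) (valP e) (valP e').
Qed.

Lemma meet_sub e i j : i \in val e -> j \in val e -> (meet tau i j \subset val e)%SET.
Proof. by move=> ie je; apply: finset.bigcap_inf; rewrite ie je. Qed.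

Lemma mem_meet i j : (i \in meet tau i j) && (j \in meet tau i j).
Proof. by apply/andP; split; apply/finset.bigcapP => e /andP[]. Qed.

Lemma meet_edge e e' i j : meet tau i j = val e ->
  both i j (val e') = (val e \subset val e')%SET.
Proof.
move=> m; apply/andP/fintype.subsetP => [[ie je]|h].
  by apply/fintype.subsetP; rewrite -m; apply: meet_sub.
by have /andP[] := mem_meet i j; rewrite m => /h -> /h ->.
Qed.

Lemma same_tree_edge e i j : i \in val e -> j \in val e -> same_tree tau i j.
Proof.
have [vt _] := forest_valid tau.
have [c [_ [cu _ _ h]]] := tedges_sub vt (valP e).
by move=> /h ie /h je; apply/hasP; exists c; rewrite ?ie.
Qed.

End Edges.

Lemma together_tree p i j : together (dforest p) i j = same_tree (projT1 p) i j.
Proof.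
rewrite /together /same_tree /dforest has_map; apply: eq_has => c /=.
by rewrite -(lword1 (decorate _ c)) -[[:: _]]/(map (decorate (cube_val p)) [:: c])
  lword_decorate word1.
Qed.

Lemma admissible_no_one p : theta_admissible p -> ~~ has_one (dforest p).
Proof.
move=> [_ tr]; apply/negP => /hasP[_ /mapP[[j|v] vin ->]] /=; first by [].
move=> /eqP e1; have [vt _] := forest_valid (projT1 p); have ut := forest_uniq (projT1 p).
have av : above (Node v) \in ledges (val (projT1 p)).
  by apply/flatten_mapP; exists (Node v); rewrite // mem_head.
apply: (tr (mk_edge av)); last by rewrite -cube_valE -e1.
apply/forallP => e'; apply/negP => /andP[/fintype.subsetP s1 /negP]; apply.
have [c [_ [cu _ _ h]]] := tedges_sub vt (valP e').
have [x xv] := tleaves_neq0 vt vin.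
have xa : x \in above (Node v) by rewrite inE.
have ec : c = Node v := pchild_eq ut cu vin (h _ (s1 _ xa)) xv.
by apply/fintype.subsetP => y /h; rewrite ec inE.
Qed.

Variable f : R -> \bar R.
Hypothesis f_diffeo : increasing_diffeo f.
Hypothesis f_zero : f 0 = 0%E.
Local Notation psi := (slope f).
Let psi_gt0 x : 0 <= x < 1 -> 0 < psi x := @slope_gt0 R f f_diffeo f_zero x.

Lemma dist_edges p (F : R -> R) i j : consecutive (projT1 p) i j ->
  dist F (dforest p) i j = F (\prod_(e : edge (projT1 p) | both i j (val e)) val (projT2 p) e).
Proof.
move=> cij; have ok := dforest_ok p; rewrite consec_gap ?eprod_edges ?(ok_valid ok) ?(ok_uniq ok) //.
by apply: infix_consec (ok_uniq ok) _; rewrite lword_decorate.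
Qed.

Lemma theta_chart_point p q : theta_admissible p ->
  (forall i j, same_part (projT1 q) i j = close 1 (dforest p) i j) ->
  is_point psi (dforest p) q -> theta_chart f p q.
Proof.
move=> adm sp [qnu qmu]; have ok := dforest_ok p.
have [vs us] := (ok_valid ok, ok_uniq ok); have n1 := admissible_no_one adm.
have iw i : i \in lword (dforest p) by apply: ok_mem.
set tau := projT1 p; have [vt _] := forest_valid tau; have ut := forest_uniq tau.
have st i j : same_part (projT1 q) i j = same_tree tau i j.
  rewrite sp -together_tree; apply/idP/idP; first exact: close_together.
  exact: together_close.
have cl i j : same_tree tau i j -> close 1 (dforest p) i j by rewrite -st sp.
have dE i j : i != j -> close 1 (dforest p) i j ->
    delta_at (chart_nu q) i j = P1fin (dist (Fw psi) (dforest p) i j).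
  move=> ij cij; rewrite /delta_at qnu nu_at_mk // /gnu cij P1inv_pt ?one_neq0 //.
  by rewrite /= -P1fin_pt.
split.
- apply/setP => A; rewrite inE.
  have blk T x : T \in val tau -> x \in tleaves T -> finset.pblock (val (projT1 q)) x = above T.
    move=> Tt xT; apply/setP => y; rewrite -same_partP st inE.
    apply/hasP/idP => [[T' T't /andP[xT' yT']]|yT]; last by exists T; rewrite ?xT.
    by rewrite -(pchild_eq ut T't Tt xT' xT).
  have /and3P[/eqP cov tri ne] := valP (projT1 q).
  apply/idP/mapP => [AS|[T Tt ->]].
    have [x xA] : exists x, x \in A.
      by apply/finset.set0Pn; apply: contraNneq ne => <-.
    have : x \in word (val tau) by rewrite -(lword_decorate (cube_val p)).
    move=> /flatten_mapP[T Tt xT]; exists T => //.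
    by rewrite -(blk T x Tt xT) (finset.def_pblock tri AS xA).
  have [x xT] := tleaves_neq0 vt Tt; rewrite -(blk T x Tt xT).
  by apply: finset.pblock_mem; rewrite cov finset.in_setT.
- move=> i j ij; rewrite sp /delta_at qnu nu_at_mk //.
  have e : P1inv (P1fin 0) = @P1inf R.
    by rewrite P1fin_pt P1inf_pt P1inv_pt // pair_neq0 /= oner_eq0 orbT.
  split=> [h|/(close_gnu psi) h h1]; last by apply: h; rewrite -(P1invK (gnu _ _ _ _)) h1 -e P1invK.
  by apply/(close_gnu psi) => h1; apply: h; rewrite h1.
- move=> i j k ijk mm; rewrite qmu // => /eq_P1inf h0.
  move: (ijk); rewrite in_partP !sp uniq3 => /and3P[/and3P[ij _ _] cij cik].
  have l0 := lmu_neq0 psi_gt0 (one01 R) vs us (iw i) (iw j) (iw k) ij cij cik.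
  have [c c0 [_ h2]] := ptP l0; move: h0; rewrite /gmu h2 => /eqP.
  rewrite mulf_eq0 (negPf c0) /=; apply/negP.
  (* If every edge carrying i and k also carried j, the meet of i and j would be contained in that
     of i and k. *)
  have [e [ie ke je]] : exists e : edge tau, [/\ i \in val e, k \in val e & j \notin val e].
    apply: contrapT => h; move: mm; rewrite fintype.properE => /andP[_ /negP]; apply.
    apply/finset.bigcapsP => e /andP[ie ke]; apply: meet_sub => //.
    by apply: contrapT => /negP je; apply: h; exists e.
  apply: (lmu_finite psi_gt0 (one01 R) vs us (iw i) (iw j) (iw k) cij _ ie ke je).
  rewrite erase_dforest; exact: valP.
- move=> e i j tr cij sij m.
  have ij : i != j.
    apply: contraTneq cij => ->; apply/negP => /infix_uniq/(_ ut).
    by rewrite /= inE eqxx.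
  (* The meet is the trunk, so the trunk is the only edge below both leaves and the product has one
     factor. *)
  rewrite dE ?cl // dist_edges // (big_pred1 e) => [|e'].
    have [us' [_ _]] : True /\ True /\ True by [].
    have te : 0 <= val (projT2 p) e < 1.
      have [v [vin ev]] := trunk_value tr; exact: trunk_lt1 vs n1 vin.
    by rewrite slopeE.
  rewrite /= (meet_edge _ m); apply/idP/eqP => [ee'|-> //].
  move/forallP: tr => /(_ e'); rewrite fintype.properE ee' /= negbK => e'e.
  by apply/val_inj/eqP; rewrite finset.eqEsubset e'e ee'.
move=> e e' i j k l /andP[pe /forallP par] cij sij m ckl skl m'.
have ek : both k l (val e') by rewrite (meet_edge _ m').
have ei : both i j (val e) by rewrite (meet_edge _ m).
have s1 : {subset val e <= val e'} by apply/fintype.subsetP/fintype.proper_sub.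
(* As the meet of k and l is the parent of [e], the edges carrying both are those strictly below
   [e]. *)
have above_e (e'' : edge tau) : both k l (val e'') = (val e \proper val e'')%SET.
  rewrite (meet_edge _ m'); apply/idP/idP => h; first exact: fintype.proper_sub_trans pe h.
  have /andP[ie _] := ei.
  have := edge_laminar (s1 _ ie) (fintype.subsetP (fintype.proper_sub h) _ ie).
  case/orP => // h2; have := par e''; rewrite h /= fintype.properE h2 /= negbK.
  by [].
have P01 := one01 R.
have ckl' : consec (lword (dforest p)) k l.
  by apply: infix_consec us _; rewrite lword_decorate.
have cij' : consec (lword (dforest p)) i j.
  by apply: infix_consec us _; rewrite lword_decorate.
have kl : k != l.
  by case/and3P: ckl' => _ _; apply: contraTneq => ->; rewrite neq_ltn ltnSn.
have rE x : x \in val e' -> ratio q k l x = lratio psi 1 (dforest p) k l x.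
  move=> xe; rewrite /ratio /lratio; case: eqP => // /eqP xk; case: eqP => // /eqP xl.
  have kx : same_tree tau k x by apply: (same_tree_edge (e := e')) => //; case/andP: ek.
  have klx : in_part (projT1 q) k l x by rewrite in_partP !st uniq3 kl eq_sym xk eq_sym xl skl kx.
  rewrite qmu // affine_pt //.
  by apply: (lmu_neq0 psi_gt0 P01 vs us) => //; apply: cl.
have [ie je] := andP ei.
rewrite !rE ?s1 // (lratio_gap psi_gt0 P01 vs us cij' ckl' (cl _ _ skl)).
  rewrite mul1r !eprod_edges /b_value -/tau.
  have -> : \prod_(e0 : edge (projT1 p) | both k l (val e0)) val (projT2 p) e0 =
      \prod_(e0 : edge tau | (val e \proper val e0)%SET) val (projT2 p) e0.
    by apply: eq_bigl => e''; apply: above_e.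
  (* Only [e] itself carries i and j but not both k and l. *)
  have -> : \prod_(e0 : edge (projT1 p) | [pred e1 | both i j e1 && ~~ both k l e1] (val e0))
      val (projT2 p) e0 = val (projT2 p) e.
    apply: big_pred1 => e'' /=; rewrite above_e (meet_edge _ m) fintype.properE negb_and negbK.
    case h : (_ \subset _)%SET => /=; last by apply/esym/negbTE/eqP => ee; rewrite ee subxx in h.
    apply/idP/eqP => [h'|->]; last by [].
    by apply/val_inj/eqP; rewrite finset.eqEsubset h h'.
  set t := val (projT2 p) e; set P := \prod_(_ | _) _.
  case: ifP => [/forallP nz|/negbT/forallPn[e'']].
    have P0 : P != 0 by apply/prodf_neq0 => e'' he; have := nz e''; rewrite he.
    rewrite !(slope_fine f_zero) /phi (mulrC t P) -(mulrA P t) -mulf_div divff // mul1r.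
    by [].
  (* Some edge below [e] has value 0. Then P = 0, and phi 0 is the identity, in accordance with b_e
     = t_e. *)
  rewrite negb_imply negbK => /andP[he /eqP t0].
  have -> : P = 0 by apply/eqP/prodf_eq0; exists e''; rewrite ?t0.
  by rewrite phi0.
move=> e0 x ex; have : e0 \in ledges (val tau).
  by rewrite -erase_dforest -lvals_keys; apply/mapP; exists (e0, x).
move=> he0; rewrite -[e0]/(val (mk_edge he0)) above_e (meet_edge _ m).
exact: fintype.proper_sub.
Qed.

End ThetaChart.

(** * The star *)

Section StarPoints.
Variables (R : realType) (n : nat).
Local Notation I := 'I_n.
Implicit Types (x y : I -> R) (l : seq I) (i j : I) (F : R -> R).

Definition val_at x l (k : nat) : R := nth 0 (map x l) k.
Definition gap x l (k : nat) : R := val_at x l k.-1 - val_at x l k.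
(** Lists take the place of permutations, for comparison with the words of forests; [perm_chain]
    translates. *)
Definition chain x l := perm_eq l (enum I) /\
  forall k, (k.+1 < size l)%N -> 0 <= gap x l k.+1 <= 1.

Lemma chain_mem x l i : chain x l -> i \in l.
Proof. by case=> /perm_mem-> _; rewrite mem_enum. Qed.

Lemma val_at_index x l i : i \in l -> val_at x l (index i l) = x i.
Proof. by move=> il; rewrite /val_at (nth_map i) ?index_mem // nth_index. Qed.

Lemma chain_mono x l a b : chain x l -> (a <= b < size l)%N -> val_at x l b <= val_at x l a.
Proof.
move=> [_ c]; elim: b => [|b IH] /andP[]; first by rewrite leqn0 => /eqP->.
rewrite leq_eqVlt ltnS => /orP[/eqP->//|ab] bl.
apply: le_trans (IH _); first by have /andP[] := c b bl; rewrite /gap /= subr_ge0.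
by rewrite ab ltnW.
Qed.

Lemma chain_gap01 x l k : chain x l -> (0 < k < size l)%N -> 0 <= gap x l k <= 1.
Proof. by move=> [_ c]; case: k => // k; apply: c. Qed.

(* Some interval of length 1 contains no value of x in its interior and
   separates x i from x j. *)
Definition sep x i j := exists v, (forall k, x k <= v - 1 \/ v <= x k) /\
  ((v <= x i /\ x j <= v - 1) \/ (v <= x j /\ x i <= v - 1)).
Definition xclose x i j : bool := `[< ~ sep x i j >].

Lemma xclose_refl x i : xclose x i i.
Proof. by apply/asboolP => -[v [_ [[h1 h2]|[h1 h2]]]]; lra. Qed.

Lemma xclose_sym x : symmetric (xclose x).
Proof.
by move=> i j; apply/asboolP/asboolP => h [v [h1 h2]]; apply: h; exists v; split=> //; tauto.
Qed.

Lemma xclose_trans x i j k : xclose x i j -> xclose x j k -> xclose x i k.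
Proof.
move=> /asboolP ij /asboolP jk; apply/asboolP => -[v [h1 h2]].
case: (h1 j) => hj; [case: h2 => -[h2 h3]; [apply: ij|apply: jk]|
  case: h2 => -[h2 h3]; [apply: jk|apply: ij]]; exists v; split=> //; tauto.
Qed.

Lemma index_between l i j k : i \in l -> j \in l -> between l i j k -> (0 < k < size l)%N.
Proof.
move=> il jl /orP[]/andP[h1 h2]; rewrite (leq_ltn_trans _ h1) //=;
  apply: leq_ltn_trans h2 _; by rewrite index_mem.
Qed.

(** A gap 1 of the chain is an interval of length 1 without values inside that separates what
    precedes it from what follows. Conversely, such an interval is crossed by a single step, whose
    length is at most 1 and therefore equal to 1. So the gaps 1 between two labels are detected by x
    alone, whatever the chain. *)
Lemma xcloseP x l i j : chain x l ->
  reflect (forall k, between l i j k -> gap x l k != 1) (xclose x i j).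
Proof.
move=> cx; have mem k : k \in l by apply: chain_mem cx.
have cross v a b : v <= x a -> x b <= v - 1 -> (forall k, x k <= v - 1 \/ v <= x k) ->
    exists2 k, between l a b k & gap x l k = 1.
  move=> va bv out.
  have ab : (index a l < index b l)%N.
    rewrite ltnNge; apply/negP => ba.
    have := @chain_mono x l (index b l) (index a l) cx; rewrite ba index_mem mem => /(_ isT).
    rewrite !val_at_index //; lra.
  have ex : exists m, [&& (index a l < m)%N, (m <= index b l)%N & val_at x l m <= v - 1].
    by exists (index b l); rewrite ab leqnn val_at_index.
  (* [m] is the first index after that of [a] at which the chain has crossed the interval. *)
  case: (ex_minnP ex) => m /and3P[m1 m2 m3] mmin.
  have ms : (m < size l)%N by apply: leq_ltn_trans m2 _; rewrite index_mem.
  exists m; first by rewrite /between m1 m2.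
  have vm : v <= val_at x l m.-1.
    have [e|ne] := eqVneq (index a l) m.-1; first by rewrite -e val_at_index.
    have m0 : (0 < m)%N by apply: leq_ltn_trans m1.
    have ml : (m.-1 < size l)%N by apply: leq_ltn_trans ms; rewrite leq_pred.
    have := out (nth a l m.-1); rewrite -[x _](nth_map a 0) // -/(val_at x l m.-1).
    case=> // h; have := mmin m.-1; rewrite h andbT; move: m1 m2 m0 ne.
    move: (index a l) (index b l) (m) => c d e; clear; lia.
  have g2 : (0 < m < size l)%N by rewrite (leq_ltn_trans _ m1).
  have /andP[_ g1] := chain_gap01 cx g2; move: g1; rewrite /gap => g1; lra.
rewrite /xclose; apply: (iffP (@asboolP (~ sep x i j))) => [ns k b|h [v [out [[vi jv]|[vj iv]]]]].
- apply/eqP => g1; apply: ns; exists (val_at x l k.-1).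
  have /andP[k0 ks] := index_between (mem i) (mem j) b.
  have lo m : (index m l < k)%N -> val_at x l k.-1 <= x m.
    move=> mk; rewrite -(val_at_index x (mem m)); apply: chain_mono cx _.
    apply/andP; split; first by rewrite -ltnS prednK.
    by apply: leq_ltn_trans ks; rewrite leq_pred.
  have hi m : (k <= index m l)%N -> x m <= val_at x l k.-1 - 1.
    move=> km; rewrite -(val_at_index x (mem m)).
    have -> : val_at x l k.-1 - 1 = val_at x l k by move: g1; rewrite /gap; lra.
    by apply: chain_mono cx _; rewrite km index_mem mem.
  split=> [m|]; first by have [mk|km] := ltnP (index m l) k; [right; apply: lo|left; apply: hi].
  by case/orP: b => /andP[b1 b2]; [left|right]; split; [apply: lo|apply: hi|apply: lo|apply: hi].
- by have [k b g1] := cross v i j vi jv out; have := h k b; rewrite g1 eqxx.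
have [k b g1] := cross v j i vj iv out; have := h k; rewrite g1 eqxx /between orbC => h'.
by have := h' b.
Qed.

Definition xpos F x l i : R := \sum_(0 <= k < index i l) F (gap x l k.+1).
Definition xdist F x l i j : R := xpos F x l j - xpos F x l i.

Lemma xdist_sum F x l i j : (index i l <= index j l)%N ->
  xdist F x l i j = \sum_(index i l <= k < index j l) F (gap x l k.+1).
Proof.
by move=> ij; rewrite /xdist /xpos (@big_cat_nat _ _ _ (index i l)) //= addrAC subrr add0r.
Qed.

Lemma xdist_trans F x l i j k : xdist F x l i k = xdist F x l i j + xdist F x l j k.
Proof. by rewrite /xdist; ring. Qed.

Lemma xdistC F x l i j : xdist F x l j i = - xdist F x l i j.
Proof. by rewrite /xdist opprB. Qed.

(** A monotone sequence with only two values makes a single jump; all other gaps are 0 and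
    contribute F 0 = 0. *)
Lemma two_value_sum F x l a b : F 0 = 0 -> (a <= b)%N ->
  (forall c d, (a <= c <= d)%N -> (d <= b)%N -> val_at x l d <= val_at x l c) ->
  (forall k, (a <= k <= b)%N -> val_at x l k = val_at x l a \/ val_at x l k = val_at x l b) ->
  \sum_(a <= k < b) F (gap x l k.+1) = F (val_at x l a - val_at x l b).
Proof.
move=> F0; elim: b => [|b IH] ab mono h.
  by move: ab; rewrite leqn0 => /eqP->; rewrite big_nil subrr F0.
move: ab; rewrite leq_eqVlt => /orP[/eqP->|]; first by rewrite big_geq // subrr F0.
rewrite ltnS => ab; rewrite big_nat_recr //= {2}/gap /=.
have hb : (a <= b <= b.+1)%N by rewrite ab leqnSn.
rewrite IH // => [|c d cd db|k /andP[k1 k2]].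
- by case: (h b hb) => ->; rewrite subrr F0 ?add0r ?addr0.
- by apply: mono => //; apply: leqW.
have := h k; rewrite k1 (leq_trans k2) // => /(_ isT).
case: (h b hb) => [e|->]; last by [].
by left; apply/eqP; rewrite eq_le -{2}e !mono ?leqnn ?k1 ?k2 ?(leqW k2) ?leqnSn.
Qed.

Lemma xdist_gap F x l i j : F 0 = 0 -> chain x l -> x j <= x i ->
  (forall k, ~~ (x j < x k < x i)) -> xdist F x l i j = F (x i - x j).
Proof.
move=> F0 cx ji h; have mem k : k \in l by apply: chain_mem cx.
have two a b : (index a l <= index b l)%N -> (forall k, ~~ (x b < x k < x a)) ->
    xdist F x l a b = F (x a - x b).
  move=> ab hab; rewrite xdist_sum // two_value_sum ?val_at_index // => [c d cd db|k /andP[k1 k2]].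
    apply: chain_mono cx _; case/andP: cd => _ ->.
    by apply: leq_ltn_trans db _; rewrite index_mem.
  have ks : (k < size l)%N by apply: leq_ltn_trans k2 _; rewrite index_mem.
  have := hab (nth a l k); have -> : x (nth a l k) = val_at x l k by rewrite /val_at (nth_map a).
  have := @chain_mono x l (index a l) k cx; rewrite k1 ks => /(_ isT).
  have := @chain_mono x l k (index b l) cx; rewrite k2 index_mem mem => /(_ isT).
  rewrite !val_at_index // => h1 h2; rewrite negb_and -!leNgt => /orP[] h3; [right|left];
    apply/eqP; by rewrite eq_le ?h1 ?h2 ?h3.
have [ij|ij] := leqP (index i l) (index j l); first exact: two.
have e : x i = x j.
  apply/eqP; rewrite eq_le ji andbT.
  have := @chain_mono x l (index j l) (index i l) cx; rewrite (ltnW ij) index_mem mem => /(_ isT).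
  by rewrite !val_at_index.
rewrite xdistC (two j i (ltnW ij)) e ?subrr ?F0 ?oppr0 // => k.
by apply/negP => /andP[h1 h2]; have := lt_trans h1 h2; rewrite ltxx.
Qed.

Lemma xclose_mid x l i j k : chain x l -> xclose x i j -> x j < x k < x i ->
  xclose x i k.
Proof.
move=> cx /asboolP ij /andP[jk ki]; apply/asboolP => -[v [out h]].
by apply: ij; exists v; split=> //; case: h => -[h1 h2]; [left|right]; split; lra.
Qed.

(* Both distances are additive and equal F (x i - x j) when no value lies strictly
   between x j and x i; ties do not matter because F 0 = 0. *)
Lemma xdist_unique F x y l l' : F 0 = 0 -> chain x l -> chain y l' ->
  (forall i j, xclose x i j = xclose y i j) ->
  (forall i j, xclose x i j -> x i - y i = x j - y j) ->
  forall i j, xclose x i j -> xdist F x l i j = xdist F y l' i j.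
Proof.
move=> F0 cx cy cE dE.
have main m i j : (#|[pred k | (x j < x k < x i)%R]| < m)%N -> xclose x i j -> x j <= x i ->
    xdist F x l i j = xdist F y l' i j.
  elim: m i j => // m IH i j; rewrite ltnS => im cij ji; have eij := dE _ _ cij.
  have [/existsP[k /andP[jk ki]]|/existsPn none] := boolP [exists k, x j < x k < x i].
    have cik : xclose x i k by apply: (xclose_mid cx cij); rewrite jk ki.
    have ckj : xclose x k j by apply: xclose_trans cij; rewrite xclose_sym.
    rewrite !(xdist_trans _ _ _ i k j) !IH ?(ltW jk) ?(ltW ki) //.
      apply: leq_trans im; apply: proper_card; apply/properP; split.
        by apply/fintype.subsetP => z; rewrite !inE => /andP[-> h]; rewrite (lt_trans h ki).
      by exists k; rewrite !inE ?jk ?ki // ltxx andbF.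
    apply: leq_trans im; apply: proper_card; apply/properP; split.
      by apply/fintype.subsetP => z; rewrite !inE => /andP[h ->]; rewrite (lt_trans jk h).
    by exists k; rewrite !inE ?jk ?ki // ltxx.
  rewrite !xdist_gap //; first by congr F; lra.
    by lra.
  move=> k; apply/negP => yk.
  have cik : xclose x i k by rewrite cE; apply: (xclose_mid cy) yk; rewrite -cE.
  have := none k; have := dE _ _ cik; move/andP: yk => [h1 h2] h3 /negP; apply.
  by apply/andP; split; lra.
move=> i j cij; have [ji|/ltW ij] := leP (x j) (x i); first exact: (main _.+1).
by rewrite xdistC [RHS]xdistC (@main _ j i (leqnn _)) // xclose_sym.
Qed.

Lemma size_chain x l : chain x l -> size l = n.
Proof. by case=> /perm_size-> _; rewrite size_enum_ord. Qed.

Lemma val_at_perm x (w : {perm I}) (a : I) : val_at x (map w (enum I)) a = x (w a).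
Proof.
by rewrite /val_at -map_comp (nth_map a) ?size_enum_ord //= nth_ord_enum.
Qed.

Lemma perm_chain x (w : {perm I}) : Xw_set w x <-> chain x (map w (enum I)).
Proof.
split=> [h|[_ h] a b ab].
  split.
    apply: uniq_perm; rewrite ?(map_inj_uniq perm_inj) ?enum_uniq // => i.
    rewrite mem_enum; apply/mapP; exists (w^-1%g i); rewrite ?mem_enum //.
    by rewrite permKV.
  move=> k; rewrite size_map size_enum_ord => kn.
  have k0 : (k < n)%N := ltnW kn.
  by have := h (Ordinal k0) (Ordinal kn) erefl; rewrite -!val_at_perm.
have := h a; rewrite size_map size_enum_ord /gap /= -ab !val_at_perm; apply.
exact: ltn_ord.
Qed.

Lemma index_perm (w : {perm I}) (a : I) : index (w a) (map w (enum I)) = a.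
Proof. by rewrite index_map ?index_enum_ord //; apply: perm_inj. Qed.

Lemma perm_of_list l : perm_eq l (enum I) -> exists w : {perm I}, map w (enum I) = l.
Proof.
move=> pl; have sl : size l = n by rewrite (perm_size pl) size_enum_ord.
have ul : uniq l by rewrite (perm_uniq pl) enum_uniq.
have inj : injective (fun k : I => nth k l k).
  move=> a b /eqP; rewrite (set_nth_default a) ?sl // nth_uniq ?sl // => /eqP.
  exact: val_inj.
exists (perm inj); case: l pl sl ul inj => [|a0 l] pl sl ul inj.
  by apply/size0nil; rewrite size_map size_enum_ord -sl.
apply: (@eq_from_nth _ a0) => [|k]; rewrite size_map size_enum_ord ?sl // => kn.
rewrite (nth_map (Ordinal kn)) ?size_enum_ord // permE (nth_ord_enum _ (Ordinal kn)) /=.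
by apply: set_nth_default; rewrite sl.
Qed.

Lemma star_chain (x : Xstar R n) : exists l, chain (val x) l.
Proof. by have [w /perm_chain h] := set_mem (valP x); exists (map w (enum I)). Qed.

Lemma joins_xclose x (w : {perm I}) S : Xw_set w x -> joins_close x w S ->
  forall i j, xclose x i j -> same_part S i j.
Proof.
move=> xw jS; have cx := (perm_chain x w).1 xw.
have main m (a b : I) : (b - a <= m)%N -> (a <= b)%N -> xclose x (w a) (w b) ->
    same_part S (w a) (w b).
  elim: m b => [|m IH] b ba ab cab.
    have -> : a = b by apply/val_inj/eqP; rewrite eqn_leq ab -subn_eq0 -leqn0.
    exact: same_part_refl.
  have [->|ne] := eqVneq a b; first exact: same_part_refl.
  have lab : (a < b)%N by rewrite ltn_neqAle ab andbT; apply: contra ne => /eqP/val_inj->.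
  have b1 : (b.-1 < n)%N by apply: leq_ltn_trans (ltn_ord b); rewrite leq_pred.
  have [c eb] : exists c : I, b = c.+1 :> nat.
    by exists (Ordinal b1); rewrite /= prednK //; apply: leq_ltn_trans lab.
  have ab1 : (a <= c)%N by rewrite -ltnS -eb.
  have gaps := xcloseP (w a) (w b) cx cab.
  apply: (@same_part_trans _ S _ (w c)).
    apply: IH => //; first by move: ba; rewrite eb subSn.
    apply/(xcloseP _ _ cx) => k bk; apply: gaps; move: bk.
    rewrite /between !index_perm => /orP[]/andP[h1 h2]; apply/orP; left.
      by rewrite h1 eb ltnW.
    by have := leq_trans h1 h2; rewrite ltnNge ab1.
  apply: (jS _ _ eb); have := gaps b; rewrite /between !index_perm lab leqnn => /(_ isT).
  rewrite /gap {1}eb /= !val_at_perm => g1; have /andP[_ g2] := xw _ _ eb.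
  by rewrite lt_neqAle g1.
move=> i j; rewrite -(permKV w i) -(permKV w j).
move: (w^-1%g i) (w^-1%g j) => a b cab; have [ab|/ltnW ba] := leqP a b.
  exact: (main _ _ _ (leqnn _)).
by rewrite same_part_sym; apply: (main _ _ _ (leqnn _) ba); rewrite xclose_sym.
Qed.

Lemma xclose_equiv x : equivalence_rel (xclose x).
Proof.
move=> i j k; split=> [|ij]; first exact: xclose_refl.
apply/idP/idP; apply: xclose_trans; rewrite // xclose_sym; exact: ij.
Qed.

Lemma joins_of_xclose x (w : {perm I}) S : Xw_set w x ->
  (forall i j, same_part S i j = xclose x i j) -> joins_close x w S.
Proof.
move=> xw SE i j ij lt1; rewrite SE; apply/(xcloseP _ _ ((perm_chain x w).1 xw)) => k.
rewrite /between !index_perm ij => /orP[]/andP[k1 k2]; last first.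
  by have := ltn_trans (leq_trans k1 k2) (ltnSn i); rewrite ltnn.
have -> : k = i.+1 by apply/eqP; rewrite eqn_leq k2.
by rewrite /gap -ij {1}ij /= !val_at_perm lt_eqF.
Qed.

(** [determines] chooses a permutation, but the finest partition joining neighbours at distance less
    than 1 always consists of the classes of [xclose]. *)
Lemma determinesE x S : determines x S -> forall i j, same_part S i j = xclose x i j.
Proof.
move=> [w [xw jS fin]] i j; have [S' SE] := setpart_of_rel (xclose_equiv x).
apply/idP/idP; last exact: (joins_xclose xw jS).
by rewrite -SE; apply: fin; apply: joins_of_xclose.
Qed.

Lemma determines_of x (w : {perm I}) S : Xw_set w x ->
  (forall i j, same_part S i j = xclose x i j) -> determines x S.
Proof.
move=> xw SE; exists w; split=> //; first exact: joins_of_xclose.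
by move=> S' jS' i j; rewrite SE; apply: (joins_xclose xw jS').
Qed.

Lemma star_relP (x y : Xstar R n) : star_rel x y <->
  (forall i j, xclose (val x) i j = xclose (val y) i j) /\
  (forall i j, xclose (val x) i j -> val x i - val y i = val x j - val y j).
Proof.
split=> [[S [dx dy hS]]|[cE dE]].
  have [ex ey] := (determinesE dx, determinesE dy).
  split=> i j; first by rewrite -ex -ey.
  have /and3P[/eqP cov tri ne] := valP S.
  have pS : finset.pblock (val S) i \in val S.
    by apply: finset.pblock_mem; rewrite cov finset.in_setT.
  have [c hc] := hS _ pS.
  by rewrite -ex => ij; rewrite !hc // -same_partP ?same_part_refl.
have [S SE] := setpart_of_rel (xclose_equiv (val x)).
have [wx hx] := set_mem (valP x); have [wy hy] := set_mem (valP y).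
exists S; split; first exact: determines_of hx SE.
  by apply: determines_of hy _ => i j; rewrite SE.
move=> A AS; have /and3P[_ tri ne] := valP S.
have [i0 i0A] : exists i, i \in A by apply/finset.set0Pn; apply: contraNneq ne => <-.
exists (val x i0 - val y i0) => i iA; apply/esym/dE.
by rewrite -SE same_partP (finset.def_pblock tri AS i0A).
Qed.

Variable psi : R -> R.

Definition xnu x l : nu_space R n := mk_nu (dist_nu (xclose x) (xdist (Fw psi) x l)).

Lemma xnu_tbar x l : tbar_set (xnu x l).
Proof.
apply: dist_nu_tbar => [|i j k|i j k]; [exact: xclose_sym|exact: xclose_trans|].
exact: xdist_trans.
Qed.

Lemma xnu_unique x y l l' : chain x l -> chain y l' ->
  (forall i j, xclose x i j = xclose y i j) ->
  (forall i j, xclose x i j -> x i - y i = x j - y j) -> xnu x l = xnu y l'.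
Proof.
move=> cx cy cE dE; apply: nu_ext => i j ij; rewrite !nu_at_mk // /dist_nu -cE.
by case: ifP => // cij; rewrite (xdist_unique _ cx cy) // /Fw mul0r.
Qed.

Definition Theta_star (x : Xstar R n) : tbar R n :=
  let l := sval (cid (star_chain x)) in exist _ (xnu (val x) l) (mem_set (xnu_tbar _ _)).

Definition Theta (z : Xhat R n) : tbar R n := Theta_star (qrepr z).

Lemma Theta_qclass (x : Xstar R n) l : chain (val x) l ->
  val (Theta (qclass (@star_rel R n) x)) = xnu (val x) l.
Proof.
move=> cx; have lift (y z : Xstar R n) : star_rel y z -> Theta_star y = Theta_star z.
  move=> /star_relP[cE dE]; apply: val_inj; apply: xnu_unique => //.
    exact: svalP (cid (star_chain y)).
  exact: svalP (cid (star_chain z)).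
rewrite /Theta (quot_lift lift); apply: (xnu_unique _ cx) => //.
  exact: svalP (cid (star_chain x)).
by move=> i j _; rewrite !subrr.
Qed.

End StarPoints.

(** * The map Theta in terms of sums of values of f *)

Section ThetaSum.
Variables (R : realType) (n : nat) (f : R -> \bar R).
Hypothesis f_diffeo : increasing_diffeo f.
Hypothesis f_zero : f 0 = 0%E.
Local Notation I := 'I_n.
Local Notation psi := (slope f).

Lemma diffeo_ge0 x : 0 <= x <= 1 -> (0 <= f x)%E.
Proof.
move=> /andP[x0 x1]; have [->|n0] := eqVneq x 0; first by rewrite f_zero.
rewrite -f_zero; apply/ltW/(diffeo_lt f_diffeo) => //.
by rewrite lt_neqAle eq_sym n0.
Qed.

(** If all gaps are below 1, every term is finite. A single gap 1 contributes +oo, and as no term is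
    negative, the sum is +oo. *)
Lemma chain_sum (x : I -> R) (w : {perm I}) (i j : I) : Xw_set w x -> (i < j)%N ->
  (\sum_(k : I * I | [&& (i <= k.1)%N, (k.1 < j)%N & k.2 == k.1.+1 :> nat])
     f (x (w k.1) - x (w k.2))%R)%E =
  if xclose x (w i) (w j) then (xdist (Fw psi) x (map w (enum I)) (w i) (w j))%:E else +oo%E.
Proof.
move=> xw ij; set l := map w (enum I); have cx : chain x l by apply/perm_chain.
have idx k : index (w k) l = k by apply: index_perm.
have -> : (\sum_(k : I * I | [&& (i <= k.1)%N, (k.1 < j)%N & k.2 == k.1.+1 :> nat])
     f (x (w k.1) - x (w k.2))%R)%E = (\sum_(k < n | (i <= k < j)%N) f (gap x l k.+1))%E.
  rewrite (eq_bigl (fun k : I * I => (i <= k.1 < j)%N && (k.2 == k.1.+1 :> nat))); last first.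
    by move=> k; rewrite andbA.
  rewrite -(pair_big_dep (fun k : I => (i <= k < j)%N) (fun k m : I => m == k.+1 :> nat)
    (fun k m => f (x (w k) - x (w m)))) /=.
  apply: eq_bigr => k /andP[_ kj]; have kn : (k.+1 < n)%N by apply: leq_ltn_trans (ltn_ord j).
  rewrite (big_pred1 (Ordinal kn)) => [|m]; last by [].
  by rewrite /gap /= val_at_perm -(val_at_perm x w (Ordinal kn)).
have g01 k : (i <= k < j)%N -> 0 <= gap x l k.+1 <= 1.
  move=> /andP[_ kj]; apply: (chain_gap01 cx); rewrite /= (size_chain cx).
  by apply: leq_ltn_trans (ltn_ord j).
case: (xcloseP (w i) (w j) cx) => [h|h].
  rewrite xdist_sum ?idx ?(ltnW ij) //.
  rewrite (eq_bigr (fun k : I => (Fw psi (gap x l k.+1))%:E)) => [|k kij].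
    rewrite sumEFin; congr EFin.
    rewrite -(big_mkord (fun k => i <= k < j)%N (fun k => Fw psi (gap x l k.+1))).
    rewrite (@big_cat_nat _ _ _ j) //=; last exact: ltnW.
    rewrite [X in _ + X]big1_seq ?addr0; last first.
      by move=> k /andP[/andP[_ kj]]; rewrite mem_index_iota leqNgt kj.
    rewrite (@big_cat_nat _ _ _ i) //=; last exact: ltnW.
    rewrite [X in X + _]big1_seq ?add0r; last first.
      by move=> k /andP[/andP[ik _]]; rewrite mem_index_iota /= ltnNge ik.
    by rewrite [RHS]big_nat.
  have /andP[g0 g1] := g01 _ kij; rewrite slopeE //.
  rewrite g0 lt_neqAle g1 andbT; apply: h; rewrite /between !idx ltnS.
  by move: kij => /andP[-> ->].
have [k b g1] : exists2 k, between l (w i) (w j) k & gap x l k = 1.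
  by apply: contrapT => no; apply: h => k b; apply/eqP => g1; apply: no; exists k.
have kij : (0 < k)%N /\ (i <= k.-1 < j)%N.
  move: b; rewrite /between !idx => /orP[]/andP[h1 h2]; last first.
    by have := leq_trans h1 h2; rewrite ltnNge (ltnW ij).
  by case: (k) h1 h2 => // m h1 h2; split=> //; rewrite /= -ltnS h1.
have kn : (k.-1 < n)%N by case: kij => _ /andP[_ kj]; apply: ltn_trans (ltn_ord j).
rewrite (bigD1 (Ordinal kn)) /=; last by case: kij.
rewrite prednK; last by case: kij.
rewrite g1 (diffeo1 f_diffeo) addye //.
rewrite -ltNye; apply: (@lt_le_trans _ _ 0%E); first exact: ltNyr.
by apply: sume_ge0 => m /andP[/g01 h2 _]; apply: diffeo_ge0.
Qed.

Lemma Theta_is_Theta : is_Theta f (@Theta R n psi).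
Proof.
move=> x w xw i j ij; have cx := (perm_chain (val x) w).1 xw.
rewrite (chain_sum xw ij) (Theta_qclass psi cx) /delta_at.
have wij : w i != w j by rewrite (inj_eq perm_inj) -val_eqE ltn_eqF.
rewrite !nu_at_mk // 1?eq_sym // /dist_nu [in xclose _ (w j) _]xclose_sym.
case: ifP => _; last first.
  have -> : P1inv (P1fin 0) = @P1inf R; last by [].
  by rewrite P1fin_pt P1inf_pt P1inv_pt // pair_neq0 /= oner_eq0 orbT.
by rewrite !P1inv_pt ?one_neq0 //= !P1fin_pt [in X in _ /\ X]xdistC.
Qed.

End ThetaSum.

(** * The map Gamma *)

Section GammaMap.
Variables (R : realType) (n : nat).
Local Notation I := 'I_n.
Implicit Types (s : seq (dtree R I)) (p : cubes R n).

(** Positions increase along the word of a forest, whereas coordinates of points of the star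
    decrease along their permutation; hence the sign. *)
Definition heights s : {ptws I -> R} := fun i => - lpos id s i.

Lemma lpos_sum F s i : lvalid s -> i \in lword s -> lpos F s i =
  F (nth 0 (lpre s) 0) + \sum_(0 <= k < index i (lword s)) F (nth 0 (lpre s) k.+1).
Proof.
move=> vs iw; have ss : (index i (lword s) < size (lpre s))%N by rewrite lvalid_size ?index_mem.
rewrite /lpos (big_nth 0) size_takel // big_nat_recl //=; congr (_ + _).
  by case: (lpre s) ss.
by rewrite big_nat [RHS]big_nat; apply: eq_bigr => k /andP[_ k1]; rewrite nth_take.
Qed.

Lemma heights_gap s k : forest_ok s -> (k.+1 < size (lword s))%N ->
  gap (heights s) (lword s) k.+1 = nth 0 (lpre s) k.+1.
Proof.
move=> ok ks; have [vs us] := (ok_valid ok, ok_uniq ok).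
case ew : (lword s) (ks) => [//|a0 w'] _; rewrite -ew.
have at_ m : (m < size (lword s))%N -> val_at (heights s) (lword s) m =
    - lpos id s (nth a0 (lword s) m) by move=> ms; rewrite /val_at (nth_map a0).
rewrite /gap /= !at_ ?(ltnW ks) //.
have mem m : (m < size (lword s))%N -> nth a0 (lword s) m \in lword s by apply: mem_nth.
rewrite !lpos_sum ?mem ?(ltnW ks) // !index_uniq ?(ltnW ks) //.
by rewrite big_nat_recr //=; ring.
Qed.

Lemma heights_chain s : forest_ok s -> chain (heights s) (lword s).
Proof.
move=> ok; split; first by case/andP: ok.
by move=> k ks; rewrite heights_gap //; apply: gap_01 (ok_valid ok).
Qed.

Lemma heights_dist F s i j : forest_ok s ->
  xdist F (heights s) (lword s) i j = dist F s i j.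
Proof.
move=> ok; have [vs us] := (ok_valid ok, ok_uniq ok).
rewrite /dist !lpos_sum ?ok_mem // opprD addrACA subrr add0r /xdist /xpos.
have e a : \sum_(0 <= k < index a (lword s)) F (gap (heights s) (lword s) k.+1) =
    \sum_(0 <= k < index a (lword s)) F (nth 0 (lpre s) k.+1).
  rewrite big_nat [RHS]big_nat; apply: eq_bigr => k /andP[_ ka]; rewrite heights_gap //.
  by apply: leq_ltn_trans ka _; rewrite index_mem ok_mem.
by rewrite !e.
Qed.

Lemma heights_close s i j : forest_ok s -> xclose (heights s) i j = close 1 s i j.
Proof.
move=> ok; have vs := ok_valid ok.
have e k : between (lword s) i j k -> gap (heights s) (lword s) k = 1 * nth 0 (lpre s) k.
  move=> b; have /andP[k0 ks] := index_between (ok_mem i ok) (ok_mem j ok) b.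
  by case: k k0 ks {b} => // k _ ks; rewrite heights_gap // mul1r.
apply/(xcloseP _ _ (heights_chain ok))/(closeP _ vs (ok_mem i ok) (ok_mem j ok)) => h k b.
  by rewrite -e // h.
by rewrite e // h.
Qed.

Lemma heights_diff s i j : heights s i - heights s j = dist id s i j.
Proof. by rewrite /heights /dist; ring. Qed.

Lemma heights_star s : forest_ok s -> [set x : {ptws I -> R} | exists w, Xw_set w x] (heights s).
Proof.
move=> ok; have cs := heights_chain ok; have [pl _] := cs.
by have [w ew] := perm_of_list pl; exists w; apply/perm_chain; rewrite ew.
Qed.

Definition Gamma_cube p : Xstar R n :=
  exist _ (heights (dforest p)) (mem_set (heights_star (dforest_ok p))).

Lemma Gamma_cube_rel p p' : cube_rel p p' -> star_rel (Gamma_cube p) (Gamma_cube p').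
Proof.
move=> pp'; have [ok ok'] := (dforest_ok p, dforest_ok p').
suff [cE dE] : (forall i j, close 1 (dforest p) i j = close 1 (dforest p') i j) /\
    (forall i j, close 1 (dforest p) i j -> dist id (dforest p) i j = dist id (dforest p') i j).
  apply/star_relP; split=> [i j|i j]; rewrite !heights_close // => /dE.
  by rewrite -!heights_diff /=; lra.
have [st|pe] := cube_rel_lstep pp'.
  have [cE dE] := lstep_close_dist (ok_valid ok) (ok_valid ok') st.
  by split=> // i j _; apply: dE.
by have [cE dE] := perm_close_dist ok pe; split=> // i j; apply: dE.
Qed.

Definition Gamma (d : Dhat R n) : Xhat R n := qclass (@star_rel R n) (Gamma_cube (qrepr d)).

Lemma Gamma_qclass p : Gamma (qclass (@cube_rel R n) p) = qclass (@star_rel R n) (Gamma_cube p).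
Proof.
apply: (quot_lift (h := fun p => qclass (@star_rel R n) (Gamma_cube p))) => x y xy.
by apply/qclass_eqP/rst_step/Gamma_cube_rel.
Qed.

Lemma Gamma_is_Gamma : is_Gamma Gamma.
Proof.
move=> p tau; have ok := dforest_ok p; have cs := heights_chain ok; have [pl _] := cs.
have [w ew] := perm_of_list pl; exists w, (Gamma_cube p); split.
- by rewrite ew lword_decorate.
- by apply/perm_chain; rewrite ew.
- move=> i j cij; rewrite heights_diff dist_edges //.
  case: ifP => // nt; rewrite big_pred0 // => e; apply/negbTE/negP => /andP[ie je].
  by move: nt; rewrite (same_tree_edge ie je).
exact: Gamma_qclass.
Qed.

End GammaMap.

Theorem theorem9p17 (R : realType) (n : nat) (f : R -> \bar R)
    (f_diffeo : increasing_diffeo f) (f_zero : f 0 = 0%E) :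
  exists (theta : Dhat R n -> Fbar R n) (Gamma : Dhat R n -> Xhat R n)
    (Theta : Xhat R n -> tbar R n),
    [/\ is_theta f theta, is_Gamma Gamma, is_Theta f Theta,
        homeomorphism theta &
        forall d : Dhat R n, gamma (theta d) = Theta (Gamma d)].
Proof.
have psi_gt0 x : 0 <= x < 1 -> 0 < slope f x := @slope_gt0 R f f_diffeo f_zero x.
have psi_continuous x : 0 <= x < 1 -> {for x, continuous (slope f)}.
  move=> /andP[x0 x1]; apply: (slope_continuous f_diffeo f_zero).
  by rewrite x1 andbT; apply: lt_le_trans x0; rewrite ltrN10.
have psi_unbounded := slope_unbounded f_diffeo f_zero.
have psi_inj := slope_inj f_diffeo f_zero.
have psi_surj := slope_surj f_diffeo f_zero.
exists (@theta R n _ psi_gt0), (@Gamma R n), (@Theta R n (slope f)); split.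
- split=> [d|p adm].
    (* An admissible representative comes from surjectivity, which yields an admissible point with
       the same image; injectivity identifies the two. *)
    have [p [adm ep]] := theta_cube_surj psi_gt0 psi_surj (theta psi_gt0 d).
    exists p => //; rewrite -(qreprK d); apply/qclass_eqP.
    by apply: (theta_cube_inj psi_inj); rewrite ep.
  have [q sp hq] := point_exists0 psi_gt0 (dforest_ok p).
  exists q; last by rewrite theta_qclass (theta_cubeE _ hq).
  exact: theta_chart_point.
- exact: Gamma_is_Gamma.
- exact: Theta_is_Theta.
- exact: theta_homeomorphism.
move=> d; rewrite -(qreprK d); move: (qrepr d) => p; have ok := dforest_ok p.
have [q sp hq] := point_exists0 psi_gt0 ok.
apply: val_inj; rewrite theta_qclass (theta_cubeE _ hq) gamma_qclass Gamma_qclass.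
rewrite (@Theta_qclass _ _ _ (Gamma_cube p) (lword (dforest p))); last exact: heights_chain.
have [-> _] := hq; apply: nu_ext => i j ij; rewrite !nu_at_mk // /gnu /dist_nu.
by rewrite heights_close // heights_dist.
Qed.
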